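(* Let $n,m\ge1$, $\mu>0$, $\nu>-1$, $D_{n,m}(\mu)=\{(z,w)\in\mathbb{C}^n\times\mathbb{C}^m:\|w\|^2<e^{-\mu\|z\|^2}\}$ endowed with the Kähler metric $g(\mu;\nu)$ with Kähler form $\frac{\sqrt{-1}}{2\pi}\partial\bar\partial\Phi$, $\Phi(z,w)=\nu\mu\|z\|^2-\ln\left(e^{-\mu\|z\|^2}-\|w\|^2\right)$. Let $\alpha>m+n$. Then the Rawnsley $\varepsilon$-function of $(D_{n,m}(\mu),g(\mu;\nu))$ is $$\varepsilon_{(\alpha,g(\mu;\nu))}(z,w)=(\alpha-m-n)_{m+n}(1-\|\tilde w\|^2)^\alpha\sum_{q\in\mathbb{N}^m}\psi(\alpha,|q|)\frac{\Gamma(|q|+\alpha)}{\Gamma(\alpha)\prod_{i=1}^m\Gamma(q_i+1)}\tilde w^q\overline{\tilde w^q},$$ where $\tilde w=e^{\frac{\mu}{2}\|z\|^2}w$, $(\alpha)_k=\frac{\Gamma(\alpha+k)}{\Gamma(\alpha)}$, $\psi(\alpha,|q|)=\frac{\Gamma(\alpha-m-n)\chi(\alpha,|q|)}{\Gamma(\alpha+|q|)}$ and $$\chi(\alpha,|q|)=\frac{[(\nu+1)\alpha+|q|]^n}{\sum_{d=0}^n\binom{n}{d}\nu^{n-d}\frac{\Gamma(\alpha-m-d)}{\Gamma(\alpha-d+|q|)}}.$$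
   Context: Let $\mathcal{H}_\alpha$ be the Hilbert space of holomorphic $f$ on $D_{n,m}(\mu)$ with $\int|f|^2e^{-\alpha\Phi}\frac{\omega^{n+m}}{(n+m)!}<\infty$, where $\omega=\frac{\sqrt{-1}}{2\pi}\partial\bar\partial\Phi$, and $K_\alpha(Z,\bar Z)$ its reproducing kernel on the diagonal. The Rawnsley $\varepsilon$-function is $\varepsilon_{(\alpha,g(\mu;\nu))}(Z)=e^{-\alpha\Phi(Z)}K_\alpha(Z,\bar Z)$. $\mathbb{N}$ includes $0$; $|q|=\sum q_i$; $\tilde w^q=\prod_j \tilde w_j^{q_j}$; $\nu^0=1$. *)

(* Defs.v *)
From HB Require Import structures.
From mathcomp Require Import all_boot all_order all_algebra.
From mathcomp Require Import all_classical all_reals all_analysis.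
From mathcomp Require Import complex.
Set Implicit Arguments. Unset Strict Implicit. Unset Printing Implicit Defensive.
Import Order.TTheory GRing.Theory Num.Theory numFieldNormedType.Exports.
Local Open Scope ring_scope.
Local Open Scope classical_set_scope.

Definition cpt (R : realType) (N : nat) := 'I_N -> R[i].

Definition cabs2 (R : realType) (z : R[i]) : R :=
  complex.Re z ^+ 2 + complex.Im z ^+ 2.

Definition sqn (R : realType) (k : nat) (v : 'I_k -> R[i]) : R :=
  \sum_(j < k) cabs2 (v j).

Definition cshift (R : realType) (N : nat) (Z : cpt R N) (j : 'I_N) (c : R[i])
  : cpt R N := fun k => if k == j then Z k + c else Z k.

(** Holomorphic on D: complex differentiable in each variable separately at
    every point of D (equivalent to joint holomorphy by Hartogs' theorem). *)
Definition holomorphic_on (R : realType) (N : nat) (D : set (cpt R N))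
    (f : cpt R N -> R[i]) : Prop :=
  forall Z, D Z -> forall j : 'I_N, exists L : R[i],
    forall eps : R, 0 < eps -> exists delta : R, 0 < delta /\
      forall h : R[i], h != 0 -> cabs2 h < delta ^+ 2 ->
        cabs2 ((f (cshift Z j h) - f Z) / h - L) < eps ^+ 2.

Definition dirderC (R : realType) (N : nat) (F : cpt R N -> R[i])
    (v : cpt R N) (Z : cpt R N) : R[i] :=
  let G := fun t : R => F (fun k => Z k + (t%:C)%C * v k) in
  (derive1 (fun t => complex.Re (G t)) 0 +i* derive1 (fun t => complex.Im (G t)) 0)%C.

Definition evec (R : realType) (N : nat) (j : 'I_N) (c : R[i]) : cpt R N :=
  fun k => if k == j then c else 0.

Definition dz (R : realType) (N : nat) (j : 'I_N) (F : cpt R N -> R[i])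
    (Z : cpt R N) : R[i] :=
  (dirderC F (evec j 1) Z - 'i%C * dirderC F (evec j 'i%C) Z) / 2.
Definition dzb (R : realType) (N : nat) (j : 'I_N) (F : cpt R N -> R[i])
    (Z : cpt R N) : R[i] :=
  (dirderC F (evec j 1) Z + 'i%C * dirderC F (evec j 'i%C) Z) / 2.

Definition kmetric (R : realType) (N : nat) (Phi : cpt R N -> R) (Z : cpt R N)
  : 'M[R[i]]_N :=
  \matrix_(j, k) dz j (dzb k (fun W => (Phi W)%:C%C)) Z.

(** density of omega^N / N! w.r.t. Lebesgue measure on C^N = R^{2N},
    where omega = (sqrt(-1)/(2 pi)) dd^c Phi:  omega^N/N! = det(g)/pi^N dLeb. *)
Definition voldens (R : realType) (N : nat) (Phi : cpt R N -> R) (Z : cpt R N)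
  : R := complex.Re (\det (kmetric Phi Z)) / pi ^+ N.

(** Lebesgue integral over C^N = R^{2N} of a nonnegative function, computed as
    an iterated integral over the real and imaginary parts of the coordinates
    (Tonelli). *)
Fixpoint iint (R : realType) (N : nat) (k : nat) (F : cpt R N -> \bar R)
    (Z : cpt R N) {struct k} : \bar R :=
  match k with
  | 0 => F Z
  | k'.+1 =>
    (\int[@lebesgue_measure R]_(s in setT)
      \int[@lebesgue_measure R]_(t in setT)
        iint k' F (fun j => if val j == k' then (s +i* t)%C else Z j))%E
  end.

Definition intC (R : realType) (N : nat) (F : cpt R N -> \bar R) : \bar R :=
  iint N F (fun _ => 0).

Definition wnorm2 (R : realType) (N : nat) (D : set (cpt R N))
    (Phi : cpt R N -> R) (alpha : R) (f : cpt R N -> R[i]) : \bar R :=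
  intC (fun Z => ((\1_D Z : R) *
      (cabs2 (f Z) * expR (- (alpha * Phi Z)) * voldens Phi Z))%:E).

Definition inH (R : realType) (N : nat) (D : set (cpt R N))
    (Phi : cpt R N -> R) (alpha : R) (f : cpt R N -> R[i]) : Prop :=
  holomorphic_on D f /\ (wnorm2 D Phi alpha f < +oo)%E.

(** inner product of H_alpha (linear in the first argument), recovered from the
    norm by the polarization identity <f,g> = 1/4 sum_{k<4} i^k ||f + i^k g||^2 *)
Definition winner (R : realType) (N : nat) (D : set (cpt R N))
    (Phi : cpt R N -> R) (alpha : R) (f g : cpt R N -> R[i]) : R[i] :=
  (\sum_(k < 4) ('i%C ^+ k) *
     ((fine (wnorm2 D Phi alpha (fun Z => f Z + 'i%C ^+ k * g Z)))%:C)%C) / 4.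

(** K is the reproducing kernel of H_alpha: K(., Wbar) in H_alpha and
    f(W) = < f, K(., Wbar) > for f in H_alpha, W in D. K Z W stands for K(Z, Wbar). *)
Definition is_repr_kernel (R : realType) (N : nat) (D : set (cpt R N))
    (Phi : cpt R N -> R) (alpha : R) (K : cpt R N -> cpt R N -> R[i]) : Prop :=
  (forall W, D W -> inH D Phi alpha (fun Z => K Z W)) /\
  (forall f W, inH D Phi alpha f -> D W ->
     f W = winner D Phi alpha f (fun Z => K Z W)).

Definition zpart (R : realType) (n m : nat) (Z : cpt R (n + m)) : 'I_n -> R[i] :=
  fun j => Z (lshift m j).
Definition wpart (R : realType) (n m : nat) (Z : cpt R (n + m)) : 'I_m -> R[i] :=
  fun j => Z (rshift n j).

Definition Dnm (R : realType) (n m : nat) (mu : R) : set (cpt R (n + m)) :=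
  [set Z | sqn (wpart Z) < expR (- (mu * sqn (zpart Z)))].

Definition PhiNM (R : realType) (n m : nat) (mu nu : R) (Z : cpt R (n + m)) : R :=
  nu * mu * sqn (zpart Z) - ln (expR (- (mu * sqn (zpart Z))) - sqn (wpart Z)).

Definition rawnsley (R : realType) (N : nat) (Phi : cpt R N -> R) (alpha : R)
    (K : cpt R N -> cpt R N -> R[i]) (Z : cpt R N) : R[i] :=
  (expR (- (alpha * Phi Z)))%:C%C * K Z Z.

(** Euler Gamma function (for x > 0) *)
Definition Gamma (R : realType) (x : R) : R :=
  fine (\int[@lebesgue_measure R]_(t in [set t : R | (0 < t)%R])
          (powR t (x - 1) * expR (- t))%R%:E)%E.

Definition poch (R : realType) (a : R) (k : nat) : R := Gamma (a + k%:R) / Gamma a.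

Definition chi (R : realType) (n m : nat) (nu alpha : R) (k : nat) : R :=
  ((nu + 1) * alpha + k%:R) ^+ n /
  (\sum_(d < n.+1) 'C(n, d)%:R * nu ^+ (n - d) *
     (Gamma (alpha - m%:R - d%:R) / Gamma (alpha - d%:R + k%:R))).

Definition psi (R : realType) (n m : nat) (nu alpha : R) (k : nat) : R :=
  Gamma (alpha - m%:R - n%:R) * chi n m nu alpha k / Gamma (alpha + k%:R).

Definition wtilde (R : realType) (n m : nat) (mu : R) (Z : cpt R (n + m))
  : 'I_m -> R[i] :=
  fun j => (expR (mu / 2 * sqn (zpart Z)))%:C%C * wpart Z j.

Definition eterm (R : realType) (n m : nat) (mu nu alpha : R) (Z : cpt R (n + m))
    (q : 'I_m -> nat) : R :=
  let k := (\sum_(i < m) q i)%N in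
  psi n m nu alpha k * Gamma (k%:R + alpha) /
    (Gamma alpha * \prod_(i < m) Gamma ((q i)%:R + 1)) *
  cabs2 (\prod_(i < m) wtilde mu Z i ^+ q i).

Definition eblock (R : realType) (n m : nat) (mu nu alpha : R) (Z : cpt R (n + m))
    (k : nat) : R :=
  \sum_(q : {ffun 'I_m -> 'I_k.+1} | (\sum_(i < m) (q i : nat))%N == k)
     @eterm R n m mu nu alpha Z (fun i => q i).

Arguments Dnm {R} n m mu.
Arguments PhiNM {R} n m mu nu Z.
Arguments eblock {R} n m mu nu alpha Z k.
Arguments eterm {R} n m mu nu alpha Z q.
Arguments psi {R} n m nu alpha k.
Arguments chi {R} n m nu alpha k.

(* Main.v *)
(** The domain is a complete Reinhardt domain and the weight
    [e^(- alpha Phi) omega^N / N!] depends only on the moduli of the coordinates,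
    so the monomials are orthogonal and [K(Z, Z) = \sum_I |Z^I|^2 / ||Z^I||^2].
    Every [f] in the space is the sum of a power series on the whole domain: the
    iterated sub-mean value inequality bounds [|f|^2] locally by [||f||^2], and
    the polynomials interpolating a bounded holomorphic function at roots of
    unity converge to it on a polydisc.  Averaging over roots of unity gives
    [||f||^2 = \sum_I |a_I|^2 ||Z^I||^2], and polarization the reproducing formula.
    With [E = e^(- mu |z|^2)] and [Q = E - |w|^2], the determinant of the metric is
    [mu^n (nu + E/Q)^n E / Q^(m+1)]; Dirichlet integrals then give, for [k = |q|]
    and [A_k = (nu + 1) alpha + k],
    [||z^p w^q||^2 = p! q! (mu A_k)^(-|p|) A_k^(-n) S_k], [S_k] being the denominator
    of [chi(alpha, k)].  Summing over [p] yields [e^(mu A_k |z|^2)], which turns [w]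
    into [w~] and cancels [e^(- alpha Phi)] up to [(1 - |w~|^2)^alpha]. *)
Require Import Defs.
From HB Require Import structures.
From mathcomp Require Import all_boot all_order all_algebra.
From mathcomp Require Import all_classical all_reals all_analysis.
From mathcomp Require Import complex.
From mathcomp Require Import measurable_realfun gauss_integral.
From mathcomp Require Import ring lra zify.
Set Implicit Arguments. Unset Strict Implicit. Unset Printing Implicit Defensive.
Import Order.TTheory GRing.Theory Num.Theory numFieldNormedType.Exports.
Local Open Scope ring_scope.
Local Open Scope classical_set_scope.

(** The hypothesis on [f] is complex differentiability in each variable separately. By itself this
    gives neither joint continuity, nor local boundedness, nor measurability, and the usual way out
    is Hartogs' theorem. Here the finite norm takes its place: one-variable analyticity yields the
    sub-mean value inequality, its iteration bounds [|f|^2] locally by [||f||^2], and only then is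
    [f] expanded in several variables. The iteration integrates functions not yet known to be
    measurable, so it rests on monotonicity of the integral of nonnegative functions alone.

    Norms enter the statement as integrals of nonnegative functions, and inner products only through
    polarization. No complex function on [C^N] is integrated anywhere: orthogonality of monomials is
    used through averages over finitely many roots of unity, taken pointwise under a nonnegative
    integral. Such averages are exact on polynomials of low degree; Fatou's lemma passes to the
    limit.

    The kernel series converges over cubes of multi-indices, while the theorem sums by total degree
    in [q] with the sum over [p] completed, so a rearrangement by comparison closes the proof. *)

Lemma exp_sum_cvg (R : realType) (x : R) : (fun L => \sum_(p < L.+1) x ^+ p / p`!%:R) @ \oo --> expR x.
Proof.
(* Here [expR x] is unfolded to the limit of the series of [exp_coeff x], so this precedes the point
   where [expR] becomes opaque. *)
have h : series (exp_coeff x) @ \oo --> expR x by exact: is_cvg_series_exp_coeff.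
move: h; rewrite -cvg_shiftS; under eq_fun do rewrite /series /= big_mkord.
by [].
Qed.

Local Open Scope complex_scope.
Local Opaque integral powR expR.

(** * Iterated integrals of Borel functions on C^N *)

(* No measurability of [f]: this is applied to holomorphic functions before they
   are known to be limits of polynomials. *)
Lemma ge0_le_integral_gen d (T : measurableType d) (R : realType)
    (mu : {measure set T -> \bar R}) (f g : T -> \bar R) :
  (forall x, 0 <= f x)%E -> (forall x, f x <= g x)%E ->
  (\int[mu]_x f x <= \int[mu]_x g x)%E.
Proof.
move=> f0 fg; have g0 x : (0 <= g x)%E by exact: le_trans (f0 x) (fg x).
rewrite !ge0_integralTE//; apply: ereal_sup_le => _ [h hf <-].
by exists h => // x; exact: le_trans (hf x) (fg x).
Qed.

(** The image of Lebesgue measure under [x -> a x + b], multiplied by [|a|], gives every half-open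
    interval its length, hence is Lebesgue measure by uniqueness. Arbitrary measurable nonnegative
    [f] are then covered at once. *)
Lemma ge0_integral_affine (R : realType) (f : R -> \bar R) (a b : R) :
  a != 0 -> measurable_fun [set: R] f -> (forall x, 0 <= f x)%E ->
  (\int[@lebesgue_measure R]_x f (a * x + b)%R =
   `|a|^-1%:E * \int[@lebesgue_measure R]_x f x)%E.
Proof.
move=> a0 mf f0.
pose phi (x : measurableTypeR R) : measurableTypeR R := (a * x + b)%R.
have mphi : measurable_fun [set: measurableTypeR R] phi.
  by apply: measurable_funD => //; exact: mulrl_measurable.
have na0 : (0 <= `|a|)%R by [].
pose nu_ : {measure set (measurableTypeR R) -> \bar R} :=
  mscale (NngNum na0) (pushforward lebesgue_measure phi).
pose nu := nu_ mphi.
have nuE A : measurable A -> lebesgue_measure A = nu A.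
  apply: lebesgue_measure_unique => _ [[x y] /= _ <-].
  rewrite /nu /nu_ /mscale /= /pushforward.
  have [agt|alt|aeq] := ltgtP 0 a; last by rewrite -aeq eqxx in a0.
    rewrite (_ : phi @^-1` _ = `](x - b) / a, (y - b) / a]%classic); last first.
      apply/seteqP; split => z /=; rewrite !in_itv /= /phi.
        by rewrite ltr_pdivrMr// ler_pdivlMr// ltrBlDr lerBrDr mulrC.
      by rewrite ltr_pdivrMr// ler_pdivlMr// ltrBlDr lerBrDr mulrC.
    rewrite !lebesgue_measure_itv /= !lte_fin ltr_pM2r ?invr_gt0// ltrD2r.
    case: ifP => _; last by rewrite mule0.
    rewrite -!EFinD -EFinM ger0_norm ?ltW//; congr EFin; by field.
  (* For [a < 0] the preimage of an interval open on the left is open on the right; the length does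
     not see the difference. *)
  rewrite (_ : phi @^-1` _ = `[(y - b) / a, (x - b) / a[%classic); last first.
    apply/seteqP; split => z /=; rewrite !in_itv /= /phi.
      by rewrite ltr_ndivlMr// ler_ndivrMr// ltrBlDr lerBrDr mulrC andbC.
    by rewrite ltr_ndivlMr// ler_ndivrMr// ltrBlDr lerBrDr mulrC andbC.
  rewrite !lebesgue_measure_itv /= !lte_fin ltr_nM2r ?invr_lt0// ltrD2r.
  case: ifP => _; last by rewrite mule0.
  rewrite -!EFinD -EFinM ler0_norm ?ltW//; congr EFin; by field.
have -> : (\int[@lebesgue_measure R]_x f x = \int[nu]_x f x)%E.
  by apply: eq_measure_integral => A mA _; exact: nuE.
rewrite ge0_integral_mscale//= ge0_integral_pushforward//=.
rewrite muleA -EFinM mulVf ?normr_eq0// mul1e.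
by [].
Qed.

Section Nice.
Variables (R : realType) (N : nat).
Local Notation C := R[i].
Local Notation mR := (measurableTypeR R).
Local Notation leb := (@lebesgue_measure R).
Implicit Types (F G : cpt R N -> \bar R) (Z : cpt R N).

(* [cpt R N] carries no sigma-algebra; a function on it is called Borel when its
   composition with every measurably parametrized family of points is measurable. *)
Definition measurable_cpt d (T : measurableType d) (g : T -> cpt R N) : Prop :=
  forall j, measurable_fun [set: T] (fun x => complex.Re (g x j)) /\
            measurable_fun [set: T] (fun x => complex.Im (g x j)).

Definition borelE (F : cpt R N -> \bar R) : Prop :=
  forall d (T : measurableType d) (g : T -> cpt R N),
    measurable_cpt g -> measurable_fun [set: T] (fun x => F (g x)).

Definition upd (k : nat) (Z : cpt R N) (c : C) : cpt R N :=
  fun j => if val j == k then c else Z j.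

Definition cint (k : nat) (F : cpt R N -> \bar R) (Z : cpt R N) : \bar R :=
  (\int[leb]_s \int[leb]_t F (upd k Z (s +i* t)%C))%E.

Lemma iintS k F Z : iint k.+1 F Z = cint k (iint k F) Z.
Proof. by []. Qed.

Lemma measurable_cpt_upd d (T : measurableType d) (g : T -> cpt R N) k (s t : T -> R) :
  measurable_cpt g -> measurable_fun [set: T] s -> measurable_fun [set: T] t ->
  measurable_cpt (fun x => upd k (g x) (s x +i* t x)%C).
Proof. by move=> mg ms mt j; rewrite /upd; case: (val j == k). Qed.

Lemma measurable_cpt_comp d d' (T : measurableType d) (T' : measurableType d')
  (g : T -> cpt R N) (h : T' -> T) :
  measurable_cpt g -> measurable_fun [set: T'] h -> measurable_cpt (fun x => g (h x)).
Proof.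
move=> mg mh j; have [m1 m2] := mg j.
by split; [exact: (measurableT_comp m1 mh)|exact: (measurableT_comp m2 mh)].
Qed.

Lemma borelE_upd F k d (T : measurableType d) (g : T -> cpt R N) : borelE F ->
  measurable_cpt g ->
  measurable_fun [set: T * mR * mR]
    (fun p => F (upd k (g p.1.1) (p.1.2 +i* p.2)%C)).
Proof.
move=> nF mg; apply: (nF _ _ (fun p => upd k (g p.1.1) (p.1.2 +i* p.2)%C)).
apply: measurable_cpt_upd => //.
  apply: (measurable_cpt_comp mg).
  exact: (measurableT_comp measurable_fst measurable_fst).
exact: (measurableT_comp measurable_snd measurable_fst).
Qed.

(** The quantification of [borelE] over all parameter spaces pays off here: adjoining [s] and [t] to
    the parameters gives a product space, where Tonelli yields measurability of the partial
    integral. *)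
Lemma borelE_cint k F : borelE F -> (forall Z, 0 <= F Z)%E -> borelE (cint k F).
Proof.
move=> nF F0 d T g mg.
have mh := borelE_upd k nF mg.
have mh2 := @measurable_fun_fubini_tonelli_F _ _ _ _ R leb _ mh
  (fun _ => F0 _).
apply: (@measurable_fun_fubini_tonelli_F _ _ _ _ R leb _ mh2).
by move=> x; apply: integral_ge0.
Qed.

Lemma cint_ge0 k F Z : (forall Z, 0 <= F Z)%E -> (0 <= cint k F Z)%E.
Proof. by move=> F0; apply: integral_ge0 => s _; exact: integral_ge0. Qed.

Lemma iint_ge0 k F Z : (forall Z, 0 <= F Z)%E -> (0 <= iint k F Z)%E.
Proof. by move=> F0; elim: k Z => [|k IH Z]; [exact: F0|exact: cint_ge0]. Qed.

Lemma borelE_iint k F : borelE F -> (forall Z, 0 <= F Z)%E -> borelE (iint k F).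
Proof.
move=> nF F0; elim: k => // k IH.
by apply: borelE_cint => // Z; exact: iint_ge0.
Qed.

Lemma cint_le k F G Z : (forall Z, 0 <= F Z)%E -> (forall Z, F Z <= G Z)%E ->
  (cint k F Z <= cint k G Z)%E.
Proof.
move=> F0 FG; apply: ge0_le_integral_gen => s; first exact: integral_ge0.
exact: ge0_le_integral_gen.
Qed.

Lemma iint_le k F G Z : (forall Z, 0 <= F Z)%E -> (forall Z, F Z <= G Z)%E ->
  (iint k F Z <= iint k G Z)%E.
Proof.
move=> F0 FG; elim: k Z => [|k IH Z]; first exact: FG.
rewrite !iintS; apply: cint_le; last exact: IH.
by move=> W; exact: iint_ge0.
Qed.

Lemma borelE_cint_meas F k Z : borelE F ->
  measurable_fun [set: mR * mR] (fun p => F (upd k Z (p.1 +i* p.2)%C)).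
Proof.
move=> nF; apply: (nF _ _ (fun p : mR * mR => upd k Z (p.1 +i* p.2)%C)).
exact: (@measurable_cpt_upd _ _ (fun _ => Z)).
Qed.

Lemma borelE_cint_meas1 F k Z (s : R) : borelE F ->
  measurable_fun [set: mR] (fun t => F (upd k Z (s +i* t)%C)).
Proof.
move=> nF; apply: (nF _ _ (fun t : mR => upd k Z (s +i* t)%C)).
exact: (@measurable_cpt_upd _ _ (fun _ => Z)).
Qed.

Lemma borelE_cint_meas2 F k Z : borelE F -> (forall Z, 0 <= F Z)%E ->
  measurable_fun [set: mR] (fun s => \int[leb]_t F (upd k Z (s +i* t)%C))%E.
Proof.
move=> nF F0.
exact: (@measurable_fun_fubini_tonelli_F _ _ _ _ R leb _
  (borelE_cint_meas k Z nF) (fun _ => F0 _)).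
Qed.

Lemma cintD k F G Z : borelE F -> borelE G -> (forall Z, 0 <= F Z)%E ->
  (forall Z, 0 <= G Z)%E ->
  cint k (fun W => F W + G W)%E Z = (cint k F Z + cint k G Z)%E.
Proof.
move=> nF nG F0 G0; rewrite /cint -ge0_integralD//; last 4 first.
- by move=> s _; exact: integral_ge0.
- exact: borelE_cint_meas2.
- by move=> s _; exact: integral_ge0.
- exact: borelE_cint_meas2.
apply: eq_integral => s _; rewrite ge0_integralD//; exact: borelE_cint_meas1.
Qed.

Lemma cintZ k F Z (a : \bar R) : borelE F -> (forall Z, 0 <= F Z)%E -> (0 <= a)%E ->
  cint k (fun W => a * F W)%E Z = (a * cint k F Z)%E.
Proof.
move=> nF F0 a0; rewrite /cint -ge0_integralZl//; last 2 first.
- exact: borelE_cint_meas2.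
- by move=> s _; exact: integral_ge0.
apply: eq_integral => s _; rewrite ge0_integralZl//; exact: borelE_cint_meas1.
Qed.

Lemma borelED F G : borelE F -> borelE G -> borelE (fun W => F W + G W)%E.
Proof.
move=> nF nG d T g mg.
by apply: emeasurable_funD; [exact: nF|exact: nG].
Qed.

Lemma borelEM F G : borelE F -> borelE G -> borelE (fun W => F W * G W)%E.
Proof.
move=> nF nG d T g mg.
by apply: emeasurable_funM; [exact: nF|exact: nG].
Qed.

Lemma borelE_cst a : borelE (fun=> a).
Proof. by move=> d T g mg; exact: measurable_cst. Qed.

Lemma iintD k F G Z : borelE F -> borelE G -> (forall Z, 0 <= F Z)%E ->
  (forall Z, 0 <= G Z)%E ->
  iint k (fun W => F W + G W)%E Z = (iint k F Z + iint k G Z)%E.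
Proof.
move=> nF nG F0 G0; elim: k Z => [|k IH Z]; first by []; rewrite !iintS.
have -> : iint k (fun W => F W + G W)%E = (fun W => iint k F W + iint k G W)%E.
  by apply/funext => W; exact: IH.
apply: cintD; [exact: borelE_iint|exact: borelE_iint| |] => W; exact: iint_ge0.
Qed.

Lemma iintZ k F Z (a : \bar R) : borelE F -> (forall Z, 0 <= F Z)%E -> (0 <= a)%E ->
  iint k (fun W => a * F W)%E Z = (a * iint k F Z)%E.
Proof.
move=> nF F0 a0; elim: k Z => [|k IH Z]; first by []; rewrite !iintS.
have -> : iint k (fun W => a * F W)%E = (fun W => a * iint k F W)%E.
  by apply/funext => W; exact: IH.
apply: cintZ; [exact: borelE_iint| |exact: a0] => W; exact: iint_ge0.
Qed.

Lemma borelE_sum (I : Type) (r : seq I) (P : pred I) (F : I -> cpt R N -> \bar R) :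
  (forall i, borelE (F i)) -> borelE (fun W => \sum_(i <- r | P i) F i W)%E.
Proof.
move=> nF; elim: r => [|i r IH].
  have -> : (fun W => \sum_(i <- [::] | P i) F i W)%E = (fun=> 0%E).
    by apply/funext => W; rewrite big_nil.
  exact: borelE_cst.
have -> : (fun W => \sum_(i <- i :: r | P i) F i W)%E =
  (fun W => if P i then F i W + \sum_(i <- r | P i) F i W else
     \sum_(i <- r | P i) F i W)%E.
  by apply/funext => W; rewrite big_cons.
by case: (P i) => //; apply: borelED.
Qed.

Lemma iint_sum k (I : Type) (r : seq I) (P : pred I) (F : I -> cpt R N -> \bar R) Z :
  (forall i, borelE (F i)) -> (forall i Z, 0 <= F i Z)%E ->
  iint k (fun W => \sum_(i <- r | P i) F i W)%E Z =
  (\sum_(i <- r | P i) iint k (F i) Z)%E.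
Proof.
move=> nF F0; elim: r => [|i r IH].
  have -> : (fun W => \sum_(i <- [::] | P i) F i W)%E = (fun=> 0%E).
    by apply/funext => W; rewrite big_nil.
  rewrite big_nil; elim: k Z => [|k IH Z]; first by [].
  rewrite iintS /cint.
  have -> : iint k (fun=> 0%E) = (fun=> 0%E :> \bar R) :> (cpt R N -> \bar R).
    by apply/funext => W; exact: IH.
  under eq_integral do rewrite integral0.
  by rewrite integral0.
rewrite big_cons.
have -> : (fun W => \sum_(i <- i :: r | P i) F i W)%E =
  (fun W => if P i then F i W + \sum_(i <- r | P i) F i W else
     \sum_(i <- r | P i) F i W)%E.
  by apply/funext => W; rewrite big_cons.
case: (P i); last exact: IH.
rewrite (iintD _ _ (nF i) (borelE_sum _ _ nF) (F0 i)) ?IH//.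
by move=> W; exact: sume_ge0.
Qed.

Lemma limn_einf_ge0 (u : (\bar R)^nat) : (forall n, 0 <= u n)%E -> (0 <= limn_einf u)%E.
Proof.
move=> u0; rewrite limn_einf_lim; apply: lime_ge; first exact: is_cvg_einfs.
by apply: nearW => n; apply: le_ereal_inf_tmp => _ [m _ <-].
Qed.

Lemma borelE_cvg (F : nat -> cpt R N -> \bar R) G :
  (forall n, borelE (F n)) -> (forall W, F ^~ W @ \oo --> G W) -> borelE G.
Proof.
move=> nF FG d T g mg.
apply: (@emeasurable_fun_cvg _ _ _ _ (fun n x => F n (g x))) => [n|x _].
  exact: nF.
exact: FG.
Qed.

(** Fatou's lemma is applied in each real variable, from the innermost integral outwards. *)
Lemma iint_fatou (F : nat -> cpt R N -> \bar R) k Z :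
  (forall n, borelE (F n)) -> (forall n Z, 0 <= F n Z)%E ->
  (iint k (fun W => limn_einf (F ^~ W)) Z <= limn_einf (fun n => iint k (F n) Z))%E.
Proof.
move=> nF F0; elim: k Z => [|k IH Z]; first by []; rewrite iintS.
apply: (@le_trans _ _ (cint k (fun W => limn_einf (fun n => iint k (F n) W)) Z)).
  apply: cint_le => // W; apply: iint_ge0 => ?; exact: limn_einf_ge0.
have nI n : borelE (iint k (F n)) by exact: borelE_iint.
have I0 n W : (0 <= iint k (F n) W)%E by exact: iint_ge0.
apply: le_trans; last first.
  apply: (@fatou _ _ _ leb _ _ (fun n s => \int[leb]_t iint k (F n) (upd k Z (s +i* t)%C))%E) => //.
    by move=> n; exact: borelE_cint_meas2.
  by move=> n s _; exact: integral_ge0.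
apply: ge0_le_integral_gen => s.
  by apply: integral_ge0 => t _; exact: limn_einf_ge0.
apply: (@fatou _ _ _ leb _ _ (fun n t => iint k (F n) (upd k Z (s +i* t)%C))) => //.
by move=> n; exact: borelE_cint_meas1.
Qed.

(** Both inequalities of the Parseval formula come from this form of Fatou. *)
Lemma iint_fatou_cvg (F : nat -> cpt R N -> \bar R) (G : cpt R N -> \bar R)
   k Z (B : \bar R) :
  (forall n, borelE (F n)) -> (forall n Z, 0 <= F n Z)%E ->
  (forall W, F ^~ W @ \oo --> G W) ->
  (\forall n \near \oo, iint k (F n) Z <= B)%E ->
  (iint k G Z <= B)%E.
Proof.
move=> nF F0 FG FB.
have -> : G = (fun W => limn_einf (F ^~ W)).
  by apply/funext => W; rewrite (is_cvg_limn_einfE (cvgP _ (FG W))); apply/esym/cvg_lim.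
apply: le_trans (iint_fatou _ _ nF F0) _.
rewrite limn_einf_lim; apply: lime_le; first exact: is_cvg_einfs.
near=> n; apply: le_trans (_ : iint k (F n) Z <= B)%E; last by near: n.
by apply: ereal_inf_lbound; exists n => /=.
Unshelve. all: by end_near. Qed.

End Nice.

(** * Invariance of the iterated integral under the torus action *)

Section Rotation.
Variable (R : realType).
Local Notation mR := (measurableTypeR R).
Local Notation leb := (@lebesgue_measure R).

(* A rotation is a product of shears and dilations of the axes, so the
   one-dimensional affine change of variables suffices. *)
Lemma ge0_integral_rot2 (G : mR * mR -> \bar R) (c d : R) :
  measurable_fun [set: mR * mR] G -> (forall p, 0 <= G p)%E ->
  c ^+ 2 + d ^+ 2 = 1 ->
  (\int[leb]_s \int[leb]_t G (c * s - d * t, c * t + d * s)%R =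
   \int[leb]_s \int[leb]_t G (s, t))%E.
Proof.
move=> mG G0 cd1.
have mGp (f g : mR * mR -> mR) : measurable_fun setT f -> measurable_fun setT g ->
    measurable_fun [set: mR * mR] (fun p => G (f p, g p)).
  by move=> mf mg; apply: (measurableT_comp mG); apply: measurable_fun_pair.
have mG1 (f g : mR -> mR) : measurable_fun setT f -> measurable_fun setT g ->
    measurable_fun [set: mR] (fun p => G (f p, g p)).
  by move=> mf mg; apply: (measurableT_comp mG); apply: measurable_fun_pair.
have mfs := @measurable_fst _ _ mR mR.
have msn := @measurable_snd _ _ mR mR.
have mM k (f : mR * mR -> mR) : measurable_fun setT f -> measurable_fun setT (fun p => k * f p)%R.
  by move=> mf; exact: measurable_funM.
(* The shears below divide by [c]. For [c = 0] the rotation exchanges the axes up to sign, since [d]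
   is 1 or -1. *)
have [c0|c0] := eqVneq c 0.
  have d0 : d != 0.
    by apply: contra_eq_neq cd1 => ->; rewrite c0 expr0n /= addr0 eq_sym oner_neq0.
  have nd : `|d| = 1.
    have : d ^+ 2 = 1 by rewrite -cd1 c0 expr0n add0r.
    by move/eqP; rewrite sqrf_eq1 => /orP[] /eqP ->; rewrite ?normrN normr1.
  transitivity (\int[leb]_s \int[leb]_t G (t, d * s)%R)%E.
    apply: eq_integral => s _.
    transitivity (\int[leb]_t (fun t => G (t, d * s)%R) (- d * t + 0)%R)%E.
      apply: eq_integral => t _; congr (G (_, _)); rewrite c0; ring.
    rewrite (@ge0_integral_affine _ (fun t => G (t, d * s)) (- d) 0) ?oppr_eq0//; last first.
      by apply: mG1 => //; exact: measurable_cst.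
    by rewrite normrN nd invr1 mul1e.
  rewrite (@fubini_tonelli _ _ _ _ _ leb leb (fun p => G (p.2, d * p.1)))//=; last first.
    by apply: mGp => //; exact: mM.
  apply: eq_integral => s _.
  transitivity (\int[leb]_t (fun t => G (s, t)%R) (d * t + 0)%R)%E.
    by apply: eq_integral => t _; rewrite addr0.
  rewrite (@ge0_integral_affine _ (fun t => G (s, t)) d 0)//; last first.
    by apply: mG1 => //; exact: measurable_cst.
  by rewrite nd invr1 mul1e.
rewrite (@fubini_tonelli _ _ _ _ _ leb leb (fun p => G (c * p.1 - d * p.2, c * p.2 + d * p.1)))//=; last first.
  apply: mGp; first by apply: measurable_funB; exact: mM.
  by apply: measurable_funD; exact: mM.
(* For fixed [t] put [x = c s - d t]. The second coordinate becomes [(c^2 + d^2) t / c + d x / c = t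
   / c + d x / c]. The substitution in [t] that follows restores the factor [|c|]. *)
transitivity (\int[leb]_t (`|c|^-1%:E * \int[leb]_x G (x, c^-1 * t + d * x / c)%R))%E.
  apply: eq_integral => t _.
  rewrite -(@ge0_integral_affine _ (fun x => G (x, c^-1 * t + d * x / c)%R) c (- (d * t)))//.
    apply: eq_integral => s _; congr (G (_, _)).
    have E (u v : R) : c * u + d * v = c^-1 * u + d * (c * v - d * u) / c.
      rewrite [RHS](_ : _ = (1 - d ^+ 2) * u / c + d * v); last by field.
      rewrite -cd1 addrK; by field.
    exact: E.
  apply: mG1 => //; apply: measurable_funD; first exact: measurable_cst.
  by apply: measurable_funM => //; exact: mulrl_measurable.
have mH : measurable_fun [set: mR * mR] (fun p => G (p.2, c^-1 * p.1 + d * p.2 / c)%R).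
  apply: mGp => //; apply: measurable_funD; first exact: mM.
  by apply: measurable_funM => //; exact: mM.
rewrite ge0_integralZl//; last 2 first.
- exact: (@measurable_fun_fubini_tonelli_F _ _ _ _ R leb _ mH).
- by move=> t _; exact: integral_ge0.
rewrite (@fubini_tonelli _ _ _ _ _ leb leb (fun p => G (p.2, c^-1 * p.1 + d * p.2 / c)%R))//=.
transitivity (`|c|^-1%:E * \int[leb]_x (`|c|%:E * \int[leb]_t G (x, t)))%E.
  congr (_ * _)%E; apply: eq_integral => x _.
  rewrite (@ge0_integral_affine _ (fun t => G (x, t)) c^-1 (d * x / c)%R) ?invr_eq0//; last first.
    by apply: mG1 => //; exact: measurable_cst.
  by rewrite normfV invrK.
rewrite ge0_integralZl//; last 2 first.
- exact: (@measurable_fun_fubini_tonelli_F _ _ _ _ R leb _ mG).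
- by move=> t _; exact: integral_ge0.
by rewrite muleA -EFinM mulVf ?normr_eq0// mul1e.
Qed.

Definition rotv N (w Z : cpt R N) : cpt R N := fun j => w j * Z j.

(** Coordinates not yet integrated are rotated as well, hence the base point [rotv w Z] on the
    right; the base point 0 of [intC] is fixed by the rotation. *)
Lemma iint_rot N k (F : cpt R N -> \bar R) (w Z : cpt R N) :
  borelE F -> (forall Z, 0 <= F Z)%E -> (forall j, cabs2 (w j) = 1) -> (k <= N)%N ->
  iint k (fun W => F (rotv w W)) Z = iint k F (rotv w Z).
Proof.
move=> nF F0 w1; elim: k Z => [|k IH Z kN]; first by [].
rewrite !iintS /cint.
under eq_integral => s _ do under eq_integral => t _ do rewrite (IH _ (ltnW kN)).
pose j := Ordinal kN.
case E : (w j) => [c d].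
have cd : c ^+ 2 + d ^+ 2 = 1 by move: (w1 j); rewrite E.
rewrite -(@ge0_integral_rot2 (fun p => iint k F (upd k (rotv w Z) (p.1 +i* p.2)%C)) c d); last 3 first.
- by apply: borelE_cint_meas; exact: borelE_iint.
- by move=> p; exact: iint_ge0.
- exact: cd.
- apply: eq_integral => s _; apply: eq_integral => t _; congr (iint k F _).
  apply/funext => i; rewrite /rotv /upd; case: eqP => [ik|]//=.
  have -> : i = j by exact: val_inj.
  by rewrite E.
Qed.

Lemma intC_rot N (F : cpt R N -> \bar R) (w : cpt R N) :
  borelE F -> (forall Z, 0 <= F Z)%E -> (forall j, cabs2 (w j) = 1) ->
  intC (fun W => F (rotv w W)) = intC F.
Proof.
move=> nF F0 w1; rewrite /intC (iint_rot _ nF F0 w1 (leqnn N)); congr iint.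
by apply/funext => j; rewrite /rotv mulr0.
Qed.

End Rotation.

(** * Radial, Gamma, Beta and Dirichlet integrals *)

Section Radial.
Variable (R : realType).
Local Notation mR := (measurableTypeR R).
Local Notation leb := (@lebesgue_measure R).

Definition norm2sq (p : mR * mR) : mR := (p.1 ^+ 2 + p.2 ^+ 2)%R.
Definition leb2 : {measure set (mR * mR) -> \bar R} := (leb \x leb)%E.

Lemma measurable_sq2 : measurable_fun [set: mR * mR] norm2sq.
Proof.
by apply: measurable_funD; apply: measurable_funX;
  [exact: measurable_fst|exact: measurable_snd].
Qed.

Lemma integral_leb2 (f : mR * mR -> \bar R) :
  measurable_fun [set: mR * mR] f -> (forall p, 0 <= f p)%E ->
  (\int[leb2]_p f p = \int[leb]_s \int[leb]_t f (s, t))%E.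
Proof. by move=> mf f0; rewrite fubini_tonelli1. Qed.

Definition disc_area (x : R) : \bar R := leb2 [set p | norm2sq p <= x].

Lemma measurable_disc x : measurable [set p | norm2sq p <= x].
Proof.
rewrite (_ : [set p | _] = norm2sq @^-1` `]-oo, x]%classic).
  by rewrite -[X in measurable X]setTI; apply: measurable_sq2.
by apply/seteqP; split => p /=; rewrite in_itv.
Qed.

Lemma disc_areaE x :
  disc_area x = (\int[leb]_s \int[leb]_t (\1_[set p | (norm2sq p <= x)%R] (s, t))%:E)%E.
Proof.
rewrite -(@integral_leb2 (fun p => (\1_[set p | (norm2sq p <= x)%R] p)%:E)).
- by rewrite integral_indic//= ?setIT//; exact: measurable_disc.
- by apply/measurable_EFinP; apply: measurable_indic; exact: measurable_disc.
- by move=> p; rewrite lee_fin.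
Qed.

(** Both axes are dilated by [sqrt x], each contributing a factor [sqrt x]. *)
Lemma disc_area_scale x : 0 < x -> disc_area x = (x%:E * disc_area 1)%E.
Proof.
move=> x0; rewrite !disc_areaE.
have sx : Num.sqrt x != 0 by rewrite gt_eqF// sqrtr_gt0.
have mI1 s : measurable_fun [set: R] (fun t => (\1_[set p | (norm2sq p <= x)%R] (s, t))%:E : \bar R).
  apply/measurable_EFinP.
  apply: (measurableT_comp (measurable_indic (measurable_disc x))).
  exact: pair1_measurable.
have mI2 : measurable_fun [set: mR] (fun s => \int[leb]_t (\1_[set p | (norm2sq p <= x)%R] (s, t))%:E)%E.
  apply: (@measurable_fun_fubini_tonelli_F _ _ _ _ R leb (fun p => (\1_[set p | (norm2sq p <= x)%R] p)%:E)).
    by apply/measurable_EFinP; apply: measurable_indic; exact: measurable_disc.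
  by move=> p; rewrite lee_fin.
transitivity ((\int[leb]_s (x%:E * \int[leb]_t (\1_[set p | (norm2sq p <= 1)%R] (s, t))%:E)))%E; last first.
  rewrite ge0_integralZl//; last 2 first.
  - by move=> s _; apply: integral_ge0 => t _; rewrite lee_fin.
  - by rewrite lee_fin ltW.
  have := (@measurable_fun_fubini_tonelli_F _ _ _ _ R leb (fun p => (\1_[set p | (norm2sq p <= 1)%R] p)%:E)).
  apply; last by move=> p; rewrite lee_fin.
  by apply/measurable_EFinP; apply: measurable_indic; exact: measurable_disc.
transitivity (\int[leb]_s (`|Num.sqrt x|%:E * (\int[leb]_t (\1_[set p | (norm2sq p <= x)%R] (Num.sqrt x * s + 0, t))%:E)))%E.
  rewrite ge0_integralZl//; last 2 first.
  - rewrite (_ : (fun s => _) = (fun s => \int[leb]_t (\1_[set p | (norm2sq p <= x)%R] (s, t))%:E)%E \o (fun s => Num.sqrt x * s + 0)%R)//.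
    apply: measurableT_comp => //; exact: measurable_funD.
  - by move=> s _; apply: integral_ge0 => t _; rewrite lee_fin.
  have I0 s : (0 <= \int[leb]_t (\1_[set p | (norm2sq p <= x)%R] (s, t))%:E)%E.
    by apply: integral_ge0 => t _; rewrite lee_fin.
  have E := ge0_integral_affine 0 sx mI2 I0.
  transitivity (`|Num.sqrt x|%:E * ((`|Num.sqrt x|^-1)%:E * \int[leb]_s \int[leb]_t (\1_[set p | (norm2sq p <= x)%R] (s, t))%:E))%E.
    by rewrite muleA -EFinM mulfV ?normr_eq0// mul1e.
  congr (_ * _)%E; exact: (esym E).
apply: eq_integral => s _.
transitivity (`|Num.sqrt x|%:E * (`|Num.sqrt x|%:E * \int[leb]_t (\1_[set p | (norm2sq p <= x)%R] (Num.sqrt x * s + 0, Num.sqrt x * t + 0)%R)%:E))%E.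
  congr (_ * _)%E.
  rewrite (@ge0_integral_affine _ (fun t => (\1_[set p | (norm2sq p <= x)%R] (Num.sqrt x * s + 0, t)%R)%:E)); last 3 first.
  - exact: sx.
  - exact: mI1.
  - by move=> t; rewrite lee_fin.
  by rewrite muleA -EFinM mulfV ?normr_eq0// mul1e.
rewrite muleA -EFinM -normrM -expr2 sqr_sqrtr ?ltW// gtr0_norm//.
congr (_ * _)%E; apply: eq_integral => t _; congr EFin.
rewrite !indicE; congr (nat_of_bool _)%:R.
rewrite -[LHS]/(_ \in _) -[RHS]/(_ \in _); apply/idP/idP; rewrite !inE /norm2sq /= !addr0 !exprMn (sqr_sqrtr (ltW x0)).
  by move=> h; nra.
by move=> h; nra.
Qed.

(** The unit disc contains the square of side [[0, 1/2]] and lies in the square of side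
    [[-1, 1]]. *)
Lemma disc_area1_fin : exists2 c, 0 < c & disc_area 1 = c%:E.
Proof.
have box (a b : R) : a < b -> leb2 (`[a, b]%classic `*` `[a, b]%classic) = ((b - a) * (b - a))%:E.
  move=> ab; rewrite [LHS](@product_measure1E _ _ _ _ _ leb leb)//.
  have h : lebesgue_measure (`[a, b]%classic : set mR) = (b - a)%:E.
    by rewrite lebesgue_measure_itv/= lte_fin ab.
  rewrite EFinM -h; reflexivity.
have mb (a b : R) : measurable (`[a, b]%classic `*` `[a, b]%classic : set (mR * mR)).
  by apply: measurableX.
have lo : (leb2 (`[0%R, 2^-1%R]%classic `*` `[0%R, 2^-1%R]%classic) <= disc_area 1)%E.
  apply: le_measure; rewrite ?inE//; first exact: measurable_disc.
  move=> [s t] /=; rewrite !in_itv /norm2sq /= => -[/andP[s0 s1] /andP[t0 t1]]; nra.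
have hi : (disc_area 1 <= leb2 (`[(-1)%R, 1%R]%classic `*` `[(-1)%R, 1%R]%classic))%E.
  apply: le_measure; rewrite ?inE//; first exact: measurable_disc.
  by move=> [s t] /=; rewrite !in_itv /norm2sq /= => h; split; apply/andP; split; nra.
rewrite box in lo; last by rewrite invr_gt0.
rewrite box in hi; last by lra.
move: lo hi; case: (disc_area 1) => [c| |]//=.
- by rewrite !lee_fin => h1 _; exists c => //; apply: lt_le_trans h1; rewrite subr0 mulr_gt0// invr_gt0.
Qed.

Lemma disc_area_le0 x : x <= 0 -> disc_area x = 0%E.
Proof.
move=> x0; have [c c0 cE] := disc_area1_fin.
apply/eqP; rewrite eq_le measure_ge0 andbT.
apply/lee_addgt0Pr => e e0; rewrite add0e.
have -> : e%:E = disc_area (e / c) by rewrite disc_area_scale ?divr_gt0// cE -EFinM divfK ?gt_eqF.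
apply: le_measure; rewrite ?inE; [exact: measurable_disc|exact: measurable_disc|].
by move=> p /= h; apply: le_trans h _; apply: le_trans x0 _; rewrite ltW// divr_gt0.
Qed.

(* The area of a disc is proportional to the squared radius, which determines the
   pushforward of the Lebesgue measure by [s^2 + t^2].  The Gaussian integral
   identifies the constant with [pi] in [ge0_integral_radial]. *)
Lemma ge0_integral_radial_aux : exists c : R, forall phi : R -> \bar R,
  measurable_fun [set: R] phi -> (forall u, 0 <= phi u)%E ->
  (\int[leb]_s \int[leb]_t phi (s ^+ 2 + t ^+ 2)%R =
   c%:E * \int[leb]_u ((\1_[set u : R | (0 < u)%R] u)%:E * phi u))%E.
Proof.
have [c c0 cE] := disc_area1_fin; exists c => phi mphi phi0.
have NE x : disc_area x = (c * Num.max x 0)%:E.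
  have [x0|x0] := ltP 0 x; last by rewrite mulr0 disc_area_le0.
  by rewrite disc_area_scale// cE -EFinM mulrC.
pose nu1_ : {measure set mR -> \bar R} := pushforward leb2 norm2sq.
pose nu1 := nu1_ measurable_sq2.
(* The pushforward charges only the positive half line. Adding Lebesgue measure on the negative half
   line gives a measure [M] that can be compared with Lebesgue measure on every interval. *)
have mneg : measurable (`]-oo, 0%R]%classic : set mR) by [].
pose nu2 : {measure set mR -> \bar R} := mrestr leb mneg.
have ci : 0 <= c^-1 by rewrite invr_ge0 ltW.
pose nu3 : {measure set mR -> \bar R} := mscale (NngNum ci) nu1.
pose M : {measure set mR -> \bar R} := measure_add nu3 nu2.
have itvE x y : x <= y -> leb2 [set p | (x < norm2sq p) && (norm2sq p <= y)] =
    (c * (Num.max y 0 - Num.max x 0))%:E.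
  move=> xy.
  rewrite (_ : [set p | _] = [set p | norm2sq p <= y] `\` [set p | norm2sq p <= x]).
    rewrite measureD//; [|exact: measurable_disc|exact: measurable_disc|].
      rewrite (_ : _ `&` _ = [set p | norm2sq p <= x]).
        transitivity (disc_area y - disc_area x)%E; first by [].
        by rewrite !NE -EFinB mulrBr.
      by apply/seteqP; split => p /=; [case|move=> h; split => //; exact: le_trans xy].
    have := ltry (c * Num.max y 0); rewrite -NE; exact.
  apply/seteqP; split => p /=.
    by move=> /andP[h1 h2]; split => //; apply/negP; rewrite -ltNge.
  by move=> [h1 /negP]; rewrite -ltNge => ->.
have ME A : measurable A -> leb A = M A.
  apply: lebesgue_measure_unique => _ [[x y] /= _ <-].
  rewrite lebesgue_measure_itv /= lte_fin.
  rewrite -[M _]/(measure_add nu3 nu2 _) measure_addE /nu3 /nu2 /mscale /mrestr /= /nu1 /nu1_ /= /pushforward.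
  transitivity ((c^-1)%:E * leb2 (norm2sq @^-1` `]x, y]%classic) + leb (`]x, y]%classic `&` `]-oo, 0%R]%classic))%E; last by [].
  have -> : `]x, y]%classic `&` `]-oo, 0%R]%classic = `]x, Num.min y 0]%classic :> set mR.
    apply/seteqP; split => z /=; rewrite !in_itv /= le_min.
      by move=> [/andP[-> ->] ->].
    by move=> /andP[-> /andP[-> ->]].
  rewrite lebesgue_measure_itv /= lte_fin.
  have [xy|yx] := ltP x y; last first.
    rewrite (_ : norm2sq @^-1` _ = set0) ?measure0 ?mule0 ?add0e.
      by case: ifP => //; rewrite lt_min => /andP[/(le_lt_trans yx)]; rewrite ltxx.
    apply/seteqP; split => p //=; rewrite in_itv /= => /andP[h1 h2].
    by have := lt_le_trans h1 (le_trans h2 yx); rewrite ltxx.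
  rewrite (_ : norm2sq @^-1` _ = [set p | (x < norm2sq p) && (norm2sq p <= y)]); last first.
    by apply/seteqP; split => p /=; rewrite in_itv.
  rewrite (itvE _ _ (ltW xy)) -EFinM mulrA mulVf ?gt_eqF// mul1r -EFinB.
  case: ifPn; rewrite lt_min xy /= => h.
    rewrite -!EFinB -EFinD; congr EFin.
    by have [y0|y0] := ltP 0 y; have [x0|x0] := ltP 0 x; lra.
  rewrite adde0; congr EFin.
  by have [y0|y0] := ltP 0 y; have [x0|x0] := ltP 0 x; lra.
pose psi := phi \_ [set u : R | 0 < u].
have mpos : measurable [set u : R | 0 < u].
  rewrite (_ : [set u | _] = `]0, +oo[%classic)//.
  by apply/seteqP; split => u /=; rewrite in_itv /= andbT.
have psi0 u : (0 <= psi u)%E by rewrite /psi patchE; case: ifP.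
have mpsi : measurable_fun [set: R] psi.
  by rewrite /psi; apply/(measurable_restrictT _ _).1 => //; exact: measurable_funTS.
have psiE u : psi u = ((\1_[set u : R | (0 < u)%R] u)%:E * phi u)%E.
  by rewrite /psi patchE indicE; case: ifP => _; rewrite ?mul1e ?mul0e.
(* At values [s^2 + t^2] the functions [phi] and [psi] differ only at the origin; it suffices to
   discard the null set [s = 0] of the outer integral. *)
transitivity (\int[leb]_s \int[leb]_t psi (s ^+ 2 + t ^+ 2)%R)%E.
  have mphi2 : measurable_fun [set: mR * mR] (fun p => phi (norm2sq p)).
    by apply: (measurableT_comp mphi); exact: measurable_sq2.
  have mpsi2 : measurable_fun [set: mR * mR] (fun p => psi (norm2sq p)).
    by apply: (measurableT_comp mpsi); exact: measurable_sq2.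
  apply: ge0_ae_eq_integral => //.
  - exact: (@measurable_fun_fubini_tonelli_F _ _ _ _ R leb _ mphi2).
  - exact: (@measurable_fun_fubini_tonelli_F _ _ _ _ R leb _ mpsi2).
  - by move=> s _; exact: integral_ge0.
  - by move=> s _; exact: integral_ge0.
  exists [set 0%R]; split => //; first exact: lebesgue_measure_set1.
  move=> s /= h; apply: contrapT => /eqP s0; apply: h => _.
  apply: eq_integral => t _; rewrite psiE indicE mem_set ?mul1e//=.
  by rewrite ltr_pwDl// ?sqr_ge0// exprn_even_gt0.
transitivity (c%:E * \int[leb]_u psi u)%E; last first.
  by congr (_ * _)%E; apply: eq_integral => u _; rewrite psiE.
have -> : (\int[leb]_u psi u = \int[M]_u psi u)%E.
  by apply: eq_measure_integral => A mA _; exact: ME.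
rewrite /M ge0_integral_measure_add//.
have -> : (\int[nu2]_x psi x = 0)%E.
  rewrite /psi -integral_mkcond null_set_integral//.
    exact: measurable_funTS.
  transitivity (leb ([set u : R | 0 < u] `&` `]-oo, 0%R]%classic)); first by [].
  rewrite (_ : _ `&` _ = set0) ?measure0//.
  apply/seteqP; split => u //=; rewrite in_itv /= => -[u0].
  by rewrite leNgt u0.
rewrite adde0 /nu3 ge0_integral_mscale//= muleA -EFinM mulfV ?gt_eqF// mul1e.
rewrite /nu1 /nu1_ /= ge0_integral_pushforward//=; last first.
  exact: measurable_sq2.
rewrite (@integral_leb2 (psi \o norm2sq))//; last by move=> p; exact: psi0.
by apply: (measurableT_comp mpsi); exact: measurable_sq2.
Qed.

Lemma integral_expRN :
  (\int[leb]_u ((\1_[set u : R | (0 < u)%R] u)%:E * (expR (- u))%:E) = 1)%E.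
Proof.
rewrite -(@integral_exponential_pdf R 1)//.
apply: ge0_ae_eq_integral => //.
- apply/measurable_EFinP; apply: measurable_funM => //.
    apply: measurable_indic; rewrite (_ : [set u | _] = `]0, +oo[%classic)//.
    by apply/seteqP; split => u /=; rewrite in_itv /= andbT.
  by apply: measurableT_comp => //; exact: oppr_measurable.
- by apply/measurable_EFinP; exact: measurable_exponential_pdf.
- by move=> u _; rewrite lee_fin exponential_pdf_ge0.
exists [set 0%R]; split => //; first exact: lebesgue_measure_set1.
move=> u /= h; apply: contrapT => /eqP u0; apply: h => _.
rewrite -EFinM; congr EFin; rewrite indicE.
have [up|un] := ltP 0 u.
  by rewrite mem_set//= mul1r exponential_pdfE ?ltW// mul1r mulN1r.
rewrite memNset/= ?mul0r; last by apply/negP; rewrite -leNgt.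
by rewrite lt0_exponential_pdf// lt_neqAle u0.
Qed.

Lemma ge0_integral_radial (phi : R -> \bar R) :
  measurable_fun [set: R] phi -> (forall u, 0 <= phi u)%E ->
  (\int[leb]_s \int[leb]_t phi (s ^+ 2 + t ^+ 2)%R =
   pi%:E * \int[leb]_u ((\1_[set u : R | (0 < u)%R] u)%:E * phi u))%E.
Proof.
move=> mphi phi0; have [c cE] := ge0_integral_radial_aux.
rewrite cE//; congr (_ * _)%E.
have := cE (fun u => (expR (- u))%:E).
rewrite integral_expRN mule1 => <-//.
- have mg : measurable_fun [set: mR] (fun t => (gauss_fun t)%:E : \bar R).
    by apply/measurable_EFinP; exact: measurable_gauss_fun.
  have g0 t : (0 <= (@gauss_fun R t)%:E)%E by rewrite lee_fin expR_ge0.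
  transitivity (\int[leb]_s ((gauss_fun s)%:E * (Num.sqrt pi)%:E))%E.
    apply: eq_integral => s _; rewrite -integralT_gauss -ge0_integralZl//.
    by apply: eq_integral => t _; rewrite -EFinM /gauss_fun -expRD opprD.
  rewrite ge0_integralZr//.
  rewrite [X in (X * _)%E]integralT_gauss.
  by rewrite -EFinM -expr2 sqr_sqrtr// pi_ge0.
- by apply/measurable_EFinP; apply: measurableT_comp => //; exact: oppr_measurable.
Qed.
End Radial.

(** * Gamma and Beta integrals *)

Section GammaBeta.
Variable (R : realType).
Local Notation mR := (measurableTypeR R).
Local Notation leb := (@lebesgue_measure R).

(* [u ^ (a - 1)] cut off at [u <= 0], where [powR] has junk values. *)
Definition pos_powR (a u : R) : R := \1_[set u : R | 0 < u] u * u `^ (a - 1).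

Lemma measurable_pos : measurable [set u : R | 0 < u].
Proof.
rewrite (_ : [set u | _] = `]0, +oo[%classic)//.
by apply/seteqP; split => u /=; rewrite in_itv /= andbT.
Qed.

Lemma pos_powRE a u : 0 < u -> pos_powR a u = u `^ (a - 1).
Proof. by move=> u0; rewrite /pos_powR indicE mem_set ?mul1r. Qed.

Lemma pos_powR_le0 a u : u <= 0 -> pos_powR a u = 0.
Proof.
by move=> u0; rewrite /pos_powR indicE memNset ?mul0r//=; apply/negP; rewrite -leNgt.
Qed.

Lemma pos_powR_ge0 a u : 0 <= pos_powR a u.
Proof. by rewrite /pos_powR mulr_ge0// powR_ge0. Qed.

Lemma measurable_pos_powR a : measurable_fun [set: R] (pos_powR a).
Proof.
apply: measurable_funM; last exact: measurable_powR.
by apply: measurable_indic; exact: measurable_pos.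
Qed.

Lemma pos_powR1 u : pos_powR 1 u = \1_[set u : R | 0 < u] u.
Proof. by rewrite /pos_powR subrr powRr0 mulr1. Qed.

Lemma pos_powR_nat k u : pos_powR k.+1%:R u = \1_[set u : R | 0 < u] u * u ^+ k.
Proof.
have [u0|u0] := ltP 0 u.
  by rewrite pos_powRE// indicE mem_set// mul1r -natr1 addrK powR_mulrn// ltW.
by rewrite pos_powR_le0// indicE memNset ?mul0r//=; apply/negP; rewrite -leNgt.
Qed.

Lemma pos_powR_scale a s u : 0 < s -> pos_powR a (s * u) = s `^ (a - 1) * pos_powR a u.
Proof.
move=> s0; have [u0|u0] := ltP 0 u.
  by rewrite !pos_powRE ?mulr_gt0// powRM// ltW.
by rewrite !pos_powR_le0 ?mulr0// pmulr_rle0.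
Qed.

(** With values in the extended reals, identities between these integrals follow from Tonelli
    without convergence hypotheses; finiteness is proved afterwards. *)
Definition eGamma (a : R) : \bar R := (\int[leb]_u (pos_powR a u * expR (- u))%:E)%E.
Definition eBeta (a b : R) : \bar R := (\int[leb]_u (pos_powR a u * pos_powR b (1 - u))%:E)%E.

Lemma GammaE a : Gamma a = fine (eGamma a).
Proof.
rewrite /Gamma integral_mkcond /eGamma; congr fine; apply: eq_integral => u _.
rewrite patchE; case: ifPn => [|u0].
  by rewrite inE /= => u0; rewrite pos_powRE.
by rewrite pos_powR_le0 ?mul0r// leNgt; apply/negP => h; move: u0; rewrite mem_set.
Qed.

Lemma eGamma_ge0 a : (0 <= eGamma a)%E.
Proof. by apply: integral_ge0 => u _; rewrite lee_fin mulr_ge0 ?pos_powR_ge0 ?expR_ge0. Qed.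

Lemma eBeta_ge0 a b : (0 <= eBeta a b)%E.
Proof. by apply: integral_ge0 => u _; rewrite lee_fin mulr_ge0 ?pos_powR_ge0. Qed.

Lemma measurable_lin (a b : R) : measurable_fun [set: R] (fun x => a * x + b)%R.
Proof. by apply: measurable_funD => //; exact: mulrl_measurable. Qed.

(** Substitute [v = s w]. For [s <= 0] one of the two cut-off factors vanishes at every [v]. *)
Lemma pos_powR_conv a b s :
  (\int[leb]_v (pos_powR b v * pos_powR a (s - v))%:E = (pos_powR (b + a) s)%:E * eBeta b a)%E.
Proof.
have [s0|s0] := ltP 0 s; last first.
  rewrite pos_powR_le0// mul0e; transitivity (\int[leb]_v (0%:E : \bar R))%E; last by rewrite integral0.
  apply: eq_integral => v _; congr EFin; have [v0|v0] := ltP 0 v; last by rewrite pos_powR_le0// mul0r.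
  by rewrite [X in _ * X]pos_powR_le0 ?mulr0// subr_le0 (le_trans s0)// ltW.
have mf : measurable_fun [set: R] (fun v => (pos_powR b v * pos_powR a (s - v))%:E : \bar R).
  apply/measurable_EFinP; apply: measurable_funM; first exact: measurable_pos_powR.
  apply: (measurableT_comp (measurable_pos_powR a)); apply: measurable_funB => //.
have sn0 : s != 0 by rewrite gt_eqF.
have f0 v : (0 <= (pos_powR b v * pos_powR a (s - v))%:E)%E by rewrite lee_fin mulr_ge0 ?pos_powR_ge0.
have E := ge0_integral_affine 0 sn0 mf f0.
transitivity (`|s|%:E * ((`|s|^-1)%:E * \int[leb]_v (pos_powR b v * pos_powR a (s - v))%:E))%E.
  by rewrite muleA -EFinM mulfV ?normr_eq0// mul1e.
rewrite -E (gtr0_norm s0).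
transitivity (s%:E * \int[leb]_w ((s `^ (b - 1) * s `^ (a - 1))%:E * (pos_powR b w * pos_powR a (1 - w))%:E))%E.
  congr (_ * _)%E; apply: eq_integral => w _; rewrite -EFinM; congr EFin.
  rewrite addr0 pos_powR_scale// (_ : s - s * w = s * (1 - w)); last by ring.
  rewrite pos_powR_scale//; ring.
rewrite ge0_integralZl; last 4 first.
- by [].
- apply/measurable_EFinP; apply: measurable_funM; first exact: measurable_pos_powR.
  by apply: (measurableT_comp (measurable_pos_powR a)); apply: measurable_funB.
- by move=> w _; rewrite lee_fin mulr_ge0 ?pos_powR_ge0.
- by rewrite lee_fin mulr_ge0 ?powR_ge0.
rewrite muleA -EFinM (pos_powRE _ s0); congr (_%:E * _)%E.
rewrite -powRD; last by rewrite sn0 implybT.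
rewrite -{1}(powRr1 (ltW s0)) -powRD; last by rewrite sn0 implybT.
by congr powR; ring.
Qed.

(** In the variable [s = u + v] the inner integral over [v] is the convolution of two powers, which
    [pos_powR_conv] evaluates. *)
Lemma dirichlet2 a b (G : R -> \bar R) : measurable_fun [set: R] G ->
  (forall u, 0 <= G u)%E ->
  (\int[leb]_v \int[leb]_u ((pos_powR b v * pos_powR a u)%:E * G (u + v)%R) =
   eBeta b a * \int[leb]_s ((pos_powR (b + a) s)%:E * G s))%E.
Proof.
move=> mG G0.
have mp1 : measurable_fun [set: mR * mR] (fun p => pos_powR b p.1).
  by apply: (measurableT_comp (measurable_pos_powR b)); exact: measurable_fst.
have mp2 : measurable_fun [set: mR * mR] (fun p => pos_powR a (p.2 - p.1)).
  apply: (measurableT_comp (measurable_pos_powR a)); apply: measurable_funB;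
  [exact: measurable_snd|exact: measurable_fst].
have mp : measurable_fun [set: mR * mR] (fun p => (pos_powR b p.1 * pos_powR a (p.2 - p.1))%:E * G p.2)%E.
  apply: emeasurable_funM; first by apply/measurable_EFinP; exact: measurable_funM.
  by apply: (measurableT_comp mG); exact: measurable_snd.
transitivity (\int[leb]_v \int[leb]_s ((pos_powR b v * pos_powR a (s - v))%:E * G s))%E.
  apply: eq_integral => v _.
  have mh : measurable_fun [set: R] (fun u => ((pos_powR b v * pos_powR a u)%:E * G (u + v)%R)%E).
    apply: emeasurable_funM.
      by apply/measurable_EFinP; apply: measurable_funM => //; exact: measurable_pos_powR.
    by apply: (measurableT_comp mG); exact: measurable_funD.
  have h0 u : (0 <= (pos_powR b v * pos_powR a u)%:E * G (u + v)%R)%E.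
    by rewrite mule_ge0// lee_fin mulr_ge0 ?pos_powR_ge0.
  have E := ge0_integral_affine (- v) (oner_neq0 R) mh h0.
  rewrite normr1 invr1 mul1e in E; rewrite -E.
  by apply: eq_integral => s _; rewrite mul1r subrK.
rewrite (@fubini_tonelli _ _ _ _ _ leb leb (fun p => (pos_powR b p.1 * pos_powR a (p.2 - p.1))%:E * G p.2)%E)//=; last first.
  by move=> p; rewrite mule_ge0// lee_fin mulr_ge0 ?pos_powR_ge0.
transitivity (\int[leb]_s (eBeta b a * ((pos_powR (b + a) s)%:E * G s)))%E.
  apply: eq_integral => s _.
  rewrite ge0_integralZr//.
  - by rewrite pos_powR_conv muleA; congr (_ * _)%E; rewrite muleC.
  - apply/measurable_EFinP; apply: measurable_funM; first exact: measurable_pos_powR.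
    by apply: (measurableT_comp (measurable_pos_powR a)); apply: measurable_funB.
  - by move=> v _; rewrite lee_fin mulr_ge0 ?pos_powR_ge0.
rewrite ge0_integralZl//.
- apply: emeasurable_funM => //; apply/measurable_EFinP; exact: measurable_pos_powR.
- by move=> s _; rewrite mule_ge0// lee_fin pos_powR_ge0.
- exact: eBeta_ge0.
Qed.

(** This is [dirichlet2] for [G s = exp (- s)], where the left side factors into two Gamma
    integrals. *)
Lemma eGamma_eBeta a b : (eGamma b * eGamma a = eBeta b a * eGamma (b + a))%E.
Proof.
have mE : measurable_fun [set: R] (fun s => (expR (- s))%:E : \bar R).
  by apply/measurable_EFinP; apply: measurableT_comp => //; exact: oppr_measurable.
have mp c : measurable_fun [set: R] (fun u => (pos_powR c u * expR (- u))%:E : \bar R).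
  apply/measurable_EFinP; apply: measurable_funM; first exact: measurable_pos_powR.
  by apply: measurableT_comp => //; exact: oppr_measurable.
have E0 s : (0 <= (expR (- s))%:E :> \bar R)%E by rewrite lee_fin expR_ge0.
have p0 c s : (0 <= (pos_powR c s * expR (- s))%:E :> \bar R)%E.
  by rewrite lee_fin mulr_ge0 ?pos_powR_ge0 ?expR_ge0.
have := @dirichlet2 a b _ mE E0.
under [in X in _ = X -> _]eq_integral => s _ do rewrite -EFinM.
move=> <-; rewrite -ge0_integralZr//; [|exact: mp|exact: eGamma_ge0].
apply: eq_integral => v _; rewrite /eGamma -ge0_integralZl//; last exact: mp.
by apply: eq_integral => u _; rewrite -!EFinM opprD expRD; congr EFin; ring.
Qed.

Lemma eGamma1 : eGamma 1 = 1%E.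
Proof.
rewrite -(@integral_expRN R); apply: eq_integral => u _.
by rewrite pos_powR1 EFinM.
Qed.

Lemma integral_pow01 (a e : R) : 0 < a -> 0 < e < 1 ->
  (\int[leb]_(u in `[e, 1%R]%classic) (u `^ (a - 1))%:E <= (a^-1)%:E)%E.
Proof.
move=> a0 /andP[e0 e1].
have an0 : a != 0 by rewrite gt_eqF.
pose F u := a^-1 * u `^ a.
have dF (u : R) : 0 < u -> is_derive u 1 F (u `^ (a - 1)).
  move=> u0; have := is_derive1_powR a u0 => h.
  have -> : u `^ (a - 1) = a^-1 *: (a * u `^ (a - 1)) by rewrite -[_ *: _]/(_ * _) mulKf.
  exact: is_deriveZ.
have cF (u : R) : 0 < u -> {for u, continuous F}.
  by move=> u0; apply: differentiable_continuous; apply/derivable1_diffP; exact: (@ex_derive _ _ _ _ _ _ _ (dF u u0)).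
rewrite (@continuous_FTC2 _ (fun u => u `^ (a - 1)) F)//.
- rewrite -EFinB lee_fin /F powR1 mulr1 lerBlDr lerDl mulr_ge0 ?powR_ge0// invr_ge0 ltW//.
- apply: continuous_in_subspaceT => u; rewrite inE /= in_itv /= => /andP[eu _].
  have u0 : 0 < u by exact: lt_le_trans eu.
  by apply: differentiable_continuous; apply/derivable1_diffP; apply: derivable_powR; rewrite in_itv /= u0.
- split.
  + move=> u; rewrite in_itv /= => /andP[eu _].
    have u0 : 0 < u by exact: lt_trans eu.
    exact: (@ex_derive _ _ _ _ _ _ _ (dF u u0)).
  + by apply: cvg_at_right_filter; exact: cF.
  + by apply: cvg_at_left_filter; exact: cF.
- move=> u; rewrite in_itv /= => /andP[eu _].
  have u0 : 0 < u by exact: lt_trans eu.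
  by rewrite derive1E; exact: (@derive_val _ _ _ _ _ _ _ (dF u u0)).
Qed.

(** For [a < 1] the integrand is singular at 0, so the primitive [u^a / a] is used on
    [[1 / (n + 2), 1]] and Fatou's lemma lets [n] grow. *)
Lemma eBeta_a1_fin (a : R) : 0 < a -> (\int[leb]_u ((\1_[set u : R | u <= 1] u)%:E * (pos_powR a u)%:E) <= (a^-1)%:E)%E.
Proof.
move=> a0.
pose e (n : nat) : R := (n.+2%:R)^-1.
have e0 n : 0 < e n < 1.
  by rewrite invr_gt0 ltr0n /= invf_lt1 ?ltr0n// ltr1n.
pose f (n : nat) (u : R) : \bar R := ((\1_`[e n, 1%R]%classic u)%:E * (pos_powR a u)%:E)%E.
have mf n : measurable_fun [set: R] (f n).
  apply: emeasurable_funM; apply/measurable_EFinP; last exact: measurable_pos_powR.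
  by apply: measurable_indic.
have f0 n u : (0 <= f n u)%E by rewrite /f -EFinM lee_fin mulr_ge0 ?pos_powR_ge0.
have -> : (fun u => ((\1_[set u : R | u <= 1] u)%:E * (pos_powR a u)%:E)%E) = (fun u => limn_einf (f ^~ u)).
  apply/funext => u; apply/esym.
  have h : f ^~ u @ \oo --> ((\1_[set u : R | u <= 1] u)%:E * (pos_powR a u)%:E)%E.
    have [u0|u0] := leP u 0.
      rewrite pos_powR_le0// mule0; apply: cvg_near_cst; apply: nearW => n.
      by rewrite /f pos_powR_le0// mule0.
    apply: cvg_near_cst; near=> n; rewrite /f; congr (_%:E * _)%E.
    rewrite !indicE; congr ((nat_of_bool _)%:R).
    apply/idP/idP; rewrite !inE /= in_itv /=; first by case/andP.
    move=> ->; rewrite andbT /e.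
    rewrite invf_ple ?posrE ?ltr0n//.
    apply: (@le_trans _ _ n%:R); last by rewrite ler_nat ltnW// ltnW.
    by near: n; exact: nbhs_infty_ger.
  by rewrite (is_cvg_limn_einfE (cvgP _ h)); apply/cvg_lim.
apply: le_trans (@fatou _ _ _ leb _ _ f _ _) _ => //.
rewrite limn_einf_lim; apply: lime_le; first exact: is_cvg_einfs.
apply: nearW => n; apply: (@le_trans _ _ (\int[leb]_x f n x)%E).
  by apply: ereal_inf_lbound; exists n => /=.
apply: le_trans (integral_pow01 a0 (e0 n)).
rewrite [leRHS]integral_mkcond le_eqVlt; apply/orP; left; apply/eqP.
apply: eq_integral => u _; rewrite patchE /f indicE; case: ifPn => [|h]; last first.
  by rewrite mul0e.
move=> h; rewrite mul1e pos_powRE//.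
by move: h; rewrite inE /= in_itv /= => /andP[h _]; apply: lt_le_trans h; case/andP: (e0 n).
Unshelve. all: by end_near. Qed.

(** Up to 1 the integrand is at most [u^(a - 1)]. Beyond 1 it is at most [c exp (- u / 2)]: a single
    term of the series of [exp (u / 2)] already dominates [u^(k + 1)], which gives the constant
    [c]. *)
Lemma eGamma_fin (a : R) : 0 < a -> (eGamma a < +oo)%E.
Proof.
move=> a0.
have [k ka] : exists k : nat, a - 1 <= k.+1%:R.
  exists (Num.bound `|a - 1|); apply: le_trans (ler_norm _) _.
  apply: le_trans (ltW (archi_boundP (normr_ge0 _))) _.
  by rewrite ler_nat.
have E0 (x : R) : 0 <= x -> x ^+ k.+1 <= (2 ^+ k.+1 * k.+1`!%:R) * expR (x / 2).
  move=> x0; have := @expR_ge1Dxn R (x / 2) k (divr_ge0 x0 (ler0n _ 2)).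
  rewrite expr_div_n => h.
  have -> : x ^+ k.+1 = (2 ^+ k.+1 * k.+1`!%:R) * (x ^+ k.+1 / 2 ^+ k.+1 / k.+1`!%:R).
    field; rewrite pnatr_eq0 -lt0n fact_gt0 /= expf_neq0//.
  rewrite ler_pM2l ?mulr_gt0 ?exprn_gt0 ?ltr0n ?fact_gt0//.
  by apply: le_trans h; rewrite lerDr.
pose c : R := 2 ^+ k.+1 * k.+1`!%:R.
have c0 : 0 <= c by rewrite mulr_ge0 ?exprn_ge0.
have mi : measurable_fun [set: R] (fun u => (\1_[set u : R | u <= 1] u)%:E : \bar R).
  apply/measurable_EFinP; apply: measurable_indic.
  by rewrite (_ : [set u | _] = `]-oo, 1%R]%classic).
have m1 : measurable_fun [set: R] (fun u => ((\1_[set u : R | u <= 1] u)%:E * (pos_powR a u)%:E)%E : \bar R).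
  by apply: emeasurable_funM => //; apply/measurable_EFinP; exact: measurable_pos_powR.
have m2 : measurable_fun [set: R] (fun u => (pos_powR 1 u * expR (- u))%:E : \bar R).
  apply/measurable_EFinP; apply: measurable_funM; first exact: measurable_pos_powR.
  by apply: measurableT_comp => //; exact: oppr_measurable.
have p2 u : (0 <= (pos_powR 1 u * expR (- u))%:E :> \bar R)%E by rewrite lee_fin mulr_ge0 ?pos_powR_ge0 ?expR_ge0.
have hn0 : (2^-1 : R) != 0 by rewrite invr_eq0.
have E := ge0_integral_affine 0 hn0 m2 p2.
have m3 : measurable_fun [set: R] (fun u => (pos_powR 1 (2^-1 * u + 0) * expR (- (2^-1 * u + 0)))%:E : \bar R).
  by apply: (measurableT_comp m2); exact: measurable_lin.
apply: (@le_lt_trans _ _ (\int[leb]_u (((\1_[set u : R | u <= 1] u)%:E * (pos_powR a u)%:E) + c%:E * (pos_powR 1 (2^-1 * u + 0) * expR (- (2^-1 * u + 0)))%:E))%E).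
  apply: ge0_le_integral_gen => u; first by rewrite lee_fin mulr_ge0 ?pos_powR_ge0 ?expR_ge0.
  rewrite -!EFinM -EFinD lee_fin addr0.
  have [u0|u0] := leP u 0.
    rewrite (pos_powR_le0 a u0) mul0r mulr0 add0r; apply: mulr_ge0 => //.
    by apply: mulr_ge0; rewrite ?pos_powR_ge0 ?expR_ge0.
  have [u1|u1] := leP u 1.
    rewrite indicE mem_set// mul1r.
    apply: (@le_trans _ _ (pos_powR a u)).
      by rewrite ler_piMr ?pos_powR_ge0// -expR0 ler_expR oppr_le0 ltW.
    rewrite lerDl; apply: mulr_ge0 => //.
    by apply: mulr_ge0; rewrite ?pos_powR_ge0 ?expR_ge0.
  rewrite indicE memNset/= ?mul0r ?add0r; last by apply/negP; rewrite -ltNge.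
  rewrite !pos_powRE ?mulr_gt0 ?invr_gt0// subrr powRr0 mul1r.
  apply: (@le_trans _ _ (u ^+ k.+1 * expR (- u))).
    rewrite ler_pM2r ?expR_gt0// -powR_mulrn ?(ltW u0)//.
    by apply: ler_powR => //; exact: ltW.
  apply: (@le_trans _ _ (c * expR (u / 2) * expR (- u))).
    by rewrite ler_pM2r ?expR_gt0// E0// ltW.
  rewrite -mulrA -expRD ler_wpM2l// ler_expR le_eqVlt; apply/orP; left; apply/eqP; by field.
rewrite ge0_integralD; last 5 first.
- by [].
- by move=> u _; rewrite -EFinM lee_fin mulr_ge0 ?pos_powR_ge0.
- exact: m1.
- by move=> u _; rewrite -EFinM lee_fin; apply: mulr_ge0 => //; apply: mulr_ge0; rewrite ?pos_powR_ge0 ?expR_ge0.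
- by apply: emeasurable_funM => //.
rewrite ge0_integralZl; last 4 first.
- by [].
- exact: m3.
- by move=> u _; rewrite lee_fin; apply: mulr_ge0; rewrite ?pos_powR_ge0 ?expR_ge0.
- by rewrite lee_fin.
rewrite E -/(eGamma 1) eGamma1 mule1 -EFinM.
by apply: lte_add_pinfty; [apply: le_lt_trans (eBeta_a1_fin a0) _|]; rewrite ltry.
Qed.

Lemma eGamma_gt0 (a : R) : (0 < eGamma a)%E.
Proof.
(* Lower bound of the integrand on [[1, 2]]; the minimum covers both signs of [a - 1]. *)
pose c : R := Num.min 1 (2 `^ (a - 1)) * expR (-2).
have c0 : 0 < c by rewrite mulr_gt0 ?expR_gt0// lt_min ltr01 powR_gt0.
apply: (@lt_le_trans _ _ (\int[leb]_(u in `[1%R, 2%R]%classic) (cst c%:E u))%E).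
  rewrite integral_cst//= lebesgue_measure_itv /= lte_fin ltr1n.
  by rewrite -EFinB -EFinM lte_fin mulr_gt0//; lra.
rewrite integral_mkcond; apply: ge0_le_integral_gen => u.
  by rewrite patchE; case: ifP => // _; rewrite lee_fin ltW.
rewrite patchE; case: ifPn => [|_]; last by rewrite lee_fin mulr_ge0 ?pos_powR_ge0 ?expR_ge0.
rewrite inE /= in_itv /= => /andP[u1 u2].
have u0 : 0 < u by exact: lt_le_trans u1.
rewrite lee_fin pos_powRE// ler_pM ?expR_ge0//; last by rewrite ler_expR lerN2.
have [h|h] := leP 0 (a - 1).
  apply: (@le_trans _ _ 1); first by rewrite ge_min lexx.
  by rewrite -{1}(powRr0 u); exact: ler_powR.
apply: (@le_trans _ _ (2 `^ (a - 1))); first by rewrite ge_min lexx orbT.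
have -> : a - 1 = - (1 - a) by ring.
rewrite !powRN lef_pV2 ?posrE ?powR_gt0//.
by apply: ge0_ler_powR; rewrite ?nnegrE//; lra.
Qed.

Lemma eGammaE (a : R) : 0 < a -> eGamma a = (Gamma a)%:E.
Proof. by move=> a0; rewrite GammaE fineK// ge0_fin_numE ?eGamma_fin// eGamma_ge0. Qed.

Lemma Gamma_gt0 (a : R) : 0 < a -> 0 < Gamma a.
Proof. by move=> a0; rewrite -lte_fin -eGammaE// eGamma_gt0. Qed.

Lemma eBetaE (a b : R) : 0 < a -> 0 < b ->
  eBeta a b = (Gamma a * Gamma b / Gamma (a + b))%:E.
Proof.
move=> a0 b0; have ab0 : 0 < a + b by exact: addr_gt0.
have := eGamma_eBeta b a; rewrite !eGammaE// => h.
have g0 : Gamma (a + b) != 0 by rewrite gt_eqF// Gamma_gt0.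
have := eBeta_ge0 a b; move: h; case: (eBeta a b) => [x| |]//=.
  by rewrite -!EFinM => -[->] _; rewrite mulfK.
(* An infinite [eBeta a b] would make the finite product of the two Gamma values infinite. *)
by rewrite mulyr gtr0_sg ?Gamma_gt0// mul1e.
Qed.

Lemma Gamma1 : Gamma (1 : R) = 1.
Proof. by rewrite GammaE eGamma1. Qed.

(** The functional equation comes from [B (1, k + 1) = 1 / (k + 1)] and the expression of Beta by
    Gamma. *)
Lemma Gamma_nat (k : nat) : Gamma (k%:R + 1 : R) = k`!%:R.
Proof.
elim: k => [|k IH]; first by rewrite add0r Gamma1.
have k0 : 0 < (k%:R + 1 : R) by rewrite natr1 ltr0n.
have := eBetaE ltr01 k0; rewrite Gamma1 mul1r.
have -> : eBeta 1 (k%:R + 1) = ((k.+1%:R)^-1)%:E.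
  rewrite -(@beta_fun0n R k.+1)// EFin_beta_fun.
  apply: ge0_ae_eq_integral => //.
  - apply/measurable_EFinP; apply: measurable_funM; first exact: measurable_pos_powR.
    by apply: (measurableT_comp (measurable_pos_powR _)); exact: measurable_funB.
  - apply/measurable_EFinP; apply/(measurable_restrictT _ _).1 => //.
    exact: measurable_XMonemX.
  - by move=> u _; rewrite lee_fin mulr_ge0 ?pos_powR_ge0.
  - move=> u _; rewrite lee_fin patchE; case: ifPn => // h.
    by apply: XMonemX_ge0; move: h; rewrite inE.
  exists [set 0%R; 1%R]; split.
  - by apply: measurableU; exact: measurable_set1.
  - apply: countable_lebesgue_measure0; apply: finite_set_countable; exact: finite_set2.
  move=> u /= h; apply: contrapT => /not_orP[/eqP u0 /eqP u1]; apply: h => _.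
  congr EFin; rewrite patchE; case: ifPn => [|h].
    rewrite inE /= in_itv /= => /andP[u0' u1'].
    have up : 0 < u by rewrite lt_def u0.
    have un : 0 < 1 - u by rewrite subr_gt0 lt_def eq_sym u1.
    rewrite pos_powR1 indicE mem_set// mul1r natr1 pos_powR_nat indicE mem_set// mul1r.
  have [up|up] := ltP 0 u; last by rewrite pos_powR_le0// mul0r.
  rewrite [X in _ * X]pos_powR_le0 ?mulr0// subr_le0 leNgt; apply: contra h => h.
  by rewrite mem_set//= in_itv /= !ltW.
move=> [h].
rewrite -natr1 [k%:R + 1 + 1]addrC.
have g0 : Gamma (1 + (k%:R + 1) : R) != 0 by rewrite gt_eqF// Gamma_gt0// addr_gt0.
have kn : (k.+1%:R : R) != 0 by rewrite pnatr_eq0.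
have : Gamma (1 + (k%:R + 1) : R) = k.+1%:R * Gamma (k%:R + 1).
  apply: (mulfI (invr_neq0 kn)); rewrite mulKf// h divfK//.
by move=> ->; rewrite IH factS natrM.
Qed.

End GammaBeta.

(** * Dirichlet integrals over blocks of complex coordinates *)

Section DirichletMulti.
Variables (R : realType) (N : nat).
Local Notation mR := (measurableTypeR R).
Local Notation leb := (@lebesgue_measure R).
Implicit Types (F : cpt R N -> \bar R) (Z W : cpt R N).

(** Integration over a block of consecutive coordinates lets the [z]-coordinates be treated before
    the [w]-coordinates. *)
Fixpoint cints (lo k : nat) F : cpt R N -> \bar R :=
  if k is k'.+1 then cint (lo + k') (cints lo k' F) else F.

Lemma iint_cints k F : iint k F = cints 0 k F.
Proof. by elim: k => //= k <-; apply/funext => Z; rewrite add0n. Qed.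

Lemma iint_cat n m F : iint (n + m) F = cints n m (iint n F).
Proof.
elim: m => [|m IH]; first by rewrite addn0.
by rewrite addnS /= -IH; apply/funext => Z.
Qed.

(** Polar coordinates turn each complex coordinate into [pi dv] with [v = |W j|^2]; [dirichlet2]
    then merges one such variable at a time, and the Beta factors telescope to a quotient of Gamma
    values. An empty block would give [G 0], which has no such expression, so the induction starts
    with one coordinate. *)
Lemma dirichlet_cints lo k (q : 'I_N -> nat) F (G : R -> \bar R) Z :
  (lo + k.+1 <= N)%N -> measurable_fun [set: R] G -> (forall u, 0 <= G u)%E ->
  (forall W, (forall j : 'I_N, ~~ (lo <= j < lo + k.+1)%N -> W j = Z j) ->
    F W = ((\prod_(j < N | (lo <= j < lo + k.+1)%N) cabs2 (W j) ^+ q j)%:E *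
      G (\sum_(j < N | (lo <= j < lo + k.+1)%N) cabs2 (W j))%R)%E) ->
  cints lo k.+1 F Z =
  ((pi ^+ k.+1 * (\prod_(j < N | (lo <= j < lo + k.+1)%N) Gamma ((q j)%:R + 1)) /
    Gamma ((\sum_(j < N | (lo <= j < lo + k.+1)%N) q j + k.+1)%N%:R))%:E *
   \int[leb]_u ((pos_powR (\sum_(j < N | (lo <= j < lo + k.+1)%N) q j + k.+1)%N%:R u)%:E * G u))%E.
Proof.
elim: k G Z => [|k IH] G Z kN mG G0 FE.
  have j0N : (lo < N)%N by rewrite -addn1.
  pose j0 := Ordinal j0N.
  have pE (j : 'I_N) : (lo <= j < lo + 1)%N = (j == j0).
    by rewrite addn1 ltnS -eqn_leq eq_sym.
  have q0 : (\sum_(j < N | (lo <= j < lo + 1)%N) q j = q j0)%N.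
    by rewrite (eq_bigl _ _ pE) big_pred1_eq.
  rewrite q0 (eq_bigl _ _ pE) big_pred1_eq expr1 addn1.
  rewrite -natr1 mulfK; last by rewrite gt_eqF// Gamma_gt0// natr1 ltr0n.
  rewrite natr1.
  have mphi : measurable_fun [set: R] (fun v => ((v ^+ q j0)%:E * G v)%E).
    by apply: emeasurable_funM => //; apply/measurable_EFinP; exact: exprn_measurable.
  (* The absolute value keeps the radial function nonnegative on all of [R]; at [s^2 + t^2] it
     changes nothing. *)
  transitivity (\int[leb]_s \int[leb]_t ((fun v => (`|v| ^+ q j0)%:E * G v) (s ^+ 2 + t ^+ 2)%R))%E.
    rewrite /= addn0 /cint; apply: eq_integral => s _; apply: eq_integral => t _.
    rewrite FE.
      rewrite !(eq_bigl _ _ pE) !big_pred1_eq /upd /= eqxx /cabs2 /=.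
      by rewrite ger0_norm// addr_ge0 ?sqr_ge0.
    move=> j; rewrite pE /upd => /negP h; case: eqP => // e.
    by case: h; apply/eqP/val_inj.
  rewrite (@ge0_integral_radial _ (fun v => (`|v| ^+ q j0)%:E * G v)%E).
  - congr (_ * _)%E; apply: eq_integral => u _; rewrite muleA pos_powR_nat -EFinM.
    congr (_%:E * _)%E; have [u0|u0] := ltP 0 u; first by rewrite gtr0_norm.
    by rewrite indicE memNset ?mul0r//=; apply/negP; rewrite -leNgt.
  - apply: emeasurable_funM => //; apply/measurable_EFinP.
    by apply: measurable_funX; exact: normr_measurable.
  - by move=> u; rewrite mule_ge0// lee_fin exprn_ge0.
have j0N : (lo + k.+1 < N)%N by rewrite -addnS.
pose j0 := Ordinal j0N.
have pE (j : 'I_N) : (lo <= j < lo + k.+2)%N && (j != j0) = (lo <= j < lo + k.+1)%N.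
  rewrite -(inj_eq val_inj) /= [(lo + k.+2)%N]addnS ltnS; case: (ltngtP j (lo + k.+1)%N) => h; rewrite ?andbF ?andbT//.
have j0P : (lo <= j0 < lo + k.+2)%N by rewrite /= leq_addr ltn_add2l ltnSn.
pose A := (\sum_(j < N | (lo <= j < lo + k.+1)%N) q j + k.+1)%N.
have qE : (\sum_(j < N | (lo <= j < lo + k.+2)%N) q j + k.+2 = (q j0).+1 + A)%N.
  by rewrite (bigD1 j0)//= (eq_bigl _ _ pE) /A addSn !addnS addnA.
have PE : \prod_(j < N | (lo <= j < lo + k.+2)%N) Gamma ((q j)%:R + 1 : R) =
   Gamma ((q j0)%:R + 1) * \prod_(j < N | (lo <= j < lo + k.+1)%N) Gamma ((q j)%:R + 1).
  by rewrite (bigD1 j0)//= (eq_bigl _ _ pE).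
rewrite qE PE.
set P := \prod_(j < N | (lo <= j < lo + k.+1)%N) Gamma ((q j)%:R + 1 : R).
have P0 : 0 < P by rewrite prodr_gt0// => j _; rewrite Gamma_gt0// natr1 ltr0n.
have A0 : 0 < (A%:R : R) by rewrite ltr0n /A addnS.
have q0 : 0 < ((q j0)%:R + 1 : R) by rewrite natr1 ltr0n.
pose c := pi ^+ k.+1 * P / Gamma (A%:R : R).
have c0 : 0 <= c by rewrite divr_ge0 ?mulr_ge0 ?exprn_ge0 ?pi_ge0// ltW// Gamma_gt0.
(* The value given by the induction hypothesis for the first [k + 1] coordinates when the last one
   has squared modulus [v]. *)
pose phi (v : R) : \bar R := (c%:E * \int[leb]_u ((pos_powR A%:R u)%:E * ((`|v| ^+ q j0)%:E * G (u + v)%R)))%E.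
have mI : measurable_fun [set: mR * mR] (fun p => ((pos_powR A%:R p.2)%:E * ((`|p.1| ^+ q j0)%:E * G (p.2 + p.1)%R))%E).
  apply: emeasurable_funM.
    by apply/measurable_EFinP; apply: (measurableT_comp (measurable_pos_powR _)); exact: measurable_snd.
  apply: emeasurable_funM.
    apply/measurable_EFinP; apply: measurable_funX.
    by apply: (measurableT_comp (@normr_measurable _ _)); exact: measurable_fst.
  apply: (measurableT_comp mG); apply: measurable_funD; [exact: measurable_snd|exact: measurable_fst].
have I0 u v : (0 <= (pos_powR A%:R u)%:E * ((`|v| ^+ q j0)%:E * G (u + v)%R))%E.
  by rewrite mule_ge0 ?lee_fin ?pos_powR_ge0// mule_ge0// lee_fin exprn_ge0.
have mphi : measurable_fun [set: R] phi.
  apply: emeasurable_funM => //.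
  exact: (@measurable_fun_fubini_tonelli_F _ _ _ _ R leb _ mI (fun p => I0 p.2 p.1)).
have phi0 v : (0 <= phi v)%E by rewrite /phi mule_ge0 ?lee_fin//; exact: integral_ge0.
transitivity (\int[leb]_s \int[leb]_t phi (s ^+ 2 + t ^+ 2)%R)%E.
  rewrite [LHS]/(cint (lo + k.+1) (cints lo k.+1 F) Z) /cint.
  apply: eq_integral => s _; apply: eq_integral => t _.
  set v := s ^+ 2 + t ^+ 2.
  rewrite (IH (fun u => (`|v| ^+ q j0)%:E * G (u + v)%R)%E) //.
  - exact: ltnW.
  - apply: emeasurable_funM => //; apply: (measurableT_comp mG); exact: measurable_funD.
  - by move=> u; rewrite mule_ge0// lee_fin exprn_ge0.
  move=> W hW.
  have Wj0 : W j0 = (s +i* t)%C.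
    rewrite hW; last by rewrite ltnn andbF.
    by rewrite /upd /= eqxx.
  rewrite FE.
    rewrite (bigD1 j0)//= (eq_bigl _ _ pE) [in G _](bigD1 j0)//= (eq_bigl _ _ pE) Wj0 /cabs2 /=.
    rewrite -/v ger0_norm; last by rewrite addr_ge0 ?sqr_ge0.
    rewrite muleA -EFinM; congr (_ * _)%E; first by rewrite mulrC.
    by rewrite addrC.
  move=> j hj; rewrite hW.
    rewrite /upd; case: eqP => // e; move: hj.
    by rewrite e leq_addr ltn_add2l ltnSn.
  by apply: contra hj; rewrite -pE => /andP[].
rewrite (ge0_integral_radial mphi phi0).
transitivity (pi%:E * \int[leb]_v (c%:E * \int[leb]_u ((pos_powR ((q j0)%:R + 1) v * pos_powR A%:R u)%:E * G (u + v)%R)))%E.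
  congr (_ * _)%E; apply: eq_integral => v _; rewrite /phi muleCA; congr (_ * _)%E.
  rewrite -ge0_integralZl//; last first.
    exact: (measurableT_comp mI (pair1_measurable _)).
  apply: eq_integral => u _; rewrite muleCA muleA muleA; congr (_ * _)%E.
  rewrite -!EFinM natr1 pos_powR_nat; congr EFin.
  have [v0|v0] := ltP 0 v; first by rewrite gtr0_norm//; ring.
  have -> : \1_[set u : R | 0 < u] v = 0 :> R.
    by rewrite indicE memNset//=; apply/negP; rewrite -leNgt.
  by rewrite mulr0 !mul0r.
rewrite ge0_integralZl; last 4 first.
- by [].
- have mJ : measurable_fun [set: mR * mR] (fun p => ((pos_powR ((q j0)%:R + 1) p.1 * pos_powR A%:R p.2)%:E * G (p.2 + p.1)%R)%E).
    apply: emeasurable_funM.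
      apply/measurable_EFinP; apply: measurable_funM.
        by apply: (measurableT_comp (measurable_pos_powR _)); exact: measurable_fst.
      by apply: (measurableT_comp (measurable_pos_powR _)); exact: measurable_snd.
    apply: (measurableT_comp mG); apply: measurable_funD; [exact: measurable_snd|exact: measurable_fst].
  apply: (@measurable_fun_fubini_tonelli_F _ _ _ _ R leb _ mJ) => p.
  by rewrite mule_ge0// lee_fin mulr_ge0 ?pos_powR_ge0.
- by move=> v _; apply: integral_ge0 => u _; rewrite mule_ge0// lee_fin mulr_ge0 ?pos_powR_ge0.
- by rewrite lee_fin.
rewrite dirichlet2// eBetaE// !muleA -!EFinM.
have -> : (q j0)%:R + 1 + A%:R = ((q j0).+1 + A)%:R :> R by rewrite natrD natr1.
congr (_%:E * _)%E.
have g1 : Gamma (A%:R : R) != 0 by rewrite gt_eqF// Gamma_gt0.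
have g2 : Gamma (((q j0).+1 + A)%:R : R) != 0 by rewrite gt_eqF// Gamma_gt0// ltr0n.
have E (p K x Pp g y : R) : g != 0 -> y != 0 ->
    p * (K * Pp / g) * (x * g / y) = K * p * (x * Pp) / y.
  by move=> g0 y0; field; rewrite y0 g0.
by rewrite [in RHS]exprSr -(E _ _ _ _ _ _ g1 g2).
Qed.

End DirichletMulti.

(** * Cauchy formula and Taylor series in one variable *)

Section Cnorm.
Variable (R : realType).
Local Notation C := R[i].
Implicit Types (z w : C).

(** The numeric norm of [R[i]] takes its values in [R[i]]; the estimates below are over [R]. *)
Definition cnorm (z : C) : R := Num.sqrt (cabs2 z).

Lemma cnormE z : cnorm z = ComplexField.Normc.normc z.
Proof. by case: z. Qed.

Lemma cabs2_ge0 z : 0 <= cabs2 z.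
Proof. by rewrite /cabs2 addr_ge0 ?sqr_ge0. Qed.

Lemma cnorm_ge0 z : 0 <= cnorm z. Proof. exact: sqrtr_ge0. Qed.

Lemma cnorm_sqr z : cnorm z ^+ 2 = cabs2 z.
Proof. by rewrite sqr_sqrtr// cabs2_ge0. Qed.

Lemma cnormM z w : cnorm (z * w) = cnorm z * cnorm w.
Proof. by rewrite !cnormE ComplexField.Normc.normcM. Qed.

Lemma cnormD z w : cnorm (z + w) <= cnorm z + cnorm w.
Proof. by rewrite !cnormE; exact: le_normcD. Qed.

Lemma cnormN z : cnorm (- z) = cnorm z.
Proof. by rewrite !cnormE normcN. Qed.

Lemma cnorm0 : cnorm 0 = 0.
Proof. by rewrite cnormE ComplexField.Normc.normc0. Qed.

Lemma cnorm1 : cnorm 1 = 1.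
Proof. by rewrite cnormE ComplexField.Normc.normc1. Qed.

Lemma cnorm_eq0 z : (cnorm z == 0) = (z == 0).
Proof.
apply/eqP/eqP => [|->]; last exact: cnorm0.
by rewrite cnormE; exact: ComplexField.Normc.eq0_normc.
Qed.

Lemma cnorm_gt0 z : (0 < cnorm z) = (z != 0).
Proof. by rewrite lt_def cnorm_ge0 andbT cnorm_eq0. Qed.

Lemma cnormV z : cnorm z^-1 = (cnorm z)^-1.
Proof. by rewrite !cnormE ComplexField.Normc.normcV. Qed.

Lemma cnormX z k : cnorm (z ^+ k) = cnorm z ^+ k.
Proof. by elim: k => [|k IH]; rewrite ?expr0 ?cnorm1// !exprS cnormM IH. Qed.

Lemma cnormB z w : cnorm (z - w) <= cnorm z + cnorm w.
Proof. by rewrite -(cnormN w); exact: cnormD. Qed.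

Lemma cnormBC z w : cnorm (z - w) = cnorm (w - z).
Proof. by rewrite -cnormN opprB. Qed.

Lemma cnorm_real (x : R) : cnorm x%:C = `|x|.
Proof. by rewrite /cnorm /cabs2 /= expr0n /= addr0 sqrtr_sqr. Qed.

Lemma cnormi : cnorm 'i%C = 1.
Proof. by rewrite /cnorm /cabs2 /= expr0n /= add0r expr1n sqrtr1. Qed.

Lemma Re_le_cnorm z : `|complex.Re z| <= cnorm z.
Proof.
by rewrite -sqrtr_sqr ler_wsqrtr// /cabs2 lerDl sqr_ge0.
Qed.

Lemma Im_le_cnorm z : `|complex.Im z| <= cnorm z.
Proof.
by rewrite -sqrtr_sqr ler_wsqrtr// /cabs2 lerDr sqr_ge0.
Qed.

Lemma cnorm_le_ReIm z : cnorm z <= `|complex.Re z| + `|complex.Im z|.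
Proof.
rewrite -(@ler_pXn2r _ 2) ?nnegrE ?cnorm_ge0 ?addr_ge0//.
by rewrite cnorm_sqr /cabs2 sqrrD !real_normK ?num_real// addrAC lerDl mulrn_wge0// mulr_ge0.
Qed.

Lemma cnorm_sum (I : Type) (r : seq I) (P : pred I) (F : I -> C) :
  cnorm (\sum_(i <- r | P i) F i) <= \sum_(i <- r | P i) cnorm (F i).
Proof.
elim/big_ind2 : _ => [|x1 x2 y1 y2 h1 h2|//]; first by rewrite cnorm0.
by apply: le_trans (cnormD _ _) _; exact: lerD.
Qed.

Lemma cabs2M z w : cabs2 (z * w) = cabs2 z * cabs2 w.
Proof. by rewrite -!cnorm_sqr cnormM exprMn. Qed.

Lemma ReD z w : complex.Re (z + w) = complex.Re z + complex.Re w.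
Proof. by case: z w => [a b] [c d]. Qed.
Lemma ImD z w : complex.Im (z + w) = complex.Im z + complex.Im w.
Proof. by case: z w => [a b] [c d]. Qed.
Lemma ReN z : complex.Re (- z) = - complex.Re z. Proof. by case: z. Qed.
Lemma ImN z : complex.Im (- z) = - complex.Im z. Proof. by case: z. Qed.
Lemma ReM z w : complex.Re (z * w) = complex.Re z * complex.Re w - complex.Im z * complex.Im w.
Proof. by case: z w => [a b] [c d]. Qed.
Lemma ImM z w : complex.Im (z * w) = complex.Re z * complex.Im w + complex.Im z * complex.Re w.
Proof. by case: z w => [a b] [c d]. Qed.
Lemma complexP z w : complex.Re z = complex.Re w -> complex.Im z = complex.Im w -> z = w.
Proof. by case: z w => [a b] [c d] /= -> ->. Qed.

End Cnorm.

(** * Integrals of continuous functions over segments *)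

Section Rint.
Variable (R : realType).
Local Notation leb := (@lebesgue_measure R).

Definition seg_int (a b : R) (f : R -> R) : R := \int[leb]_(x in `[a, b]%classic) f x.
Definition seg_cont (a b : R) (f : R -> R) : Prop := {within `[a, b]%classic, continuous f}.

Lemma seg_cont_sub a b c d f : a <= c -> d <= b -> seg_cont a b f -> seg_cont c d f.
Proof.
move=> ac db; apply: continuous_subspaceW => x /=; rewrite !in_itv /= => /andP[h1 h2].
by rewrite (le_trans ac h1) (le_trans h2 db).
Qed.

Lemma seg_cont_integrable a b f : seg_cont a b f -> leb.-integrable `[a, b]%classic (EFin \o f).
Proof. by move=> cf; apply: continuous_compact_integrable => //; exact: segment_compact. Qed.

Lemma seg_cont_pt a b f : (forall x, a <= x <= b -> forall eps : R, 0 < eps ->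
   exists2 d : R, 0 < d & forall y, a <= y <= b -> `|y - x| < d -> `|f y - f x| <= eps) -> seg_cont a b f.
Proof.
move=> H; apply/subspace_continuousP => x /=; rewrite in_itv /= => xab.
apply/cvgrPdist_le => e e0.
have [d d0 h] := H x xab e e0.
near=> y.
have yab : a <= y <= b.
  by have : `[a, b]%classic y by near: y; exact: withinT; rewrite /= in_itv.
rewrite distrC; apply: h => //.
near: y; apply: cvg_within; apply/nbhs_ballP; exists d => //= z.
by rewrite /ball /= distrC.
Unshelve. all: by end_near. Qed.

Lemma seg_int_split a m b f : a <= m <= b -> seg_cont a b f -> seg_int a b f = seg_int a m f + seg_int m b f.
Proof.
move=> /andP[am mb] cf; have ii := seg_cont_integrable cf.
have := @Rintegral_itvB R f (BLeft a) (BRight b) m ii.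
move=> H; have -> : seg_int m b f = \int[leb]_(x in `]m, b]%classic) f x.
  rewrite /seg_int Rintegral_itv_obnd_cbnd//; apply: integrableS ii => //.
  move=> x /=; rewrite !in_itv /= => /andP[mx xb].
  by rewrite xb (le_trans am (ltW mx)).
by rewrite -H ?bnd_simp// /seg_int addrC subrK.
Qed.

Lemma seg_intD a b f g : seg_cont a b f -> seg_cont a b g -> seg_int a b (fun x => f x + g x) = seg_int a b f + seg_int a b g.
Proof. by move=> cf cg; rewrite /seg_int RintegralD//; exact: seg_cont_integrable. Qed.

Lemma seg_int_bound a b f (c e : R) : a <= b -> seg_cont a b f ->
  (forall x, a <= x <= b -> `|f x - c| <= e) -> `|seg_int a b f - c * (b - a)| <= e * (b - a).
Proof.
move=> ab cf H.
have cst k : seg_cont a b (fun=> k) by move=> x; exact: cst_continuous.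
have ck k : seg_int a b (fun=> k) = k * (b - a).
  rewrite /seg_int Rintegral_cst//= lebesgue_measure_itv /= lte_fin.
  by case: ltP => //= h; rewrite (le_anti (introT andP (conj ab h))) subrr.
rewrite ler_norml; apply/andP; split.
  rewrite lerBrDl (_ : _ + _ = (c - e) * (b - a)); last by ring.
  rewrite -ck; apply: le_Rintegral => //; try exact: seg_cont_integrable.
  move=> x /=; rewrite in_itv /= => /H; rewrite ler_norml => /andP[h _]; lra.
rewrite lerBlDl (_ : _ + _ = (c + e) * (b - a)); last by ring.
rewrite -ck; apply: le_Rintegral => //; try exact: seg_cont_integrable.
move=> x /=; rewrite in_itv /= => /H; rewrite ler_norml => /andP[_ h]; lra.
Qed.

End Rint.

(* Closedness of [P dx + Q dy] without continuity of the derivatives: [p2] is both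
   [dP/dy] and [dQ/dx] at the point. *)
Section Goursat.
Variables (R : realType) (A B C D : R) (P Q : R -> R -> R).
Hypothesis hcl : forall x y, A <= x <= B -> C <= y <= D ->
  exists p1 p2 q2 : R, forall eps : R, 0 < eps -> exists2 d : R, 0 < d &
   forall x' y', A <= x' <= B -> C <= y' <= D -> `|x' - x| < d -> `|y' - y| < d ->
    `|P x' y' - (P x y + p1 * (x' - x) + p2 * (y' - y))| <= eps * (`|x' - x| + `|y' - y|) /\
    `|Q x' y' - (Q x y + p2 * (x' - x) + q2 * (y' - y))| <= eps * (`|x' - x| + `|y' - y|).

Lemma lipschitz_eps (p1 p2 u v eps w : R) : 0 < eps -> `|u| + `|v| <= w ->
  w * (1 + `|p1| + `|p2|) <= eps -> forall f g, `|f - (g + p1 * u + p2 * v)| <= 1 * (`|u| + `|v|) -> `|f - g| <= eps.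
Proof.
move=> e0 uv wE f g h.
have -> : f - g = (f - (g + p1 * u + p2 * v)) + (p1 * u + p2 * v) by ring.
apply: le_trans (ler_normD _ _) _.
apply: le_trans (lerD h (ler_normD _ _)) _; rewrite !normrM.
have := normr_ge0 u; have := normr_ge0 v; have := normr_ge0 p1; have := normr_ge0 p2; nra.
Qed.

Lemma goursat_cont x y : A <= x <= B -> C <= y <= D -> forall eps : R, 0 < eps ->
  exists2 d : R, 0 < d & forall x' y', A <= x' <= B -> C <= y' <= D ->
    `|x' - x| < d -> `|y' - y| < d -> `|P x' y' - P x y| <= eps /\ `|Q x' y' - Q x y| <= eps.
Proof.
move=> xAB yCD eps e0; have [p1 [p2 [q2 H]]] := hcl xAB yCD.
have [d d0 h] := H 1 ltr01.
(* The factor 2 accounts for the two increments, each below [eps / K]. *)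
pose K := 2 * (1 + `|p1| + `|p2| + `|q2|).
have K0 : 0 < K by rewrite mulr_gt0// -!addrA ltr_pwDl// !addr_ge0.
exists (Num.min d (eps / K)); first by rewrite lt_min d0 divr_gt0.
move=> x' y' hx' hy'; rewrite !lt_min => /andP[x1 x2] /andP[y1 y2].
have [h1 h2] := h _ _ hx' hy' x1 y1.
have wle : `|x' - x| + `|y' - y| <= 2 * (eps / K).
  by rewrite mulrDl mul1r lerD// ltW.
have n1 := normr_ge0 p1; have n2 := normr_ge0 p2; have n3 := normr_ge0 q2.
have ek : 0 <= eps / K by rewrite divr_ge0// ltW.
have ee : eps / K * K = eps by rewrite divfK// gt_eqF.
split.
  apply: (lipschitz_eps e0 wle _ h1); rewrite /K in ek ee *; nra.
apply: (lipschitz_eps e0 wle _ h2); rewrite /K in ek ee *; nra.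
Qed.

Lemma conP y : C <= y <= D -> seg_cont A B (P ^~ y).
Proof.
move=> yCD; apply: seg_cont_pt => x xAB eps e0.
have [d d0 h] := goursat_cont xAB yCD e0; exists d => // x' hx' xd.
by have [] := h x' y hx' yCD xd; rewrite ?subrr ?normr0.
Qed.

Lemma conQ x : A <= x <= B -> seg_cont C D (Q x).
Proof.
move=> xAB; apply: seg_cont_pt => y yCD eps e0.
have [d d0 h] := goursat_cont xAB yCD e0; exists d => // y' hy' yd.
by have [] := h x y' xAB hy' _ yd; rewrite ?subrr ?normr0.
Qed.

(** Circulation of [P dx + Q dy] counterclockwise around the rectangle [[a, b] x [c, d]]. *)
Let W a b c d := seg_int a b (fun x => P x c - P x d) + seg_int c d (fun y => Q b y - Q a y).

Lemma seg_cont_comb (a b : R) (f g : R -> R) : seg_cont a b f -> seg_cont a b g -> seg_cont a b (fun x => f x - g x).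
Proof. by move=> cf cg x; apply: continuousB; [exact: cf|exact: cg]. Qed.

Lemma W_split_x a m b c d : A <= a -> a <= m -> m <= b -> b <= B -> C <= c -> c <= d -> d <= D ->
  W a b c d = W a m c d + W m b c d.
Proof.
move=> Aa am mb bB Cc cd dD; rewrite /W.
have cP y : c <= y <= d -> seg_cont a b (P ^~ y).
  move=> /andP[cy yd]; apply: (seg_cont_sub Aa bB); apply: conP.
  by rewrite (le_trans Cc cy) (le_trans yd dD).
have cQ x : a <= x <= b -> seg_cont c d (Q x).
  move=> /andP[ax xb]; apply: (seg_cont_sub Cc dD); apply: conQ.
  by rewrite (le_trans Aa ax) (le_trans xb bB).
rewrite (@seg_int_split _ a m b) ?am ?mb//; last first.
  by apply: seg_cont_comb; apply: cP; rewrite lexx cd.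
have -> : (fun y => Q b y - Q a y) = (fun y => (Q m y - Q a y) + (Q b y - Q m y)).
  by apply/funext => y; ring.
rewrite (@seg_intD _ c d (fun y => Q m y - Q a y) (fun y => Q b y - Q m y)).
- by rewrite addrACA.
- by apply: seg_cont_comb; apply: cQ; rewrite ?lexx ?am ?mb ?(le_trans am mb).
- by apply: seg_cont_comb; apply: cQ; rewrite ?lexx ?am ?mb ?(le_trans am mb).
Qed.

Lemma W_split_y a b c m d : A <= a -> a <= b -> b <= B -> C <= c -> c <= m -> m <= d -> d <= D ->
  W a b c d = W a b c m + W a b m d.
Proof.
move=> Aa ab bB Cc cm md dD; rewrite /W.
have cP y : c <= y <= d -> seg_cont a b (P ^~ y).
  move=> /andP[cy yd]; apply: (seg_cont_sub Aa bB); apply: conP.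
  by rewrite (le_trans Cc cy) (le_trans yd dD).
have cQ x : a <= x <= b -> seg_cont c d (Q x).
  move=> /andP[ax xb]; apply: (seg_cont_sub Cc dD); apply: conQ.
  by rewrite (le_trans Aa ax) (le_trans xb bB).
rewrite (@seg_int_split _ c m d) ?cm ?md//; last first.
  by apply: seg_cont_comb; apply: cQ; rewrite lexx ab.
have -> : (fun x => P x c - P x d) = (fun x => (P x c - P x m) + (P x m - P x d)).
  by apply/funext => x; ring.
rewrite (@seg_intD _ a b (fun x => P x c - P x m) (fun x => P x m - P x d)).
- by rewrite addrACA.
- by apply: seg_cont_comb; apply: cP; rewrite ?lexx ?cm ?md ?(le_trans cm md).
- by apply: seg_cont_comb; apply: cP; rewrite ?lexx ?cm ?md ?(le_trans cm md).
Qed.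

(** The affine parts of [P] and [Q] at the point have circulation [(p2 - p2)] times the area, which
    is 0. Only the remainders count, and they are of size [eps] times the perimeter on sides of
    comparable length. *)
Lemma W_local x0 y0 : A <= x0 <= B -> C <= y0 <= D -> forall eps : R, 0 < eps ->
  exists2 d : R, 0 < d & forall a b c e, A <= a -> a <= x0 -> x0 <= b -> b <= B ->
    C <= c -> c <= y0 -> y0 <= e -> e <= D -> b - a < d -> e - c < d ->
    `|W a b c e| <= 2 * eps * (b - a + (e - c)) ^+ 2.
Proof.
move=> xAB yCD eps e0; have [p1 [p2 [q2 H]]] := hcl xAB yCD.
have [d d0 h] := H _ e0; exists d => // a b c e Aa ax xb bB Cc cy ye eD bad ecd.
have near_x x : a <= x <= b -> `|x - x0| < d /\ `|x - x0| <= b - a.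
  move=> /andP[h1 h2]; rewrite ltr_norml ler_norml; split; apply/andP; split; lra.
have near_y y : c <= y <= e -> `|y - y0| < d /\ `|y - y0| <= e - c.
  move=> /andP[h1 h2]; rewrite ltr_norml ler_norml; split; apply/andP; split; lra.
have inx x : a <= x <= b -> A <= x <= B by move=> /andP[h1 h2]; apply/andP; split; lra.
have iny y : c <= y <= e -> C <= y <= D by move=> /andP[h1 h2]; apply/andP; split; lra.
have ce : c <= e by lra.
have ab : a <= b by lra.
have est x y : a <= x <= b -> c <= y <= e ->
    `|P x y - (P x0 y0 + p1 * (x - x0) + p2 * (y - y0))| <= eps * (b - a + (e - c)) /\
    `|Q x y - (Q x0 y0 + p2 * (x - x0) + q2 * (y - y0))| <= eps * (b - a + (e - c)).
  move=> hx hy; have [h1 h2] := near_x _ hx; have [h3 h4] := near_y _ hy.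
  have [h5 h6] := h _ _ (inx _ hx) (iny _ hy) h1 h3.
  split; [apply: le_trans h5 _|apply: le_trans h6 _]; rewrite ler_pM2l// lerD//.
have cc : c <= c <= e by rewrite lexx.
have ee : c <= e <= e by rewrite lexx andbT.
have aa : a <= a <= b by rewrite lexx.
have bb : a <= b <= b by rewrite lexx andbT.
have B1 : `|seg_int a b (fun x => P x c - P x e) - p2 * (c - e) * (b - a)| <=
    2 * eps * (b - a + (e - c)) * (b - a).
  apply: seg_int_bound => //.
    by apply: seg_cont_comb; apply: (seg_cont_sub Aa bB); apply: conP; exact: iny.
  move=> x hx; have [h1 _] := est _ _ hx cc; have [h2 _] := est _ _ hx ee.
  rewrite (_ : _ - _ = (P x c - (P x0 y0 + p1 * (x - x0) + p2 * (c - y0))) -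
     (P x e - (P x0 y0 + p1 * (x - x0) + p2 * (e - y0)))); last by ring.
  apply: le_trans (ler_normB _ _) _; lra.
have B2 : `|seg_int c e (fun y => Q b y - Q a y) - p2 * (b - a) * (e - c)| <=
    2 * eps * (b - a + (e - c)) * (e - c).
  apply: seg_int_bound => //.
    by apply: seg_cont_comb; apply: (seg_cont_sub Cc eD); apply: conQ; exact: inx.
  move=> y hy; have [_ h1] := est _ _ aa hy; have [_ h2] := est _ _ bb hy.
  rewrite (_ : _ - _ = (Q b y - (Q x0 y0 + p2 * (b - x0) + q2 * (y - y0))) -
     (Q a y - (Q x0 y0 + p2 * (a - x0) + q2 * (y - y0)))); last by ring.
  apply: le_trans (ler_normB _ _) _; lra.
rewrite /W (_ : _ + _ = (seg_int a b (fun x => P x c - P x e) - p2 * (c - e) * (b - a)) +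
  (seg_int c e (fun y => Q b y - Q a y) - p2 * (b - a) * (e - c))); last by ring.
apply: le_trans (ler_normD _ _) _; apply: le_trans (lerD B1 B2) _.
by rewrite -mulrDr expr2 mulrA.
Qed.

(** Bisection: [S n] is the lower left corner of the [n]-th rectangle, of sides [h n] and [k n].
    Each round halves first in [x], then in [y], keeping the half of larger circulation. *)
Let h n : R := (B - A) / 2 ^+ n.
Let k n : R := (D - C) / 2 ^+ n.
Let nx n (p : R * R) : R :=
  if `|W (p.1 + h n.+1) (p.1 + h n) p.2 (p.2 + k n)| <= `|W p.1 (p.1 + h n.+1) p.2 (p.2 + k n)|
  then p.1 else p.1 + h n.+1.
Let ny n (p : R * R) : R :=
  let x := nx n p in
  if `|W x (x + h n.+1) (p.2 + k n.+1) (p.2 + k n)| <= `|W x (x + h n.+1) p.2 (p.2 + k n.+1)|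
  then p.2 else p.2 + k n.+1.
Let S := fix S n := if n is m.+1 then (nx m (S m), ny m (S m)) else (A, C).

Lemma nested_real (u v : nat -> R) : (forall n, u n <= u n.+1) -> (forall n, v n.+1 <= v n) ->
  (forall n, u n <= v n) -> exists x, forall n, u n <= x <= v n.
Proof.
move=> hu hv uv.
have um i j : (i <= j)%N -> u i <= u j.
  by move=> ij; apply: (homo_leq (r := <=%R)) ij => //; exact: le_trans.
have vm i j : (i <= j)%N -> v j <= v i.
  by move=> ij; apply: (homo_leq (r := fun x y : R => y <= x)) ij => // x y z xy yz; exact: le_trans yz xy.
have uvm i j : u i <= v j.
  have [ij|ji] := leqP i j; first by apply: le_trans (um _ _ ij) (uv j).
  by apply: le_trans (uv i) _; apply: vm; exact: ltnW.
exists (sup (range u)) => n; apply/andP; split.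
  apply: sup_upper_bound; last by exists n.
  by split; [exists (u 0%N), 0%N|exists (v 0%N) => _ [i _ <-]].
by apply: ge_sup; [exists (u 0%N), 0%N|move=> _ [i _ <-]].
Qed.

Lemma goursat : A <= B -> C <= D -> W A B C D = 0.
Proof.
move=> AB cderiv.
have h0 n : 0 <= h n by rewrite /h divr_ge0 ?subr_ge0// exprn_ge0.
have k0 n : 0 <= k n by rewrite /k divr_ge0 ?subr_ge0// exprn_ge0.
have hS n : h n = h n.+1 + h n.+1.
  rewrite /h exprS; field; by rewrite expf_neq0.
have kS n : k n = k n.+1 + k n.+1.
  rewrite /k exprS; field; by rewrite expf_neq0.
have half1 (x u v : R) : x <= u + v -> v <= u -> x / 2 <= u by move=> *; lra.
have half2 (x u v : R) : x <= u + v -> u <= v -> x / 2 <= v by move=> *; lra.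
have step n p : A <= p.1 -> p.1 + h n <= B -> C <= p.2 -> p.2 + k n <= D ->
   [/\ p.1 <= nx n p, nx n p + h n.+1 <= p.1 + h n, p.2 <= ny n p, ny n p + k n.+1 <= p.2 + k n &
     `|W p.1 (p.1 + h n) p.2 (p.2 + k n)| / 4 <= `|W (nx n p) (nx n p + h n.+1) (ny n p) (ny n p + k n.+1)|].
  move=> Ap pB Cp pD.
  have hn := h0 n.+1; have kn := k0 n.+1; have hs := hS n; have ks := kS n.
  have x1 : p.1 <= nx n p /\ nx n p + h n.+1 <= p.1 + h n.
    by rewrite /nx; case: ifP => _; split; lra.
  have y1 : p.2 <= ny n p /\ ny n p + k n.+1 <= p.2 + k n.
    by rewrite /ny; case: ifP => _; split; lra.
  have hx : `|W p.1 (p.1 + h n) p.2 (p.2 + k n)| / 2 <= `|W (nx n p) (nx n p + h n.+1) p.2 (p.2 + k n)|.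
    rewrite (@W_split_x p.1 (p.1 + h n.+1) (p.1 + h n)); try lra.
    have := @ler_normD _ _ (W p.1 (p.1 + h n.+1) p.2 (p.2 + k n)) (W (p.1 + h n.+1) (p.1 + h n) p.2 (p.2 + k n)).
    rewrite /nx; case: ifP => [hc tri|/negbT]; [exact: half1 tri hc|rewrite -ltNge => /ltW hc tri].
    have -> : p.1 + h n.+1 + h n.+1 = p.1 + h n by lra.
    exact: half2 tri hc.
  have hy : `|W (nx n p) (nx n p + h n.+1) p.2 (p.2 + k n)| / 2 <= `|W (nx n p) (nx n p + h n.+1) (ny n p) (ny n p + k n.+1)|.
    case: x1 => x1 x2.
    rewrite (@W_split_y (nx n p) (nx n p + h n.+1) p.2 (p.2 + k n.+1) (p.2 + k n)); try lra.
    have := @ler_normD _ _ (W (nx n p) (nx n p + h n.+1) p.2 (p.2 + k n.+1)) (W (nx n p) (nx n p + h n.+1) (p.2 + k n.+1) (p.2 + k n)).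
    rewrite /ny; case: ifP => [hc tri|/negbT]; [exact: half1 tri hc|rewrite -ltNge => /ltW hc tri].
    have -> : p.2 + k n.+1 + k n.+1 = p.2 + k n by lra.
    exact: half2 tri hc.
  case: x1 => x1 x2; case: y1 => y1 y2; split => //.
  by move: hx hy; lra.
have inv n : [/\ A <= (S n).1, (S n).1 + h n <= B, C <= (S n).2, (S n).2 + k n <= D &
   `|W A B C D| / 4 ^+ n <= `|W (S n).1 ((S n).1 + h n) (S n).2 ((S n).2 + k n)| ].
  elim: n => [|n [i1 i2 i3 i4 i5]].
    rewrite /= /h /k !expr0 !divr1 !subrKC; split => //.
  have [s1 s2 s3 s4 s5] := step n (S n) i1 i2 i3 i4.
  split; rewrite [S n.+1]/=.
  - exact: le_trans s1.
  - exact: le_trans i2.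
  - exact: le_trans s3.
  - exact: le_trans i4.
  - apply: le_trans s5; rewrite exprSr invfM mulrA ler_pM2r//.
have [xs hxs] : exists x, forall n, (S n).1 <= x <= (S n).1 + h n.
  apply: nested_real => n; have [i1 i2 i3 i4 i5] := inv n.
  - by have [] := step n (S n) i1 i2 i3 i4.
  - by have [] := step n (S n) i1 i2 i3 i4.
  - by rewrite lerDl.
have [ys hys] : exists x, forall n, (S n).2 <= x <= (S n).2 + k n.
  apply: nested_real => n; have [i1 i2 i3 i4 i5] := inv n.
  - by have [] := step n (S n) i1 i2 i3 i4.
  - by have [] := step n (S n) i1 i2 i3 i4.
  - by rewrite lerDl.
have xsAB : A <= xs <= B by have := hxs 0%N; rewrite /= /h expr0 divr1 subrKC.
have ysCD : C <= ys <= D by have := hys 0%N; rewrite /= /k expr0 divr1 subrKC.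
have small (d s : R) : 0 < d -> 0 <= s -> exists n, s / 2 ^+ n < d.
  move=> d0 s0; exists (Num.bound (s / d)).
  have := archi_boundP (divr_ge0 s0 (ltW d0)); rewrite ltr_pdivrMr// => hb.
  rewrite ltr_pdivrMr ?exprn_gt0// mulrC; apply: lt_le_trans hb _.
  rewrite ler_pM2r// -natrX ler_nat; exact/ltnW/ltn_expl.
apply/eqP; rewrite -normr_eq0; apply/eqP/le_anti; rewrite normr_ge0 andbT.
apply/ler_addgt0Pr => eps e0; rewrite add0r.
pose s := B - A + (D - C) : R.
have s0 : 0 <= s by rewrite addr_ge0 ?subr_ge0.
(* The factor [4^n] lost by bisection equals the gain in the squared size:
   [|W| / 4^n <= 2 e1 (s / 2^n)^2], hence [|W| <= 2 e1 s^2]. The [+ 1] covers a degenerate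
   rectangle. *)
pose e1 : R := eps / (2 * s ^+ 2 + 1).
have e10 : 0 < e1 by rewrite divr_gt0// ltr_wpDl// mulr_ge0 ?sqr_ge0.
have [d d0 hd] := W_local xsAB ysCD e10.
have [n hn] := small d s d0 s0.
have [i1 i2 i3 i4 i5] := inv n.
have /andP[x1 x2] := hxs n; have /andP[y1 y2] := hys n.
have dbar_factor : h n + k n = s / 2 ^+ n by rewrite /h /k -mulrDl.
have := h0 n; have := k0 n => kn hn0.
have := hd _ _ _ _ i1 x1 x2 i2 i3 y1 y2 i4.
have eh (u v : R) : u + v - u = v by ring.
rewrite !eh dbar_factor => hW.
have {}hW : `|W (S n).1 ((S n).1 + h n) (S n).2 ((S n).2 + k n)| <= 2 * e1 * (s / 2 ^+ n) ^+ 2.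
  by apply: hW; lra.
have := le_trans i5 hW.
rewrite expr_div_n -exprM mulnC exprM (_ : 2 ^+ 2 = 4 :> R); last by ring.
rewrite mulrA ler_pM2r ?invr_gt0 ?exprn_gt0// => hh.
apply: le_trans hh _.
have -> : 2 * e1 * s ^+ 2 = eps * ((2 * s ^+ 2) / (2 * s ^+ 2 + 1)).
  by rewrite /e1; ring.
rewrite ler_piMr ?(ltW e0)// ler_pdivrMr ?mul1r ?lerDl// ltr_wpDl// mulr_ge0 ?sqr_ge0//.
Qed.

End Goursat.

(** * Complex derivatives and real differentiability in two variables *)

Section rdiff2.
Variable R : realType.
Local Notation C := R[i].

(** Written without a quotient, so that [h = 0] is allowed and the chain rule needs no case
    distinction. *)
Definition cderiv (f : C -> C) (z L : C) : Prop := forall eps : R, 0 < eps ->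
  exists2 d : R, 0 < d & forall h, cnorm h < d -> cnorm (f (z + h) - f z - L * h) <= eps * cnorm h.

(** Differentiability at a point with partial derivatives [A] and [B]; its real and imaginary parts
    have the form of the hypothesis of the Goursat section. *)
Definition rdiff2 (F : R -> R -> C) (x y : R) (A B : C) : Prop := forall eps : R, 0 < eps ->
  exists2 d : R, 0 < d & forall x' y', `|x' - x| < d -> `|y' - y| < d ->
   cnorm (F x' y' - F x y - A * (x' - x)%:C - B * (y' - y)%:C) <= eps * (`|x' - x| + `|y' - y|).

Lemma rdiff2_lip F x y A B : rdiff2 F x y A B -> exists2 d : R, 0 < d & forall x' y',
  `|x' - x| < d -> `|y' - y| < d ->
  cnorm (F x' y' - F x y) <= (1 + cnorm A + cnorm B) * (`|x' - x| + `|y' - y|).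
Proof.
move=> /(_ 1 ltr01)[d d0 h]; exists d => // x' y' hx hy.
have -> : F x' y' - F x y = (F x' y' - F x y - A * (x' - x)%:C - B * (y' - y)%:C) + (A * (x' - x)%:C + B * (y' - y)%:C) by ring.
apply: le_trans (cnormD _ _) _; apply: le_trans (lerD (h _ _ hx hy) (cnormD _ _)) _.
rewrite !cnormM !cnorm_real.
have := cnorm_ge0 A; have := cnorm_ge0 B; have := normr_ge0 (x' - x); have := normr_ge0 (y' - y); nra.
Qed.

Lemma rdiff2_cst c x y : rdiff2 (fun _ _ => c) x y 0 0.
Proof.
move=> eps e0; exists 1 => // x' y' _ _.
by rewrite !mul0r !subr0 subrr cnorm0 mulr_ge0 ?addr_ge0// ltW.
Qed.

Lemma rdiff2_fst x y : rdiff2 (fun x _ => x%:C) x y 1 0.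
Proof.
move=> eps e0; exists 1 => // x' y' _ _.
have E : x'%:C - x%:C - 1 * (x' - x)%:C - 0 * (y' - y)%:C = 0 :> C.
  by apply: complexP; rewrite /= !(mul0r, mul1r, subr0, oppr0, addr0, add0r, mulr0, subrr).
by rewrite E cnorm0 mulr_ge0 ?addr_ge0// ltW.
Qed.

Lemma rdiff2_add F G x y A B A' B' : rdiff2 F x y A B -> rdiff2 G x y A' B' ->
  rdiff2 (fun x y => F x y + G x y) x y (A + A') (B + B').
Proof.
move=> hF hG eps e0; have e2 : 0 < eps / 2 by rewrite divr_gt0.
have [d1 d10 h1] := hF _ e2; have [d2 d20 h2] := hG _ e2.
exists (Num.min d1 d2); first by rewrite lt_min d10 d20.
move=> x' y'; rewrite !lt_min => /andP[x1 x2] /andP[y1 y2].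
have := lerD (h1 _ _ x1 y1) (h2 _ _ x2 y2).
rewrite -mulrDl -splitr; apply: le_trans; apply: le_trans (cnormD _ _).
rewrite le_eqVlt; apply/orP; left; apply/eqP; congr cnorm; ring.
Qed.

Lemma rdiff2_mul F G x y A B A' B' : rdiff2 F x y A B -> rdiff2 G x y A' B' ->
  rdiff2 (fun x y => F x y * G x y) x y (A * G x y + F x y * A') (B * G x y + F x y * B').
Proof.
move=> hF hG eps e0.
pose KF := 1 + cnorm A + cnorm B; pose KG := 1 + cnorm A' + cnorm B'.
have KF0 : 0 < KF by rewrite /KF -addrA ltr_pwDl// addr_ge0 ?cnorm_ge0.
have KG0 : 0 < KG by rewrite /KG -addrA ltr_pwDl// addr_ge0 ?cnorm_ge0.
have nF := cnorm_ge0 (F x y); have nG := cnorm_ge0 (G x y).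
pose e1 := eps / (3 * (1 + cnorm (F x y) + cnorm (G x y))).
have den : 0 < 3 * (1 + cnorm (F x y) + cnorm (G x y)) by rewrite mulr_gt0//; lra.
have e10 : 0 < e1 by rewrite divr_gt0.
have [d1 d10 h1] := hF _ e10; have [d2 d20 h2] := hG _ e10.
have [d3 d30 h3] := rdiff2_lip hF; have [d4 d40 h4] := rdiff2_lip hG.
pose d5 := eps / (6 * KF * KG).
have d50 : 0 < d5 by rewrite divr_gt0// !mulr_gt0.
exists (Num.min d1 (Num.min d2 (Num.min d3 (Num.min d4 d5)))).
  by rewrite !lt_min d10 d20 d30 d40 d50.
move=> x' y'; rewrite !lt_min => /and5P[x1 x2 x3 x4 x5] /and5P[y1 y2 y3 y4 y5].
set u := F x' y' - F x y - A * (x' - x)%:C - B * (y' - y)%:C.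
set v := G x' y' - G x y - A' * (x' - x)%:C - B' * (y' - y)%:C.
set s := F x' y' - F x y; set t := G x' y' - G x y.
(* The errors [u] and [v] of the two factors enter linearly, while the product [s * t] of the full
   increments is quadratic and is made small by [d5]. *)
rewrite (_ : _ - _ = u * G x y + F x y * v + s * t); last by rewrite /u /v /s /t; ring.
apply: le_trans (cnormD _ _) _; apply: le_trans (lerD (cnormD _ _) (lexx _)) _; rewrite !cnormM.
have hu := h1 _ _ x1 y1; have hv := h2 _ _ x2 y2; have hs := h3 _ _ x3 y3; have ht := h4 _ _ x4 y4.
rewrite -/u -/v -/s -/t -/KF -/KG in hu hv hs ht.
set w := `|x' - x| + `|y' - y|.
rewrite -/w in hu hv hs ht.
have w0 : 0 <= w by rewrite addr_ge0.
have w5 : w <= 2 * d5 by rewrite /w; lra.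
have e1E : e1 * (3 * (1 + cnorm (F x y) + cnorm (G x y))) = eps by rewrite divfK// gt_eqF.
have d5E : d5 * (6 * KF * KG) = eps by rewrite divfK// gt_eqF// !mulr_gt0.
have b1 : cnorm u * cnorm (G x y) <= e1 * w * cnorm (G x y) by rewrite ler_wpM2r.
have b2 : cnorm (F x y) * cnorm v <= cnorm (F x y) * (e1 * w) by rewrite ler_wpM2l.
have b3 : cnorm s * cnorm t <= (KF * w) * (KG * w) by rewrite ler_pM ?cnorm_ge0.
have b4 : (KF * w) * (KG * w) <= (2 * d5 * KF * KG) * w.
  rewrite (_ : KF * w * (KG * w) = w * (KF * KG) * w); last by ring.
  rewrite ler_wpM2r// (_ : 2 * d5 * KF * KG = 2 * d5 * (KF * KG)); last by ring.
  by rewrite ler_wpM2r// mulr_ge0// ltW.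
have b5 : 2 * d5 * KF * KG = eps / 3 by rewrite -d5E; field.
have b6 : e1 * w * cnorm (G x y) + cnorm (F x y) * (e1 * w) <= eps / 3 * w.
  rewrite (_ : _ + _ = (e1 * (cnorm (F x y) + cnorm (G x y))) * w); last by ring.
  rewrite ler_wpM2r// -e1E; nra.
nra.
Qed.

Lemma rdiff2_comp f L F x y A B : rdiff2 F x y A B -> cderiv f (F x y) L ->
  rdiff2 (fun x y => f (F x y)) x y (L * A) (L * B).
Proof.
move=> hF hf eps e0.
pose KF := 1 + cnorm A + cnorm B; pose KL := 1 + cnorm L.
have KF0 : 0 < KF by rewrite /KF -addrA ltr_pwDl// addr_ge0 ?cnorm_ge0.
have KL0 : 0 < KL by rewrite /KL ltr_pwDl// cnorm_ge0.
have [d1 d10 h1] := hF (eps / (2 * KL)) ltac:(by rewrite divr_gt0// mulr_gt0).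
have [d2 d20 h2] := hf (eps / (2 * KF)) ltac:(by rewrite divr_gt0// mulr_gt0).
have [d3 d30 h3] := rdiff2_lip hF.
exists (Num.min d1 (Num.min d3 (d2 / (2 * KF)))).
  by rewrite !lt_min d10 d30 divr_gt0// mulr_gt0.
move=> x' y'; rewrite !lt_min => /and3P[x1 x3 x2] /and3P[y1 y3 y2].
set u := F x' y' - F x y - A * (x' - x)%:C - B * (y' - y)%:C.
set s := F x' y' - F x y.
set w := `|x' - x| + `|y' - y|.
have w0 : 0 <= w by rewrite addr_ge0.
have hu : cnorm u <= eps / (2 * KL) * w := h1 _ _ x1 y1.
have hs : cnorm s <= KF * w := h3 _ _ x3 y3.
have wd : w < d2 / KF.
  rewrite (_ : d2 / KF = d2 / (2 * KF) + d2 / (2 * KF)); first exact: ltrD.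
  by field; rewrite gt_eqF.
have sd : cnorm s < d2.
  by apply: le_lt_trans hs _; rewrite mulrC -ltr_pdivlMr.
have := h2 s sd; rewrite (_ : F x y + s = F x' y'); last by rewrite /s; ring.
move=> h4.
rewrite (_ : _ - _ = (f (F x' y') - f (F x y) - L * s) + L * u); last by rewrite /u /s; ring.
apply: le_trans (cnormD _ _) _; rewrite cnormM.
have b1 : cnorm (f (F x' y') - f (F x y) - L * s) <= eps / 2 * w.
  apply: le_trans h4 _; apply: le_trans (ler_wpM2l _ hs) _.
    by rewrite divr_ge0 ?mulr_ge0 ?ltW.
  rewrite le_eqVlt; apply/orP; left; apply/eqP; by field; rewrite gt_eqF.
have b2 : cnorm L * cnorm u <= eps / 2 * w.
  apply: (@le_trans _ _ (KL * cnorm u)).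
    by rewrite ler_wpM2r ?cnorm_ge0// /KL lerDr.
  apply: le_trans (ler_wpM2l (ltW KL0) hu) _.
  rewrite le_eqVlt; apply/orP; left; apply/eqP; by field; rewrite gt_eqF.
by apply: le_trans (lerD b1 b2) _; rewrite -mulrDl -splitr.
Qed.

Lemma cderiv_inv z : z != 0 -> cderiv (fun w => w^-1) z (- z^-1 ^+ 2).
Proof.
move=> z0 eps e0.
have nz : 0 < cnorm z by rewrite cnorm_gt0.
(* The remainder is [h^2 / (z^2 (z + h))], of modulus at most [2 |h|^2 / |z|^3] as soon as
   [|h| <= |z| / 2]. *)
exists (Num.min (cnorm z / 2) (eps * cnorm z ^+ 3 / 2)).
  by rewrite lt_min !divr_gt0// mulr_gt0// exprn_gt0.
move=> h; rewrite lt_min => /andP[h1 h2].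
have zh : cnorm z / 2 <= cnorm (z + h).
  have := cnormB (z + h) h; rewrite addrK; lra.
have zh0 : z + h != 0 by rewrite -cnorm_gt0; apply: lt_le_trans zh; rewrite divr_gt0.
rewrite (_ : _ - _ = h ^+ 2 * (z^-1 ^+ 2 * (z + h)^-1)); last first.
  field; by rewrite z0 zh0.
rewrite cnormM !cnormX cnormM cnormX !cnormV [X in X * _]expr2 -mulrA [leRHS]mulrC ler_wpM2l ?cnorm_ge0//.
have zi : (cnorm (z + h))^-1 <= 2 / cnorm z.
  have -> : 2 / cnorm z = (cnorm z / 2)^-1 by rewrite invf_div.
  by rewrite lef_pV2 ?posrE ?divr_gt0// cnorm_gt0.
apply: (@le_trans _ _ (cnorm h * ((cnorm z)^-1 ^+ 2 * (2 / cnorm z)))).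
  by rewrite ler_wpM2l ?cnorm_ge0// ler_wpM2l// exprn_ge0// invr_ge0 cnorm_ge0.
apply: (@le_trans _ _ (eps * cnorm z ^+ 3 / 2 * ((cnorm z)^-1 ^+ 2 * (2 / cnorm z)))).
  by rewrite ler_wpM2r ?(ltW h2)// mulr_ge0 ?exprn_ge0 ?invr_ge0 ?divr_ge0 ?cnorm_ge0.
rewrite le_eqVlt; apply/orP; left; apply/eqP; field; by rewrite gt_eqF.
Qed.

Lemma cderiv_exp k z : cderiv (fun w => w ^+ k) z (k%:R * z ^+ k.-1).
Proof.
elim: k => [|k IH] eps e0.
  by exists 1 => // h _; rewrite !expr0 subrr mul0r mul0r subrr cnorm0 mulr_ge0 ?cnorm_ge0 ?ltW.
pose K := 1 + cnorm z + cnorm (k%:R * z ^+ k.-1).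
have K0 : 0 < K by rewrite /K -addrA ltr_pwDl// addr_ge0 ?cnorm_ge0.
have [d d0 hd] := IH (eps / (2 * K)) ltac:(by rewrite divr_gt0// mulr_gt0).
exists (Num.min d (Num.min 1 (eps / (2 * (K + eps))))).
  by rewrite !lt_min d0 ltr01 divr_gt0// mulr_gt0// addr_gt0.
move=> h; rewrite !lt_min => /and3P[h1 h2 h3].
set s := (z + h) ^+ k - z ^+ k - k%:R * z ^+ k.-1 * h.
have hs : cnorm s <= eps / (2 * K) * cnorm h := hd h h1.
rewrite (_ : _ - _ = (z + h) * s + k%:R * z ^+ k.-1 * h ^+ 2); last first.
  rewrite /s !exprS -natr1 /=; case: (k) => [|j]; first by rewrite !expr0; ring.
  by rewrite -pred_Sn !exprS; ring.
have nh := cnorm_ge0 h; have nz := cnorm_ge0 z; have nL := cnorm_ge0 (k%:R * z ^+ k.-1).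
apply: le_trans (cnormD _ _) _; rewrite !(cnormM, cnormX).
have zh : cnorm (z + h) <= K by have := cnormD z h; rewrite /K; lra.
have b1 : cnorm (z + h) * cnorm s <= eps / 2 * cnorm h.
  apply: le_trans (ler_pM (cnorm_ge0 _) (cnorm_ge0 _) zh hs) _.
  rewrite le_eqVlt; apply/orP; left; apply/eqP; by field; rewrite gt_eqF.
have b2 : cnorm (k%:R * z ^+ k.-1) * cnorm h ^+ 2 <= eps / 2 * cnorm h.
  rewrite expr2 mulrA ler_wpM2r//.
  apply: (@le_trans _ _ (K * (eps / (2 * (K + eps))))).
    by rewrite ler_pM// ?(ltW h3)// /K; lra.
  have -> : K * (eps / (2 * (K + eps))) = eps / 2 * (K / (K + eps)).
    field; by rewrite gt_eqF// addr_gt0.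
  have Kp : 0 < K + eps by apply: addr_gt0.
  have q : K / (K + eps) <= 1 by rewrite (ler_pdivrMr _ _ Kp) mul1r lerDl ltW.
  by rewrite ler_piMr// divr_ge0// ltW.
by rewrite cnormM cnormX in b2; apply: le_trans (lerD b1 b2) _; rewrite -mulrDl -splitr.
Qed.

Lemma derive_eps (f : R -> R) (x df : R) : is_derive x 1 f df -> forall eps : R, 0 < eps ->
  exists2 d : R, 0 < d & forall y, `|y - x| < d -> `|f y - f x - df * (y - x)| <= eps * `|y - x|.
Proof.
move=> [dx dE] eps e0; have := dx; rewrite /derivable => /cvg_ex[l hl].
have ll : l = df by rewrite -dE /derive; apply/esym/cvg_lim.
rewrite ll in hl.
have /cvgrPdist_le /(_ _ e0) := hl; move=> /nbhs_ballP[d d0 hd].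
exists d => // y yx; have [->|yx0] := eqVneq y x; first by rewrite !subrr mulr0 subr0 !normr0 mulr0.
have h0 : y - x != 0 by rewrite subr_eq0.
have := hd (y - x); rewrite /ball /= sub0r normrN => /(_ yx h0).
rewrite /= -[_ *: 1]/(_ * 1) mulr1 subrK => hh.
rewrite (_ : f y - f x - df * (y - x) = - ((df - (y - x)^-1 *: (f y - f x)) * (y - x))).
  by rewrite normrN normrM ler_wpM2r.
by rewrite -[_ *: _]/(_ * _); field.
Qed.

Definition ei (y : R) : C := (cos y +i* sin y)%C.

Lemma cnorm_ei y : cnorm (ei y) = 1.
Proof. by rewrite /cnorm /cabs2 /= cos2Dsin2 sqrtr1. Qed.

Lemma rdiff2_ei x y : rdiff2 (fun _ y => ei y) x y 0 ('i%C * ei y).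
Proof.
move=> eps e0; have e2 : 0 < eps / 2 by rewrite divr_gt0.
have [d1 d10 h1] := derive_eps (is_derive_cos y) e2.
have [d2 d20 h2] := derive_eps (is_derive_sin y) e2.
exists (Num.min d1 d2); first by rewrite lt_min d10 d20.
move=> x' y' _; rewrite lt_min => /andP[y1 y2].
apply: le_trans (cnorm_le_ReIm _) _.
have := lerD (h1 _ y1) (h2 _ y2); rewrite -mulrDl -splitr => h.
apply: (@le_trans _ _ (eps * `|y' - y|)); last first.
  by rewrite ler_wpM2l ?lerDr// ltW.
apply: le_trans h; rewrite !(ReD, ImD, ReN, ImN, ReM, ImM) /=.
by apply: lerD; rewrite le_eqVlt; apply/orP; left; apply/eqP; congr (Num.norm _); ring.
Qed.

End rdiff2.

(** * Integration of complex functions of the angle *)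

Section CI.
Variable R : realType.
Local Notation C := R[i].
Local Notation T := (2 * pi : R).

Definition circ_cont (F : R -> C) : Prop :=
  seg_cont 0 T (fun t => complex.Re (F t)) /\ seg_cont 0 T (fun t => complex.Im (F t)).
(** An integral in the angle [t]; contour integrals appear through [dz = i z dt]. *)
Definition circ_int (F : R -> C) : C :=
  (seg_int 0 T (fun t => complex.Re (F t)) +i* seg_int 0 T (fun t => complex.Im (F t)))%C.

Lemma two_pi_ge0 : 0 <= T. Proof. by rewrite mulr_ge0// pi_ge0. Qed.

Lemma seg_cont_cst a b (k : R) : seg_cont a b (fun=> k).
Proof. by move=> x; exact: cst_continuous. Qed.
Lemma seg_cont_D a b (f g : R -> R) : seg_cont a b f -> seg_cont a b g -> seg_cont a b (fun x => f x + g x).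
Proof. by move=> cf cg x; apply: continuousD; [exact: cf|exact: cg]. Qed.
Lemma seg_cont_N a b (f : R -> R) : seg_cont a b f -> seg_cont a b (fun x => - f x).
Proof. by move=> cf x; apply: continuousN; exact: cf. Qed.
Lemma seg_cont_M a b (f g : R -> R) : seg_cont a b f -> seg_cont a b g -> seg_cont a b (fun x => f x * g x).
Proof. by move=> cf cg x; apply: continuousM; [exact: cf|exact: cg]. Qed.
Lemma seg_cont_B a b (f g : R -> R) : seg_cont a b f -> seg_cont a b g -> seg_cont a b (fun x => f x - g x).
Proof. by move=> cf cg; apply: seg_cont_D => //; exact: seg_cont_N. Qed.

Lemma seg_cont_eq a b (f g : R -> R) : f =1 g -> seg_cont a b f -> seg_cont a b g.
Proof. by move=> /funext ->. Qed.

Lemma circ_cont_cst k : circ_cont (fun=> k). Proof. by split; exact: seg_cont_cst. Qed.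
Lemma circ_cont_D F G : circ_cont F -> circ_cont G -> circ_cont (fun t => F t + G t).
Proof.
move=> [f1 f2] [g1 g2]; split.
  by apply: (seg_cont_eq (f := fun t => complex.Re (F t) + complex.Re (G t))); [move=> t; rewrite ReD|exact: seg_cont_D].
by apply: (seg_cont_eq (f := fun t => complex.Im (F t) + complex.Im (G t))); [move=> t; rewrite ImD|exact: seg_cont_D].
Qed.
Lemma circ_cont_M F G : circ_cont F -> circ_cont G -> circ_cont (fun t => F t * G t).
Proof.
move=> [f1 f2] [g1 g2]; split.
  apply: (seg_cont_eq (f := fun t => complex.Re (F t) * complex.Re (G t) - complex.Im (F t) * complex.Im (G t))); first by move=> t; rewrite ReM.
  by apply: seg_cont_B; exact: seg_cont_M.
apply: (seg_cont_eq (f := fun t => complex.Re (F t) * complex.Im (G t) + complex.Im (F t) * complex.Re (G t))); first by move=> t; rewrite ImM.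
by apply: seg_cont_D; exact: seg_cont_M.
Qed.
Lemma circ_cont_X F k : circ_cont F -> circ_cont (fun t => F t ^+ k).
Proof.
move=> cF; elim: k => [|k IH].
  by have -> : (fun t => F t ^+ 0) = (fun=> 1) by []; exact: circ_cont_cst.
have -> : (fun t => F t ^+ k.+1) = (fun t => F t * F t ^+ k) by apply/funext => t; rewrite exprS.
exact: circ_cont_M.
Qed.
Lemma circ_cont_sum (I : Type) (r : seq I) (F : I -> R -> C) : (forall i, circ_cont (F i)) ->
  circ_cont (fun t => \sum_(i <- r) F i t).
Proof.
move=> cF; elim: r => [|i r IH].
  have -> : (fun t => \sum_(i <- [::]) F i t) = (fun=> 0) by apply/funext => t; rewrite big_nil.
  exact: circ_cont_cst.
have -> : (fun t => \sum_(i <- i :: r) F i t) = (fun t => F i t + \sum_(i <- r) F i t) by apply/funext => t; rewrite big_cons.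
exact: circ_cont_D.
Qed.

Lemma seg_intZ (f : R -> R) (c : R) : seg_cont 0 T f -> seg_int 0 T (fun t => c * f t) = c * seg_int 0 T f.
Proof. by move=> cf; rewrite /seg_int RintegralZl//; exact: seg_cont_integrable. Qed.

Lemma circ_intD F G : circ_cont F -> circ_cont G -> circ_int (fun t => F t + G t) = circ_int F + circ_int G.
Proof.
move=> [f1 f2] [g1 g2]; apply: complexP.
  rewrite [LHS]/= ReD [X in _ = X + _]/= [X in _ = _ + X]/= -seg_intD//.
  by congr seg_int; apply/funext => t; rewrite ReD.
rewrite [LHS]/= ImD [X in _ = X + _]/= [X in _ = _ + X]/= -seg_intD//.
by congr seg_int; apply/funext => t; rewrite ImD.
Qed.

Lemma circ_intZ F c : circ_cont F -> circ_int (fun t => c * F t) = c * circ_int F.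
Proof.
move=> [f1 f2]; apply: complexP.
  rewrite ReM [LHS]/= [complex.Re (circ_int F)]/= [complex.Im (circ_int F)]/= -!seg_intZ//.
  rewrite -mulN1r -seg_intZ ?mulN1r; last by apply: seg_cont_M => //; exact: seg_cont_cst.
  rewrite -seg_intD; last 2 first.
  - by apply: seg_cont_M => //; exact: seg_cont_cst.
  - by apply: seg_cont_M; [exact: seg_cont_cst|apply: seg_cont_M => //; exact: seg_cont_cst].
  by congr seg_int; apply/funext => t; rewrite ReM mulN1r.
rewrite ImM [LHS]/= [complex.Re (circ_int F)]/= [complex.Im (circ_int F)]/= -!seg_intZ//.
rewrite -seg_intD; [|by apply: seg_cont_M => //; exact: seg_cont_cst|by apply: seg_cont_M => //; exact: seg_cont_cst].
by congr seg_int; apply/funext => t; rewrite ImM.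
Qed.

(** The real and imaginary parts are estimated separately, which accounts for the factor 2. *)
Lemma circ_int_bound F (e : R) : circ_cont F -> (forall t, 0 <= t <= T -> cnorm (F t) <= e) -> cnorm (circ_int F) <= 2 * T * e.
Proof.
move=> [f1 f2] H; apply: le_trans (cnorm_le_ReIm _) _.
have h1 : `|seg_int 0 T (fun t => complex.Re (F t))| <= e * T.
  have := @seg_int_bound _ _ _ _ 0 e two_pi_ge0 f1; rewrite mul0r !subr0; apply => x hx.
  by rewrite subr0; apply: le_trans (Re_le_cnorm _) (H x hx).
have h2 : `|seg_int 0 T (fun t => complex.Im (F t))| <= e * T.
  have := @seg_int_bound _ _ _ _ 0 e two_pi_ge0 f2; rewrite mul0r !subr0; apply => x hx.
  by rewrite subr0; apply: le_trans (Im_le_cnorm _) (H x hx).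
by apply: le_trans (lerD h1 h2) _; rewrite le_eqVlt; apply/orP; left; apply/eqP; ring.
Qed.

Lemma circ_int_cst c : circ_int (fun=> c) = T%:C * c.
Proof.
have h k : seg_int 0 T (fun=> k) = T * k.
  apply/eqP; rewrite -subr_eq0 -normr_eq0; apply/eqP/le_anti; rewrite normr_ge0 andbT.
  have := @seg_int_bound _ _ _ _ k 0 two_pi_ge0 (@seg_cont_cst 0 T k); rewrite mul0r !subr0 (mulrC k); apply => x _.
  by rewrite subrr normr0.
by rewrite /circ_int !h; case: c => u v; apply: complexP; rewrite /=; ring.
Qed.

Lemma circ_int_sum (I : Type) (r : seq I) (F : I -> R -> C) : (forall i, circ_cont (F i)) ->
  circ_int (fun t => \sum_(i <- r) F i t) = \sum_(i <- r) circ_int (F i).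
Proof.
move=> cF; elim: r => [|i r IH].
  have -> : (fun t => \sum_(i <- [::]) F i t) = (fun=> 0) by apply/funext => t; rewrite big_nil.
  by rewrite big_nil circ_int_cst mulr0.
have -> : (fun t => \sum_(i <- i :: r) F i t) = (fun t => F i t + \sum_(i <- r) F i t) by apply/funext => t; rewrite big_cons.
by rewrite big_cons circ_intD// ?IH//; exact: circ_cont_sum.
Qed.

Lemma circ_int_conj F : circ_cont F -> circ_int (fun t => (F t)^*%C) = (circ_int F)^*%C.
Proof.
move=> [f1 f2]; apply: complexP.
  by rewrite /=; congr seg_int; apply/funext => t; case: (F t).
rewrite /= -mulN1r -seg_intZ//; congr seg_int; apply/funext => t; rewrite mulN1r; by case: (F t).
Qed.

Lemma rdiff2_coef (F : R -> R -> C) x y A B A' B' : rdiff2 F x y A B -> A = A' -> B = B' -> rdiff2 F x y A' B'.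
Proof. by move=> h <- <-. Qed.

Lemma rdiff2_contC F x : (forall t, exists A B, rdiff2 F x t A B) -> circ_cont (F x).
Proof.
move=> H.
have key t (eps : R) : 0 < eps -> exists2 d : R, 0 < d & forall t', `|t' - t| < d -> cnorm (F x t' - F x t) <= eps.
  move=> e0; have [A [B h]] := H t; have [d d0 hd] := rdiff2_lip h.
  pose K := 1 + cnorm A + cnorm B.
  have K0 : 0 < K by rewrite /K -addrA ltr_pwDl// addr_ge0 ?cnorm_ge0.
  exists (Num.min d (eps / K)); first by rewrite lt_min d0 divr_gt0.
  move=> t'; rewrite lt_min => /andP[h1 h2].
  have := hd x t'; rewrite subrr normr0 add0r => /(_ d0 h1) h3.
  apply: le_trans h3 _; rewrite -/K mulrC -ler_pdivlMr// ltW//.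
split; apply: seg_cont_pt => t _ eps e0; have [d d0 h] := key t eps e0; exists d => // t' _ tt'.
  by rewrite -ReN -ReD; apply: le_trans (Re_le_cnorm _) _; exact: h.
by rewrite -ImN -ImD; apply: le_trans (Im_le_cnorm _) _; exact: h.
Qed.

End CI.

(** * Cauchy formula on a circle *)

Section Cauchy.
Variables (R : realType) (f : R[i] -> R[i]) (R0 r : R).
Local Notation C := R[i].
Local Notation T := (2 * pi : R).
Hypothesis hf : forall z, cnorm z < R0 -> exists L, cderiv f z L.
Hypotheses (r0 : 0 < r) (rR : r < R0).

Definition circ (t : R) : C := r%:C * ei t.

Lemma cnorm_circ t : cnorm (circ t) = r.
Proof. by rewrite cnormM cnorm_real cnorm_ei mulr1 gtr0_norm. Qed.

Lemma circ_neq0 t : circ t != 0.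
Proof. by rewrite -cnorm_gt0 cnorm_circ. Qed.

Lemma circ_2pi : circ 0 = circ T.
Proof. by rewrite /circ /ei mulr_natl cos2pi sin2pi cos0 sin0. Qed.

Lemma rdiff2_circ x t : rdiff2 (fun _ t => circ t) x t 0 ('i%C * circ t).
Proof.
apply: rdiff2_coef (rdiff2_mul (rdiff2_cst _ _ _) (rdiff2_ei _ _)) _ _; first by rewrite mul0r mulr0 addr0.
by rewrite mul0r add0r mulrCA.
Qed.

Section A.
Variable a : C.
Hypothesis ar : cnorm a < r.

Lemma gamB_neq0 t : circ t - a != 0.
Proof.
rewrite subr_eq0; apply/eqP => e; have := cnorm_circ t; rewrite e => h.
by move: ar; rewrite h ltxx.
Qed.

Lemma cnorm_gamB t : r - cnorm a <= cnorm (circ t - a).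
Proof. by have := cnormD (circ t - a) a; rewrite subrK cnorm_circ; lra. Qed.

(** The form [dz / (i (z - a))] on the circle. Its integral is evaluated later, from a geometric
    expansion. *)
Definition cauchy_ker (t : R) : C := circ t * (circ t - a)^-1.
(* The circle [circ] is contracted to [a] along [zet]; [Pc dl + Qc dt] is the pullback
   of [f(z) dz / (i (z - a))], and Goursat on [l, 1] x [0, 2 pi] makes the integral of
   [Qc l] independent of [l]. *)
Let zet (l t : R) : C := a + l%:C * (circ t - a).

Lemma rdiff2_gamB x t : rdiff2 (fun _ t => circ t - a) x t 0 ('i%C * circ t).
Proof.
by apply: rdiff2_coef (rdiff2_add (rdiff2_circ _ _) (rdiff2_cst _ _ _)) _ _; rewrite addr0.
Qed.

Lemma rdiff2_gk x t : rdiff2 (fun _ t => cauchy_ker t) x t 0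
  ('i%C * circ t * (circ t - a)^-1 - circ t * ((circ t - a)^-1 ^+ 2 * ('i%C * circ t))).
Proof.
have h := rdiff2_comp (rdiff2_gamB x t) (cderiv_inv (gamB_neq0 t)).
apply: rdiff2_coef (rdiff2_mul (rdiff2_circ x t) h) _ _; ring.
Qed.

Lemma circ_cont_gk : circ_cont cauchy_ker.
Proof. by apply: (@rdiff2_contC _ (fun _ t => cauchy_ker t) 0) => t; eexists; eexists; exact: rdiff2_gk. Qed.

Lemma cnorm_gk t : cnorm (cauchy_ker t) <= r / (r - cnorm a).
Proof.
rewrite cnormM cnormV cnorm_circ ler_pM2l// lef_pV2 ?posrE ?cnorm_gamB//.
  by rewrite cnorm_gt0 gamB_neq0.
by rewrite subr_gt0.
Qed.

Lemma rdiff2_zet l t : rdiff2 zet l t (circ t - a) (l%:C * ('i%C * circ t)).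
Proof.
by apply: rdiff2_coef (rdiff2_add (rdiff2_cst a _ _) (rdiff2_mul (rdiff2_fst _ _) (rdiff2_gamB l t))) _ _; ring.
Qed.

Lemma zet_in l t : 0 <= l <= 1 -> cnorm (zet l t) < R0.
Proof.
move=> /andP[l0 l1]; apply: le_lt_trans rR.
rewrite (_ : zet l t = (1 - l)%:C * a + l%:C * circ t); last first.
  by rewrite /zet rmorphB /=; ring.
apply: le_trans (cnormD _ _) _; rewrite cnormM [cnorm (l%:C * _)]cnormM !cnorm_real cnorm_circ.
rewrite !ger0_norm ?subr_ge0//.
have : (1 - l) * cnorm a <= (1 - l) * r by rewrite ler_wpM2l ?subr_ge0// ltW.
lra.
Qed.

Let Pc (l t : R) : C := f (zet l t) * ((l%:C)^-1 * - 'i%C).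
Let Qc (l t : R) : C := f (zet l t) * cauchy_ker t.

(** Both mixed derivatives equal [L * circ t]: in [Pc] the factor [l] cancels its inverse and [- i]
    meets [i], in [Qc] the factor [circ t - a] cancels against the kernel. The inverse of [l]
    requires [0 < l]. *)
Lemma PQ_closed l t : 0 < l -> l <= 1 -> exists p1 p2 q2, rdiff2 Pc l t p1 p2 /\ rdiff2 Qc l t p2 q2.
Proof.
move=> l0 l1; have [L hL] := hf (@zet_in l t ltac:(by rewrite ltW)).
have hz := rdiff2_comp (rdiff2_zet l t) hL.
have l0' : l%:C != 0 :> C by rewrite -cnorm_gt0 cnorm_real gtr0_norm.
have hl := rdiff2_mul (rdiff2_comp (rdiff2_fst l t) (cderiv_inv l0')) (rdiff2_cst (- 'i%C) l t).
have hP := rdiff2_mul hz hl; have hQ := rdiff2_mul hz (rdiff2_gk l t).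
eexists; eexists; eexists; split; first exact: hP.
apply: rdiff2_coef hQ _ _; last by reflexivity.
have i2 := sqr_i R; rewrite /cauchy_ker.
have g0 := gamB_neq0 t.
have e1 : (circ t - a) * (circ t - a)^-1 = 1 by rewrite mulfV.
have e2 : l%:C * (l%:C)^-1 = 1 :> C by rewrite mulfV.
transitivity (L * circ t * ((circ t - a) * (circ t - a)^-1)); first by ring.
rewrite e1 mulr1.
transitivity (- ('i%C ^+ 2) * (L * circ t) * (l%:C * (l%:C)^-1)); last by ring.
by rewrite e2 i2 opprK mulr1 mul1r.
Qed.

Lemma circ_cont_Qc l : 0 < l -> l <= 1 -> circ_cont (Qc l).
Proof.
move=> l0 l1; apply: rdiff2_contC => t; have [p1 [p2 [q2 [_ h]]]] := PQ_closed t l0 l1.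
by exists p2, q2.
Qed.

Lemma cauchy_step l : 0 < l -> l <= 1 -> circ_int (fun t => Qc 1 t - Qc l t) = 0.
Proof.
move=> l0 l1.
(* Goursat concerns real forms; [p] will be the real part, then the imaginary part. *)
have main (p : C -> R) : (forall z w, p (z + w) = p z + p w) -> (forall z (x : R), p (z * x%:C) = p z * x) ->
   (forall z, `|p z| <= cnorm z) -> seg_int 0 T (fun t => p (Qc 1 t - Qc l t)) = 0.
  move=> pD pZ pn.
  have pN z : p (- z) = - p z.
    have p0 : p 0 = 0 by have := pD 0 0; rewrite addr0; lra.
    by have := pD z (- z); rewrite subrr p0 => /eqP; rewrite eq_sym addrC addr_eq0 => /eqP.
  have hcl x y : l <= x <= 1 -> 0 <= y <= T -> exists p1 p2 q2 : R,
     forall eps : R, 0 < eps -> exists2 d : R, 0 < d &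
     forall x' y', l <= x' <= 1 -> 0 <= y' <= T -> `|x' - x| < d -> `|y' - y| < d ->
    `|p (Pc x' y') - (p (Pc x y) + p1 * (x' - x) + p2 * (y' - y))| <= eps * (`|x' - x| + `|y' - y|) /\
    `|p (Qc x' y') - (p (Qc x y) + p2 * (x' - x) + q2 * (y' - y))| <= eps * (`|x' - x| + `|y' - y|).
    move=> /andP[lx x1] _.
    have [p1 [p2 [q2 [hP hQ]]]] := PQ_closed y (lt_le_trans l0 lx) x1.
    exists (p p1), (p p2), (p q2) => eps e0.
    have [d1 d10 h1] := hP _ e0; have [d2 d20 h2] := hQ _ e0.
    exists (Num.min d1 d2); first by rewrite lt_min d10 d20.
    move=> x' y' _ _; rewrite !lt_min => /andP[xx1 xx2] /andP[yy1 yy2].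
    split.
      apply: le_trans (h1 _ _ xx1 yy1); apply: le_trans (pn _).
      rewrite !pD !pN !pZ !opprD !addrA; exact: lexx.
    apply: le_trans (h2 _ _ xx2 yy2); apply: le_trans (pn _).
    rewrite !pD !pN !pZ !opprD !addrA; exact: lexx.
  (* The sides [t = 0] and [t = 2 pi] of the rectangle carry the same values of [Pc], so only the
     sides at [l] and 1 remain. *)
  have := goursat hcl l1 (@two_pi_ge0 R).
  have -> : (fun x => p (Pc x 0) - p (Pc x T)) = (fun=> 0).
    by apply/funext => x; rewrite /Pc /zet circ_2pi subrr.
  have -> : seg_int l 1 (fun=> 0) = 0 :> R.
    apply/eqP; rewrite -normr_eq0; apply/eqP/le_anti; rewrite normr_ge0 andbT.
    have := @seg_int_bound _ _ _ _ 0 0 l1 (@seg_cont_cst _ _ _ (0 : R)); rewrite !mul0r !subr0; apply => x _.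
    by rewrite normr0.
  rewrite add0r => h; rewrite -[RHS]h; congr seg_int.
  by apply/funext => t; rewrite pD pN.
apply: complexP.
  apply: (main (@complex.Re R)); [exact: ReD|by move=> [u v] x; rewrite /= mulr0 subr0|exact: Re_le_cnorm].
apply: (main (@complex.Im R)); [exact: ImD|by move=> [u v] x; rewrite /= mulr0 add0r|exact: Im_le_cnorm].
Qed.

Lemma circ_cont_fgam : circ_cont (fun t => f (circ t)).
Proof.
apply: (@rdiff2_contC _ (fun _ t => f (circ t)) 0) => t.
have [L hL] := hf (z := circ t) ltac:(by rewrite cnorm_circ).
by eexists; eexists; exact: rdiff2_comp (rdiff2_circ 0 t) hL.
Qed.

(** By [cauchy_step] the difference of the two sides equals the integral of
    [(f (zet l t) - f a) * cauchy_ker t] for every [l] in []0, 1]], and continuity of [f] at [a]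
    makes it arbitrarily small. *)
Lemma cauchy : circ_int (fun t => f (circ t) * cauchy_ker t) = f a * circ_int cauchy_ker.
Proof.
have Q1 t : Qc 1 t = f (circ t) * cauchy_ker t by rewrite /Qc /zet mul1r addrC subrK.
apply/eqP; rewrite -subr_eq0 -cnorm_eq0; apply/eqP/le_anti; rewrite cnorm_ge0 andbT.
apply/ler_addgt0Pr => eps e0; rewrite add0r.
pose K := r / (r - cnorm a).
have K0 : 0 < K by rewrite divr_gt0// subr_gt0.
have Tp : 0 < T by rewrite mulr_gt0// pi_gt0.
pose e1 := eps / (2 * T * K).
have e10 : 0 < e1 by rewrite divr_gt0// mulr_gt0// mulr_gt0.
have [L hL] := hf (lt_trans ar rR).
have [d d0 hd] := hL 1 ltr01.
pose K2 := 1 + cnorm L.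
have K20 : 0 < K2 by rewrite ltr_pwDl// cnorm_ge0.
(* The point [zet l t] is at distance at most [2 r l] from [a]: the second entry brings it within
   [d], the third gives [K2 * (2 r l) <= e1]. *)
pose l := Num.min 1 (Num.min (d / (4 * r)) (e1 / (K2 * (2 * r)))).
have q1 : 0 < d / (4 * r) by rewrite divr_gt0// mulr_gt0.
have q2 : 0 < e1 / (K2 * (2 * r)) by apply: divr_gt0 => //; rewrite mulr_gt0// mulr_gt0.
have l0 : 0 < l by rewrite /l !lt_min ltr01 q1 q2.
have l1 : l <= 1 by rewrite /l ge_min lexx.
have l2 : l <= d / (4 * r) by rewrite /l !ge_min lexx orbT.
have l3 : l <= e1 / (K2 * (2 * r)) by rewrite /l !ge_min lexx !orbT.
have small t : cnorm (f (zet l t) - f a) <= e1.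
  pose h := l%:C * (circ t - a).
  have nh : cnorm h <= l * (2 * r).
    rewrite cnormM cnorm_real gtr0_norm// ler_pM2l//.
    by apply: le_trans (cnormB _ _) _; rewrite cnorm_circ mulr_natl mulr2n lerD2l ltW.
  have hdd : cnorm h < d.
    apply: le_lt_trans nh _; apply: le_lt_trans (ler_wpM2r _ l2) _; first by rewrite mulr_ge0// ltW.
    rewrite (_ : d / (4 * r) * (2 * r) = d / 2); last by field; rewrite gt_eqF.
    by rewrite ltr_pdivrMr// ltr_pMr// ltr1n.
  have -> : f (zet l t) - f a = (f (a + h) - f a - L * h) + L * h by rewrite /zet -/h; ring.
  apply: le_trans (cnormD _ _) _; apply: le_trans (lerD (hd _ hdd) (lexx _)) _.
  rewrite cnormM -mulrDl -/K2.
  apply: le_trans (ler_wpM2l (ltW K20) nh) _.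
  by rewrite mulrCA -ler_pdivlMr ?mulr_gt0// mulr_gt0.
have c1 := circ_cont_fgam; have cg := circ_cont_gk.
have cQ := circ_cont_Qc l0 l1.
have step := cauchy_step l0 l1.
have E : circ_int (fun t => f (circ t) * cauchy_ker t) - f a * circ_int cauchy_ker = circ_int (fun t => (f (zet l t) - f a) * cauchy_ker t).
  have -> : (fun t => (f (zet l t) - f a) * cauchy_ker t) = (fun t => Qc l t + (- f a) * cauchy_ker t).
    by apply/funext => t; rewrite mulrDl mulNr.
  rewrite circ_intD//; last by apply: circ_cont_M => //; exact: circ_cont_cst.
  rewrite circ_intZ// mulNr; congr (_ - _).
  have := step; rewrite circ_intD//.
  - have -> : (fun t => - Qc l t) = (fun t => (-1) * Qc l t) by apply/funext => t; rewrite mulN1r.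
    rewrite circ_intZ// mulN1r => /eqP; rewrite subr_eq0 => /eqP <-.
    by congr circ_int; apply/funext => t; rewrite Q1.
  - exact: circ_cont_Qc.
  - have -> : (fun t => - Qc l t) = (fun t => (-1) * Qc l t) by apply/funext => t; rewrite mulN1r.
    by apply: circ_cont_M => //; exact: circ_cont_cst.
rewrite E; apply: (@le_trans _ _ (2 * T * (e1 * K))); last first.
  rewrite (_ : 2 * T * (e1 * K) = e1 * (2 * T * K)); last by ring.
  by rewrite /e1 divfK// gt_eqF// mulr_gt0// mulr_gt0.
apply: circ_int_bound => [|t _].
  have -> : (fun t => (f (zet l t) - f a) * cauchy_ker t) = (fun t => Qc l t + (- f a) * cauchy_ker t).
    by apply/funext => t; rewrite mulrDl mulNr.
  by apply: circ_cont_D => //; apply: circ_cont_M => //; exact: circ_cont_cst.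
rewrite cnormM; apply: ler_pM; rewrite ?cnorm_ge0//; exact: cnorm_gk.
Qed.

End A.
End Cauchy.

Section Ccvg.
Variable R : realType.
Local Notation C := R[i].

Definition ccvg (u : nat -> C) (l : C) : Prop := forall eps : R, 0 < eps ->
  exists N : nat, forall n, (N <= n)%N -> cnorm (u n - l) <= eps.

Lemma geom_small (q K eps : R) : 0 <= q < 1 -> 0 < eps -> exists N : nat, forall n,
  (N <= n)%N -> K * q ^+ n <= eps.
Proof.
move=> /andP[q0 q1] e0.
have K1 : 0 < `|K| + 1 by rewrite ltr_wpDl.
have e1 : 0 < eps / (`|K| + 1) by rewrite divr_gt0.
have : q ^+ n @[n --> \oo] --> 0 by apply: cvg_expr; rewrite ger0_norm.
move=> /cvgrPdist_le /(_ _ e1)[N _ hN]; exists N => n Nn.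
have := hN n Nn; rewrite /= sub0r normrN ger0_norm ?exprn_ge0// => h.
apply: le_trans (ler_norm _) _; rewrite normrM [`|q ^+ n|]ger0_norm ?exprn_ge0//.
apply: (@le_trans _ _ ((`|K| + 1) * (eps / (`|K| + 1)))).
  by rewrite ler_pM ?exprn_ge0// lerDl.
by rewrite mulrC divfK// gt_eqF.
Qed.

End Ccvg.

(** * Taylor expansion on a disc *)

Section PowerSeries.
Variables (R : realType) (f : R[i] -> R[i]) (R0 r : R).
Local Notation C := R[i].
Local Notation T := (2 * pi : R).
Hypothesis hf : forall z, cnorm z < R0 -> exists L, cderiv f z L.
Hypotheses (r0 : 0 < r) (rR : r < R0).
Local Notation circ := (circ r).

Lemma fgam_bounded : exists2 M : R, 0 <= M & forall t, 0 <= t <= T -> cnorm (f (circ t)) <= M.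
Proof.
have [c1 c2] := circ_cont_fgam hf r0 rR.
have c3 : seg_cont 0 T (fun t => complex.Re (f (circ t)) * complex.Re (f (circ t)) + complex.Im (f (circ t)) * complex.Im (f (circ t))).
  by apply: seg_cont_D; exact: seg_cont_M.
have [c _ hc] := EVT_max (@two_pi_ge0 R) c3.
exists (cnorm (f (circ c))); first exact: cnorm_ge0.
move=> t ht; rewrite /cnorm ler_sqrt ?cabs2_ge0// /cabs2 !expr2.
by apply: hc; rewrite in_itv.
Qed.

Lemma circ_cont_gamV : circ_cont (fun t => (circ t)^-1).
Proof.
apply: (@rdiff2_contC _ (fun _ t => (circ t)^-1) 0) => t.
by eexists; eexists; exact: rdiff2_comp (rdiff2_circ r 0 t) (cderiv_inv (circ_neq0 r0 t)).
Qed.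

Lemma circ_cont_gam : circ_cont circ.
Proof. by apply: (@rdiff2_contC _ (fun _ t => circ t) 0) => t; eexists; eexists; exact: rdiff2_circ. Qed.

(** At [a = 0] the kernel is 1, and the Cauchy formula returns the value of [w^(k + 1)] at 0. *)
Lemma circ_int_X k : circ_int (fun t => circ t ^+ k.+1) = 0.
Proof.
have dbar_factor z : cnorm z < r + 1 -> exists L, cderiv (fun w => w ^+ k.+1) z L by eexists; exact: cderiv_exp.
have r1 : r < r + 1 by rewrite ltrDl.
have a0 : cnorm (0 : C) < r by rewrite cnorm0.
have := cauchy dbar_factor r0 r1 a0; rewrite expr0n /= mul0r => <-; congr circ_int.
by apply/funext => t; rewrite /cauchy_ker subr0 mulfV ?mulr1// circ_neq0.
Qed.

(** Through this identity negative powers on the circle become conjugates of positive ones, whose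
    integrals are known. *)
Lemma circV t : (circ t)^-1 = (r ^- 2)%:C * (circ t)^*%C.
Proof.
have g0 := circ_neq0 r0 t; apply: (mulfI g0); rewrite mulfV//.
have := cos2Dsin2 t => h.
apply: complexP => /=.
  have E : r ^- 2 * r ^+ 2 * (cos t ^+ 2 + sin t ^+ 2) = 1.
    by rewrite h mulVf ?mulr1// expf_neq0// gt_eqF.
  by rewrite -[LHS]E; ring.
by ring.
Qed.

Lemma circ_int_VX k : circ_int (fun t => (circ t)^-1 ^+ k.+1) = 0.
Proof.
have -> : (fun t => (circ t)^-1 ^+ k.+1) = (fun t => (r ^- 2)%:C ^+ k.+1 * (circ t ^+ k.+1)^*%C).
  by apply/funext => t; rewrite circV exprMn rmorphXn.
have cg : circ_cont (fun t => circ t ^+ k.+1) by apply: circ_cont_X; exact: circ_cont_gam.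
rewrite circ_intZ; last first.
  case: cg => h1 h2; split.
    by apply: seg_cont_eq h1 => t; case: (circ t ^+ k.+1).
  by apply: seg_cont_eq (seg_cont_N h2) => t; case: (circ t ^+ k.+1).
by rewrite circ_int_conj// circ_int_X rmorph0 mulr0.
Qed.

(** A finite geometric expansion with exact remainder: integration only meets finite sums, and the
    remainder is estimated after integration. *)
Lemma gk_expand a t L : cnorm a < r ->
  cauchy_ker r a t = \sum_(k < L) a ^+ k * (circ t)^-1 ^+ k + (a * (circ t)^-1) ^+ L * cauchy_ker r a t.
Proof.
move=> ar; elim: L => [|L IH]; first by rewrite big_ord0 add0r expr0 mul1r.
rewrite big_ord_recr /= {1}IH -addrA; congr (_ + _).
rewrite -exprMn exprSr -mulrA -[X in _ = X + _]mulr1 -mulrDr.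
have {1}-> : cauchy_ker r a t = 1 + a * (circ t)^-1 * cauchy_ker r a t; last by [].
rewrite /cauchy_ker; field; by rewrite circ_neq0// gamB_neq0.
Qed.

Let u k := circ_int (fun t => f (circ t) * (circ t)^-1 ^+ k).

Lemma circ_cont_u k : circ_cont (fun t => f (circ t) * (circ t)^-1 ^+ k).
Proof.
by apply: circ_cont_M; [exact: circ_cont_fgam hf r0 rR|apply: circ_cont_X; exact: circ_cont_gamV].
Qed.

End PowerSeries.

(** This is applied twice: to the constant 1, where only the term [k = 0] survives and evaluates the
    integral of [cauchy_ker], and to [f], where it gives the Taylor coefficients. *)
Lemma circ_int_expand (R : realType) (f : R[i] -> R[i]) (R0 r M : R) (a : R[i]) (L : nat) :
  (forall z, cnorm z < R0 -> exists L, cderiv f z L) -> 0 < r -> r < R0 -> cnorm a < r ->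
  (forall t, 0 <= t <= 2 * pi -> cnorm (f (circ r t)) <= M) ->
  cnorm (circ_int (fun t => f (circ r t) * cauchy_ker r a t) -
    \sum_(k < L) a ^+ k * circ_int (fun t => f (circ r t) * (circ r t)^-1 ^+ k)) <=
  2 * (2 * pi) * (M * (r / (r - cnorm a))) * (cnorm a / r) ^+ L.
Proof.
move=> hf r0 rR ar hM.
have cu k : circ_cont (fun t => a ^+ k * (f (circ r t) * (circ r t)^-1 ^+ k)).
  by apply: circ_cont_M; [exact: circ_cont_cst|exact: circ_cont_u hf r0 rR k].
have cr : circ_cont (fun t => (a * (circ r t)^-1) ^+ L * (f (circ r t) * cauchy_ker r a t)).
  apply: circ_cont_M.
    by apply: circ_cont_X; apply: circ_cont_M; [exact: circ_cont_cst|exact: circ_cont_gamV].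
  by apply: circ_cont_M; [exact: circ_cont_fgam hf r0 rR|exact: circ_cont_gk].
have -> : (fun t => f (circ r t) * cauchy_ker r a t) = (fun t =>
   \sum_(k < L) a ^+ k * (f (circ r t) * (circ r t)^-1 ^+ k) + (a * (circ r t)^-1) ^+ L * (f (circ r t) * cauchy_ker r a t)).
  apply/funext => t; rewrite {1}(gk_expand r0 t L ar) mulrDr mulr_sumr; congr (_ + _).
    by apply: eq_bigr => k _; rewrite mulrCA.
  by rewrite mulrCA.
rewrite circ_intD//; last by apply: circ_cont_sum => k; exact: cu.
rewrite circ_int_sum//.
rewrite (eq_bigr (fun k : 'I_L => a ^+ k * circ_int (fun t => f (circ r t) * (circ r t)^-1 ^+ k))); last first.
  by move=> k _; apply: circ_intZ; exact: circ_cont_u hf r0 rR k.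
rewrite addrAC subrr add0r -mulrA; apply: circ_int_bound => // t ht.
rewrite cnormM cnormX cnormM cnormV cnorm_circ// mulrC ler_wpM2r ?exprn_ge0 ?divr_ge0 ?cnorm_ge0 ?(ltW r0)//.
by rewrite cnormM ler_pM ?cnorm_ge0 ?hM// cnorm_gk.
Qed.

Section PowerSeries2.
Variables (R : realType) (f : R[i] -> R[i]) (R0 r : R).
Local Notation C := R[i].
Local Notation T := (2 * pi : R).
Hypothesis hf : forall z, cnorm z < R0 -> exists L, cderiv f z L.
Hypotheses (r0 : 0 < r) (rR : r < R0).

Lemma two_pi_gt0 : 0 < T. Proof. by rewrite mulr_gt0// pi_gt0. Qed.

Lemma two_pi_neq0 : T%:C != 0 :> C.
Proof. by rewrite -cnorm_gt0 cnorm_real gtr0_norm two_pi_gt0. Qed.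

Lemma circ_int_cauchy_ker a : cnorm a < r -> circ_int (cauchy_ker r a) = T%:C.
Proof.
move=> ar; apply/eqP; rewrite -subr_eq0 -cnorm_eq0; apply/eqP/le_anti; rewrite cnorm_ge0 andbT.
apply/ler_addgt0Pr => eps e0; rewrite add0r.
have h1 z : cnorm z < R0 -> exists L, cderiv (fun _ => 1 : C) z L.
  by move=> _; exists 0 => e ee; exists 1 => // h _; rewrite subrr mul0r subr0 cnorm0 mulr_ge0 ?cnorm_ge0// ltW.
have hM t : 0 <= t <= 2 * pi -> cnorm ((fun _ => 1 : C) (circ r t)) <= 1 by rewrite cnorm1.
have hq : 0 <= cnorm a / r < 1.
  by rewrite divr_ge0 ?cnorm_ge0 ?(ltW r0)// ltr_pdivrMr// mul1r.
have [N hN] := geom_small (2 * (2 * pi) * (1 * (r / (r - cnorm a)))) hq e0.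
have := circ_int_expand N.+1 h1 r0 rR ar hM.
rewrite big_ord_recl /= expr0 !mul1r big1 ?addr0; last first.
  move=> k _; rewrite (_ : (fun t => _) = (fun t => (circ r t)^-1 ^+ k.+1)); last first.
    by apply/funext => t; rewrite mul1r.
  by rewrite circ_int_VX// mulr0.
rewrite (_ : (fun t => 1 * cauchy_ker r a t) = cauchy_ker r a); last by apply/funext => t; rewrite mul1r.
rewrite (_ : (fun t => 1 * (circ r t)^-1 ^+ 0) = (fun=> 1)); last by apply/funext => t; rewrite mul1r.
by rewrite circ_int_cst mulr1 => h; apply: le_trans h _; have := hN N.+1 (leqnSn N); rewrite mul1r.
Qed.

Lemma taylor : exists (c : nat -> C) (K : R), (forall k, cnorm (c k) <= K * r^-1 ^+ k) /\
  forall z, cnorm z < r -> ccvg (fun L => \sum_(k < L) c k * z ^+ k) (f z).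
Proof.
have [M M0 hM] := fgam_bounded hf r0 rR.
have T0 := two_pi_gt0.
(* Cauchy's coefficient integrals; the 2 in [2 * M] is the factor of [circ_int_bound]. *)
exists (fun k => (T%:C)^-1 * circ_int (fun t => f (circ r t) * (circ r t)^-1 ^+ k)), (2 * M); split.
  move=> k; rewrite cnormM cnormV cnorm_real gtr0_norm//.
  rewrite mulrC ler_pdivrMr//.
  have := @circ_int_bound _ _ (M * r^-1 ^+ k) (circ_cont_u hf r0 rR k).
  move=> /(_ _)/le_trans; apply => [t ht|].
    by rewrite cnormM cnormX cnormV cnorm_circ// ler_wpM2r ?exprn_ge0 ?invr_ge0 ?(ltW r0)// hM.
  by rewrite le_eqVlt; apply/orP; left; apply/eqP; ring.
move=> a ar eps e0.
have hq : 0 <= cnorm a / r < 1.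
  by rewrite divr_ge0 ?cnorm_ge0 ?(ltW r0)// ltr_pdivrMr// mul1r.
have [N hN] := geom_small (2 * (M * (r / (r - cnorm a)))) hq e0.
exists N => L NL; apply: le_trans (hN L NL).
have := circ_int_expand L hf r0 rR ar hM.
rewrite (cauchy hf r0 rR ar) circ_int_cauchy_ker// => h.
rewrite cnormBC.
rewrite (_ : f a - _ = (T%:C)^-1 * (f a * T%:C - \sum_(k < L) a ^+ k * circ_int (fun t => f (circ r t) * (circ r t)^-1 ^+ k))); last first.
  rewrite mulrBr mulrCA mulVf ?two_pi_neq0// mulr1 mulr_sumr; congr (_ - _).
  by apply: eq_bigr => k _; rewrite -mulrA; congr (_ * _); rewrite mulrC.
rewrite cnormM cnormV cnorm_real gtr0_norm// mulrC ler_pdivrMr//.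
apply: le_trans h _; rewrite le_eqVlt; apply/orP; left; apply/eqP; ring.
Qed.

End PowerSeries2.

(** * Multiple power series and averages over roots of unity *)

Section Cubes.
Variables (R : realType) (N : nat).
Local Notation C := R[i].
Local Notation mi := ('I_N -> nat).
Local Notation cube L := {ffun 'I_N -> 'I_L.+1}.

(* Series over multi-indices are limits of sums over the cubes [0 .. L]^N. *)
Definition cube_mi L (g : cube L) : mi := fun j => g j : nat.

Definition monomial (Z : cpt R N) (I : mi) : C := \prod_(j < N) Z j ^+ I j.

Definition incube L (I : mi) := [forall j : 'I_N, (I j <= L)%N].

Lemma fI_incube L (g : cube L) : incube L (cube_mi g).
Proof. by apply/forallP => j; rewrite -ltnS ltn_ord. Qed.

Definition to_cube L (I : mi) : cube L := [ffun j => inord (I j)].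

Lemma toCK L I : incube L I -> cube_mi (to_cube L I) = I.
Proof.
by move=> /forallP h; apply/funext => j; rewrite /cube_mi ffunE inordK// ltnS.
Qed.

Lemma fIK L (g : cube L) : to_cube L (cube_mi g) = g.
Proof. by apply/ffunP => j; rewrite ffunE /cube_mi inord_val. Qed.

Lemma fI_inj L : injective (@cube_mi L).
Proof. by move=> g h e; rewrite -(fIK g) e fIK. Qed.

Lemma sum_cube_widen (V : nmodType) L L' (F : mi -> V) : (L <= L')%N ->
  \sum_(g : cube L' | incube L (cube_mi g)) F (cube_mi g) = \sum_(g : cube L) F (cube_mi g).
Proof.
move=> LL'; rewrite (reindex (fun g : cube L => to_cube L' (cube_mi g))); last first.
  exists (fun g => to_cube L (cube_mi g)) => g hg; apply: fI_inj; rewrite !toCK//.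
  - apply/forallP => j; apply: leq_trans LL'; exact: (forallP (fI_incube g) j).
  - exact: fI_incube.
  - apply/forallP => j; apply: leq_trans LL'; exact: (forallP (fI_incube g) j).
  - by apply/forallP => j; apply: leq_trans LL'; move: hg; rewrite inE => /forallP.
have h (g : cube L) : incube L' (cube_mi g).
  by apply/forallP => j; apply: leq_trans LL'; exact: (forallP (fI_incube g) j).
apply: eq_big => [g|g _]; rewrite toCK//.
by rewrite fI_incube.
Qed.

Lemma sum_cube_split (V : zmodType) L L' (F : mi -> V) : (L <= L')%N ->
  \sum_(g : cube L') F (cube_mi g) - \sum_(g : cube L) F (cube_mi g) =
  \sum_(g : cube L' | ~~ incube L (cube_mi g)) F (cube_mi g).
Proof.
move=> LL'; rewrite (bigID (fun g : cube L' => incube L (cube_mi g)))/= sum_cube_widen//.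
by rewrite addrAC subrr add0r.
Qed.

Lemma sum_cube_le L L' (t : mi -> R) : (forall I, 0 <= t I) -> (L <= L')%N ->
  \sum_(g : cube L) t (cube_mi g) <= \sum_(g : cube L') t (cube_mi g).
Proof.
by move=> t0 LL'; rewrite -subr_ge0 (sum_cube_split _ LL') sumr_ge0.
Qed.

Lemma bounded_cube_cauchy (t : mi -> R) (B : R) : (forall I, 0 <= t I) ->
  (forall L, \sum_(g : cube L) t (cube_mi g) <= B) -> forall eps : R, 0 < eps ->
  exists M, forall L L', (M <= L)%N -> (L <= L')%N ->
    \sum_(g : cube L') t (cube_mi g) - \sum_(g : cube L) t (cube_mi g) <= eps.
Proof.
move=> t0 hB eps e0.
pose T L := \sum_(g : cube L) t (cube_mi g).
have hs : has_sup (range T).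
  by split; [exists (T 0%N), 0%N|exists B => _ [L _ <-]; exact: hB].
have [_ [M _ <-] hM] := sup_adherent e0 hs; exists M => L L' ML LL'.
have h1 : T L' <= sup (range T) by apply: sup_upper_bound => //; exists L'.
have h2 : T M <= T L by exact: sum_cube_le.
rewrite -/(T L') -/(T L); lra.
Qed.

Lemma abs_cube_diff (t : mi -> C) L L' : (L <= L')%N ->
  cnorm (\sum_(g : cube L') t (cube_mi g) - \sum_(g : cube L) t (cube_mi g)) <=
  \sum_(g : cube L') cnorm (t (cube_mi g)) - \sum_(g : cube L) cnorm (t (cube_mi g)).
Proof.
move=> LL'; rewrite (sum_cube_split t LL') (sum_cube_split (fun I => cnorm (t I)) LL').
exact: cnorm_sum.
Qed.

Lemma real_cauchy_cvg (x : nat -> R) : (forall eps : R, 0 < eps -> exists M, forall n n',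
   (M <= n)%N -> (n <= n')%N -> `|x n' - x n| <= eps) ->
  exists l, forall eps : R, 0 < eps -> exists M, forall n, (M <= n)%N -> `|x n - l| <= eps.
Proof.
(* The supremum of the eventual lower bounds is the lower limit of the sequence. *)
move=> H; pose S := [set y | exists M, forall n, (M <= n)%N -> y <= x n].
have B eps M : (forall n n', (M <= n)%N -> (n <= n')%N -> `|x n' - x n| <= eps) ->
    S (x M - eps) /\ ubound S (x M + eps).
  move=> h; split; first by exists M => n Mn; have := h _ _ (leqnn M) Mn; rewrite ler_norml => /andP[h1 _]; lra.
  move=> y [M' h']; have h1 := h' _ (leq_maxr M M'); have := h _ _ (leqnn M) (leq_maxl M M').
  rewrite ler_norml => /andP[_ h2]; lra.
have [M1 hM1] := H 1 ltr01.
have [s1 u1] := B _ _ hM1.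
have hs : has_sup S by split; [exists (x M1 - 1)|exists (x M1 + 1)].
exists (sup S) => eps e0; have e2 : 0 < eps / 2 by rewrite divr_gt0.
have [M hM] := H _ e2; exists M => n Mn; have [s2 u2] := B _ _ hM.
have h1 := sup_upper_bound hs s2; have h2 := ge_sup (proj1 hs) u2.
have := hM _ _ (leqnn M) Mn; rewrite !ler_norml => /andP[h3 h4]; apply/andP; split; lra.
Qed.

Lemma ccvg_cauchy (u : nat -> C) : (forall eps : R, 0 < eps -> exists M, forall n n',
   (M <= n)%N -> (n <= n')%N -> cnorm (u n' - u n) <= eps) -> exists l, ccvg u l.
Proof.
move=> H.
have [a ha] : exists l, forall eps : R, 0 < eps -> exists M, forall n, (M <= n)%N -> `|complex.Re (u n) - l| <= eps.
  apply: real_cauchy_cvg => eps e0; have [M hM] := H _ e0; exists M => n n' h h'.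
  by rewrite -ReN -ReD; apply: le_trans (Re_le_cnorm _) (hM _ _ h h').
have [b hb] : exists l, forall eps : R, 0 < eps -> exists M, forall n, (M <= n)%N -> `|complex.Im (u n) - l| <= eps.
  apply: real_cauchy_cvg => eps e0; have [M hM] := H _ e0; exists M => n n' h h'.
  by rewrite -ImN -ImD; apply: le_trans (Im_le_cnorm _) (hM _ _ h h').
exists (a +i* b) => eps e0; have e2 : 0 < eps / 2 by rewrite divr_gt0.
have [M hM] := ha _ e2; have [M' hM'] := hb _ e2; exists (maxn M M') => n; rewrite geq_max => /andP[n1 n2].
apply: le_trans (cnorm_le_ReIm _) _; rewrite ReD ImD ReN ImN /= [eps]splitr lerD ?hM ?hM'//.
Qed.

Lemma ccvg_unique (u : nat -> C) l l' : ccvg u l -> ccvg u l' -> l = l'.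
Proof.
move=> h h'; apply/eqP; rewrite -subr_eq0 -cnorm_eq0; apply/eqP/le_anti; rewrite cnorm_ge0 andbT.
apply/ler_addgt0Pr => eps e0; rewrite add0r; have e2 : 0 < eps / 2 by rewrite divr_gt0.
have [M hM] := h _ e2; have [M' hM'] := h' _ e2.
have h1 := hM (maxn M M') (leq_maxl _ _); have h2 := hM' (maxn M M') (leq_maxr _ _).
rewrite (_ : l - l' = (u (maxn M M') - l') - (u (maxn M M') - l)); last by ring.
by apply: le_trans (cnormB _ _) _; rewrite [eps]splitr lerD.
Qed.

Lemma ccvgD (u v : nat -> C) l l' : ccvg u l -> ccvg v l' -> ccvg (fun n => u n + v n) (l + l').
Proof.
move=> h h' eps e0; have e2 : 0 < eps / 2 by rewrite divr_gt0.
have [M hM] := h _ e2; have [M' hM'] := h' _ e2; exists (maxn M M') => n; rewrite geq_max => /andP[n1 n2].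
rewrite (_ : _ - _ = (u n - l) + (v n - l')); last by ring.
by apply: le_trans (cnormD _ _) _; rewrite [eps]splitr lerD ?hM ?hM'.
Qed.

Lemma ccvgZ (u : nat -> C) l c : ccvg u l -> ccvg (fun n => c * u n) (c * l).
Proof.
move=> h eps e0.
have c1 : 0 < cnorm c + 1 by rewrite ltr_wpDl ?cnorm_ge0.
have [M hM] := h (eps / (cnorm c + 1)) ltac:(by rewrite divr_gt0); exists M => n Mn.
rewrite -mulrBr cnormM; apply: (@le_trans _ _ ((cnorm c + 1) * (eps / (cnorm c + 1)))).
  by rewrite ler_pM ?cnorm_ge0// ?lerDl// hM.
by rewrite mulrC divfK// gt_eqF.
Qed.

Lemma ccvg_sum (I : Type) (r : seq I) (u : I -> nat -> C) (l : I -> C) :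
  (forall i, ccvg (u i) (l i)) -> ccvg (fun n => \sum_(i <- r) u i n) (\sum_(i <- r) l i).
Proof.
move=> h; elim: r => [|i r IH].
  by rewrite big_nil => eps e0; exists 0%N => n _; rewrite big_nil subrr cnorm0 ltW.
rewrite big_cons (_ : (fun n => _) = (fun n => u i n + \sum_(j <- r) u j n)).
  exact: ccvgD.
by apply/funext => n; rewrite big_cons.
Qed.

Lemma ccvg_le (u : nat -> C) l c (B : R) : ccvg u l ->
  (exists M, forall n, (M <= n)%N -> cnorm (u n - c) <= B) -> cnorm (l - c) <= B.
Proof.
move=> h [M hM]; apply/ler_addgt0Pr => eps e0; have [M' hM'] := h _ e0.
have h1 := hM (maxn M M') (leq_maxl _ _); have h2 := hM' (maxn M M') (leq_maxr _ _).
rewrite (_ : l - c = (u (maxn M M') - c) - (u (maxn M M') - l)); last by ring.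
by apply: le_trans (cnormB _ _) _; rewrite lerD.
Qed.

Definition cube_psum (a : mi -> C) L (Z : cpt R N) : C := \sum_(g : cube L) a (cube_mi g) * monomial Z (cube_mi g).

(** The bound on the absolute sums depends only on the moduli of the coordinates, which makes
    convergence uniform on the torus orbit of the point. *)
Definition power_series_at (f : cpt R N -> C) (a : mi -> C) (Z : cpt R N) : Prop :=
  (exists B, forall L, \sum_(g : cube L) cnorm (a (cube_mi g) * monomial Z (cube_mi g)) <= B) /\
  ccvg (fun L => cube_psum a L Z) (f Z).

Lemma cnorm_monomial Z I : cnorm (monomial Z I) = \prod_(j < N) cnorm (Z j) ^+ I j.
Proof.
rewrite /monomial; elim/big_ind2 : _ => [|x1 x2 y1 y2 <- <-|j _]; first exact: cnorm1.
  exact: cnormM.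
exact: cnormX.
Qed.

Lemma monomialM Z W I : monomial (fun j => Z j * W j) I = monomial Z I * monomial W I.
Proof. by rewrite /monomial -big_split; apply: eq_bigr => j _; rewrite exprMn. Qed.

End Cubes.

(** * Averages over roots of unity *)

Section Roots.
Variables (R : realType) (N : nat).
Local Notation C := R[i].
Local Notation mi := ('I_N -> nat).
Local Notation cube L := {ffun 'I_N -> 'I_L.+1}.

Lemma eiD (x y : R) : ei (x + y) = ei x * ei y.
Proof. by apply: complexP; rewrite /= ?cosD ?sinD//; ring. Qed.

Lemma ei0 : ei (0 : R) = 1.
Proof. by rewrite /ei cos0 sin0. Qed.

Lemma eiX (x : R) k : ei x ^+ k = ei (k%:R * x).
Proof.
elim: k => [|k IH]; first by rewrite mul0r ei0.
by rewrite exprS IH -eiD -natr1; congr ei; ring.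
Qed.

Lemma eiN (x : R) : (ei x)^*%C = ei (- x).
Proof. by rewrite /ei cosN sinN. Qed.

Lemma ei_2pi : ei (2 * pi : R) = 1.
Proof. by rewrite /ei mulr_natl cos2pi sin2pi. Qed.

Lemma ei_neq1 (x : R) : 0 < x < 2 * pi -> ei x != 1.
Proof.
move=> /andP[x0 x2]; apply/eqP => -[h _]; move: h.
rewrite (splitr x) cosD => h.
have s0 : 0 < sin (x / 2) by apply: sin_gt0_pi; rewrite ?divr_gt0//; lra.
have := cos2Dsin2 (x / 2); move: h; nra.
Qed.

Definition unity_root M : C := ei (2 * pi / M.+1%:R).

Lemma unity_root_conj M k l : unity_root M ^+ k * (unity_root M ^+ l)^*%C = ei ((k%:R - l%:R) * (2 * pi / M.+1%:R)).
Proof. by rewrite /unity_root !eiX eiN -eiD; congr ei; ring. Qed.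

(** The ratio [x] satisfies [x^(M + 1) = 1], so its geometric sum vanishes unless [x = 1]; exponents
    up to [M] exclude [x = 1] for [k != l]. *)
Lemma unity_root_sum M k l : (k <= M)%N -> (l <= M)%N ->
  \sum_(i < M.+1) (unity_root M ^+ i) ^+ k * ((unity_root M ^+ i) ^+ l)^*%C = (if k == l then M.+1%:R else 0).
Proof.
move=> kM lM.
have E (i : 'I_M.+1) : (unity_root M ^+ i) ^+ k * ((unity_root M ^+ i) ^+ l)^*%C = (unity_root M ^+ k * (unity_root M ^+ l)^*%C) ^+ i.
  by rewrite exprMn -rmorphXn /= -!exprM mulnC [(l * i)%N]mulnC.
rewrite (eq_bigr _ (fun i _ => E i)).
case: eqP => [->|/eqP kl].
  rewrite unity_root_conj subrr mul0r ei0; under eq_bigr do rewrite expr1n.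
  by rewrite sumr_const card_ord.
set x := unity_root M ^+ k * _.
have x1 : x != 1.
  rewrite /x unity_root_conj; have p0 := pi_gt0 R.
  have M0 : 0 < M.+1%:R :> R by rewrite ltr0n.
  have [klt|lkt|/eqP h] := ltngtP k l; last by rewrite h in kl.
    (* For [k < l] a full turn is added so that the angle falls in []0, 2 pi[]. *)
    rewrite -[ei _]mulr1 -[X in _ * X]ei_2pi -eiD; apply: ei_neq1.
    rewrite (_ : _ + _ = (k%:R + M.+1%:R - l%:R) / M.+1%:R * (2 * pi)); last by field; rewrite gt_eqF.
    have h1 : k%:R < l%:R :> R by rewrite ltr_nat.
    have h2 : l%:R < M.+1%:R :> R by rewrite ltr_nat ltnS.
    have h3 : 0 <= k%:R :> R by rewrite ler0n.
    rewrite pmulr_lgt0; last by lra.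
    rewrite divr_gt0//=; last by lra.
    by rewrite -[ltRHS]mul1r ltr_pM2r ?mulr_gt0// ltr_pdivrMr//; lra.
  apply: ei_neq1.
  rewrite (_ : _ * _ = (k%:R - l%:R) / M.+1%:R * (2 * pi)); last by field; rewrite gt_eqF.
  have h1 : l%:R < k%:R :> R by rewrite ltr_nat.
  have h2 : k%:R < M.+1%:R :> R by rewrite ltr_nat ltnS.
  have h3 : 0 <= l%:R :> R by rewrite ler0n.
  rewrite pmulr_lgt0; last by lra.
  rewrite divr_gt0//=; last by lra.
  by rewrite -[ltRHS]mul1r ltr_pM2r ?mulr_gt0// ltr_pdivrMr//; lra.
have xM : x ^+ M.+1 = 1.
  rewrite /x unity_root_conj eiX (_ : _ * _ = k%:R * (2 * pi) - l%:R * (2 * pi)); last first.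
    by field; rewrite // addrC natr1 pnatr_eq0.
  by rewrite eiD -eiN -!(eiX (2 * pi)) ei_2pi !expr1n rmorph1 mulr1.
have x10 : x - 1 != 0 by rewrite subr_eq0.
by apply: (mulfI x10); rewrite mulr0 -subrX1 xM subrr.
Qed.

Definition unity_pt M (w : cube M) : cpt R N := fun j => unity_root M ^+ w j.

Lemma cnorm_unity_pt M (w : cube M) j : cnorm (unity_pt w j) = 1.
Proof. by rewrite cnormX cnorm_ei expr1n. Qed.

Lemma cnorm_monomial_unity_pt M (w : cube M) I : cnorm (monomial (unity_pt w) I) = 1.
Proof. by rewrite cnorm_monomial big1// => j _; rewrite cnorm_unity_pt expr1n. Qed.

Lemma unity_pt_orth M (a b : mi) : incube M a -> incube M b ->
  \sum_(w : cube M) monomial (unity_pt w) a * (monomial (unity_pt w) b)^*%C =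
  (if [forall j, a j == b j] then (M.+1%:R ^+ N) else 0).
Proof.
move=> /forallP ha /forallP hb.
transitivity (\sum_(w : cube M) \prod_(j < N) ((unity_root M ^+ w j) ^+ a j * ((unity_root M ^+ w j) ^+ b j)^*%C)).
  apply: eq_bigr => w _; rewrite /monomial rmorph_prod -big_split; apply: eq_bigr => j _.
  by rewrite /unity_pt.
rewrite -(bigA_distr_bigA (fun (j : 'I_N) (i : 'I_M.+1) => (unity_root M ^+ i) ^+ a j * ((unity_root M ^+ i) ^+ b j)^*%C)).
under eq_bigr => j _ do rewrite unity_root_sum//.
case: ifPn => [/forallP h|].
  by rewrite (eq_bigr (fun=> M.+1%:R)) ?prodr_const ?card_ord// => j _; rewrite h.
rewrite negb_forall => /existsP[j hj]; apply/eqP; rewrite prodf_seq_eq0; apply/hasP; exists j => //=.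
  by rewrite mem_index_enum.
by rewrite (negbTE hj).
Qed.

Lemma cabs2_conj (z : C) : (cabs2 z)%:C = z * z^*%C.
Proof. by apply: complexP; case: z => x y; rewrite /cabs2 /=; ring. Qed.

(** The mean over [(M + 1)^N] points of the torus, in place of the Haar integral. *)
Definition cube_avg M (F : cube M -> C) : C := (M.+1%:R ^+ N)^-1 * \sum_(w : cube M) F w.

Lemma cube_avg_coef M L (b : mi -> C) (h : cube L) : (L <= M)%N ->
  cube_avg (fun w : cube M => (\sum_(g : cube L) b (cube_mi g) * monomial (unity_pt w) (cube_mi g)) * (monomial (unity_pt w) (cube_mi h))^*%C) = b (cube_mi h).
Proof.
move=> LM; rewrite /cube_avg.
have inM (g : cube L) : incube M (cube_mi g).
  by apply/forallP => j; apply: leq_trans LM; exact: (forallP (fI_incube g) j).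
under eq_bigr => w _ do rewrite mulr_suml.
rewrite exchange_big /=.
under eq_bigr => g _.
  under eq_bigr => w _ do rewrite -mulrA.
  rewrite -mulr_sumr unity_pt_orth//. over.
rewrite (bigD1 h)//= big1 ?addr0; last first.
  move=> g gh; case: ifPn => [/forallP e|_]; last by rewrite mulr0.
  by case/eqP: gh; apply: fI_inj; apply/funext => j; apply/eqP.
rewrite ifT; last by apply/forallP.
by rewrite mulrCA mulVf ?mulr1// expf_neq0// pnatr_eq0.
Qed.

Lemma cube_avg_parseval M L (b : mi -> C) : (L <= M)%N ->
  cube_avg (fun w : cube M => (cabs2 (\sum_(g : cube L) b (cube_mi g) * monomial (unity_pt w) (cube_mi g)))%:C) =
  (\sum_(g : cube L) cabs2 (b (cube_mi g)))%:C.
Proof.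
move=> LM; rewrite rmorph_sum /=.
pose S (w : cube M) := \sum_(g : cube L) b (cube_mi g) * monomial (unity_pt w) (cube_mi g).
transitivity (\sum_(h : cube L) cube_avg (fun w : cube M => S w * (monomial (unity_pt w) (cube_mi h))^*%C) * (b (cube_mi h))^*%C); last first.
  by apply: eq_bigr => h _; rewrite /S (cube_avg_coef b h LM) cabs2_conj.
rewrite /cube_avg.
transitivity (\sum_(h : cube L) (M.+1%:R ^+ N)^-1 * \sum_(w : cube M) S w * (monomial (unity_pt w) (cube_mi h))^*%C * (b (cube_mi h))^*%C); last first.
  by apply: eq_bigr => h _; rewrite -mulrA mulr_suml.
rewrite -mulr_sumr exchange_big /=; congr (_ * _); apply: eq_bigr => w _.
rewrite -/(S w) cabs2_conj {2}/S rmorph_sum mulr_sumr; apply: eq_bigr => h _; rewrite rmorphM /=; ring.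
Qed.

(** The mean of [|v - S|^2] is nonnegative, [S] being the orthogonal projection of [v] on the
    monomials of the cube. Both cross terms and the mean of [|S|^2] equal the sum of the [|b|^2], by
    orthogonality. *)
Lemma cube_avg_bessel M L (v : cube M -> C) : (L <= M)%N ->
  \sum_(g : cube L) cabs2 (cube_avg (fun w : cube M => v w * (monomial (unity_pt w) (cube_mi g))^*%C)) <=
  (M.+1%:R ^+ N)^-1 * \sum_(w : cube M) cabs2 (v w).
Proof.
move=> LM.
pose b (I : mi) := cube_avg (fun w : cube M => v w * (monomial (unity_pt w) I)^*%C).
pose S (w : cube M) := \sum_(g : cube L) b (cube_mi g) * monomial (unity_pt w) (cube_mi g).
have c0 : 0 <= (M.+1%:R ^+ N)^-1 :> R by rewrite invr_ge0 exprn_ge0.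
have E0 : 0 <= (M.+1%:R ^+ N)^-1 * \sum_(w : cube M) cabs2 (v w - S w).
  by rewrite mulr_ge0// sumr_ge0// => w _; exact: cabs2_ge0.
have E1 : ((M.+1%:R ^+ N)^-1 * \sum_(w : cube M) cabs2 (v w - S w))%:C =
   ((M.+1%:R ^+ N)^-1 * \sum_(w : cube M) cabs2 (v w) - \sum_(g : cube L) cabs2 (b (cube_mi g)))%:C :> C.
  have cC : ((M.+1%:R ^+ N)^-1)%:C = (M.+1%:R ^+ N)^-1 :> C.
    by rewrite fmorphV rmorphXn /= rmorph_nat.
  have P1 : (M.+1%:R ^+ N)^-1 * \sum_(w : cube M) (S w * (S w)^*%C) = (\sum_(g : cube L) cabs2 (b (cube_mi g)))%:C.
    by rewrite -(cube_avg_parseval b LM) /cube_avg; congr (_ * _); apply: eq_bigr => w _; rewrite cabs2_conj.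
  have P2 : (M.+1%:R ^+ N)^-1 * \sum_(w : cube M) (v w * (S w)^*%C) = (\sum_(g : cube L) cabs2 (b (cube_mi g)))%:C.
    rewrite rmorph_sum /=; under [RHS]eq_bigr => g _ do rewrite cabs2_conj {1}/b /cube_avg -mulrA mulr_suml.
    rewrite -mulr_sumr; congr (_ * _); rewrite exchange_big; apply: eq_bigr => w _ /=.
    rewrite /S rmorph_sum mulr_sumr; apply: eq_bigr => g _; rewrite rmorphM /=; ring.
  have P3 : (M.+1%:R ^+ N)^-1 * \sum_(w : cube M) (S w * (v w)^*%C) = (\sum_(g : cube L) cabs2 (b (cube_mi g)))%:C.
    rewrite -[RHS]conjc_real -P2 rmorphM /= fmorphV rmorphXn /= rmorph_nat; congr (_ * _).
    by rewrite rmorph_sum /=; apply: eq_bigr => w _; rewrite rmorphM /= conjcK mulrC.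
  rewrite rmorphM rmorphB rmorphM /= cC !rmorph_sum /=.
  rewrite -[X in _ = _ - X](rmorph_sum _ _ _ (fun g : cube L => cabs2 (b (cube_mi g)))) /=.
  rewrite (eq_bigr (fun w => v w * (v w)^*%C - v w * (S w)^*%C - S w * (v w)^*%C + S w * (S w)^*%C)); last first.
    by move=> w _; rewrite cabs2_conj rmorphB /=; ring.
  rewrite big_split /= sumrB sumrB !mulrDr !mulrN P1 P2 P3.
  rewrite (eq_bigr (fun w => (cabs2 (v w))%:C)); last by move=> w _; rewrite cabs2_conj.
  ring.
by move/complexI: E1 => E1; move: E0; rewrite E1 subr_ge0.
Qed.

End Roots.

(** * Parseval formula for a torus-invariant weight *)

Section BorelFunctions.
Variables (R : realType) (N : nat).
Local Notation C := R[i].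

Definition borelR (f : cpt R N -> R) : Prop :=
  forall d (T : measurableType d) (g : T -> cpt R N),
    measurable_cpt g -> measurable_fun [set: T] (fun x => f (g x)).

Definition borelC (F : cpt R N -> C) : Prop :=
  borelR (fun Z => complex.Re (F Z)) /\ borelR (fun Z => complex.Im (F Z)).

Lemma borelR_EFin f : borelR f -> borelE (fun Z => (f Z)%:E).
Proof. by move=> nf d T g mg; apply/measurable_EFinP; exact: nf. Qed.

Lemma borelR_cst c : borelR (fun=> c).
Proof. by move=> d T g mg; exact: measurable_cst. Qed.

Lemma borelR_D f g : borelR f -> borelR g -> borelR (fun Z => f Z + g Z).
Proof. by move=> nf ng d T h mh; apply: measurable_funD; [exact: nf|exact: ng]. Qed.

Lemma borelR_N f : borelR f -> borelR (fun Z => - f Z).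
Proof. by move=> nf d T h mh; apply: measurableT_comp => //; exact: nf. Qed.

Lemma borelR_M f g : borelR f -> borelR g -> borelR (fun Z => f Z * g Z).
Proof. by move=> nf ng d T h mh; apply: measurable_funM; [exact: nf|exact: ng]. Qed.

Lemma borelR_eq f g : f =1 g -> borelR f -> borelR g.
Proof. by move=> /funext ->. Qed.

Lemma borelC_cst c : borelC (fun=> c).
Proof. by split; exact: borelR_cst. Qed.

Lemma borelC_eq f g : f =1 g -> borelC f -> borelC g.
Proof. by move=> /funext ->. Qed.

Lemma borelC_D f g : borelC f -> borelC g -> borelC (fun Z => f Z + g Z).
Proof.
move=> [f1 f2] [g1 g2]; split.
  by apply: (borelR_eq (f := fun Z => complex.Re (f Z) + complex.Re (g Z))); [move=> Z; rewrite ReD|exact: borelR_D].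
by apply: (borelR_eq (f := fun Z => complex.Im (f Z) + complex.Im (g Z))); [move=> Z; rewrite ImD|exact: borelR_D].
Qed.

Lemma borelC_M f g : borelC f -> borelC g -> borelC (fun Z => f Z * g Z).
Proof.
move=> [f1 f2] [g1 g2]; split.
  apply: (borelR_eq (f := fun Z => complex.Re (f Z) * complex.Re (g Z) + - (complex.Im (f Z) * complex.Im (g Z)))).
    by move=> Z; rewrite ReM.
  by apply: borelR_D; [|apply: borelR_N]; exact: borelR_M.
apply: (borelR_eq (f := fun Z => complex.Re (f Z) * complex.Im (g Z) + complex.Im (f Z) * complex.Re (g Z))).
  by move=> Z; rewrite ImM.
by apply: borelR_D; exact: borelR_M.
Qed.

Lemma borelC_sum (I : Type) (r : seq I) (F : I -> cpt R N -> C) : (forall i, borelC (F i)) ->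
  borelC (fun Z => \sum_(i <- r) F i Z).
Proof.
move=> nF; elim: r => [|i r IH].
  by apply: (borelC_eq (f := fun=> 0)); [move=> Z; rewrite big_nil|exact: borelC_cst].
apply: (borelC_eq (f := fun Z => F i Z + \sum_(j <- r) F j Z)); first by move=> Z; rewrite big_cons.
exact: borelC_D.
Qed.

Lemma borelC_prod (I : Type) (r : seq I) (F : I -> cpt R N -> C) : (forall i, borelC (F i)) ->
  borelC (fun Z => \prod_(i <- r) F i Z).
Proof.
move=> nF; elim: r => [|i r IH].
  by apply: (borelC_eq (f := fun=> 1)); [move=> Z; rewrite big_nil|exact: borelC_cst].
apply: (borelC_eq (f := fun Z => F i Z * \prod_(j <- r) F j Z)); first by move=> Z; rewrite big_cons.
exact: borelC_M.
Qed.

Lemma borelC_X f k : borelC f -> borelC (fun Z => f Z ^+ k).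
Proof.
move=> nf; elim: k => [|k IH]; first exact: borelC_cst.
by apply: (borelC_eq (f := fun Z => f Z * f Z ^+ k)); [move=> Z; rewrite exprS|exact: borelC_M].
Qed.

Lemma borelC_coord j : borelC (fun Z => Z j).
Proof. by split => d T g mg; have [h1 h2] := mg j. Qed.

Lemma borelR_cabs2 f : borelC f -> borelR (fun Z => cabs2 (f Z)).
Proof.
move=> [f1 f2]; apply: (borelR_eq (f := fun Z => complex.Re (f Z) * complex.Re (f Z) + complex.Im (f Z) * complex.Im (f Z))).
  by move=> Z; rewrite /cabs2 !expr2.
by apply: borelR_D; exact: borelR_M.
Qed.

Lemma borelC_mon I : borelC (fun Z => monomial Z I).
Proof. by apply: borelC_prod => j; apply: borelC_X; exact: borelC_coord. Qed.

Lemma borelC_psum a L : borelC (fun Z => cube_psum a L Z).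
Proof.
apply: borelC_sum => g; apply: borelC_M; [exact: borelC_cst|exact: borelC_mon].
Qed.

Lemma borelE_rotv H (w : cpt R N) : borelE H -> borelE (fun Z => H (rotv w Z)).
Proof.
move=> nH d T g mg; apply: (nH _ _ (fun x => rotv w (g x))) => j.
have [h1 h2] := @borelC_M (fun=> w j) (fun Z => Z j) (borelC_cst _) (borelC_coord j).
by split; [exact: h1|exact: h2].
Qed.

End BorelFunctions.

Arguments unity_pt {R N M} w _.
Arguments cnorm_unity_pt {R N M} w j.
Arguments cnorm_monomial_unity_pt {R N M} w I.

Lemma cnorm_conj (R : realType) (z : R[i]) : cnorm z^*%C = cnorm z.
Proof. by rewrite /cnorm; congr Num.sqrt; case: z => x y; rewrite /cabs2 /= sqrrN. Qed.

Section Limits.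
Variable R : realType.
Local Notation C := R[i].

Lemma ccvg_Re (u : nat -> C) l : ccvg u l -> (fun n => complex.Re (u n)) @ \oo --> complex.Re l.
Proof.
move=> h; apply/cvgrPdist_le => eps e0; have [M hM] := h _ e0; exists M => // n /= Mn.
by rewrite distrC -ReN -ReD; apply: le_trans (Re_le_cnorm _) (hM _ Mn).
Qed.

Lemma ccvg_Im (u : nat -> C) l : ccvg u l -> (fun n => complex.Im (u n)) @ \oo --> complex.Im l.
Proof.
move=> h; apply/cvgrPdist_le => eps e0; have [M hM] := h _ e0; exists M => // n /= Mn.
by rewrite distrC -ImN -ImD; apply: le_trans (Im_le_cnorm _) (hM _ Mn).
Qed.

Lemma ccvg_cabs2 (u : nat -> C) l : ccvg u l -> (fun n => cabs2 (u n)) @ \oo --> cabs2 l.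
Proof.
move=> h; rewrite /cabs2.
have h1 := ccvg_Re h; have h2 := ccvg_Im h.
by apply: cvgD; under eq_fun do rewrite expr2; rewrite expr2; apply: cvgM.
Qed.

Lemma ccvg_cabs2E (u : nat -> C) l c : ccvg u l -> (fun n => (cabs2 (u n) * c)%:E) @ \oo --> (cabs2 l * c)%:E.
Proof.
move=> h; apply: cvg_EFin; first by apply: nearW => n.
by apply: cvgM; [exact: ccvg_cabs2|exact: cvg_cst].
Qed.

End Limits.

Section Parseval.
Variables (R : realType) (N : nat).
Local Notation C := R[i].
Local Notation mi := ('I_N -> nat).
Local Notation cube L := {ffun 'I_N -> 'I_L.+1}.
Local Open Scope ereal_scope.

(** By rotation invariance each of the [(M + 1)^N] summands integrates to [intC H]. *)
Lemma intC_avg M (H : cpt R N -> \bar R) : borelE H -> (forall Z, 0 <= H Z) ->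
  intC (fun Z => ((M.+1%:R ^+ N)^-1)%:E * \sum_(w : cube M) H (rotv (unity_pt w) Z)) = intC H.
Proof.
move=> nH H0.
have c0 : (0 <= ((M.+1%:R : R) ^+ N)^-1)%R by rewrite invr_ge0 exprn_ge0.
have w1 (w : cube M) j : cabs2 (unity_pt w j : C) = 1%R.
  by rewrite -cnorm_sqr cnorm_unity_pt expr1n.
have nw (w : cube M) : borelE (fun Z => H (rotv (unity_pt w) Z)) by exact: borelE_rotv.
rewrite /intC iintZ; last 3 first.
- by apply: borelE_sum.
- by move=> Z; apply: sume_ge0.
- by rewrite lee_fin.
rewrite iint_sum//.
rewrite (eq_bigr (fun=> intC H)); last by move=> w _; exact: intC_rot.
rewrite (eq_bigr (fun=> 1%:E * intC H)); last by move=> w _; rewrite mul1e.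
rewrite -ge0_sume_distrl// sumEFin sumr_const /= card_ffun !card_ord muleA -EFinM.
by rewrite natrX mulVf ?mul1e// expf_neq0// pnatr_eq0.
Qed.

Variables (D : set (cpt R N)) (wt : cpt R N -> R).
Hypothesis wt_ge0 : forall Z, (0 <= wt Z)%R.
Hypothesis wt_nice : borelR wt.
Hypothesis wt_rot : forall w Z, (forall j, cabs2 (w j) = 1%R) -> wt (rotv w Z) = wt Z.
Hypothesis wt_out : forall Z, ~ D Z -> wt Z = 0%R.
Hypothesis D_rot : forall w Z, (forall j, cabs2 (w j) = 1%R) -> D Z -> D (rotv w Z).

Definition sqnormW (f : cpt R N -> C) : \bar R := intC (fun Z => (cabs2 (f Z) * wt Z)%:E).
Definition mon_sqnorm (I : mi) : \bar R := sqnormW (fun Z => monomial Z I).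
Definition power_series_on (f : cpt R N -> C) (a : mi -> C) := forall Z, D Z -> power_series_at f a Z.

Lemma unity_pt_cabs2 M (w : cube M) j : cabs2 (unity_pt w j : C) = 1%R.
Proof. by rewrite -cnorm_sqr cnorm_unity_pt expr1n. Qed.

Lemma sqnormW_ge0 f : 0 <= sqnormW f.
Proof. by apply: iint_ge0 => Z; rewrite lee_fin mulr_ge0// cabs2_ge0. Qed.

Lemma wt_niceE f : borelC f -> borelE (fun Z => (cabs2 (f Z) * wt Z)%:E).
Proof. by move=> nf; apply: borelR_EFin; apply: borelR_M => //; exact: borelR_cabs2. Qed.

Lemma intC_sum_coef (b : mi -> C) L :
  intC (fun Z => (\sum_(g : cube L) cabs2 (b (cube_mi g) * monomial Z (cube_mi g)) * wt Z)%:E) =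
  \sum_(g : cube L) (cabs2 (b (cube_mi g)))%:E * mon_sqnorm (cube_mi g).
Proof.
rewrite (_ : (fun Z => _) = (fun Z => \sum_(g : cube L) (cabs2 (b (cube_mi g)))%:E * (cabs2 (monomial Z (cube_mi g)) * wt Z)%:E)); last first.
  apply/funext => Z; rewrite -sumEFin; apply: eq_bigr => g _.
  by rewrite cabs2M -EFinM mulrA.
have nm (g : cube L) : borelE (fun Z => (cabs2 (monomial Z (cube_mi g)) * wt Z)%:E).
  by apply: wt_niceE; exact: borelC_mon.
have m0 (g : cube L) Z : 0 <= (cabs2 (monomial Z (cube_mi g)) * wt Z)%:E.
  by rewrite lee_fin mulr_ge0// cabs2_ge0.
have b0 (g : cube L) : 0 <= (cabs2 (b (cube_mi g)))%:E by rewrite lee_fin cabs2_ge0.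
rewrite /intC iint_sum; last 2 first.
- by move=> g; apply: borelEM => //; exact: borelE_cst.
- by move=> g Z; exact: mule_ge0.
by apply: eq_bigr => g _; rewrite iintZ.
Qed.

Lemma cube_psum_rot (a : mi -> C) L w Z :
  cube_psum a L (rotv w Z) = (\sum_(g : cube L) (a (cube_mi g) * monomial Z (cube_mi g)) * monomial w (cube_mi g))%R.
Proof. by apply: eq_bigr => g _; rewrite /rotv monomialM mulrCA mulrC. Qed.

(** The integrand is averaged over the torus points, which leaves the integral unchanged; the finite
    Parseval formula then removes the cross terms pointwise, before integration. *)
Lemma sqnormW_psum (a : mi -> C) L :
  sqnormW (cube_psum a L) = \sum_(g : cube L) (cabs2 (a (cube_mi g)))%:E * mon_sqnorm (cube_mi g).
Proof.
rewrite -intC_sum_coef /sqnormW -(intC_avg L); last 2 first.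
- by apply: wt_niceE; exact: borelC_psum.
- by move=> Z; rewrite lee_fin mulr_ge0// cabs2_ge0.
congr intC; apply/funext => Z.
rewrite sumEFin -EFinM; congr EFin.
transitivity ((L.+1%:R ^+ N)^-1 * (\sum_(w : cube L) cabs2 (cube_psum a L (rotv (unity_pt w) Z))) * wt Z)%R.
  rewrite -mulrA mulr_suml; congr (_ * _)%R; apply: eq_bigr => w _.
  by rewrite wt_rot//; exact: unity_pt_cabs2.
rewrite -mulr_suml; congr (_ * _)%R; apply: complexI.
rewrite -(cube_avg_parseval (fun I => a I * monomial Z I)%R (leqnn L)) /cube_avg rmorphM rmorph_sum /=.
rewrite fmorphV rmorphXn /= rmorph_nat; congr (_ * _)%R; apply: eq_bigr => w _.
by rewrite cube_psum_rot.
Qed.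

Section PSfun.
Variables (f : cpt R N -> C) (a : mi -> C).
Hypothesis ps : power_series_on f a.

Lemma power_series_wt_cvg Z : (fun L => (cabs2 (cube_psum a L Z) * wt Z)%:E) @ \oo --> (cabs2 (f Z) * wt Z)%:E.
Proof.
have [DZ|DZ] := pselect (D Z); first by apply: ccvg_cabs2E; have [_] := ps DZ.
by rewrite (wt_out DZ) mulr0; under eq_fun do rewrite mulr0; exact: cvg_cst.
Qed.

Lemma power_series_nice : borelE (fun Z => (cabs2 (f Z) * wt Z)%:E).
Proof.
apply: borelE_cvg power_series_wt_cvg => L; apply: wt_niceE; exact: borelC_psum.
Qed.

Lemma sqnormW_PS_le (B : \bar R) :
  (forall L, \sum_(g : cube L) (cabs2 (a (cube_mi g)))%:E * mon_sqnorm (cube_mi g) <= B) -> sqnormW f <= B.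
Proof.
move=> hB; apply: iint_fatou_cvg power_series_wt_cvg _.
- by move=> L; apply: wt_niceE; exact: borelC_psum.
- by move=> L Z; rewrite lee_fin mulr_ge0// cabs2_ge0.
- by apply: nearW => L; have := hB L; rewrite -sqnormW_psum.
Qed.

Definition torus_coef M Z (I : mi) : C := cube_avg (fun w : cube M => f (rotv (unity_pt w) Z) * (monomial (unity_pt w) I)^*%C)%R.

(** Rotations preserve the moduli of the terms, so one absolutely convergent series controls the
    tails on the whole orbit. *)
Lemma power_series_tail Z : D Z -> forall eps : R, (0 < eps)%R -> exists K, forall L (w : cpt R N), (K <= L)%N ->
  (forall j, cabs2 (w j) = 1%R) -> (cnorm (f (rotv w Z) - cube_psum a L (rotv w Z)) <= eps)%R.
Proof.
move=> DZ eps e0; have [[B hB] _] := ps DZ.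
have [K hK] := bounded_cube_cauchy (t := fun I => cnorm (a I * monomial Z I)%R) (fun I => cnorm_ge0 _) hB e0.
exists K => L w KL w1; have [_ h] := ps (D_rot w1 DZ); apply: ccvg_le h _; exists L => L' LL'.
apply: le_trans (abs_cube_diff (fun I => a I * monomial (rotv w Z) I)%R LL') _.
have E I : cnorm (a I * monomial (rotv w Z) I)%R = cnorm (a I * monomial Z I)%R.
  rewrite /rotv monomialM !cnormM cnorm_monomial big1 ?mul1r// => j _.
  by rewrite /cnorm w1 sqrtr1 expr1n.
rewrite (eq_bigr (fun g : cube L' => cnorm (a (cube_mi g) * monomial Z (cube_mi g)))%R); last by move=> g _; exact: E.
rewrite (eq_bigr (fun g : cube L => cnorm (a (cube_mi g) * monomial Z (cube_mi g)))%R); last by move=> g _; exact: E.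
exact: hK.
Qed.

Lemma cnorm_avg M (F : cube M -> C) (e : R) : (forall w, cnorm (F w) <= e)%R -> (cnorm (cube_avg F) <= e)%R.
Proof.
move=> h; rewrite /cube_avg cnormM cnormV cnormX.
have -> : cnorm (M.+1%:R : C) = M.+1%:R by rewrite -[M.+1%:R in LHS](rmorph_nat (@real_complex R)) /= cnorm_real ger0_norm.
rewrite ler_pdivrMl ?exprn_gt0//; apply: le_trans (cnorm_sum _ _ _) _.
apply: le_trans (ler_sum _ (fun w _ => h w)) _.
by rewrite sumr_const card_ffun !card_ord -natrX mulr_natl.
Qed.

(** The average of order [M] recovers exactly the coefficient of the partial sum of order [M]; what
    remains is at most the uniform tail. *)
Lemma torus_coef_cvg Z L (g : cube L) : D Z -> ccvg (fun M => torus_coef M Z (cube_mi g)) (a (cube_mi g) * monomial Z (cube_mi g))%R.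
Proof.
move=> DZ eps e0; have [K hK] := power_series_tail DZ e0; exists (maxn K L) => M; rewrite geq_max => /andP[KM LM].
have inM : incube M (cube_mi g).
  by apply/forallP => j; apply: leq_trans LM; exact: (forallP (fI_incube g) j).
have E := cube_avg_coef (fun I => a I * monomial Z I)%R (to_cube M (cube_mi g)) (leqnn M).
rewrite toCK// in E; rewrite -E /torus_coef /cube_avg -mulrBr -sumrB.
apply: (@cnorm_avg M (fun w => f (rotv (unity_pt w) Z) * (monomial (unity_pt w) (cube_mi g))^* -
   (\sum_(g0 : cube M) a (cube_mi g0) * monomial Z (cube_mi g0) * monomial (unity_pt w) (cube_mi g0)) * (monomial (unity_pt w) (cube_mi g))^*)%R) => w.
rewrite -mulrBl cnormM -cube_psum_rot.
rewrite cnorm_conj cnorm_monomial_unity_pt mulr1; apply: hK => // j; exact: unity_pt_cabs2.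
Qed.

(* Bessel for the averages over roots of unity of order [M], then Fatou as [M] grows,
   replaces the integral of [f] against a monomial. *)
Lemma sqnormW_PS_ge L : \sum_(g : cube L) (cabs2 (a (cube_mi g)))%:E * mon_sqnorm (cube_mi g) <= sqnormW f.
Proof.
rewrite -intC_sum_coef.
pose G M Z := (\sum_(g : cube L) cabs2 (torus_coef M Z (cube_mi g)) * wt Z)%:E.
(* Borel measurability of [torus_coef] passes through the partial sums: on [D] it is the limit of
   [S K] as [K] grows, and outside [D] the weight vanishes. *)
pose S K M Z (I : mi) : C := cube_avg (fun w : cube M => cube_psum a K (rotv (unity_pt w) Z) * (monomial (unity_pt w) I)^*%C)%R.
have nS K M I : borelC (fun Z => S K M Z I).
  apply: borelC_M; first exact: borelC_cst.
  apply: borelC_sum => w; apply: borelC_M; last exact: borelC_cst.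
  apply: (borelC_eq (f := fun Z => \sum_(g : cube K) (a (cube_mi g) * monomial Z (cube_mi g)) * monomial (unity_pt w) (cube_mi g))%R).
    by move=> Z; rewrite cube_psum_rot.
  apply: borelC_sum => g; apply: borelC_M; last exact: borelC_cst.
  by apply: borelC_M; [exact: borelC_cst|exact: borelC_mon].
have cvgS M Z I : D Z -> ccvg (fun K => S K M Z I) (torus_coef M Z I).
  move=> DZ; apply: ccvgZ; apply: ccvg_sum => w.
  rewrite mulrC; under eq_fun do rewrite mulrC.
  by apply: ccvgZ; have [_] := ps (D_rot (unity_pt_cabs2 w) DZ).
have G_cvg (T : nat -> cpt R N -> mi -> C) (T' : cpt R N -> mi -> C) :
   (forall Z g, D Z -> ccvg (fun K => T K Z (@cube_mi N L g)) (T' Z (cube_mi g))) -> forall Z,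
   (fun K => (\sum_(g : cube L) cabs2 (T K Z (cube_mi g)) * wt Z)%:E) @ \oo --> (\sum_(g : cube L) cabs2 (T' Z (cube_mi g)) * wt Z)%:E.
  move=> h Z; have [DZ|DZ] := pselect (D Z); last first.
    rewrite big1; last by move=> g _; rewrite (wt_out DZ) mulr0.
    under eq_fun do (rewrite big1; last by move=> g _; rewrite (wt_out DZ) mulr0).
    exact: cvg_cst.
  rewrite -sumEFin; under eq_fun do rewrite -sumEFin.
  apply: cvg_nnesum => [g _|g _].
    by apply: nearW => K; rewrite lee_fin mulr_ge0// cabs2_ge0.
  by apply: ccvg_cabs2E; exact: h.
have nT (T : cpt R N -> mi -> C) : (forall I, borelC (T ^~ I)) -> borelE (fun Z => (\sum_(g : cube L) cabs2 (T Z (cube_mi g)) * wt Z)%:E).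
  move=> nT; rewrite (_ : (fun Z => _) = (fun Z => \sum_(g : cube L) (cabs2 (T Z (cube_mi g)) * wt Z)%:E)).
    by apply: borelE_sum => g; exact: wt_niceE.
  by apply/funext => Z; rewrite sumEFin.
have nG M : borelE (G M).
  apply: (@borelE_cvg _ _ (fun K Z => (\sum_(g : cube L) cabs2 (S K M Z (cube_mi g)) * wt Z)%:E)).
    by move=> K; apply: nT => I; exact: nS.
  by move=> Z; apply: (G_cvg (fun K Z I => S K M Z I) (fun Z I => torus_coef M Z I)) => // Z' g D'; exact: cvgS.
apply: (@iint_fatou_cvg _ _ G).
- exact: nG.
- by move=> M Z; rewrite lee_fin sumr_ge0// => g _; rewrite mulr_ge0// cabs2_ge0.
- move=> Z; apply: (G_cvg (fun M Z I => torus_coef M Z I) (fun Z I => a I * monomial Z I)%R) => // Z' g D'; exact: torus_coef_cvg.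
exists L => // M /= LM.
(* Bessel holds pointwise in [Z]; the average of [|f|^2] over the rotated points has integral
   [||f||^2]. *)
apply: (@le_trans _ _ (intC (fun Z => ((M.+1%:R ^+ N)^-1)%:E * \sum_(w : cube M) (cabs2 (f (rotv (unity_pt w) Z)) * wt (rotv (unity_pt w) Z))%:E))).
  apply: iint_le => Z.
    by rewrite lee_fin sumr_ge0// => g _; rewrite mulr_ge0// cabs2_ge0.
  rewrite sumEFin -EFinM lee_fin -mulr_suml.
  rewrite [X in (_ <= _ * X)%R](eq_bigr (fun w => cabs2 (f (rotv (unity_pt w) Z)) * wt Z)%R); last first.
    by move=> w _; rewrite wt_rot//; exact: unity_pt_cabs2.
  rewrite -mulr_suml mulrA ler_wpM2r//.
  exact: cube_avg_bessel.
rewrite (intC_avg M (H := fun Z => (cabs2 (f Z) * wt Z)%:E))//; first exact: power_series_nice.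
by move=> Z; rewrite lee_fin mulr_ge0// cabs2_ge0.
Qed.

End PSfun.

(** Both terms are limits of the same [torus_coef], which involves [f] and not its expansion. *)
Lemma power_series_unique_coef f a a' Z I : power_series_on f a -> power_series_on f a' -> D Z -> (a I * monomial Z I = a' I * monomial Z I)%R.
Proof.
move=> h h' DZ.
pose L := (\max_(j < N) I j)%N.
have hI : incube L I by apply/forallP => j; rewrite (leq_bigmax j).
rewrite -(toCK hI); apply: ccvg_unique (torus_coef_cvg h _ DZ) (torus_coef_cvg h' _ DZ).
Qed.

End Parseval.

(** * Power series expansion of holomorphic functions *)

Lemma ler_bernoulli (R : realType) (x : R) n : -1 <= x -> 1 + n%:R * x <= (1 + x) ^+ n.
Proof.
move=> x1; elim: n => [|n IH]; first by rewrite mul0r addr0 expr0.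
have x0 : 0 <= 1 + x by lra.
have h := ler_wpM2l x0 IH; rewrite exprS; apply: le_trans h.
have := sqr_ge0 x; have n0 : 0 <= n%:R :> R by rewrite ler0n.
rewrite -natr1; nra.
Qed.

(** Bernoulli gives [q <= p^(k + 1)] with [p < 1]. Then [k] factors [p^M] absorb the [k] factors
    [M + 2], and one [p^M] is left to tend to 0. *)
Lemma poly_geom_small (R : realType) (k : nat) (q K eps : R) : 0 <= q < 1 -> 0 <= K -> 0 < eps ->
  exists M0 : nat, forall M, (M0 <= M)%N -> K * M.+2%:R ^+ k * q ^+ M <= eps.
Proof.
move=> /andP[q0 q1] K0 e0.
have k1 : 0 < k.+1%:R :> R by rewrite ltr0n.
pose y := (1 - q) / k.+1%:R; pose p := 1 - y.
have y0 : 0 < y by rewrite divr_gt0// subr_gt0.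
have y1 : y <= 1 by rewrite ler_pdivrMr// mul1r (@le_trans _ _ 1)// ?ler1n//; lra.
have p0 : 0 <= p by rewrite /p; lra.
have p1 : p < 1 by rewrite /p; lra.
have qp : q <= p ^+ k.+1.
  have := @ler_bernoulli R (- y) k.+1; rewrite -/p.
  have -> : 1 + k.+1%:R * (- y) = q by rewrite /y; field; rewrite nat1r pnatr_eq0.
  by apply; lra.
have bnd (M : nat) : M.+2%:R * p ^+ M <= 2 / y + 2.
  have pM0 : 0 <= p ^+ M by rewrite exprn_ge0.
  have pM1 : p ^+ M <= 1 by rewrite exprn_ile1// ltW.
  have h2 : M%:R * y * p ^+ M <= 1.
    have h : (1 + M%:R * y) * p ^+ M <= 1.
      apply: (@le_trans _ _ ((1 + y) ^+ M * p ^+ M)).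
        by rewrite ler_wpM2r// ler_bernoulli//; lra.
      by rewrite -exprMn exprn_ile1//; rewrite /p; nra.
    nra.
  have h3 : M%:R * p ^+ M <= y^-1 by rewrite -[leRHS]mul1r ler_pdivlMr//; lra.
  rewrite -addn2 natrD mulrDl; apply: lerD.
    by apply: le_trans h3 _; rewrite ler_peMl ?invr_ge0 ?ler1n// ltW.
  by rewrite ler_piMr.
pose A := 2 / y + 2.
have A0 : 0 <= A by rewrite addr_ge0// divr_ge0// ltW.
have [M0 hM0] := @geom_small R p (K * A ^+ k) eps ltac:(by rewrite p0 p1) e0.
exists M0 => M MM; apply: le_trans (hM0 M MM).
rewrite -!mulrA ler_wpM2l//.
apply: (@le_trans _ _ (M.+2%:R ^+ k * (p ^+ M) ^+ k.+1)).
  rewrite ler_wpM2l ?exprn_ge0// -exprM mulnC exprM.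
  by rewrite lerXn2r ?nnegrE// exprn_ge0.
rewrite exprSr mulrA -exprMn ler_wpM2r ?exprn_ge0//.
by rewrite lerXn2r ?nnegrE// mulr_ge0// exprn_ge0.
Qed.

(** * Interpolation at roots of unity in one variable *)

Section OneVar.
Variable R : realType.
Local Notation C := R[i].

Lemma geom_sum_le (q : R) L : 0 <= q < 1 -> \sum_(k < L) q ^+ k <= (1 - q)^-1.
Proof.
move=> /andP[q0 q1].
have h1 : 0 < 1 - q by rewrite subr_gt0.
rewrite -[leRHS]mul1r ler_pdivlMr// mulrC.
have -> : (1 - q) * (\sum_(k < L) q ^+ k) = 1 - q ^+ L.
  by rewrite -opprB mulNr -subrX1 opprB.
by rewrite gerBl exprn_ge0.
Qed.

Lemma sum_cube1 (V : nmodType) L (F : nat -> V) :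
  \sum_(g : {ffun 'I_1 -> 'I_L.+1}) F (cube_mi g ord0) = \sum_(k < L.+1) F k.
Proof.
rewrite (reindex (fun k : 'I_L.+1 => [ffun _ : 'I_1 => k])) /=.
  by apply: eq_bigr => k _; rewrite /cube_mi ffunE.
exists (fun g : {ffun 'I_1 -> 'I_L.+1} => g ord0) => g _; rewrite ?ffunE//.
by apply/ffunP => j; rewrite ffunE (ord1 j); congr (g _); exact: val_inj.
Qed.

Lemma power_series_at1 (g : C -> C) (c : nat -> C) (K r : R) (Z : cpt R 1) :
  (forall k, cnorm (c k) <= K * r^-1 ^+ k) -> cnorm (Z ord0) < r ->
  ccvg (fun L => \sum_(k < L) c k * Z ord0 ^+ k) (g (Z ord0)) ->
  power_series_at (fun W : cpt R 1 => g (W ord0)) (fun I => c (I ord0)) Z.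
Proof.
move=> hc Zr h.
have E I : monomial Z I = Z ord0 ^+ I ord0 by rewrite /monomial big_ord1.
have r0 : 0 < r by apply: le_lt_trans Zr; exact: cnorm_ge0.
have K0 : 0 <= K by have := hc 0%N; rewrite expr0 mulr1; apply: le_trans; exact: cnorm_ge0.
split.
  exists (K * (1 - cnorm (Z ord0) / r)^-1) => L.
  rewrite (eq_bigr (fun g : {ffun 'I_1 -> 'I_L.+1} => (fun k => cnorm (c k * Z ord0 ^+ k)) (cube_mi g ord0))); last first.
    by move=> f _; rewrite E.
  rewrite (sum_cube1 L (fun k => cnorm (c k * Z ord0 ^+ k))).
  apply: (@le_trans _ _ (\sum_(k < L.+1) K * (cnorm (Z ord0) / r) ^+ k)).
    apply: ler_sum => k _; rewrite cnormM cnormX exprMn mulrCA [leRHS]mulrC mulrC.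
    by rewrite mulrC ler_wpM2r ?exprn_ge0 ?cnorm_ge0// mulrC.
  rewrite -mulr_sumr ler_wpM2l// geom_sum_le// divr_ge0 ?cnorm_ge0 ?ltW//=.
  by rewrite ltr_pdivrMr// mul1r.
move=> eps e0; have [M hM] := h _ e0; exists M => L ML.
rewrite /cube_psum (eq_bigr (fun g : {ffun 'I_1 -> 'I_L.+1} => (fun k => c k * Z ord0 ^+ k) (cube_mi g ord0))); last first.
  by move=> f _; rewrite E.
by rewrite (sum_cube1 L (fun k => c k * Z ord0 ^+ k)); apply: hM; rewrite leqW.
Qed.

(** Cauchy's estimate is read off the torus averages at radius [R1], not from the constant in
    [taylor]. The error then depends on [g] only through [B], hence is uniform over the slices of a
    function of several variables. *)
Lemma taylor_bound (g : C -> C) (R0 R1 B : R) : 1 < R1 -> R1 < R0 ->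
  (forall z, cnorm z < R0 -> exists L, cderiv g z L) -> (forall z, cnorm z < R0 -> cnorm (g z) <= B) ->
  exists c : nat -> C, forall L z, cnorm z <= 1 ->
    cnorm (g z - \sum_(k < L) c k * z ^+ k) <= B / (1 - R1^-1) * R1^-1 ^+ L.
Proof.
move=> R11 R10 hg hB.
(* An intermediate radius, so that the expansion is available on the circle of radius [R1]
   itself. *)
pose R2 := (R1 + R0) / 2.
have h12 : R1 < R2 by rewrite /R2; lra.
have h20 : R2 < R0 by rewrite /R2; lra.
have [c [K [hc hcv]]] := @taylor R g R0 R2 hg ltac:(lra) h20.
have B0 : 0 <= B by apply: le_trans (hB 0 _); rewrite ?cnorm_ge0// cnorm0; lra.
pose D := [set Z : cpt R 1 | cnorm (Z ord0) < R2].
have ps : power_series_on D (fun W : cpt R 1 => g (W ord0)) (fun I => c (I ord0)).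
  by move=> Z DZ; apply: (power_series_at1 (g := g) hc DZ); exact: (hcv _ DZ).
have Drot w Z : (forall j, cabs2 (w j) = 1) -> D Z -> D (rotv w Z).
  by move=> w1; rewrite /D /= /rotv cnormM /cnorm w1 sqrtr1 mul1r.
have cest k : cnorm (c k) * R1 ^+ k <= B.
  pose Z : cpt R 1 := fun=> R1%:C.
  have DZ : D Z by rewrite /D /= cnorm_real gtr0_norm//; lra.
  pose I : 'I_1 -> nat := fun=> k.
  have hI : incube k I by apply/forallP.
  have := @torus_coef_cvg R 1 D Drot _ _ ps Z k (to_cube k I) DZ.
  rewrite toCK// => h; have := @ccvg_le _ _ _ 0 B h.
  rewrite subr0 cnormM cnorm_monomial big_ord1 cnorm_real (gtr0_norm (lt_trans ltr01 R11)) /I; apply.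
  exists 0%N => M _; rewrite subr0; apply: (@cnorm_avg R 1) => w.
  rewrite cnormM cnorm_conj cnorm_monomial_unity_pt mulr1; apply: hB.
  by rewrite /rotv cnormM cnorm_unity_pt mul1r cnorm_real gtr0_norm//; lra.
exists c => L z z1.
rewrite cnormBC; have z2 : cnorm z < R2 by lra.
have q0 : 0 <= R1^-1 by rewrite invr_ge0; lra.
have q1 : R1^-1 < 1 by rewrite invf_lt1//; lra.
apply/ler_addgt0Pr => eps e0.
have [M hM] := hcv z z2 _ e0.
have h1 := hM (maxn M L) (leq_maxl _ _); have LM := leq_maxr M L; move: LM h1.
set P := maxn M L => LM h1.
rewrite (_ : _ - g z = (\sum_(k < P) c k * z ^+ k - g z) - (\sum_(k < P) c k * z ^+ k - \sum_(k < L) c k * z ^+ k)); last by ring.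
apply: le_trans (cnormB _ _) _; rewrite addrC lerD//.
rewrite -(big_mkord xpredT (fun k => c k * z ^+ k)) -[X in _ - X](big_mkord xpredT (fun k => c k * z ^+ k)).
rewrite (@big_cat_nat _ _ _ L 0 P)//= addrAC subrr add0r.
apply: le_trans (cnorm_sum _ _ _) _.
rewrite -{1}[L]add0n big_addn big_mkord.
apply: (@le_trans _ _ (\sum_(k < P - L) B * R1^-1 ^+ L * R1^-1 ^+ k)).
  apply: ler_sum => k _; rewrite cnormM cnormX -mulrA -exprD addnC.
  apply: (@le_trans _ _ (cnorm (c (L + k)%N))).
    by rewrite ler_piMr ?cnorm_ge0// exprn_ile1 ?cnorm_ge0.
  rewrite exprVn -[leLHS]mulr1 -(@mulfV _ (R1 ^+ (L + k))); last by rewrite expf_neq0// gt_eqF//; lra.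
  by rewrite mulrA ler_wpM2r// invr_ge0 exprn_ge0//; lra.
rewrite -mulr_sumr mulrAC -mulrA -[leRHS]mulrA ler_wpM2l//.
by rewrite ler_wpM2r ?exprn_ge0// geom_sum_le// q0.
Qed.

(** For [i <= M], [kap M x i / (M + 1)] is the Lagrange basis polynomial at the node
    [unity_root M ^+ i]. *)
Definition kap M (x : C) (i : nat) : C := \sum_(m < M.+1) x ^+ m * ((unity_root R M ^+ i) ^+ m)^*%C.
Definition interp1 M (g : C -> C) (x : C) : C := M.+1%:R^-1 * \sum_(i < M.+1) g (unity_root R M ^+ i) * kap M x i.

Lemma cnorm_rtX M i : cnorm (unity_root R M ^+ i) = 1.
Proof. by rewrite cnormX cnorm_ei expr1n. Qed.

Lemma cnorm_kap M x i : cnorm x <= 1 -> cnorm (kap M x i) <= M.+1%:R.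
Proof.
move=> x1; apply: le_trans (cnorm_sum _ _ _) _.
apply: (@le_trans _ _ (\sum_(m < M.+1) 1)); last by rewrite sumr_const card_ord.
apply: ler_sum => m _; rewrite cnormM cnorm_conj !cnormX cnorm_ei !expr1n mulr1.
by rewrite exprn_ile1 ?cnorm_ge0.
Qed.

Lemma cnorm_nat n : cnorm (n%:R : C) = n%:R.
Proof. by rewrite -[n%:R in LHS](rmorph_nat (@real_complex R)) /= cnorm_real ger0_norm. Qed.

Lemma cnorm_interp1 M g x e : cnorm x <= 1 -> (forall z, cnorm z <= 1 -> cnorm (g z) <= e) ->
  cnorm (interp1 M g x) <= M.+1%:R * e.
Proof.
move=> x1 hg; rewrite /interp1 cnormM cnormV cnorm_nat ler_pdivrMl//.
apply: le_trans (cnorm_sum _ _ _) _.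
apply: (@le_trans _ _ (\sum_(m < M.+1) (e * M.+1%:R))).
  apply: ler_sum => i _; rewrite cnormM ler_pM ?cnorm_ge0 ?cnorm_kap//.
  by apply: hg; rewrite cnorm_rtX.
by rewrite sumr_const card_ord -[leLHS]mulr_natl [e * _]mulrC.
Qed.

Lemma interp1B M g h x : interp1 M (fun z => g z - h z) x = interp1 M g x - interp1 M h x.
Proof. by rewrite /interp1 -mulrBr -sumrB; congr (_ * _); apply: eq_bigr => i _; rewrite mulrBl. Qed.

Lemma interp1_poly M (c : nat -> C) x :
  interp1 M (fun z => \sum_(k < M.+1) c k * z ^+ k) x = \sum_(k < M.+1) c k * x ^+ k.
Proof.
rewrite /interp1 /kap.
transitivity (M.+1%:R^-1 * \sum_(k < M.+1) \sum_(m < M.+1) (c k * x ^+ m) *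
   \sum_(i < M.+1) (unity_root R M ^+ i) ^+ k * ((unity_root R M ^+ i) ^+ m)^*%C).
  congr (_ * _).
  under [RHS]eq_bigr => k _ do under eq_bigr => m _ do rewrite mulr_sumr.
  under [RHS]eq_bigr => k _ do rewrite exchange_big.
  rewrite [RHS]exchange_big; apply: eq_bigr => i _ /=.
  rewrite mulr_suml; apply: eq_bigr => k _; rewrite mulr_sumr; apply: eq_bigr => m _; ring.
rewrite mulr_sumr; apply: eq_bigr => k _.
rewrite (bigD1 k)//= [X in _ + X]big1; last first.
  move=> m mk; rewrite (unity_root_sum R (leq_ord k) (leq_ord m)) ifF ?mulr0//.
  by apply/negbTE; move: mk; apply: contraNN => /eqP e; apply/eqP/val_inj.
rewrite (unity_root_sum R (leq_ord k) (leq_ord k)) eqxx addr0 mulrCA mulVf ?mulr1// pnatr_eq0//.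
Qed.

(* [interp1] reproduces polynomials of degree at most [M] and has norm at most [M + 1]
   on the unit disc, so it is as good as the Taylor polynomial up to a factor [M + 2]. *)
Lemma interp1_err M (g : C -> C) (R0 R1 B : R) x : 1 < R1 -> R1 < R0 ->
  (forall z, cnorm z < R0 -> exists L, cderiv g z L) -> (forall z, cnorm z < R0 -> cnorm (g z) <= B) ->
  cnorm x <= 1 -> cnorm (g x - interp1 M g x) <= M.+2%:R * (B / (1 - R1^-1) * R1^-1 ^+ M.+1).
Proof.
move=> R11 R10 hg hB x1; have [c hc] := taylor_bound R11 R10 hg hB.
set e := _ * _ ^+ _.
rewrite (_ : g x - interp1 M g x = (g x - \sum_(k < M.+1) c k * x ^+ k) -
   interp1 M (fun z => g z - \sum_(k < M.+1) c k * z ^+ k) x); last first.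
  by rewrite interp1B interp1_poly; ring.
apply: le_trans (cnormB _ _) _; rewrite -nat1r mulrDl mul1r lerD//; first exact: hc.
by apply: cnorm_interp1 => // z z1; exact: hc.
Qed.

End OneVar.

(** * Interpolation coordinate by coordinate on the unit polydisc *)

Section Multi.
Variables (R : realType) (N : nat).
Local Notation C := R[i].
Local Notation mi := ('I_N -> nat).
Local Notation cube L := {ffun 'I_N -> 'I_L.+1}.

Lemma upd_at (Z : cpt R N) (j : 'I_N) c : upd j Z c j = c.
Proof. by rewrite /upd eqxx. Qed.

Lemma upd_ne (Z : cpt R N) (j k : 'I_N) c : k != j -> upd j Z c k = Z k.
Proof. by rewrite /upd -val_eqE => /negbTE ->. Qed.

Lemma upd_id (Z : cpt R N) (j : 'I_N) : upd j Z (Z j) = Z.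
Proof.
apply/funext => k; have [->|kj] := eqVneq k j; first by rewrite upd_at.
by rewrite upd_ne.
Qed.

Lemma upd_upd (Z : cpt R N) (j : nat) c d : upd j (upd j Z c) d = upd j Z d.
Proof. by apply/funext => k; rewrite /upd; case: (val k == j). Qed.

Lemma monomial_upd (Z : cpt R N) (j : 'I_N) c (e : mi) : e j = 0%N -> monomial (upd j Z c) e = monomial Z e.
Proof.
move=> ej; apply: eq_bigr => k _; have [->|kj] := eqVneq k j; first by rewrite ej !expr0.
by rewrite upd_ne.
Qed.

Lemma monomial_set (Z : cpt R N) (j : 'I_N) m (e : mi) : e j = 0%N ->
  monomial Z (fun l => if l == j then m else e l) = monomial Z e * Z j ^+ m.
Proof.
move=> ej; rewrite /monomial (bigD1 j)//= [in RHS](bigD1 j)//= eqxx ej expr0 mul1r mulrC.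
by congr (_ * _); apply: eq_bigr => k /negbTE ->.
Qed.

Definition interp_coord M (j : 'I_N) (h : cpt R N -> C) (Z : cpt R N) : C :=
  interp1 M (fun c => h (upd j Z c)) (Z j).

(** Polynomials in the coordinates of [s], with coefficients that are arbitrary functions of the
    others: the invariant of interpolating one coordinate after another. *)
Definition poly_in M (s : seq 'I_N) (F : cpt R N -> C) : Prop :=
  exists (K : finType) (e : K -> mi) (b : K -> cpt R N -> C),
   [/\ forall Z, F Z = \sum_k b k Z * monomial Z (e k), forall k j, (e k j <= M)%N,
    forall k j, j \notin s -> e k j = 0%N &
    forall k Z Z', (forall j, j \notin s -> Z j = Z' j) -> b k Z = b k Z'].

Lemma poly_in_T M j s F : j \notin s -> poly_in M s F -> poly_in M (j :: s) (interp_coord M j F).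
Proof.
move=> js [K [e [b [h1 h2 h3 h4]]]].
exists (K * ('I_M.+1 * 'I_M.+1))%type, (fun p l => if l == j then nat_of_ord p.2.2 else e p.1 l).
exists (fun (p : K * ('I_M.+1 * 'I_M.+1)) Z => M.+1%:R^-1 * b p.1 (upd j Z (unity_root R M ^+ p.2.1)) * ((unity_root R M ^+ p.2.1) ^+ p.2.2)^*%C).
split.
- move=> Z; rewrite /interp_coord /interp1 /kap.
  rewrite -(pair_bigA _ (fun k (p : 'I_M.+1 * 'I_M.+1) => M.+1%:R^-1 * b k (upd j Z (unity_root R M ^+ p.1)) * ((unity_root R M ^+ p.1) ^+ p.2)^*%C *
     monomial Z (fun l => if l == j then nat_of_ord p.2 else e k l))) /=.
  transitivity (M.+1%:R^-1 * \sum_(i < M.+1) \sum_(k : K) \sum_(m < M.+1)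
     b k (upd j Z (unity_root R M ^+ i)) * ((unity_root R M ^+ i) ^+ m)^*%C * (monomial Z (e k) * Z j ^+ m)).
    congr (_ * _); apply: eq_bigr => i _; rewrite h1 mulr_suml; apply: eq_bigr => k _.
    rewrite monomial_upd ?h3// mulr_sumr; apply: eq_bigr => m _; ring.
  rewrite exchange_big mulr_sumr; apply: eq_bigr => k _ /=.
  rewrite -(pair_bigA _ (fun i m : 'I_M.+1 => M.+1%:R^-1 * b k (upd j Z (unity_root R M ^+ i)) * ((unity_root R M ^+ i) ^+ m)^*%C *
     monomial Z (fun l => if l == j then nat_of_ord m else e k l))) /=.
  rewrite mulr_sumr; apply: eq_bigr => i _; rewrite mulr_sumr; apply: eq_bigr => m _.
  by rewrite (monomial_set _ _ (h3 k j js)) !mulrA.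
- by move=> [k [i m]] l /=; case: ifP => _; [rewrite -ltnS|].
- move=> [k [i m]] l /=; rewrite inE negb_or => /andP[/negbTE -> ls]; exact: h3.
- move=> [k [i m]] Z Z' h /=; congr (_ * _ * _); apply: h4 => l ls.
  have [->|lj] := eqVneq l j; first by rewrite !upd_at.
  by rewrite !upd_ne// h// inE negb_or lj.
Qed.

Lemma poly_in_fold M F s : uniq s -> poly_in M s (foldr (interp_coord M) F s).
Proof.
elim: s => [_|j s IH /= /andP[js us]]; last by apply: poly_in_T => //; exact: IH.
exists 'I_1, (fun _ _ => 0%N), (fun _ => F); split => //.
  by move=> Z; rewrite big_ord1 /monomial big1 ?mulr1.
by move=> _ Z Z' h; congr F; apply/funext => j; exact: h.
Qed.

Lemma poly_in_psum M F : poly_in M (enum 'I_N) F -> exists a, forall Z, F Z = cube_psum a M Z.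
Proof.
move=> [K [e [b [h1 h2 _ h4]]]].
have inM k : incube M (e k) by apply/forallP => j.
(* Once every coordinate has been interpolated the [b k] are constant and may be evaluated at 0;
   terms with the same exponent are grouped. *)
exists (fun I => \sum_(k | to_cube M (e k) == to_cube M I) b k (fun=> 0)) => Z.
rewrite h1 /cube_psum (partition_big (fun k => to_cube M (e k)) xpredT)//=.
apply: eq_bigr => g _; rewrite mulr_suml fIK; apply: eq_bigr => k /eqP ek.
rewrite -ek toCK//; congr (_ * _); apply: h4 => j; by rewrite mem_enum.
Qed.

Variables (g : cpt R N -> C) (R0 B : R).
Hypothesis R01 : 1 < R0.
Hypothesis hg : forall Z, (forall j, cnorm (Z j) < R0) -> forall j : 'I_N,
  exists L, cderiv (fun c => g (upd j Z c)) (Z j) L.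
Hypothesis hB : forall Z, (forall j, cnorm (Z j) < R0) -> cnorm (g Z) <= B.

Let R1 := (1 + R0) / 2.
Let R11 : 1 < R1.
Proof. by have := R01; rewrite /R1; lra. Qed.
Let R10 : R1 < R0.
Proof. by have := R01; rewrite /R1; lra. Qed.
Let B0 : 0 <= B.
Proof. by apply: le_trans (cnorm_ge0 _) (hB (Z := fun=> 0) _) => j; rewrite cnorm0; have := R01; lra. Qed.

Let Em M : R := M.+2%:R * (B / (1 - R1^-1) * R1^-1 ^+ M.+1).
Let Q (Z : cpt R N) := forall j, cnorm (Z j) <= 1.

Let Q_upd Z (j : 'I_N) c : Q Z -> cnorm c <= 1 -> Q (upd j Z c).
Proof.
move=> QZ c1 k; have [->|kj] := eqVneq k j; first by rewrite upd_at.
by rewrite upd_ne.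
Qed.

Let Tj_err M j Z : Q Z -> cnorm (g Z - interp_coord M j g Z) <= Em M.
Proof.
move=> QZ; rewrite -{1}(upd_id Z j).
have inZ c : cnorm c < R0 -> forall k, cnorm (upd j Z c k) < R0.
  move=> hc k; have [->|kj] := eqVneq k j; first by rewrite upd_at.
  by rewrite upd_ne//; have := R01; have := QZ k; lra.
apply: (@interp1_err R M (fun c => g (upd j Z c)) R0 R1 B (Z j)) => //.
- move=> z hz; have [L hL] := hg (inZ _ hz) j; exists L.
  by rewrite upd_at in hL; move: hL; under eq_fun do rewrite upd_upd.
- by move=> z hz; apply: hB; exact: inZ.
Qed.

(** One more interpolation multiplies the previous error by at most [M + 1] and adds [Em M]; the
    powers of [M + 2] absorb both. *)
Let fold_err M s Z : Q Z -> cnorm (g Z - foldr (interp_coord M) g s Z) <= M.+2%:R ^+ size s * Em M.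
Proof.
have E0 : 0 <= Em M.
  have h : R1^-1 < 1 by rewrite invf_lt1//; have := R11; lra.
  have h' : 0 <= R1^-1 by rewrite invr_ge0; have := R11; lra.
  by rewrite /Em !mulr_ge0// ?exprn_ge0// invr_ge0 subr_ge0 ltW.
elim: s Z => [|j s IH] Z QZ; first by rewrite /= subrr cnorm0 mulr_ge0.
rewrite /= (_ : g Z - _ = (g Z - interp_coord M j g Z) + interp1 M (fun c => g (upd j Z c) - foldr (interp_coord M) g s (upd j Z c)) (Z j)); last first.
  by rewrite interp1B /interp_coord; ring.
apply: le_trans (cnormD _ _) _.
apply: (@le_trans _ _ (Em M + M.+1%:R * (M.+2%:R ^+ size s * Em M))).
  apply: lerD; first exact: Tj_err.
  by apply: cnorm_interp1 => // z z1; apply: IH; exact: Q_upd.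
rewrite exprS -mulrA -[in leRHS]nat1r mulrDl mul1r lerD2r ler_peMl//.
by rewrite exprn_ege1// lerDl.
Qed.

Let interp : exists (aM : nat -> mi -> C), forall eps : R, 0 < eps -> exists M0, forall M, (M0 <= M)%N ->
  forall Z, Q Z -> cnorm (cube_psum (aM M) M Z - g Z) <= eps.
Proof.
have H M : exists a, forall Z, foldr (interp_coord M) g (enum 'I_N) Z = cube_psum a M Z.
  by apply: poly_in_psum; apply: poly_in_fold; exact: enum_uniq.
have [aM haM] := choice H; exists aM => eps e0.
have q1 : R1^-1 < 1 by rewrite invf_lt1//; have := R11; lra.
have q0 : 0 <= R1^-1 by rewrite invr_ge0; have := R11; lra.
have K0 : 0 <= B / (1 - R1^-1) by rewrite divr_ge0// subr_ge0 ltW.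
have [M0 hM0] := @poly_geom_small R N.+1 R1^-1 (B / (1 - R1^-1)) eps ltac:(by rewrite q0 q1) K0 e0.
exists M0 => M MM Z QZ; rewrite -haM cnormBC; apply: le_trans (fold_err _ _ QZ) _.
apply: le_trans (hM0 M MM); rewrite size_enum_ord /Em.
rewrite mulrA -exprSr mulrA [_ ^+ N.+1 * _]mulrC ler_wpM2l//.
  by rewrite mulr_ge0// exprn_ge0.
by rewrite exprS ler_piMl ?exprn_ge0// ltW.
Qed.

Lemma monomial_cube_bounded (Z : cpt R N) L : (forall j, cnorm (Z j) < 1) ->
  \sum_(h : cube L) cnorm (monomial Z (cube_mi h)) <= \prod_(j < N) (1 - cnorm (Z j))^-1.
Proof.
move=> Z1.
rewrite (eq_bigr (fun h : cube L => \prod_(j < N) cnorm (Z j) ^+ h j)); last by move=> h _; rewrite cnorm_monomial.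
rewrite -(bigA_distr_bigA (fun (j : 'I_N) (i : 'I_L.+1) => cnorm (Z j) ^+ i)).
apply: ler_prod => j _; rewrite sumr_ge0 ?geom_sum_le ?cnorm_ge0 ?Z1// => i _.
by rewrite exprn_ge0// cnorm_ge0.
Qed.

(* The interpolating polynomials converge uniformly on the closed unit polydisc, hence so
   do their coefficients, which are bounded independently of the degree. *)
Lemma unit_polydisc_PS : exists a : mi -> C, forall Z, (forall j, cnorm (Z j) < 1) -> power_series_at g a Z.
Proof.
have [aM haM] := interp.
have Qom M (w : cube M) : Q (unity_pt w) by move=> j; rewrite cnorm_unity_pt.
have Q0 Z : Q Z -> forall j, cnorm (Z j) < R0 by move=> QZ j; have := R01; have := QZ j; lra.
have coefE M M' I : (M <= M')%N -> incube M I ->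
   aM M I = cube_avg (fun w : cube M' => cube_psum (aM M) M (unity_pt w) * (monomial (unity_pt w) I)^*%C).
  by move=> MM' hI; have := cube_avg_coef (aM M) (to_cube M I) MM'; rewrite toCK.
have avgB M' (F G : cube M' -> C) : cube_avg F - cube_avg G = cube_avg (fun w => F w - G w).
  by rewrite /cube_avg -mulrBr -sumrB.
have cauchyI I (eps : R) : 0 < eps -> exists M0, forall M M', (M0 <= M)%N -> (M <= M')%N ->
    cnorm (aM M' I - aM M I) <= eps.
  move=> e0; have e2 : 0 < eps / 2 by rewrite divr_gt0.
  have [M0 hM0] := haM _ e2; exists (maxn M0 (\max_(j < N) I j)) => M M'; rewrite geq_max => /andP[h1 h2] h3.
  have iM : incube M I by apply/forallP => j; apply: leq_trans h2; exact: (leq_bigmax j).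
  have iM' : incube M' I by apply/forallP => j; apply: leq_trans h3; exact: (forallP iM j).
  rewrite (coefE M' M')// (coefE M M')// avgB; apply: cnorm_avg => w.
  rewrite -mulrBl cnormM cnorm_conj cnorm_monomial_unity_pt mulr1 [eps]splitr.
  rewrite (_ : _ - _ = (cube_psum (aM M') M' (unity_pt w) - g (unity_pt w)) - (cube_psum (aM M) M (unity_pt w) - g (unity_pt w))); last by ring.
  (* Both interpolating polynomials are within [eps / 2] of [g] on the torus, and averaging against
     a monomial is a contraction. *)
  by apply: le_trans (cnormB _ _) _; rewrite lerD// hM0// (leq_trans h1).
have [M1 hM1] := haM 1 ltr01.
have bndI M I : (M1 <= M)%N -> incube M I -> cnorm (aM M I) <= B + 1.
  move=> h1 h2; rewrite (coefE M M)//; apply: cnorm_avg => w.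
  rewrite cnormM cnorm_conj cnorm_monomial_unity_pt mulr1 -[cube_psum _ _ _](subrK (g (unity_pt w))).
  apply: le_trans (cnormD _ _) _; rewrite addrC lerD ?hM1//.
  by apply: hB; exact: Q0.
have limI I : exists l, ccvg (fun M => aM M I) l.
  by apply: ccvg_cauchy => eps e0; exact: cauchyI.
have [a ha] := choice limI.
have aB I : cnorm (a I) <= B + 1.
  have := @ccvg_le _ _ _ 0 (B + 1) (ha I); rewrite subr0; apply.
  exists (maxn M1 (\max_(j < N) I j)) => M; rewrite geq_max subr0 => /andP[h1 h2]; apply: bndI => //.
  by apply/forallP => j; apply: leq_trans h2; exact: (leq_bigmax j).
exists a => Z Z1.
have bnd : forall L, \sum_(h : cube L) (B + 1) * cnorm (monomial Z (cube_mi h)) <= (B + 1) * \prod_(j < N) (1 - cnorm (Z j))^-1.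
  by move=> L; rewrite -mulr_sumr ler_wpM2l ?monomial_cube_bounded// addr_ge0.
split.
  exists ((B + 1) * \prod_(j < N) (1 - cnorm (Z j))^-1) => L; apply: le_trans (bnd L).
  by apply: ler_sum => h _; rewrite cnormM ler_wpM2r ?cnorm_ge0.
move=> eps e0; have e2 : 0 < eps / 2 by rewrite divr_gt0.
have t0 I : 0 <= (B + 1) * cnorm (monomial Z I) by rewrite mulr_ge0 ?cnorm_ge0// addr_ge0.
have [K hK] := bounded_cube_cauchy (t := fun I => (B + 1) * cnorm (monomial Z I)) t0 bnd e2.
have [M2 hM2] := haM _ e2.
exists K => L KL.
have cv : ccvg (fun M => cube_psum (aM M) L Z) (cube_psum a L Z).
  apply: ccvg_sum => h; rewrite mulrC; under eq_fun do rewrite mulrC.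
  by apply: ccvgZ; exact: ha.
apply: ccvg_le cv _; exists (maxn M1 (maxn M2 L)) => M; rewrite !geq_max => /and3P[h1 h2 h3].
rewrite (_ : _ - _ = (cube_psum (aM M) M Z - g Z) - (cube_psum (aM M) M Z - cube_psum (aM M) L Z)); last by ring.
apply: le_trans (cnormB _ _) _; rewrite [eps]splitr lerD//.
  by apply: hM2 => // j; exact: ltW.
rewrite /cube_psum (sum_cube_split (fun I => aM M I * monomial Z I) h3).
apply: le_trans (cnorm_sum _ _ _) _; apply: le_trans (hK L M KL h3).
rewrite (sum_cube_split (fun I => (B + 1) * cnorm (monomial Z I)) h3).
by apply: ler_sum => h _; rewrite cnormM ler_wpM2r ?cnorm_ge0// bndI ?fI_incube.
Qed.

End Multi.

(** * Rescaling to arbitrary polydiscs *)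

Section Polydisc.
Variables (R : realType) (N : nat).
Local Notation C := R[i].
Local Notation mi := ('I_N -> nat).

Lemma cderiv_scale (f : C -> C) (s z L : C) : cderiv f (s * z) L -> cderiv (fun w => f (s * w)) z (s * L).
Proof.
move=> h eps e0.
have s1 : 0 < cnorm s + 1 by rewrite ltr_wpDl ?cnorm_ge0.
have [d d0 hd] := h (eps / (cnorm s + 1)) ltac:(by rewrite divr_gt0).
exists (d / (cnorm s + 1)) => [|k dbar_factor]; first by rewrite divr_gt0.
have hs : cnorm (s * k) <= (cnorm s + 1) * cnorm k by rewrite cnormM ler_wpM2r ?cnorm_ge0// lerDl.
rewrite mulrDr (_ : s * L * k = L * (s * k)); last by ring.
apply: le_trans (hd (s * k) _) _.
  by apply: le_lt_trans hs _; move: dbar_factor; rewrite ltr_pdivlMr// mulrC.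
rewrite -mulrA ler_wpM2l ?(ltW e0)// ler_pdivrMl//.
Qed.

Lemma polydisc_PS (f : cpt R N -> C) (r r0 : 'I_N -> R) (B : R) :
  (forall j, 0 < r j < r0 j) ->
  (forall Z, (forall j, cnorm (Z j) < r0 j) -> forall j : 'I_N, exists L, cderiv (fun c => f (upd j Z c)) (Z j) L) ->
  (forall Z, (forall j, cnorm (Z j) < r0 j) -> cnorm (f Z) <= B) ->
  exists a : mi -> C, forall Z, (forall j, cnorm (Z j) < r j) -> power_series_at f a Z.
Proof.
move=> rr hf hB.
have rj0 j : 0 < r j by have /andP[] := rr j.
have rC j : (r j)%:C != 0 :> C by rewrite -cnorm_gt0 cnorm_real gtr0_norm.
pose sc (Z : cpt R N) : cpt R N := fun j => (r j)%:C * Z j.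
have [R0 R01 hR0] : exists2 R0 : R, 1 < R0 & forall j, R0 * r j <= r0 j.
  (* A common dilation factor above 1 for all coordinates; the default 2 covers [N = 0]. *)
  exists (\big[Num.min/2]_(j < N) (r0 j / r j)).
    apply: lt_bigmin => [|j _]; first by rewrite ltr1n.
    by rewrite ltr_pdivlMr// mul1r; have /andP[] := rr j.
  by move=> j; rewrite -ler_pdivlMr//; apply: bigmin_le_cond.
have inZ Z : (forall j, cnorm (Z j) < R0) -> forall j, cnorm (sc Z j) < r0 j.
  move=> h j; rewrite /sc cnormM cnorm_real gtr0_norm// mulrC.
  by apply: lt_le_trans (hR0 j); rewrite ltr_pM2r.
have sc_upd Z (j : 'I_N) c : sc (upd j Z c) = upd j (sc Z) ((r j)%:C * c).
  apply/funext => k; rewrite /sc; have [->|kj] := eqVneq k j; first by rewrite !upd_at.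
  by rewrite !upd_ne.
have [a ha] : exists a : mi -> C, forall Z, (forall j, cnorm (Z j) < 1) -> power_series_at (fun Z => f (sc Z)) a Z.
  apply: (@unit_polydisc_PS R N (fun Z => f (sc Z)) R0 B R01).
    move=> Z hZ j; have [L hL] := hf _ (inZ Z hZ) j; exists ((r j)%:C * L).
    have := @cderiv_scale (fun c => f (upd j (sc Z) c)) (r j)%:C (Z j) L hL.
    by under eq_fun do rewrite -sc_upd.
  by move=> Z hZ; apply: hB; exact: inZ.
exists (fun I => a I * (monomial (fun j => (r j)%:C) I)^-1) => Z hZ.
pose Z' : cpt R N := fun j => (r j)%:C^-1 * Z j.
have sZ : sc Z' = Z by apply/funext => j; rewrite /sc /Z' mulrA mulfV ?mul1r.
have Z'1 j : cnorm (Z' j) < 1.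
  by rewrite /Z' cnormM cnormV cnorm_real gtr0_norm// ltr_pdivrMl// mulr1.
have E I : a I * (monomial (fun j => (r j)%:C) I)^-1 * monomial Z I = a I * monomial Z' I.
  rewrite -[in LHS]sZ /sc monomialM -mulrA; congr (_ * _); rewrite mulrA mulVf ?mul1r//.
  by apply/prodf_neq0 => j _; rewrite expf_neq0.
have [[B' hB'] h2] := ha Z' Z'1; split.
  by exists B' => L; under eq_bigr do rewrite E.
move: h2; rewrite sZ /cube_psum; congr (ccvg _ _); apply/funext => L.
by apply: eq_bigr => h _; rewrite E.
Qed.

End Polydisc.

(** * Sub-mean value inequality and its iteration *)

Section Submean.
Variable R : realType.
Local Notation C := R[i].
Local Notation leb := (@lebesgue_measure R).

Lemma cderiv_shift (f : C -> C) (a z L : C) : cderiv f (a + z) L -> cderiv (fun w => f (a + w)) z L.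
Proof. by move=> h eps e0; have [d d0 hd] := h _ e0; exists d => // k dbar_factor; rewrite addrA; exact: hd. Qed.

Lemma iint1_shift (H : cpt R 1 -> \bar R) (a : C) : borelE H -> (forall Z, 0 <= H Z)%E ->
  intC (fun Z => H (fun j => a + Z j)) = intC H.
Proof.
move=> nH H0; case: a => a1 a2.
pose F (s t : R) := H (upd 0 (fun=> 0) (s +i* t)).
have E s t : H (fun j => (a1 +i* a2) + upd 0 (fun=> 0) (s +i* t) j) = F (1 * s + a1) (1 * t + a2).
  rewrite /F; congr H; apply/funext => j; rewrite /upd (ord1 j) /= !mul1r.
  by apply: complexP => /=; rewrite addrC.
rewrite /intC !iintS /cint.
have -> : (\int[leb]_s \int[leb]_t iint 0 (fun Z => H (fun j => ((a1 +i* a2) + Z j)%R)) (upd 0 (fun=> 0%R) (s +i* t)) =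
           \int[leb]_s \int[leb]_t F (1 * s + a1)%R (1 * t + a2)%R)%E.
  by apply: eq_integral => s _; apply: eq_integral => t _; exact: E.
have E2 s : (\int[leb]_t F s (1 * t + a2)%R = \int[leb]_t F s t)%E.
  have mF := @borelE_cint_meas1 R 1 H 0 (fun=> 0) s nH.
  by rewrite (ge0_integral_affine a2 (oner_neq0 R) mF (fun t => H0 _)) normr1 invr1 mul1e.
transitivity (\int[leb]_s \int[leb]_t F (1 * s + a1)%R t)%E.
  by apply: eq_integral => s _; exact: E2.
have mF := @borelE_cint_meas2 R 1 H 0 (fun=> 0) nH H0.
have F0 s : (0 <= \int[leb]_t F s t)%E by apply: integral_ge0 => t _; exact: H0.
by rewrite (ge0_integral_affine a1 (oner_neq0 R) mF F0) normr1 invr1 mul1e.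
Qed.

(* This is [sqnormW_PS_ge] for the disc of radius [r], with only the constant
   coefficient kept. *)
Lemma sub_mean_value (r : R) : 0 < r -> exists2 k : R, 0 < k & forall (g : C -> C) (a : C) (R0 q : R),
  r < R0 -> 0 <= q -> (forall z, cnorm (z - a) < R0 -> exists L, cderiv g z L) ->
  ((q * k * cabs2 (g a))%:E <= \int[leb]_s \int[leb]_t
     (if cnorm ((s +i* t) - a) < r then q * cabs2 (g (s +i* t)) else 0)%:E)%E.
Proof.
move=> r0; have [c c0 cE] := disc_area1_fin R.
have r2 : 0 < (r / 2) ^+ 2 by rewrite exprn_gt0// divr_gt0.
(* The area of the disc of radius [r / 2], whose closure lies in the open disc of radius [r]. *)
exists ((r / 2) ^+ 2 * c) => [|g a R0 q rR q0 hg]; first by rewrite mulr_gt0.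
pose G z := g (a + z).
have hG z : cnorm z < R0 -> exists L, cderiv G z L.
  move=> hz; have [|L hL] := hg (a + z); first by rewrite addrAC subrr add0r.
  by exists L; exact: cderiv_shift.
have [cc [K [hc hcv]]] := @taylor R G R0 ((r + R0) / 2) hG ltac:(lra) ltac:(lra).
pose D := [set Z : cpt R 1 | cnorm (Z ord0) < r].
pose wt (Z : cpt R 1) : R := if cnorm (Z ord0) < r then q else 0.
have ps : power_series_on D (fun W : cpt R 1 => G (W ord0)) (fun I => cc (I ord0)).
  move=> Z DZ; have DZ' : cnorm (Z ord0) < (r + R0) / 2 by move: DZ; rewrite /D /=; lra.
  by apply: (power_series_at1 (g := G) hc DZ'); exact: (hcv _ DZ').
have Drot w Z : (forall j, cabs2 (w j) = 1) -> D Z -> D (rotv w Z).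
  by move=> w1; rewrite /D /= /rotv cnormM /cnorm w1 sqrtr1 mul1r.
have wt0 Z : 0 <= wt Z by rewrite /wt; case: ifP.
have wtrot w Z : (forall j, cabs2 (w j) = 1) -> wt (rotv w Z) = wt Z.
  by move=> w1; rewrite /wt /rotv cnormM {1}/cnorm w1 sqrtr1 mul1r.
have wtout Z : ~ D Z -> wt Z = 0 by rewrite /D /wt /=; case: ifP.
have nwt : borelR wt.
  move=> d T h mh.
  have E x : (cnorm (h x ord0) < r) = (cabs2 (h x ord0) < r ^+ 2).
    by rewrite -cnorm_sqr ltr_pXn2r// ?nnegrE ?cnorm_ge0// ltW.
  rewrite (_ : (fun x => _) = (fun x => if cabs2 (h x ord0) < r ^+ 2 then q else 0)); last first.
    by apply/funext => x; rewrite /wt E.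
  apply: measurable_fun_ifT => //; apply: measurable_fun_ltr => //.
  exact: (@borelR_cabs2 R 1 (fun Z => Z ord0) (borelC_coord R ord0) _ _ _ mh).
have := sqnormW_PS_ge wt0 nwt wtrot wtout Drot ps 0.
have F0 : cube_mi ([ffun=> ord0] : {ffun 'I_1 -> 'I_1}) = fun=> 0%N by apply/funext => j; rewrite /cube_mi ffunE.
rewrite (big_pred1 [ffun=> ord0]); last first.
  by move=> h /=; apply/esym/eqP/ffunP => j; rewrite ffunE [h j]ord1; exact: val_inj.
rewrite F0.
have -> : cc 0%N = g a.
  have := hcv 0; rewrite cnorm0 => /(_ ltac:(lra)); rewrite /G addr0 => h.
  apply: ccvg_unique h => eps e0; exists 1%N => -[//|L] _.
  rewrite big_ord_recl /= expr0 mulr1 big1 ?addr0 ?subrr ?cnorm0 ?ltW// => i _.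
  by rewrite exprS mul0r mulr0.
move=> h.
have hq : ((q * ((r / 2) ^+ 2 * c))%:E <= mon_sqnorm wt (fun=> 0%N))%E.
  have mon0 Z : monomial Z (fun=> 0%N) = 1 :> C by rewrite /monomial big1// => j _; rewrite expr0.
  apply: (@le_trans _ _ (iint 1 (fun Z : cpt R 1 => q%:E * (\1_[set p | (norm2sq p <= (r / 2) ^+ 2)%R] (complex.Re (Z ord0), complex.Im (Z ord0)))%:E) (fun=> 0%R))%E).
    rewrite iintZ ?lee_fin//.
    - have -> : iint 1 (fun Z : cpt R 1 => (\1_[set p | (norm2sq p <= (r / 2) ^+ 2)%R] (complex.Re (Z ord0), complex.Im (Z ord0)))%:E) (fun=> 0%R) = ((r / 2) ^+ 2 * c)%:E.
        by rewrite EFinM -cE -(disc_area_scale r2) disc_areaE.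
      by rewrite -EFinM lexx.
    - move=> d T h' mh; apply/measurable_EFinP.
      apply: (measurableT_comp (measurable_indic (measurable_disc _))).
      by have [m1 m2] := mh ord0; exact/measurable_fun_pairP.
  apply: iint_le => Z; first by rewrite mule_ge0 ?lee_fin.
  rewrite mon0 -EFinM lee_fin /cabs2 /= expr1n expr0n /= addr0 mul1r indicE.
  have [|_] := boolP ((complex.Re (Z ord0), complex.Im (Z ord0)) \in _); last by rewrite mulr0.
  rewrite inE /= mulr1 => hs; rewrite /wt ifT// /cnorm -(@ltr_pXn2r _ 2)// ?nnegrE ?sqrtr_ge0 ?ltW//.
  rewrite sqr_sqrtr ?cabs2_ge0//; apply: le_lt_trans hs _.
  by rewrite ltr_pXn2r// ?nnegrE ?divr_ge0 ?ltW// ltr_pdivrMr// mulr_natr mulr2n ltrDl.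
rewrite mulrC EFinM; apply: (@le_trans _ _ (sqnormW wt (fun W : cpt R 1 => G (W ord0)))).
  apply: le_trans h; rewrite lee_wpmul2l// lee_fin cabs2_ge0//.
have nG := power_series_nice nwt wtout ps.
rewrite /sqnormW -(iint1_shift (- a) nG); last by move=> Z; rewrite lee_fin mulr_ge0// cabs2_ge0.
rewrite /intC /=; apply: ge0_le_integral_gen => s.
  by apply: integral_ge0 => t _; rewrite lee_fin mulr_ge0// cabs2_ge0.
apply: ge0_le_integral_gen => t.
  by rewrite lee_fin mulr_ge0// cabs2_ge0.
rewrite lee_fin /wt /= addrC; case: ifP => _; last by rewrite mulr0.
by rewrite /G [a + _]addrC subrK mulrC.
Qed.

Lemma iint_indep N k (F : cpt R N -> \bar R) Z Z' :
  (forall j : 'I_N, (k <= j)%N -> Z j = Z' j) -> iint k F Z = iint k F Z'.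
Proof.
elim: k Z Z' => [|k IH] Z Z' h; first by congr F; apply/funext => j; exact: h.
rewrite !iintS; apply: eq_integral => s _; apply: eq_integral => t _; apply: IH => j kj.
by rewrite /upd; case: eqP => // /eqP jk; apply: h; rewrite ltn_neqAle eq_sym jk.
Qed.

(** The constant [k] is fixed by [r] before [N], [f] and the centre are chosen, so that the
    one-variable inequality can be applied in every coordinate with the same [k]. *)
Lemma local_iint (r : R) : 0 < r -> exists2 k : R, 0 < k & forall N (f : cpt R N -> C) (Z0 : cpt R N) (R0 c : R),
  r < R0 -> 0 <= c ->
  (forall Z, (forall j, cnorm (Z j - Z0 j) < R0) -> forall j : 'I_N, exists L, cderiv (fun w => f (upd j Z w)) (Z j) L) ->
  ((c * k ^+ N * cabs2 (f Z0))%:E <=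
   intC (fun Z => (if [forall j, (cnorm (Z j - Z0 j) < r)%R] then c * cabs2 (f Z) else 0)%:E))%E.
Proof.
move=> r0; have [k k0 dbar_factor] := sub_mean_value r0; exists k => // N f Z0 R0 c rR c0 hf.
set F := (fun Z => _).
have FP Z : (0 <= F Z)%E by rewrite /F lee_fin; case: ifP => // _; rewrite mulr_ge0// cabs2_ge0.
have R00 : 0 < R0 by exact: lt_trans rR.
(* After [l] coordinates the remaining ones are still arbitrary in the polydisc, while those already
   integrated start at the centre; the factor [c * k ^+ l] is carried as the constant [q] of
   [sub_mean_value]. *)
suff H l : (l <= N)%N -> forall Z, (forall j, cnorm (Z j - Z0 j) < r) -> (forall j : 'I_N, (j < l)%N -> Z j = Z0 j) ->
    ((c * k ^+ l * cabs2 (f Z))%:E <= iint l F Z)%E.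
  apply: (le_trans (H N (leqnn N) Z0 _ _)) => // [j|]; first by rewrite subrr cnorm0.
  by rewrite /intC (@iint_indep N N F _ Z0)// => j; rewrite leqNgt ltn_ord.
elim: l => [_ Z hZ _|l IH lN Z hZ hl].
  by rewrite expr0 mulr1 /= /F ifT//; apply/forallP.
rewrite iintS; pose j := Ordinal lN.
have Zj : Z j = Z0 j by apply: hl => /=.
have := dbar_factor (fun w => f (upd j Z w)) (Z0 j) R0 (c * k ^+ l) rR ltac:(by rewrite mulr_ge0// exprn_ge0// ltW).
move=> /(_ _)/le_trans; rewrite -Zj upd_id exprSr mulrA; apply.
  move=> z hz.
  have hz' : forall i, cnorm (upd j Z z i - Z0 i) < R0.
    move=> i; have [->|ij] := eqVneq i j; first by rewrite upd_at -Zj.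
    by rewrite upd_ne//; apply: lt_trans rR.
  have [L hL] := hf _ hz' j; exists L; rewrite upd_at in hL.
  by move: hL; under eq_fun do rewrite upd_upd.
apply: ge0_le_integral_gen => s.
  apply: integral_ge0 => t _; rewrite lee_fin; case: ifP => // _.
  by rewrite mulr_ge0 ?cabs2_ge0// mulr_ge0// exprn_ge0// ltW.
apply: ge0_le_integral_gen => t.
  rewrite lee_fin; case: ifP => // _.
  by rewrite mulr_ge0 ?cabs2_ge0// mulr_ge0// exprn_ge0// ltW.
case: ifPn => [h|_]; last exact: iint_ge0.
apply: IH; first exact: ltnW.
  by move=> i; have [->|ij] := eqVneq i j; [rewrite upd_at -Zj|rewrite upd_ne].
move=> i il; rewrite upd_ne; last by apply/eqP => e; move: il; rewrite e /= ltnn.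
by apply: hl; exact: ltnW.
Qed.

End Submean.

Lemma hol_CD (R : realType) N (D : set (cpt R N)) (f : cpt R N -> R[i]) Z (j : 'I_N) :
  holomorphic_on D f -> D Z -> exists L, cderiv (fun c => f (upd j Z c)) (Z j) L.
Proof.
move=> hf DZ; have [L hL] := hf Z DZ j; exists L => eps e0.
have [d [d0 hd]] := hL eps e0; exists d => // h hh.
have [->|h0] := eqVneq h 0; first by rewrite addr0 subrr mulr0 subrr cnorm0 mulr0.
have hn : 0 < cnorm h by rewrite cnorm_gt0.
have := hd h h0; rewrite -!cnorm_sqr !ltr_pXn2r ?nnegrE ?cnorm_ge0 ?(ltW d0) ?(ltW e0)// => /(_ hh) h1.
have -> : f (upd j Z (Z j + h)) = f (cshift Z j h).
  congr f; apply/funext => k; rewrite /cshift; have [->|kj] := eqVneq k j; first by rewrite upd_at.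
  by rewrite upd_ne.
rewrite upd_id (_ : _ - _ - _ = ((f (cshift Z j h) - f Z) / h - L) * h); last by field.
by rewrite cnormM ler_wpM2r ?cnorm_ge0// ltW.
Qed.

(** * Power series on a complete Reinhardt domain *)

Section Reinhardt.
Variables (R : realType) (N : nat) (D : set (cpt R N)) (wt : cpt R N -> R).
Local Notation C := R[i].
Local Notation mi := ('I_N -> nat).
Hypothesis wt_ge0 : forall Z, 0 <= wt Z.
Hypothesis wt_nice : borelR wt.
Hypothesis wt_rot : forall w Z, (forall j, cabs2 (w j) = 1) -> wt (rotv w Z) = wt Z.
Hypothesis wt_out : forall Z, ~ D Z -> wt Z = 0.
(** One statement for three facts: the domain is open, it is complete Reinhardt since moduli may
    decrease freely, and the weight is locally bounded below. *)
Hypothesis D_nbhs : forall Z, D Z -> exists d c : R, [/\ 0 < d, 0 < c &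
  forall Z', (forall j, cabs2 (Z' j) <= cabs2 (Z j) + d) -> D Z' /\ c <= wt Z'].

Lemma D_mod Z Z' : D Z -> (forall j, cabs2 (Z' j) <= cabs2 (Z j)) -> D Z'.
Proof.
move=> DZ h; have [d [c [d0 c0 H]]] := D_nbhs DZ.
by apply: (proj1 (H Z' _)) => j; apply: le_trans (h j) _; rewrite lerDl (ltW d0).
Qed.

Lemma D_rot w Z : (forall j, cabs2 (w j) = 1) -> D Z -> D (rotv w Z).
Proof. by move=> w1 DZ; apply: (D_mod DZ) => j; rewrite /rotv cabs2M w1 mul1r. Qed.

Lemma local_bound Z0 : D Z0 -> exists d K : R, [/\ 0 < d, 0 < K,
   forall Z, (forall j, cabs2 (Z j) <= cabs2 (Z0 j) + d) -> D Z &
   forall f, holomorphic_on D f -> forall Z, (forall j, cabs2 (Z j) <= cabs2 (Z0 j) + d) ->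
   ((cabs2 (f Z))%:E <= K%:E * sqnormW wt f)%E].
Proof.
move=> DZ; have [d [c [d0 c0 H]]] := D_nbhs DZ.
pose A := 1 + sqn Z0 + d.
have s0 : 0 <= sqn Z0 by rewrite sumr_ge0// => j _; rewrite cabs2_ge0.
have A1 : 1 <= A by rewrite /A; lra.
(* With [|Z j| <= A] and [r <= 1], moving by [2 r] raises [|Z j|^2] by at most
   [4 r (A + 1) <= d / 2]. *)
pose r := Num.min 1 (d / (8 * (A + 1))).
have r0 : 0 < r by rewrite lt_min ltr01 divr_gt0//; lra.
have r1 : r <= 1 by rewrite ge_min lexx.
have rA : 4 * r * (A + 1) <= d / 2.
  have h : r <= d / (8 * (A + 1)) by rewrite ge_min lexx orbT.
  have h8 : 0 < 8 * (A + 1) by lra.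
  by move: h; rewrite ler_pdivlMr//; lra.
have [k k0 dbar_factor] := local_iint (R := R) r0.
have hd2 : d / 2 <= d by lra.
exists (d / 2), (c * k ^+ N)^-1; split.
- by rewrite divr_gt0.
- by rewrite invr_gt0 mulr_gt0// exprn_gt0.
- by move=> Z hZ; apply: (proj1 (H Z _)) => j; apply: le_trans (hZ j) _; rewrite lerD2l.
move=> f hf Z hZ.
have near Z' : (forall j, cnorm (Z' j - Z j) < 2 * r) -> forall j, cabs2 (Z' j) <= cabs2 (Z0 j) + d.
  move=> h j.
  have h1 : cnorm (Z' j) <= cnorm (Z j) + 2 * r.
    rewrite -[Z' j](subrK (Z j)); apply: le_trans (cnormD _ _) _.
    by rewrite addrC lerD2l ltW.
  have h2 : cnorm (Z j) ^+ 2 <= cabs2 (Z0 j) + d / 2 by rewrite cnorm_sqr.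
  have h3 : cabs2 (Z0 j) <= sqn Z0.
    by rewrite /sqn (bigD1 j)//= lerDl sumr_ge0// => i _; rewrite cabs2_ge0.
  have h4 : cnorm (Z j) <= A.
    have := cnorm_ge0 (Z j) => h5; rewrite /A in A1 *; nra.
  have h5 := cnorm_ge0 (Z' j).
  have h6 : cnorm (Z' j) ^+ 2 <= (cnorm (Z j) + 2 * r) ^+ 2.
    by rewrite lerXn2r// nnegrE addr_ge0 ?cnorm_ge0// mulr_ge0// ltW.
  by rewrite -cnorm_sqr; nra.
have := dbar_factor N f Z (2 * r) c ltac:(lra) (ltW c0).
move=> /(_ _)/le_trans h; rewrite muleC -lee_pdivrMr ?invr_gt0 ?mulr_gt0 ?exprn_gt0//.
rewrite invrK -EFinM mulrC; apply: h.
  by move=> Z' hZ' j; apply: (hol_CD j hf); have [] := H Z' (near _ hZ').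
apply: iint_le => Z'.
  by rewrite lee_fin; case: ifP => // _; rewrite mulr_ge0 ?cabs2_ge0// ltW.
rewrite lee_fin; case: ifPn => [/forallP hh|_]; last by rewrite mulr_ge0// cabs2_ge0.
rewrite mulrC ler_wpM2l ?cabs2_ge0//.
have [|_ ->//] := H Z'; apply: near => j; have := hh j; lra.
Qed.

Hypothesis D0 : D (fun=> 0).

(** Every point of [D] lies in a polydisc centred at 0 on which [f] is bounded, hence a power
    series. Two such expansions agree on a common smaller polydisc, so a single family of
    coefficients serves all of [D]. *)
Lemma holomorphic_power_series f : holomorphic_on D f -> (sqnormW wt f < +oo)%E -> exists a, power_series_on D f a.
Proof.
move=> hf fin.
have W0 := sqnormW_ge0 wt_ge0 f.
have loc Z : D Z -> exists (p : mi -> C) (r : 'I_N -> R), (forall j, 0 < r j /\ cnorm (Z j) < r j) /\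
   forall W, (forall j, cnorm (W j) < r j) -> D W /\ power_series_at f p W.
  move=> DZ; have [d [K [d0 K0 h1 h2]]] := local_bound DZ.
  pose r j := Num.sqrt (cabs2 (Z j) + d / 2); pose r0 j := Num.sqrt (cabs2 (Z j) + d).
  have c0 j := cabs2_ge0 (Z j).
  have in0 W : (forall j, cnorm (W j) < r0 j) -> forall j, cabs2 (W j) <= cabs2 (Z j) + d.
    move=> h j; have := h j; rewrite /cnorm ltr_sqrt; first by move/ltW.
    by have := c0 j; lra.
  have rr j : r j < r0 j by rewrite /r /r0 ltr_sqrt; have := c0 j; lra.
  have rp j : 0 < r j by rewrite sqrtr_gt0; have := c0 j; lra.
  have [p hp] : exists a : mi -> C, forall W, (forall j, cnorm (W j) < r j) -> power_series_at f a W.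
    apply: (@polydisc_PS R N f r r0 (Num.sqrt (K * fine (sqnormW wt f)))).
    - by move=> j; rewrite rp rr.
    - by move=> W hW j; apply: (hol_CD j hf); apply: h1; exact: in0.
    - move=> W hW; rewrite /cnorm ler_wsqrtr// -lee_fin EFinM fineK ?ge0_fin_numE//.
      by apply: h2 => //; exact: in0.
  exists p, r; split=> [j|W hW]; first by rewrite rp /cnorm /r ltr_sqrt; have := c0 j; lra.
  by split; [apply: h1; apply: in0 => j; apply: lt_trans (rr j)|exact: hp].
have [a [ra [ra0 ha]]] := loc _ D0.
exists a => Z DZ; have [p [r [rp hp]]] := loc _ DZ.
suff -> : a = p by have [_] := hp Z (fun j => proj2 (rp j)).
apply/funext => I.
pose m j := Num.min (ra j) (r j); have m0 j : 0 < m j by rewrite lt_min (proj1 (ra0 j)) (proj1 (rp j)).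
pose E := [set W : cpt R N | forall j, cnorm (W j) < m j].
have hr w W : (forall j, cabs2 (w j) = 1) -> E W -> E (rotv w W).
  by move=> w1 h j; rewrite /rotv cnormM {1}/cnorm w1 sqrtr1 mul1r.
have psa : power_series_on E f a.
  by move=> W hW; apply: (proj2 (ha W _)) => j; apply: lt_le_trans (hW j) _; rewrite ge_min lexx.
have psp : power_series_on E f p.
  by move=> W hW; apply: (proj2 (hp W _)) => j; apply: lt_le_trans (hW j) _; rewrite ge_min lexx orbT.
(* A point with no zero coordinate: no monomial vanishes there and the coefficients can be
   compared. *)
pose W : cpt R N := fun j => (m j / 2)%:C.
have hE : E W.
  move=> j; rewrite cnorm_real gtr0_norm ?divr_gt0// ltr_pdivrMr//; have := m0 j; lra.
have := power_series_unique_coef hr I psa psp hE => /mulIf; apply.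
apply/prodf_neq0 => j _; rewrite expf_neq0// -cnorm_gt0 cnorm_real gtr0_norm ?divr_gt0//.
Qed.

End Reinhardt.

(** * Reproducing kernel of a Reinhardt weight *)

Section CubeSeries.
Variables (R : realType) (N : nat).
Local Notation C := R[i].
Local Notation mi := ('I_N -> nat).
Local Notation cube L := {ffun 'I_N -> 'I_L.+1}.

Lemma abs_cube_ccvg (t : mi -> C) (B : R) : (forall L, \sum_(g : cube L) cnorm (t (cube_mi g)) <= B) ->
  exists l, ccvg (fun L => \sum_(g : cube L) t (cube_mi g)) l.
Proof.
move=> hB; apply: ccvg_cauchy => eps e0.
have [M hM] := bounded_cube_cauchy (t := fun I => cnorm (t I)) (fun I => cnorm_ge0 _) hB e0.
by exists M => n n' h h'; apply: le_trans (abs_cube_diff t h') _; exact: hM.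
Qed.

Lemma cube_psum_trunc (b : mi -> C) L L' Z : (L <= L')%N ->
  cube_psum (fun I => if incube L I then b I else 0) L' Z = cube_psum b L Z.
Proof.
move=> LL'; rewrite /cube_psum -(sum_cube_widen (fun I => b I * monomial Z I) LL') [RHS]big_mkcond/=.
by apply: eq_bigr => g _; case: ifP => //; rewrite mul0r.
Qed.

Lemma power_series_at_psum (b : mi -> C) L Z : power_series_at (cube_psum b L) (fun I => if incube L I then b I else 0) Z.
Proof.
split; last first.
  by move=> eps e0; exists L => L' LL'; rewrite cube_psum_trunc// subrr cnorm0 ltW.
pose t I := cnorm ((if incube L I then b I else 0) * monomial Z I).
exists (\sum_(g : cube L) t (cube_mi g)) => L'.
apply: le_trans (sum_cube_le (t := t) (fun I => cnorm_ge0 _) (leq_maxr L L')) _.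
rewrite -(sum_cube_widen t (leq_maxl L L')) [leRHS]big_mkcond; apply: ler_sum => g _.
by rewrite /t; case: ifP => // _; rewrite mul0r cnorm0.
Qed.

Lemma cube_psum1 (I : mi) L (Z : cpt R N) : incube L I ->
  cube_psum (fun J => if [forall j, J j == I j] then 1 else 0 : C) L Z = monomial Z I.
Proof.
move=> hI; rewrite /cube_psum (bigD1 (to_cube L I))//= toCK// ifT ?mul1r; last by apply/forallP.
rewrite big1 ?addr0// => g gI; rewrite ifF ?mul0r//; apply/negbTE; move: gI; apply: contraNN => /forallP h.
by apply/eqP/fI_inj; rewrite toCK//; apply/funext => j; apply/eqP.
Qed.

Lemma incube_max (I : mi) : incube (\max_(j < N) I j) I.
Proof. by apply/forallP => j; exact: (leq_bigmax j). Qed.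

Lemma monomial_updE (Z : cpt R N) (j : 'I_N) c (I : mi) :
  monomial (upd j Z c) I = c ^+ I j * \prod_(l < N | l != j) Z l ^+ I l.
Proof.
rewrite /monomial (bigD1 j)//= upd_at; congr (_ * _); apply: eq_bigr => l lj.
by rewrite upd_ne.
Qed.

Lemma power_series_at_lin (f g : cpt R N -> C) a b (c : C) Z : power_series_at f a Z -> power_series_at g b Z ->
  power_series_at (fun Z => f Z + c * g Z) (fun I => a I + c * b I) Z.
Proof.
move=> [[B hB] h1] [[B' hB'] h2]; split.
  exists (B + cnorm c * B') => L.
  apply: (@le_trans _ _ (\sum_(g0 : cube L) (cnorm (a (cube_mi g0) * monomial Z (cube_mi g0)) + cnorm c * cnorm (b (cube_mi g0) * monomial Z (cube_mi g0))))).
    by apply: ler_sum => h _; rewrite mulrDl -mulrA -cnormM; exact: cnormD.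
  rewrite big_split/= -mulr_sumr; apply: lerD; first exact: hB.
  by rewrite ler_wpM2l ?cnorm_ge0//; exact: hB'.
move: (ccvgD h1 (ccvgZ c h2)); congr (ccvg _ _); apply/funext => L.
by rewrite /cube_psum mulr_sumr -big_split; apply: eq_bigr => h _ /=; rewrite mulrDl mulrA.
Qed.

End CubeSeries.

(** * Bounds for termwise differentiation *)

Section Binomial.
Variable R : realType.
Local Notation C := R[i].

(** The left side collects the binomial terms of index at least 2, where
    [(|h| / d)^i <= (|h| / d)^2]. *)
Lemma pow_deriv_bound (z h : C) (d : R) k : 0 < d -> cnorm h <= d ->
  cnorm ((z + h) ^+ k - z ^+ k - k%:R * z ^+ k.-1 * h) <= (cnorm h / d) ^+ 2 * (cnorm z + d) ^+ k.
Proof.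
move=> d0 hd; have z0 := cnorm_ge0 z; have h0 := cnorm_ge0 h.
have q0 : 0 <= cnorm h / d by rewrite divr_ge0// ltW.
have q1 : cnorm h / d <= 1 by rewrite ler_pdivrMr// mul1r.
case: k => [|[|k]].
- by rewrite !expr0 subrr mul0r mul0r subrr cnorm0 mulr1 exprn_ge0.
- rewrite (_ : _ - _ - _ = 0) ?cnorm0; last by rewrite /=; ring.
  by rewrite mulr_ge0 ?exprn_ge0 ?addr_ge0 ?(ltW d0).
rewrite exprDn (big_ord_recl _) big_ord_recl /= subn0 expr0 mulr1 bin0 mulr1n.
rewrite [bump 0 0]/= expr1 bin1 subn1 /=.
rewrite (_ : _ - _ - _ = \sum_(i < k.+1) z ^+ (k.+2 - (bump 0 (bump 0 i))) * h ^+ (bump 0 (bump 0 i)) *+ 'C(k.+2, bump 0 (bump 0 i))); last first.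
  by rewrite -mulr_natl; ring.
apply: le_trans (cnorm_sum _ _ _) _.
rewrite [in leRHS]exprDn [in leRHS]big_ord_recl [in leRHS]big_ord_recl /= !mulrDr.
have hh i : 0 <= (cnorm h / d) ^+ 2 * (cnorm z ^+ (k.+2 - i) * d ^+ i *+ 'C(k.+2, i)).
  by rewrite mulr_ge0 ?exprn_ge0// mulrn_wge0// mulr_ge0 ?exprn_ge0// ltW.
apply: ler_wpDl; first exact: (hh 0%N).
apply: ler_wpDl; first exact: (hh 1%N).
rewrite mulr_sumr; apply: ler_sum => i _; rewrite !/bump !add1n /=.
rewrite -[_ *+ 'C(_, _)]mulr_natl cnormM cnorm_nat cnormM !cnormX.
rewrite -[X in _ <= _ * X]mulr_natl [leRHS]mulrCA ler_wpM2l// [leRHS]mulrCA ler_wpM2l ?exprn_ge0//.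
have -> : cnorm h ^+ i.+2 = (cnorm h / d) ^+ i.+2 * d ^+ i.+2.
  by rewrite -exprMn divfK// gt_eqF.
rewrite ler_wpM2r ?exprn_ge0 ?(ltW d0)//.
by rewrite -[i.+2]addn2 exprD ler_piMl ?exprn_ge0// exprn_ile1.
Qed.

(** The left side is one term of the binomial expansion of the right side. *)
Lemma pow_deriv_le (x d : R) k : 0 <= x -> 0 <= d -> k%:R * x ^+ k.-1 * d <= (x + d) ^+ k.
Proof.
move=> x0 d0; case: k => [|k]; first by rewrite !mul0r expr0.
rewrite exprDn (big_ord_recl _) big_ord_recl /= subn0 expr0 mulr1 bin0 mulr1n.
rewrite [bump 0 0]/= expr1 bin1 subn1 /= -[_ * d *+ _]mulr_natl mulrA.
have h1 : 0 <= x ^+ k.+1 by rewrite exprn_ge0.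
apply: ler_wpDl => //; rewrite lerDl sumr_ge0// => i _.
by rewrite mulrn_wge0// mulr_ge0 ?exprn_ge0.
Qed.

End Binomial.

Section Kernel.
Variables (R : realType) (N : nat) (D : set (cpt R N)) (wt : cpt R N -> R).
Local Notation C := R[i].
Local Notation mi := ('I_N -> nat).
Local Notation cube L := {ffun 'I_N -> 'I_L.+1}.
Hypothesis wt_ge0 : forall Z, 0 <= wt Z.
Hypothesis wt_nice : borelR wt.
Hypothesis wt_rot : forall w Z, (forall j, cabs2 (w j) = 1) -> wt (rotv w Z) = wt Z.
Hypothesis wt_out : forall Z, ~ D Z -> wt Z = 0.
Hypothesis D_nbhs : forall Z, D Z -> exists d c : R, [/\ 0 < d, 0 < c &
  forall Z', (forall j, cabs2 (Z' j) <= cabs2 (Z j) + d) -> D Z' /\ c <= wt Z'].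
Hypothesis D0 : D (fun=> 0).
Hypothesis c_fin : forall I, (mon_sqnorm wt I < +oo)%E.

Let Drot := D_rot D_nbhs.

(** The series at the larger radius [|Z j| + p] dominates both the differentiated series and,
    through [pow_deriv_bound], remainders that are quadratic in [h]. *)
Lemma power_series_holomorphic f a : power_series_on D f a -> holomorphic_on D f.
Proof.
move=> ps Z DZ j; have [d [c [d0 c0 H]]] := D_nbhs DZ.
have z0 := cnorm_ge0 (Z j).
(* Ensures [(|Z j| + p)^2 <= |Z j|^2 + d], so that the enlarged point stays in [D]. *)
pose p := Num.min 1 (d / (2 * cnorm (Z j) + 1)).
have p0 : 0 < p by rewrite lt_min ltr01 divr_gt0//; lra.
have p1 : p <= 1 by rewrite ge_min lexx.
have p2 : p * (2 * cnorm (Z j) + 1) <= d.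
  by rewrite -ler_pdivlMr ?ge_min ?lexx ?orbT//; lra.
have inD h : cnorm h <= cnorm (Z j) + p -> D (upd j Z h).
  move=> hh; apply: (proj1 (H _ _)) => l; have [->|lj] := eqVneq l j; last by rewrite upd_ne// lerDl ltW.
  rewrite upd_at -!cnorm_sqr; have := cnorm_ge0 h; nra.
pose r := (cnorm (Z j) + p).
have r0 : 0 <= r by rewrite addr_ge0// ltW.
have Dr : D (upd j Z r%:C) by apply: inD; rewrite cnorm_real ger0_norm.
have [[B hB] _] := ps _ Dr.
have B0 : 0 <= B by apply: le_trans (hB 0%N); rewrite sumr_ge0// => g _; exact: cnorm_ge0.
pose P (I : mi) := \prod_(l < N | l != j) Z l ^+ I l.
pose e (I : mi) : C := a I * P I * ((I j)%:R * Z j ^+ (I j).-1).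
have tE I : cnorm (a I * monomial (upd j Z r%:C) I) = cnorm (a I * P I) * r ^+ I j.
  rewrite monomial_updE -/(P I) (_ : a I * _ = a I * P I * r%:C ^+ I j); last by ring.
  by rewrite [LHS]cnormM cnormX cnorm_real ger0_norm.
have [L hL] : exists L, ccvg (fun K => \sum_(g : cube K) e (cube_mi g)) L.
  apply: (@abs_cube_ccvg R N e (B / p)) => K.
  apply: (@le_trans _ _ (\sum_(g : cube K) cnorm (a (cube_mi g) * monomial (upd j Z r%:C) (cube_mi g)) / p)).
    apply: ler_sum => g _; rewrite tE /e cnormM -mulrA ler_wpM2l ?cnorm_ge0//.
    by rewrite ler_pdivlMr// cnormM cnorm_nat cnormX pow_deriv_le// ltW.
  by rewrite -mulr_suml ler_wpM2r ?invr_ge0 ?(ltW p0).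
exists L => eps e0.
exists (Num.min p (eps * p ^+ 2 / (B + 1))); split.
  by rewrite lt_min p0 divr_gt0// ?mulr_gt0 ?exprn_gt0//; lra.
move=> h h0; rewrite -cnorm_sqr ltr_pXn2r ?nnegrE ?cnorm_ge0//; last first.
  by rewrite le_min (ltW p0) divr_ge0// ?mulr_ge0 ?exprn_ge0 ?(ltW e0) ?(ltW p0)// addr_ge0.
rewrite lt_min => /andP[hp he].
have hn : 0 < cnorm h by rewrite cnorm_gt0.
have Zh : cshift Z j h = upd j Z (Z j + h).
  apply/funext => l; rewrite /cshift; have [->|lj] := eqVneq l j; first by rewrite upd_at.
  by rewrite upd_ne.
have Dh : D (upd j Z (Z j + h)).
  by apply: inD; apply: le_trans (cnormD _ _) _; rewrite lerD2l ltW.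
have main : cnorm (f (cshift Z j h) - f Z - L * h) <= (cnorm h / p) ^+ 2 * B.
  have [_ h1] := ps _ Dh; have [_ h2] := ps _ DZ.
  have h3 := ccvgD (ccvgD h1 (ccvgZ (-1) h2)) (ccvgZ (- h) hL).
  rewrite Zh (_ : _ - _ - _ = f (upd j Z (Z j + h)) + -1 * f Z + - h * L); last by ring.
  have := @ccvg_le _ _ _ 0 _ h3; rewrite subr0; apply; exists 0%N => K _.
  rewrite subr0 /cube_psum !mulr_sumr -!big_split /=.
  apply: le_trans (cnorm_sum _ _ _) _.
  apply: (@le_trans _ _ (\sum_(g : cube K) (cnorm h / p) ^+ 2 * cnorm (a (cube_mi g) * monomial (upd j Z r%:C) (cube_mi g)))).
    apply: ler_sum => g _; rewrite tE.
    have -> : monomial Z (cube_mi g) = Z j ^+ cube_mi g j * P (cube_mi g) by rewrite -{1}(upd_id Z j) monomial_updE.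
    rewrite [monomial (upd j Z (Z j + h)) _]monomial_updE -/(P (cube_mi g)).
    rewrite (_ : _ + _ + _ = a (cube_mi g) * P (cube_mi g) * ((Z j + h) ^+ cube_mi g j - Z j ^+ cube_mi g j - (cube_mi g j)%:R * Z j ^+ (cube_mi g j).-1 * h)); last first.
      by rewrite /e; ring.
    by rewrite [leRHS]mulrCA cnormM ler_wpM2l ?cnorm_ge0// pow_deriv_bound// ltW.
  by rewrite -mulr_sumr ler_wpM2l ?exprn_ge0 ?divr_ge0 ?cnorm_ge0 ?(ltW p0).
rewrite -cnorm_sqr ltr_pXn2r ?nnegrE ?cnorm_ge0 ?(ltW e0)//.
rewrite (_ : _ - L = (f (cshift Z j h) - f Z - L * h) / h); last by field.
rewrite cnormM cnormV ltr_pdivrMr//; apply: le_lt_trans main _.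
rewrite exprMn exprVn -mulrA expr2 -mulrA mulrC ltr_pM2r//.
rewrite mulrC -mulrA mulrC -mulrA mulrC.
move: he; rewrite ltr_pdivlMr; last by lra.
move=> he; have pp : 0 < p ^+ 2 by rewrite exprn_gt0.
rewrite -(@ltr_pM2r _ (p ^+ 2))// (_ : _ * p ^+ 2 = cnorm h * B).
  apply: le_lt_trans he; rewrite ler_wpM2l ?cnorm_ge0//; lra.
by field; rewrite gt_eqF.
Qed.

Let c I := fine (mon_sqnorm wt I).
Let cE I : mon_sqnorm wt I = (c I)%:E.
Proof. by rewrite /c fineK// ge0_fin_numE ?c_fin// sqnormW_ge0. Qed.

Lemma cube_psum_hol b L : holomorphic_on D (cube_psum b L).
Proof. by apply: power_series_holomorphic => Z _; exact: power_series_at_psum. Qed.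

(** The local bound around 0, taken for the monomial at a point with all coordinates [sqrt d], reads
    [0 < |Z^I|^2 <= K c_I]. *)
Lemma c_gt0 I : 0 < c I.
Proof.
have [d [K [d0 K0 h1 h2]]] := local_bound wt_ge0 D_nbhs D0.
have s0 : 0 < Num.sqrt d by rewrite sqrtr_gt0.
pose Z : cpt R N := fun=> (Num.sqrt d)%:C.
have hZ j : cabs2 (Z j) <= cabs2 (0 : C) + d.
  by rewrite -!cnorm_sqr cnorm0 cnorm_real gtr0_norm// sqr_sqrtr ?(ltW d0)// expr0n add0r.
have := h2 _ (cube_psum_hol (fun J => if [forall j, J j == I j] then 1 else 0) (\max_(j < N) I j)) Z hZ.
rewrite (_ : cube_psum _ _ = fun Z => monomial Z I); last first.
  by apply/funext => W; rewrite cube_psum1// incube_max.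
rewrite -/(mon_sqnorm wt I) cE -EFinM lee_fin => h.
have : 0 < K * c I; last by rewrite pmulr_rgt0.
apply: lt_le_trans h; rewrite -cnorm_sqr exprn_gt0// cnorm_monomial prodr_gt0// => j _.
by rewrite exprn_gt0// cnorm_real gtr0_norm.
Qed.

Lemma sum_coefE (a : mi -> C) L :
  (\sum_(g : cube L) (cabs2 (a (cube_mi g)))%:E * mon_sqnorm wt (cube_mi g))%E = (\sum_(g : cube L) cabs2 (a (cube_mi g)) * c (cube_mi g))%:E.
Proof. by rewrite -sumEFin; apply: eq_bigr => g _; rewrite cE. Qed.

Definition ker_coef (W : cpt R N) (I : mi) : C := (monomial W I)^*%C / (c I)%:C.

Lemma cabs2_kc W I : cabs2 (ker_coef W I) * c I = cabs2 (monomial W I) / c I.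
Proof.
have h := c_gt0 I; rewrite /ker_coef cabs2M -!cnorm_sqr cnorm_conj cnormV cnorm_real gtr0_norm//.
by field; rewrite gt_eqF.
Qed.

Lemma ker_coef_conj W I : (ker_coef W I)^*%C * (c I)%:C = monomial W I.
Proof.
have cC : (c I)%:C != 0 :> C by rewrite -cnorm_gt0 cnorm_real gtr0_norm ?c_gt0.
have -> : ker_coef W I = (monomial W I)^*%C * ((c I)^-1)%:C by rewrite /ker_coef -fmorphV.
rewrite rmorphM /= conjcK -[RHS]mulr1 -mulrA; congr (_ * _).
have c0 : c I != 0 by rewrite gt_eqF ?c_gt0.
by apply: complexP; rewrite /=; field.
Qed.

Lemma ker_coef_mon W I : ker_coef W I * monomial W I = (cabs2 (monomial W I) / c I)%:C.
Proof. by rewrite /ker_coef mulrAC [_^*%C * _]mulrC -cabs2_conj rmorphM /= fmorphV. Qed.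

(* The local bound for the partial kernel [S = \sum_I conj(W^I) Z^I / ||Z^I||^2] reads
   [S(W)^2 <= K ||S||^2 = K S(W)]. *)
Lemma ker_coef_bound W : D W -> exists B, forall L, \sum_(g : cube L) cabs2 (monomial W (cube_mi g)) / c (cube_mi g) <= B.
Proof.
move=> DW; have [d [K [d0 K0 h1 h2]]] := local_bound wt_ge0 D_nbhs DW.
exists K => L; set T := \sum_(g : cube L) _.
have T0 : 0 <= T by rewrite sumr_ge0// => g _; rewrite divr_ge0 ?cabs2_ge0// ltW// c_gt0.
have := h2 _ (cube_psum_hol (ker_coef W) L) W (fun j => ltac:(by rewrite lerDl ltW)).
rewrite sqnormW_psum// sum_coefE (eq_bigr (fun g : cube L => cabs2 (monomial W (cube_mi g)) / c (cube_mi g))); last first.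
  by move=> g _; exact: cabs2_kc.
have -> : cube_psum (ker_coef W) L W = T%:C.
  rewrite rmorph_sum; apply: eq_bigr => g _.
  exact: ker_coef_mon.
rewrite -cnorm_sqr cnorm_real ger0_norm// -/T -EFinM lee_fin => h.
have [->|Tn] := eqVneq T 0; first exact: ltW.
have Tp : 0 < T by rewrite lt_def Tn.
by move: h; rewrite expr2 ler_pM2r.
Qed.

Lemma ker_coef_abs Z W : D Z -> D W -> exists B, forall L, \sum_(g : cube L) cnorm (ker_coef W (cube_mi g) * monomial Z (cube_mi g)) <= B.
Proof.
move=> DZ DW; have [B hB] := ker_coef_bound DZ; have [B' hB'] := ker_coef_bound DW.
exists (B + B') => L; apply: (@le_trans _ _ (\sum_(g : cube L) (cabs2 (monomial Z (cube_mi g)) / c (cube_mi g) + cabs2 (monomial W (cube_mi g)) / c (cube_mi g)))).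
  apply: ler_sum => g _; rewrite /ker_coef !cnormM cnorm_conj cnormV cnorm_real gtr0_norm ?c_gt0//.
  rewrite -mulrDl mulrAC ler_wpM2r ?invr_ge0 ?(ltW (c_gt0 _))// -!cnorm_sqr.
  have := cnorm_ge0 (monomial Z (cube_mi g)); have := cnorm_ge0 (monomial W (cube_mi g)); nra.
by rewrite big_split lerD.
Qed.

Definition ccvg_lim (u : nat -> C) : C := xget 0 [set l | ccvg u l].

Lemma limCP u l : ccvg u l -> ccvg u (ccvg_lim u).
Proof. by move=> h; rewrite /ccvg_lim; case: xgetP => [_ -> //|/(_ l)]. Qed.

Definition ker (Z W : cpt R N) : C := ccvg_lim (fun L => cube_psum (ker_coef W) L Z).

Lemma ker_PS W : D W -> power_series_on D (fun Z => ker Z W) (ker_coef W).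
Proof.
move=> DW Z DZ; have [B hB] := ker_coef_abs DZ DW; split; first by exists B.
have [l hl] := @abs_cube_ccvg R N (fun I => ker_coef W I * monomial Z I) B hB; exact: limCP hl.
Qed.

Lemma sqnormW_fin_bound f a : power_series_on D f a -> (sqnormW wt f < +oo)%E ->
  forall L, \sum_(g : cube L) cabs2 (a (cube_mi g)) * c (cube_mi g) <= fine (sqnormW wt f).
Proof.
move=> ps fin L; rewrite -lee_fin fineK ?ge0_fin_numE ?sqnormW_ge0// -sum_coefE.
exact: (sqnormW_PS_ge wt_ge0 wt_nice wt_rot wt_out Drot ps).
Qed.

Lemma sqnormW_fin_of_bound f a B : power_series_on D f a ->
  (forall L, \sum_(g : cube L) cabs2 (a (cube_mi g)) * c (cube_mi g) <= B) -> (sqnormW wt f < +oo)%E.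
Proof.
move=> ps hB; apply: (@le_lt_trans _ _ B%:E); last exact: ltry.
by apply: (sqnormW_PS_le wt_ge0 wt_nice wt_rot wt_out ps) => L; rewrite sum_coefE lee_fin.
Qed.

(** Bessel keeps the partial sums below the norm, and Fatou forbids a smaller limit. *)
Lemma sqnormW_lim f a : power_series_on D f a -> (sqnormW wt f < +oo)%E ->
  ccvg (fun L => (\sum_(g : cube L) cabs2 (a (cube_mi g)) * c (cube_mi g))%:C) (fine (sqnormW wt f))%:C.
Proof.
move=> ps fin eps e0; have ub := sqnormW_fin_bound ps fin.
have [M hM] : exists M, fine (sqnormW wt f) - eps < \sum_(g : cube M) cabs2 (a (cube_mi g)) * c (cube_mi g).
  apply: contrapT => /forallNP h.
  have : (sqnormW wt f <= (fine (sqnormW wt f) - eps)%:E)%E.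
    apply: (sqnormW_PS_le wt_ge0 wt_nice wt_rot wt_out ps) => L; rewrite sum_coefE lee_fin leNgt.
    by apply/negP; exact: h.
  rewrite -{1}(@fineK _ (sqnormW wt f)) ?ge0_fin_numE ?sqnormW_ge0// lee_fin; lra.
exists M => L ML; rewrite -rmorphB cnorm_real distrC ger0_norm; last by rewrite subr_ge0.
have h : forall I, 0 <= cabs2 (a I) * c I by move=> I; rewrite mulr_ge0 ?cabs2_ge0// ltW// c_gt0.
have := sum_cube_le (t := fun I => cabs2 (a I) * c I) h ML; lra.
Qed.

Lemma sqnormW_lin_fin f g a b s : power_series_on D f a -> power_series_on D g b -> (sqnormW wt f < +oo)%E -> (sqnormW wt g < +oo)%E ->
  cnorm s = 1 -> (sqnormW wt (fun Z => f Z + s * g Z)%R < +oo)%E.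
Proof.
move=> pf pg ff fg s1.
have ps : power_series_on D (fun Z => f Z + s * g Z) (fun I => a I + s * b I) by move=> Z DZ; apply: power_series_at_lin; [exact: pf|exact: pg].
apply: (sqnormW_fin_of_bound (B := 2 * (fine (sqnormW wt f) + fine (sqnormW wt g))) ps) => L.
have h1 := sqnormW_fin_bound pf ff L; have h2 := sqnormW_fin_bound pg fg L.
apply: (@le_trans _ _ (2 * (\sum_(g : cube L) cabs2 (a (cube_mi g)) * c (cube_mi g) + \sum_(g : cube L) cabs2 (b (cube_mi g)) * c (cube_mi g)))); last by lra.
rewrite -big_split mulr_sumr; apply: ler_sum => h _ /=.
rewrite -mulrDl mulrA ler_wpM2r ?(ltW (c_gt0 _))// -!cnorm_sqr.
have := cnormD (a (cube_mi h)) (s * b (cube_mi h)); rewrite cnormM s1 mul1r => h3.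
have := cnorm_ge0 (a (cube_mi h) + s * b (cube_mi h)).
have := sqr_ge0 (cnorm (a (cube_mi h)) - cnorm (b (cube_mi h))).
have := cnorm_ge0 (a (cube_mi h)); have := cnorm_ge0 (b (cube_mi h)); nra.
Qed.

Lemma polarization_C (x y : C) : (\sum_(k < 4) 'i%C ^+ k * (cabs2 (x + 'i%C ^+ k * y))%:C) / 4 = x * y^*%C.
Proof.
have i2 : 'i%C * 'i%C = -1 :> C by rewrite -expr2 sqr_i.
have i3 : 'i%C ^+ 3 = - 'i%C :> C by rewrite !exprS expr0 mulr1 i2 mulrN1.
have i2' : 'i%C ^+ 2 = -1 :> C by rewrite sqr_i.
rewrite !big_ord_recl big_ord0 /= !/bump /= !add1n expr0 expr1 i2' i3 !mul1r addr0.
case: x y => [x1 x2] [y1 y2]; rewrite /cabs2 /=.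
apply: (mulIf (x := 4)); first by rewrite pnatr_eq0.
rewrite divfK ?pnatr_eq0//; apply: complexP; rewrite /=; ring.
Qed.

Definition inner (f g : cpt R N -> C) : C :=
  (\sum_(k < 4) ('i%C ^+ k) * ((fine (sqnormW wt (fun Z => f Z + 'i%C ^+ k * g Z)))%:C)%C) / 4.

(** The four norms in [inner] are limits of sums of squared coefficients; polarization of each
    coefficient pair recombines them. *)
Lemma inner_lim f g a b : power_series_on D f a -> power_series_on D g b -> (sqnormW wt f < +oo)%E -> (sqnormW wt g < +oo)%E ->
  ccvg (fun L => \sum_(h : cube L) a (cube_mi h) * (b (cube_mi h))^*%C * (c (cube_mi h))%:C) (inner f g).
Proof.
move=> pf pg ff fg; rewrite /inner mulrC.
have E L : \sum_(h : cube L) a (cube_mi h) * (b (cube_mi h))^*%C * (c (cube_mi h))%:C =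
  4^-1 * \sum_(k < 4) 'i%C ^+ k * (\sum_(h : cube L) cabs2 (a (cube_mi h) + 'i%C ^+ k * b (cube_mi h)) * c (cube_mi h))%:C.
  under [in RHS]eq_bigr => k _ do rewrite rmorph_sum mulr_sumr.
  rewrite exchange_big mulr_sumr; apply: eq_bigr => h _ /=.
  rewrite -polarization_C mulrC [_ / 4]mulrC mulrCA; congr (_ * _).
  rewrite mulr_sumr; apply: eq_bigr => k _; rewrite rmorphM /=; ring.
under eq_fun do rewrite E.
apply: ccvgZ; apply: ccvg_sum => k; apply: ccvgZ.
apply: (@sqnormW_lim (fun Z => f Z + 'i%C ^+ k * g Z) (fun I => a I + 'i%C ^+ k * b I)).
  by move=> Z DZ; apply: power_series_at_lin; [exact: pf|exact: pg].
by apply: sqnormW_lin_fin pf pg ff fg _; rewrite cnormX cnormi expr1n.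
Qed.

Lemma ker_fin W : D W -> (sqnormW wt (fun Z => ker Z W) < +oo)%E.
Proof.
move=> DW; have [B hB] := ker_coef_bound DW; apply: (sqnormW_fin_of_bound (B := B) (ker_PS DW)) => L.
rewrite (eq_bigr (fun g : cube L => cabs2 (monomial W (cube_mi g)) / c (cube_mi g))) => [|g _]; [exact: hB|exact: cabs2_kc].
Qed.

Lemma ker_repr f W : holomorphic_on D f -> (sqnormW wt f < +oo)%E -> D W -> f W = inner f (fun Z => ker Z W).
Proof.
move=> hf ff DW; have [a pf] := holomorphic_power_series wt_ge0 D_nbhs D0 hf ff.
have h1 := inner_lim pf (ker_PS DW) ff (ker_fin DW).
have [_ h2] := pf W DW; apply: ccvg_unique h2 _; move: h1; congr (ccvg _ _).
apply/funext => L; apply: eq_bigr => h _; rewrite -mulrA; congr (_ * _).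
exact: ker_coef_conj.
Qed.

(* Reproducing the monomial [Z^I] determines the [I]-th coefficient of [K(., Z)]. *)
Lemma repr_unique (K : cpt R N -> cpt R N -> C) :
  (forall W, D W -> holomorphic_on D (fun Z => K Z W) /\ (sqnormW wt (fun Z => K Z W) < +oo)%E) ->
  (forall f W, holomorphic_on D f -> (sqnormW wt f < +oo)%E -> D W -> f W = inner f (fun Z => K Z W)) ->
  forall Z, D Z -> ccvg (fun L => (\sum_(g : cube L) cabs2 (monomial Z (cube_mi g)) / c (cube_mi g))%:C) (K Z Z).
Proof.
move=> hK hr Z DZ; have [hol fin] := hK Z DZ.
have [b pb] := holomorphic_power_series wt_ge0 D_nbhs D0 hol fin.
have [_ h2] := pb Z DZ; move: h2; congr (ccvg _ _); apply/funext => L.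
rewrite rmorph_sum; apply: eq_bigr => g _ /=; set I := cube_mi g.
pose e := fun J : mi => if [forall j, J j == I j] then 1 else 0 : C.
pose M := (\max_(j < N) I j)%N.
have eM W : cube_psum e M W = monomial W I by rewrite cube_psum1// incube_max.
have pe : power_series_on D (fun W => monomial W I) (fun J => if incube M J then e J else 0).
  by move=> W _; rewrite (_ : (fun W => monomial W I) = cube_psum e M); [exact: power_series_at_psum|apply/funext => W'; rewrite eM].
have := hr (fun W => monomial W I) Z (power_series_holomorphic pe) (c_fin I) DZ.
have := inner_lim pe pb (c_fin I) fin => h1 h3; rewrite -h3 in h1.
have c0 := c_gt0 I.
have cC : (c I)%:C != 0 :> C by rewrite -cnorm_gt0 cnorm_real gtr0_norm.
(* Once the cube contains [I] the sum is constant, since the monomial has a single coefficient. *)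
have h4 : ccvg (fun L => \sum_(h : cube L) (if incube M (cube_mi h) then e (cube_mi h) else 0) * (b (cube_mi h))^*%C * (c (cube_mi h))%:C) ((b I)^*%C * (c I)%:C).
  move=> eps e0; exists M => L' ML'.
  have IL' : incube L' I by apply/forallP => j; apply: leq_trans ML'; exact: (forallP (incube_max I) j).
  rewrite (bigD1 (to_cube L' I))//= toCK// ifT ?incube_max// /e ifT; last by apply/forallP.
  rewrite big1 ?addr0 ?mul1r ?subrr ?cnorm0 ?(ltW e0)// => h hI.
  rewrite (_ : (if _ then _ else _) = 0) ?mul0r//; case: ifP => // _; rewrite ifF//.
  apply/negbTE; move: hI; apply: contraNN => /forallP h'.
  by apply/eqP/fI_inj; rewrite toCK//; apply/funext => j; apply/eqP.
have := ccvg_unique h1 h4 => E.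
have -> : b I = (monomial Z I)^*%C / (c I)%:C.
  apply: (mulIf cC); rewrite divfK// E rmorphM /= conjcK; congr (_ * _).
  by rewrite /= oppr0.
exact: ker_coef_mon.
Qed.

End Kernel.

(** * Kaehler metric and volume density *)

Lemma det2 (F : comNzRingType) (M : 'M[F]_2) : \det M = M 0 0 * M 1 1 - M 0 1 * M 1 0.
Proof.
rewrite (expand_det_row _ 0) !big_ord_recl big_ord0 /cofactor !det_mx11 !mxE /= addr0.
rewrite expr0 expr1 mul1r mulN1r mulrN.
have e (i j : 'I_2) : val i = val j -> i = j by exact: val_inj.
by congr (M _ _ * M _ _ - M _ _ * M _ _); apply: e.
Qed.

(* Sylvester: the block matrix [[A, - U], [V, 1]] is triangularized in two ways. *)
Lemma det_add_mul (F : fieldType) N k (A : 'M[F]_N) (U : 'M[F]_(N, k)) (V : 'M[F]_(k, N)) :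
  A \in unitmx -> \det (A + U *m V) = \det A * \det (1%:M + V *m invmx A *m U).
Proof.
move=> uA; pose B := block_mx A (- U) V 1%:M.
have h1 : B *m block_mx 1%:M 0 (- V) 1%:M = block_mx (A + U *m V) (- U) 0 1%:M.
  by rewrite mulmx_block !mulmx1 !mulmx0 !add0r !mul1mx mulNmx mulmxN opprK subrr.
have h2 : block_mx 1%:M 0 (- (V *m invmx A)) 1%:M *m B = block_mx A (- U) 0 (1%:M + V *m invmx A *m U).
  by rewrite mulmx_block !mul1mx !mul0mx !addr0 !mulNmx mulmxN opprK mulmxKV// addNr addrC.
have := congr1 (fun M => \det M) h1; rewrite /= det_mulmx det_lblock det_ublock !det1 !mulr1 => <-.
have := congr1 (fun M => \det M) h2; rewrite /= det_mulmx det_lblock det_ublock !det1 !mul1r => <- //.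
Qed.

Section Der.
Variable R : realType.
Implicit Types (f g : R -> R) (x a b : R).
Local Notation der x f a := (is_derive x 1 f a).

Lemma der_eq f x a b : der x f a -> a = b -> der x f b.
Proof. by move=> h <-. Qed.
Lemma der_cst x a : der x (fun=> a) 0.
Proof. exact: is_derive_cst. Qed.
Lemma der_id x : der x (fun t => t) 1.
Proof. exact: is_derive_id. Qed.
Lemma der_add f g x a b : der x f a -> der x g b -> der x (fun t => f t + g t) (a + b).
Proof. by move=> h1 h2; exact: is_deriveD. Qed.
Lemma der_sub f g x a b : der x f a -> der x g b -> der x (fun t => f t - g t) (a - b).
Proof. by move=> h1 h2; exact: is_deriveB. Qed.
Lemma der_opp f x a : der x f a -> der x (fun t => - f t) (- a).
Proof. by move=> h; exact: is_deriveN. Qed.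
Lemma der_mul f g x a b : der x f a -> der x g b -> der x (fun t => f t * g t) (a * g x + f x * b).
Proof.
move=> h1 h2; apply: der_eq (is_deriveM h1 h2) _.
by rewrite /GRing.scale /= addrC [g x * _]mulrC.
Qed.
Lemma der_comp f g x a b : der (g x) f b -> der x g a -> der x (fun t => f (g t)) (b * a).
Proof. by move=> h1 h2; exact: is_derive1_comp. Qed.
Lemma der_inv f x a : f x != 0 -> der x f a -> der x (fun t => (f t)^-1) (- a / f x ^+ 2).
Proof. by move=> h0 h; apply: der_eq (is_deriveV h0 h) _; rewrite /GRing.scale /= !mulNr mulrC. Qed.
Lemma der_sum k (f : 'I_k -> R -> R) (a : 'I_k -> R) x : (forall i, der x (f i) (a i)) ->
  der x (fun t => \sum_i f i t) (\sum_i a i).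
Proof.
move=> h; have := is_derive_sum (h := f) (x := x) (v := 1) (dh := a) h.
by congr (is_derive _ _ _ _); apply/funext => t; rewrite fct_sumE.
Qed.
Lemma der_cont f x a : der x f a -> {for x, continuous f}.
Proof. by move=> h; apply: differentiable_continuous; apply/derivable1_diffP; have [] := h. Qed.
Lemma der1 f x a : der x f a -> derive1 f x = a.
Proof. by move=> h; rewrite derive1E; exact: derive_val. Qed.
End Der.

(** * The metric of the potential and its determinant *)

Section Metric.
Variables (R : realType) (n m : nat) (mu nu : R).
Local Notation C := R[i].
Local Notation N := (n + m)%N.
Local Notation der x f a := (is_derive (x : R) 1 f a).
Implicit Types (Z v : cpt R N).

Definition gauss_factor Z : R := expR (- (mu * sqn (zpart Z))).
Definition defining_fun Z : R := gauss_factor Z - sqn (wpart Z).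
Definition line Z v (t : R) : cpt R N := fun k => Z k + t%:C * v k.
Definition dsqn k (z v : 'I_k -> C) : R :=
  \sum_j (2 * (complex.Re (z j) * complex.Re (v j) + complex.Im (z j) * complex.Im (v j))).

Lemma line0 Z v : line Z v 0 = Z.
Proof. by apply/funext => k; rewrite /line mul0r addr0. Qed.

Lemma der_sqn k (z v : 'I_k -> C) : der 0 (fun t => sqn (fun j => z j + t%:C * v j)) (dsqn z v).
Proof.
apply: (@der_sum R k (fun j t => cabs2 (z j + t%:C * v j))) => j.
case: (z j) (v j) => [x y] [a b] /=.
rewrite (_ : (fun t => _) = (fun t => (x + t * a) * (x + t * a) + (y + t * b) * (y + t * b))); last first.
  by apply/funext => t; rewrite /cabs2 /= !expr2 !mul0r subr0 addr0.
have h c d : der 0 (fun t => c + t * d) d.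
  apply: der_eq (der_add (der_cst _ c) (der_mul (der_id _) (der_cst _ d))) _.
  by rewrite mul1r mulr0 addr0 add0r.
apply: der_eq (der_add (der_mul (h x a) (h x a)) (der_mul (h y b) (h y b))) _.
by rewrite !mul0r !addr0; ring.
Qed.

Definition dsqn_z Z v := dsqn (zpart Z) (zpart v).
Definition dsqn_w Z v := dsqn (wpart Z) (wpart v).

Lemma der_A Z v : der 0 (fun t => sqn (zpart (line Z v t))) (dsqn_z Z v).
Proof. exact: der_sqn. Qed.
Lemma der_B Z v : der 0 (fun t => sqn (wpart (line Z v t))) (dsqn_w Z v).
Proof. exact: der_sqn. Qed.

Lemma der_E Z v : der 0 (fun t => gauss_factor (line Z v t)) (- (mu * gauss_factor Z * dsqn_z Z v)).
Proof.
have h : der 0 (fun t => - (mu * sqn (zpart (line Z v t)))) (- (mu * dsqn_z Z v)).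
  by apply: der_eq (der_opp (der_mul (der_cst _ mu) (der_A Z v))) _; ring.
apply: der_eq (der_comp (is_derive_expR _) h) _.
by rewrite line0 -/(gauss_factor Z); ring.
Qed.

Lemma der_Q Z v : der 0 (fun t => defining_fun (line Z v t)) (- (mu * gauss_factor Z * dsqn_z Z v) - dsqn_w Z v).
Proof. exact: der_sub (der_E Z v) (der_B Z v). Qed.

Lemma DnmE Z : Dnm n m mu Z <-> 0 < defining_fun Z.
Proof. by rewrite /Dnm /= /defining_fun subr_gt0. Qed.

Lemma der_Phi Z v : 0 < defining_fun Z -> der 0 (fun t => PhiNM n m mu nu (line Z v t))
  (nu * mu * dsqn_z Z v + (mu * gauss_factor Z * dsqn_z Z v + dsqn_w Z v) / defining_fun Z).
Proof.
move=> Q0; have Q0' : 0 < defining_fun (line Z v 0) by rewrite line0.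
have hl := @der_comp R (@ln R) (fun t => defining_fun (line Z v t)) 0 _ _ (is_derive1_ln Q0') (der_Q Z v).
apply: der_eq (der_sub (der_mul (der_cst _ (nu * mu)) (der_A Z v)) hl) _.
by rewrite line0 mul0r add0r -mulrN mulrC -mulrN; congr (_ + _); rewrite opprB; ring.
Qed.

Lemma near_line Z v : 0 < defining_fun Z -> \forall t \near (0 : R), 0 < defining_fun (line Z v t).
Proof.
move=> Q0; have := der_cont (der_Q Z v); move/cvgrPdist_lt => /(_ (defining_fun Z) Q0).
apply: filterS => t; rewrite /= line0 ltr_norml => /andP[_]; lra.
Qed.

(** Real 0/1 indicators allow one formula for derivatives in the [z]- and in the [w]-directions. *)
Definition is_zcoord (k : 'I_N) : R := if fintype.split k is inl _ then 1 else 0.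
Definition is_wcoord (k : 'I_N) : R := if fintype.split k is inl _ then 0 else 1.

Lemma splitl i : fintype.split (lshift m i : 'I_N) = inl i.
Proof. by rewrite -[lshift m i]/(unsplit (inl i)) unsplitK. Qed.
Lemma splitr' i : fintype.split (rshift n i : 'I_N) = inr i.
Proof. by rewrite -[rshift n i]/(unsplit (inr i)) unsplitK. Qed.

Lemma dA_evec Z k c : dsqn_z Z (evec k c) = is_zcoord k * (2 * (complex.Re (Z k) * complex.Re c + complex.Im (Z k) * complex.Im c)).
Proof.
rewrite /dsqn_z /dsqn /is_zcoord /zpart /evec -(splitK k); case: (fintype.split k) => i /=.
  rewrite splitl mul1r (bigD1 i)//= eqxx big1 ?addr0// => j ji.
  by rewrite (inj_eq (@lshift_inj _ _)) (negbTE ji) /= !mulr0 addr0 mulr0.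
rewrite splitr' mul0r big1// => j _.
by rewrite eq_lrshift /= !mulr0 addr0 mulr0.
Qed.

Lemma dB_evec Z k c : dsqn_w Z (evec k c) = is_wcoord k * (2 * (complex.Re (Z k) * complex.Re c + complex.Im (Z k) * complex.Im c)).
Proof.
rewrite /dsqn_w /dsqn /is_wcoord /wpart /evec -(splitK k); case: (fintype.split k) => i /=; last first.
  rewrite splitr' mul1r (bigD1 i)//= eqxx big1 ?addr0// => j ji.
  by rewrite (inj_eq (@rshift_inj _ _)) (negbTE ji) /= !mulr0 addr0 mulr0.
rewrite splitl mul0r big1// => j _.
by rewrite eq_rlshift /= !mulr0 addr0 mulr0.
Qed.

(** Since the potential depends only on the moduli, its derivative in the conjugate of [Z k] is a
    real multiple of [Z k], with this factor. *)
Definition dbar_factor k Z : R := is_zcoord k * (nu * mu + mu * (gauss_factor Z / defining_fun Z)) + is_wcoord k * (defining_fun Z)^-1.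

Lemma dzb_Phi k Z : 0 < defining_fun Z -> dzb k (fun W => (PhiNM n m mu nu W)%:C) Z = (dbar_factor k Z)%:C * Z k.
Proof.
move=> Q0.
have dd v : dirderC (fun W => (PhiNM n m mu nu W)%:C) v Z =
   (nu * mu * dsqn_z Z v + (mu * gauss_factor Z * dsqn_z Z v + dsqn_w Z v) / defining_fun Z)%:C.
  rewrite /dirderC /=; congr (_ +i* _); first exact: der1 (der_Phi v Q0).
  by apply: (@der1 R (fun=> 0)); exact: der_cst.
rewrite /dzb !dd !dA_evec !dB_evec.
apply: (mulIf (x := 2)); first by rewrite pnatr_eq0.
rewrite divfK ?pnatr_eq0// /dbar_factor; move: (gauss_factor Z) (defining_fun Z) (is_zcoord k) (is_wcoord k) Q0 => E Q a b Q0.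
have Qn : Q != 0 by rewrite gt_eqF.
case: (Z k) => x y; apply: complexP; rewrite /=; by field.
Qed.

Definition dh Z v k : R := is_zcoord k * (mu * ((mu * gauss_factor Z * (gauss_factor Z - defining_fun Z) * dsqn_z Z v + gauss_factor Z * dsqn_w Z v) / defining_fun Z ^+ 2)) +
  is_wcoord k * ((mu * gauss_factor Z * dsqn_z Z v + dsqn_w Z v) / defining_fun Z ^+ 2).

Lemma der_hk Z v k : 0 < defining_fun Z -> der 0 (fun t => dbar_factor k (line Z v t)) (dh Z v k).
Proof.
move=> Q0; have Qn : defining_fun Z != 0 by rewrite gt_eqF.
have hi : der 0 (fun t => (defining_fun (line Z v t))^-1) (- (- (mu * gauss_factor Z * dsqn_z Z v) - dsqn_w Z v) / defining_fun Z ^+ 2).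
  by apply: der_eq (der_inv _ (der_Q Z v)) _; rewrite line0.
have hEQ := der_mul (der_E Z v) hi.
apply: der_eq (der_add (der_mul (der_cst _ (is_zcoord k)) (der_add (der_cst _ (nu * mu)) (der_mul (der_cst _ mu) hEQ)))
   (der_mul (der_cst _ (is_wcoord k)) hi)) _.
by rewrite !line0 /dh; field.
Qed.

Lemma dz_dzb j k Z : 0 < defining_fun Z ->
  kmetric (PhiNM n m mu nu) Z j k =
  (is_zcoord k * (mu * ((mu * gauss_factor Z * (gauss_factor Z - defining_fun Z) * is_zcoord j + gauss_factor Z * is_wcoord j) / defining_fun Z ^+ 2)) +
   is_wcoord k * ((mu * gauss_factor Z * is_zcoord j + is_wcoord j) / defining_fun Z ^+ 2))%:C * ((Z j)^*%C * Z k) + (dbar_factor k Z)%:C * (j == k)%:R.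
Proof.
move=> Q0; rewrite mxE.
have dd v : dirderC (fun W => dzb k (fun W => (PhiNM n m mu nu W)%:C) W) v Z = (dh Z v k)%:C * Z k + (dbar_factor k Z)%:C * v k.
  rewrite /dirderC /=.
  have hz c d : der 0 (fun t => c + t * d) d.
    apply: der_eq (der_add (der_cst _ c) (der_mul (der_id _) (der_cst _ d))) _.
    by rewrite mul1r mulr0 addr0 add0r.
  have gen (p : C -> R) : (forall (x : R) z, p (x%:C * z) = x * p z) -> (forall z w, p (z + w) = p z + p w) ->
      derive1 (fun t => p (dzb k (fun W => (PhiNM n m mu nu W)%:C) (fun l => Z l + t%:C * v l))) 0 =
      p ((dh Z v k)%:C * Z k + (dbar_factor k Z)%:C * v k).
    move=> pZ pD; apply: der1.
    (* The formula for the first derivative holds only inside the domain, hence along the line only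
       for [t] near 0. *)
    apply: (@near_eq_is_derive _ _ _ (fun t => dbar_factor k (line Z v t) * (p (Z k) + t * p (v k)))).
    - near=> t; rewrite -/(line Z v t) dzb_Phi; last by near: t; exact: near_line.
      by rewrite pZ pD pZ.
    - apply: der_eq (der_mul (der_hk v k Q0) (hz _ _)) _.
      by rewrite line0 mul0r addr0 pD !pZ.
  rewrite (gen (fun z => complex.Re z)); last 2 first.
  - by move=> x [a b]; rewrite /= mul0r subr0.
  - by move=> [a b] [c d].
  rewrite (gen (fun z => complex.Im z)); last 2 first.
  - by move=> x [a b]; rewrite /= mul0r addr0.
  - by move=> [a b] [c d].
  by case: (_ * _ + _).
rewrite /dz !dd /dh !dA_evec !dB_evec.
apply: (mulIf (x := 2)); first by rewrite pnatr_eq0.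
rewrite divfK ?pnatr_eq0//.
have Ee c : evec j c k = c * (j == k)%:R :> C by rewrite /evec eq_sym; case: eqP; rewrite ?mulr1 ?mulr0.
rewrite !Ee.
have -> : (j == k)%:R = ((j == k)%:R : R)%:C :> C by rewrite rmorph_nat.
move: (gauss_factor Z) (defining_fun Z) (is_zcoord k) (is_wcoord k) (is_zcoord j) (is_wcoord j) Q0 (dbar_factor k Z) ((j == k)%:R : R) => E Q a b a' b' Q0 h d.
have Qn : Q != 0 by rewrite gt_eqF.
case: (Z k) (Z j) => x y [x' y']; apply: complexP; rewrite /=; by field.
Unshelve. all: by end_near. Qed.

Lemma sum_cabs2 k (z : 'I_k -> C) : (sqn z)%:C = \sum_j (z j)^*%C * z j.
Proof.
rewrite /sqn rmorph_sum; apply: eq_bigr => j _ /=.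
by case: (z j) => x y; apply: complexP; rewrite /cabs2 /=; ring.
Qed.

Lemma sA_l i : is_zcoord (lshift m i) = 1. Proof. by rewrite /is_zcoord splitl. Qed.
Lemma sA_r i : is_zcoord (rshift n i) = 0. Proof. by rewrite /is_zcoord splitr'. Qed.
Lemma sB_l i : is_wcoord (lshift m i) = 0. Proof. by rewrite /is_wcoord splitl. Qed.
Lemma sB_r i : is_wcoord (rshift n i) = 1. Proof. by rewrite /is_wcoord splitr'. Qed.

Hypothesis mu0 : 0 < mu.
Hypothesis nu1 : -1 < nu.

Lemma E_ge_Q Z : defining_fun Z <= gauss_factor Z.
Proof. by rewrite /defining_fun gerBl sumr_ge0// => j _; rewrite cabs2_ge0. Qed.

Lemma nuEQ_gt0 Z : 0 < defining_fun Z -> 0 < nu + gauss_factor Z / defining_fun Z.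
Proof.
by move=> Q0; have : 1 <= gauss_factor Z / defining_fun Z; [rewrite ler_pdivlMr// mul1r E_ge_Q|have := nu1; lra].
Qed.

(** By [dz_dzb] the metric is diagonal plus a product [U *m V] of rank at most 2, with one column of
    [U] for [z] and one for [w]. The remaining 2 x 2 determinant involves only [|z|^2] and
    [|w|^2]. *)
Lemma det_kmetric Z : 0 < defining_fun Z -> \det (kmetric (PhiNM n m mu nu) Z) =
  (mu ^+ n * (nu + gauss_factor Z / defining_fun Z) ^+ n * (gauss_factor Z / defining_fun Z ^+ m.+1))%:C.
Proof.
move=> Q0; have Qn : defining_fun Z != 0 by rewrite gt_eqF.
pose hz := mu * (nu + gauss_factor Z / defining_fun Z).
have hz0 : hz != 0 by rewrite gt_eqF// mulr_gt0// nuEQ_gt0.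
have hkl i : dbar_factor (lshift m i) Z = hz by rewrite /dbar_factor sA_l sB_l /hz; ring.
have hkr i : dbar_factor (rshift n i) Z = (defining_fun Z)^-1 by rewrite /dbar_factor sA_r sB_r; ring.
have CR (x : R) : x != 0 -> x%:C != 0 :> C by move=> x0; rewrite -(rmorph0 (@real_complex R)) (inj_eq (@complexI R)).
pose h := \row_k (dbar_factor k Z)%:C.
pose P k := (is_zcoord k * (mu * (mu * gauss_factor Z * (gauss_factor Z - defining_fun Z) / defining_fun Z ^+ 2)) + is_wcoord k * (mu * gauss_factor Z / defining_fun Z ^+ 2))%:C : C.
pose T k := (is_zcoord k * (mu * (gauss_factor Z / defining_fun Z ^+ 2)) + is_wcoord k * (defining_fun Z ^+ 2)^-1)%:C : C.
pose U : 'M[C]_(N, 2) := \matrix_(j, c) ((if c == 0 then is_zcoord j else is_wcoord j)%:C * (Z j)^*%C).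
pose V : 'M[C]_(2, N) := \matrix_(c, k) ((if c == 0 then P k else T k) * Z k).
have uh : diag_mx h \in unitmx.
  rewrite unitmxE det_diag unitfE; apply/prodf_neq0 => k _; rewrite mxE; apply: CR.
  by rewrite -(splitK k); case: (fintype.split k) => i /=; rewrite ?hkl ?hkr// invr_neq0.
have -> : kmetric (PhiNM n m mu nu) Z = diag_mx h + U *m V.
  apply/matrixP => j k; rewrite dz_dzb// !mxE !big_ord_recl big_ord0 !mxE /= addr0 addrC.
  congr (_ + _); last by rewrite mulr_natr; case: eqP => [->|//].
  rewrite /P /T; move: (Z j) (Z k) (is_zcoord j) (is_wcoord j) (is_zcoord k) (is_wcoord k) => [x y] [x' y'] a b a' b'.
  apply: complexP; rewrite /=; by field.
rewrite det_add_mul// det_diag big_split_ord /=.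
rewrite (eq_bigr (fun=> hz%:C)); last by move=> i _; rewrite mxE hkl.
rewrite prodr_const card_ord (eq_bigr (fun=> ((defining_fun Z)^-1)%:C)); last by move=> i _; rewrite mxE hkr.
rewrite prodr_const card_ord.
have VU (S : 'I_N -> C) (c d : 'I_2) : (forall k, V c k = S k * Z k) ->
    (V *m invmx (diag_mx h) *m U) c d =
    \sum_k (S k * (dbar_factor k Z)^-1%:C * (if d == 0 then is_zcoord k else is_wcoord k)%:C) * ((Z k)^*%C * Z k).
  move=> hS; have -> : invmx (diag_mx h) = diag_mx (\row_k (dbar_factor k Z)^-1%:C).
    rewrite -[RHS](mulKmx uh) -[LHS]mulmx1; congr (_ *m _).
    apply/matrixP => i k; rewrite mulmx_diag !mxE; case: eqP => [->|_]; rewrite ?mulr1n ?mulr0n ?mul0r//.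
    rewrite -rmorphM /= mulfV ?rmorph1//.
    by rewrite -(splitK k); case: (fintype.split k) => l /=; rewrite ?hkl ?hkr// invr_neq0.
  rewrite mul_mx_diag !mxE; apply: eq_bigr => k _; rewrite !mxE; have := hS k; rewrite mxE => ->; ring.
pose A := sqn (zpart Z); pose B := sqn (wpart Z).
(* The indicators and [dbar_factor] are constant on each block, so each sum reduces to [A = |z|^2]
   and [B = |w|^2]. *)
have SUM (f : R -> R -> R -> R) : \sum_k (f (is_zcoord k) (is_wcoord k) (dbar_factor k Z))%:C * ((Z k)^*%C * Z k) =
   (f 1 0 hz * A + f 0 1 (defining_fun Z)^-1 * B)%:C.
  rewrite big_split_ord /= rmorphD !rmorphM /= !sum_cabs2 !mulr_sumr; congr (_ + _); apply: eq_bigr => i _.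
    by rewrite sA_l sB_l hkl.
  by rewrite sA_r sB_r hkr.
have ent (c d : 'I_2) (f : R -> R -> R -> R) :
    (forall k, (if c == 0 then P k else T k) * (dbar_factor k Z)^-1%:C * (if d == 0 then is_zcoord k else is_wcoord k)%:C = (f (is_zcoord k) (is_wcoord k) (dbar_factor k Z))%:C) ->
    (V *m invmx (diag_mx h) *m U) c d = (f 1 0 hz * A + f 0 1 (defining_fun Z)^-1 * B)%:C.
  move=> hf; rewrite (@VU (fun k => if c == 0 then P k else T k)); last by move=> k; rewrite mxE.
  by rewrite -SUM; apply: eq_bigr => k _; rewrite hf.
pose p a b := (a * (mu * (mu * gauss_factor Z * (gauss_factor Z - defining_fun Z) / defining_fun Z ^+ 2)) + b * (mu * gauss_factor Z / defining_fun Z ^+ 2)) : R.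
pose q a b := (a * (mu * (gauss_factor Z / defining_fun Z ^+ 2)) + b * (defining_fun Z ^+ 2)^-1) : R.
have e00 : (V *m invmx (diag_mx h) *m U) 0 0 = _ := @ent 0 0 (fun a b x => p a b * x^-1 * a) (fun k => ltac:(by rewrite !rmorphM)).
have e01 : (V *m invmx (diag_mx h) *m U) 0 1 = _ := @ent 0 1 (fun a b x => p a b * x^-1 * b) (fun k => ltac:(by rewrite !rmorphM)).
have e10 : (V *m invmx (diag_mx h) *m U) 1 0 = _ := @ent 1 0 (fun a b x => q a b * x^-1 * a) (fun k => ltac:(by rewrite !rmorphM)).
have e11 : (V *m invmx (diag_mx h) *m U) 1 1 = _ := @ent 1 1 (fun a b x => q a b * x^-1 * b) (fun k => ltac:(by rewrite !rmorphM)).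
have ad (X Y : 'M[C]_2) i j : (X + Y) i j = X i j + Y i j by rewrite mxE.
rewrite det2 !ad e00 e01 e10 e11 !mxE /= mulr0n mulr1n.
rewrite -!rmorphXn /= -!rmorphM /= -[1]/((1 : R)%:C) -?rmorphD -?rmorphM -?rmorphB.
have EB : gauss_factor Z = defining_fun Z + B by rewrite /defining_fun subrK.
apply: etrans (esym (rmorphM (@real_complex R) _ _)) _ => /=; congr (_%:C).
have -> : mu ^+ n * (nu + gauss_factor Z / defining_fun Z) ^+ n * (gauss_factor Z / defining_fun Z ^+ m.+1) = hz ^+ n * (defining_fun Z)^-1 ^+ m * (gauss_factor Z / defining_fun Z).
  by rewrite -exprMn -/hz exprVn exprS invfM; ring.
congr (_ * _); rewrite /p /q; rewrite EB; field.
by rewrite Qn hz0.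
Qed.

End Metric.

(** * Norms of the monomials *)

(* The powers of [nu] may be negative: their terms are moved to the other side so that
   only nonnegative integrals are added. *)
Lemma integral_signed_sum (R : realType) k (c b : 'I_k -> R) (g : 'I_k -> R -> R) (f : R -> R) :
  (forall d, measurable_fun [set: R] (g d)) -> (forall d x, 0 <= g d x) ->
  (forall d, \int[@lebesgue_measure R]_x (g d x)%:E = (b d)%:E)%E ->
  measurable_fun [set: R] f -> (forall x, 0 <= f x) -> (forall x, f x = \sum_d c d * g d x) ->
  (\int[@lebesgue_measure R]_x (f x)%:E = (\sum_d c d * b d)%:E)%E.
Proof.
pose leb := @lebesgue_measure R.
move=> mg g0 gb mf f0 fE.
have S (e : 'I_k -> R) : (forall d, 0 <= e d) ->
    (\int[@lebesgue_measure R]_x (\sum_d e d * g d x)%:E = (\sum_d e d * b d)%:E)%E.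
  move=> e0; transitivity (\int[@lebesgue_measure R]_x \sum_d (e d * g d x)%:E)%E.
    by apply: eq_integral => x _; rewrite sumEFin.
  have mE d : measurable_fun [set: R] (fun x => (e d * g d x)%:E : \bar R).
    by apply/measurable_EFinP; apply: measurable_funM.
  have pE d x : [set: R] x -> (0 <= (e d * g d x)%:E)%E by rewrite lee_fin mulr_ge0.
  rewrite (ge0_integral_sum leb measurableT mE pE).
  rewrite -sumEFin; apply: eq_bigr => d _; rewrite EFinM -gb.
  have mG : measurable_fun [set: R] (fun x => (g d x)%:E : \bar R) by exact/measurable_EFinP.
  have pG x : [set: R] x -> (0 <= (g d x)%:E)%E by rewrite lee_fin.
  have e0' : (0 <= (e d)%:E)%E by rewrite lee_fin.
  by rewrite -(ge0_integralZl leb measurableT mG pG e0').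
have ms (e : 'I_k -> R) : measurable_fun [set: R] (fun x => \sum_d e d * g d x).
  by apply: measurable_sum => d; apply: measurable_funM.
pose cp d := Num.max (c d) 0; pose cn d := Num.max (- c d) 0.
have cp0 d : 0 <= cp d by rewrite le_max lexx orbT.
have cn0 d : 0 <= cn d by rewrite le_max lexx orbT.
have ccE d : c d + cn d = cp d.
  rewrite /cp /cn; have [h|h] := leP (c d) 0.
    by rewrite max_l ?oppr_ge0// subrr.
  by rewrite max_r ?addr0// oppr_le0 ltW.
have H : (\int[@lebesgue_measure R]_x (f x)%:E + (\sum_d cn d * b d)%:E = (\sum_d cp d * b d)%:E)%E.
  have f0' x : [set: R] x -> (0 <= (f x)%:E)%E by rewrite lee_fin.
  have mf' : measurable_fun [set: R] (fun x => (f x)%:E : \bar R) by exact/measurable_EFinP.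
  have s0 x : [set: R] x -> (0 <= (\sum_d cn d * g d x)%:E)%E.
    by move=> _; rewrite lee_fin sumr_ge0// => d _; rewrite mulr_ge0.
  have ms' : measurable_fun [set: R] (fun x => (\sum_d cn d * g d x)%:E : \bar R) by exact/measurable_EFinP.
  rewrite -(S cn cn0) -(S cp cp0) -(ge0_integralD leb measurableT f0' mf' s0 ms').
  apply: eq_integral => x _; rewrite -EFinD; congr EFin; rewrite fE -big_split; apply: eq_bigr => d _ /=.
  by rewrite -mulrDl ccE.
have : (\int[@lebesgue_measure R]_x (f x)%:E = (\sum_d cp d * b d)%:E - (\sum_d cn d * b d)%:E)%E.
  by rewrite -H addeK.
move=> ->; rewrite -EFinB; congr EFin; rewrite -sumrB; apply: eq_bigr => d _.
by rewrite -ccE mulrDl addrK.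
Qed.

(** * The weight as a function of the squared radii *)

Section Weight.
Variables (R : realType) (n m : nat) (mu nu alpha : R).
Local Notation C := R[i].
Local Notation N := (n + m)%N.
Local Notation mR := (measurableTypeR R).
Hypothesis mu0 : 0 < mu.
Hypothesis nu1 : -1 < nu.
Hypothesis al : (m + n)%:R < alpha.
Hypothesis n0 : (0 < n)%N.

(* [pos_powR 0 t] is [1 / t] for [0 < t] and [0] otherwise, so this vanishes outside the
   domain. *)
Definition radial_wgt (a b : R) : R :=
  mu ^+ n / pi ^+ N * expR (- (alpha * nu * mu * a)) * expR (- (mu * a)) *
  (nu + expR (- (mu * a)) * pos_powR 0 (expR (- (mu * a)) - b)) ^+ n * pos_powR (alpha - m%:R) (expR (- (mu * a)) - b).

Definition wgt (Z : cpt R N) : R :=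
  \1_(Dnm n m mu) Z * (expR (- (alpha * PhiNM n m mu nu Z)) * voldens (PhiNM n m mu nu) Z).

Lemma pos_powRM a b (u : R) : 0 < u -> pos_powR a u * pos_powR b u = pos_powR (a + b - 1) u.
Proof.
move=> u0; rewrite !pos_powRE// -powRD; last by rewrite (gt_eqF u0) implybT.
by congr powR; ring.
Qed.

Lemma pos_powR_inv (u : R) : 0 < u -> pos_powR 0 u = u^-1.
Proof. by move=> u0; rewrite pos_powRE// sub0r powR_inv1// ltW. Qed.

Lemma wgtE Z : wgt Z = radial_wgt (sqn (zpart Z)) (sqn (wpart Z)).
Proof.
rewrite /wgt /radial_wgt -/(gauss_factor mu Z) -/(defining_fun mu Z).
have [Q0|Q0] := ltP 0 (defining_fun mu Z); last first.
  by rewrite [X in _ = _ * X]pos_powR_le0// mulr0 indicE memNset ?mul0r// => /DnmE; lra.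
rewrite indicE mem_set ?mul1r; last by apply/DnmE.
rewrite /voldens det_kmetric//= pos_powR_inv//.
have -> : expR (- (alpha * PhiNM n m mu nu Z)) = expR (- (alpha * nu * mu * sqn (zpart Z))) * (defining_fun mu Z) `^ alpha.
  rewrite -[in RHS](lnK (x := defining_fun mu Z)) ?posrE// -expRM -expRD; congr expR.
  by rewrite /PhiNM -/(gauss_factor mu Z) -/(defining_fun mu Z); ring.
rewrite -/(gauss_factor mu Z) pos_powRE//.
have -> : defining_fun mu Z `^ (alpha - m%:R - 1) = defining_fun mu Z `^ alpha / defining_fun mu Z ^+ m.+1.
  have -> : alpha - m%:R - 1 = alpha + - m.+1%:R by rewrite -natr1; ring.
  rewrite powRD; last by rewrite (gt_eqF Q0) implybT.
  by rewrite powRN powR_mulrn// ltW.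
ring.
Qed.

Lemma measurable_omg : measurable_fun [set: mR * mR] (fun p => radial_wgt p.1 p.2).
Proof.
have mf : measurable_fun [set: mR * mR] (fun p => p.1 : R) by exact: measurable_fst.
have mg : measurable_fun [set: mR * mR] (fun p => p.2 : R) by exact: measurable_snd.
have me (c : R) : measurable_fun [set: mR * mR] (fun p => expR (- (c * p.1))).
  apply: (measurableT_comp (@measurable_expR R)).
  by apply: (measurableT_comp (@oppr_measurable R setT)); exact: measurable_funM.
have mq : measurable_fun [set: mR * mR] (fun p => expR (- (mu * p.1)) - p.2).
  by apply: measurable_funB.
have mp a : measurable_fun [set: mR * mR] (fun p => pos_powR a (expR (- (mu * p.1)) - p.2)).
  exact: (measurableT_comp (measurable_pos_powR a) mq).
apply: measurable_funM; last exact: mp.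
apply: measurable_funM; first by apply: measurable_funM => //; apply: measurable_funM.
by apply: measurable_funX; apply: measurable_funD => //; apply: measurable_funM.
Qed.

Lemma borelR_wgt : borelR wgt.
Proof.
move=> d T g mg.
have -> : (fun x => wgt (g x)) = (fun x => radial_wgt (sqn (zpart (g x))) (sqn (wpart (g x)))).
  by apply/funext => x; exact: wgtE.
have ms k (s : 'I_k -> 'I_N) : measurable_fun [set: T] (fun x => sqn (fun j => g x (s j))).
  by apply: measurable_sum => j; exact: (@borelR_cabs2 R N (fun Z => Z (s j)) (borelC_coord R (s j)) _ _ _ mg).
exact: (measurableT_comp measurable_omg (measurable_fun_pair (ms n (@lshift n m)) (ms m (@rshift n m)))).
Qed.

Lemma radial_wgt_ge0 a b : 0 <= b -> 0 <= radial_wgt a b.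
Proof.
move=> b0; rewrite /radial_wgt; set E := expR (- (mu * a)).
have [Q0|Q0] := ltP 0 (E - b); last by rewrite [X in _ * X]pos_powR_le0// mulr0.
have E0 : 0 < E by exact: expR_gt0.
rewrite mulr_ge0 ?pos_powR_ge0// mulr_ge0 ?mulr_ge0 ?expR_ge0 ?invr_ge0 ?exprn_ge0 ?pi_ge0 ?(ltW mu0)//.
rewrite pos_powR_inv//; have : 1 <= E / (E - b) by rewrite ler_pdivlMr// mul1r; lra.
have := nu1; lra.
Qed.

Lemma sqn_ge0 k (v : 'I_k -> C) : 0 <= sqn v.
Proof. by rewrite sumr_ge0// => j _; exact: cabs2_ge0. Qed.

Lemma wgt_ge0 Z : 0 <= wgt Z.
Proof. by rewrite wgtE radial_wgt_ge0// sqn_ge0. Qed.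

Lemma wgt_rot w Z : (forall j, cabs2 (w j) = 1) -> wgt (rotv w Z) = wgt Z.
Proof.
move=> w1; rewrite !wgtE; congr radial_wgt; apply: eq_bigr => j _; by rewrite /zpart /wpart /rotv cabs2M w1 mul1r.
Qed.

Lemma wgt_out Z : ~ Dnm n m mu Z -> wgt Z = 0.
Proof. by move=> DZ; rewrite /wgt indicE memNset ?mul0r. Qed.

Lemma Dnm0 : Dnm n m mu (fun=> 0 : C).
Proof.
have z k : sqn (fun _ : 'I_k => 0 : C) = 0 by rewrite /sqn big1// => j _; rewrite /cabs2 /= expr0n addr0.
by rewrite /Dnm /= /wpart /zpart !z mulr0 oppr0 expR0.
Qed.

Lemma Dnm_nbhs Z : Dnm n m mu Z -> exists d c : R, [/\ 0 < d, 0 < c &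
  forall Z', (forall j, cabs2 (Z' j) <= cabs2 (Z j) + d) -> Dnm n m mu Z' /\ c <= wgt Z'].
Proof.
move=> /DnmE; set Q := defining_fun mu Z => Q0.
pose A := sqn (zpart Z); pose B := sqn (wpart Z).
have A0 : 0 <= A by exact: sqn_ge0.
have nn : 0 <= n%:R :> R by rewrite ler0n.
have mm : 0 <= m%:R :> R by rewrite ler0n.
(* Raising every squared modulus by [d] lowers [Q] by at most [(mu n + m) d], using
   [exp (- x) >= 1 - x]; with [s d = Q / 2] at least half of [Q] remains. *)
pose s := mu * n%:R + m%:R + 1.
have mn : 0 <= mu * n%:R by rewrite mulr_ge0// ltW.
have s0 : 0 < s by rewrite /s; lra.
pose d := Q / (2 * s).
have d0 : 0 < d by rewrite divr_gt0// mulr_gt0.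
have sd : s * d = Q / 2 by rewrite /d; field; rewrite gt_eqF.
pose a1 := A + n%:R * d.
have a10 : 0 <= a1 by rewrite addr_ge0// mulr_ge0// ltW.
have al1 : 0 < alpha - m%:R - 1.
  have : 1 <= n%:R :> R by rewrite ler1n.
  by move: al; rewrite natrD; lra.
(* A lower bound factor by factor: the absolute value handles both signs of [nu], [E / Q >= 1] gives
   [nu + 1], and the last power is increasing since [alpha - m - 1 > 0]. *)
pose c := mu ^+ n / pi ^+ N * expR (- (`|alpha * nu * mu| * a1)) * expR (- (mu * a1)) * (nu + 1) ^+ n * (Q / 2) `^ (alpha - m%:R - 1).
have q2 : 0 < Q / 2 by rewrite divr_gt0.
exists d, c; split => //.
  have p1 : 0 < mu ^+ n / pi ^+ N by rewrite divr_gt0 ?exprn_gt0 ?pi_gt0.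
  have p2 : 0 < (nu + 1) ^+ n by rewrite exprn_gt0//; have := nu1; lra.
  have p3 := expR_gt0 (- (`|alpha * nu * mu| * a1)); have p4 := expR_gt0 (- (mu * a1)).
  have p5 : 0 < (Q / 2) `^ (alpha - m%:R - 1) by exact: powR_gt0.
  by rewrite /c; exact: (mulr_gt0 (mulr_gt0 (mulr_gt0 (mulr_gt0 p1 p3) p4) p2) p5).
move=> Z' hZ'.
have A0' : 0 <= sqn (zpart Z') by exact: sqn_ge0.
have B0' : 0 <= sqn (wpart Z') by exact: sqn_ge0.
have hA : sqn (zpart Z') <= a1.
  rewrite /a1 /A /sqn; apply: (@le_trans _ _ (\sum_(j < n) (cabs2 (zpart Z j) + d))).
    by apply: ler_sum => j _; exact: hZ'.
  by rewrite big_split /= sumr_const card_ord -(mulr_natl d).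
have hB : sqn (wpart Z') <= B + m%:R * d.
  rewrite /B /sqn; apply: (@le_trans _ _ (\sum_(j < m) (cabs2 (wpart Z j) + d))).
    by apply: ler_sum => j _; exact: hZ'.
  by rewrite big_split /= sumr_const card_ord -(mulr_natl d).
have E1 x : 0 <= x -> expR (- (mu * x)) <= 1 by move=> x0; rewrite -expR0 ler_expR oppr_le0 mulr_ge0// ltW.
have Ea1 : expR (- (mu * a1)) <= expR (- (mu * sqn (zpart Z'))).
  by rewrite ler_expR lerN2 ler_wpM2l// ltW.
have hE : expR (- (mu * A)) - mu * n%:R * d <= expR (- (mu * a1)).
  have -> : - (mu * a1) = - (mu * A) + - (mu * n%:R * d) by rewrite /a1; ring.
  rewrite expRD; have h := expR_ge1Dx (- (mu * n%:R * d)).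
  have h1 := E1 A A0; have h0 : 0 <= expR (- (mu * A)) by exact: expR_ge0.
  have h2 : 0 <= mu * n%:R * d by apply: mulr_ge0 => //; exact: ltW.
  nra.
have hQ : Q / 2 <= defining_fun mu Z'.
  rewrite /defining_fun /gauss_factor; have : Q = expR (- (mu * A)) - B by [].
  by move: sd; rewrite /s; have := d0; nra.
have Q0' : 0 < defining_fun mu Z' by exact: lt_le_trans hQ.
split; first by apply/DnmE.
rewrite wgtE /radial_wgt -/(gauss_factor mu Z') -/(defining_fun mu Z') pos_powR_inv// pos_powRE//.
have b0 : 0 <= mu ^+ n / pi ^+ N by rewrite divr_ge0 ?exprn_ge0 ?pi_ge0 ?(ltW mu0).
have nu2 : 0 <= nu + 1 by have := nu1; lra.
apply: ler_pM.
- exact: (mulr_ge0 (mulr_ge0 (mulr_ge0 b0 (expR_ge0 _)) (expR_ge0 _)) (exprn_ge0 _ nu2)).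
- exact: powR_ge0.
- apply: ler_pM.
  + exact: (mulr_ge0 (mulr_ge0 b0 (expR_ge0 _)) (expR_ge0 _)).
  + by rewrite exprn_ge0.
  + apply: ler_pM => //; first exact: (mulr_ge0 b0 (expR_ge0 _)).
    rewrite ler_wpM2l// ler_expR lerN2.
    apply: (@le_trans _ _ (`|alpha * nu * mu| * sqn (zpart Z'))); first by rewrite ler_wpM2r// ler_norm.
    by rewrite ler_wpM2l.
  + rewrite lerXn2r ?nnegrE//.
      have : 1 <= gauss_factor mu Z' / defining_fun mu Z' by rewrite ler_pdivlMr// mul1r E_ge_Q.
      by lra.
    by rewrite lerD2l ler_pdivlMr// mul1r E_ge_Q.
- by rewrite ge0_ler_powR// ?nnegrE ltW.
Qed.

End Weight.

(** * Evaluation of the monomial norms *)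

Section Explicit.
Variables (R : realType) (n m : nat) (mu nu alpha : R).
Local Notation C := R[i].
Local Notation N := (n + m)%N.
Local Notation leb := (@lebesgue_measure R).
Local Notation mR := (measurableTypeR R).
Hypothesis mu0 : 0 < mu.
Hypothesis nu1 : -1 < nu.
Hypothesis al : (m + n)%:R < alpha.
Hypothesis n0 : (0 < n)%N.
Hypothesis m0 : (0 < m)%N.

Lemma integral_pos_powR_expR (a s : R) : 0 < a -> 0 < s ->
  (\int[leb]_u (pos_powR a u * expR (- (s * u)))%:E = (Gamma a / s `^ a)%:E)%E.
Proof.
move=> a0 s0; pose f v := (pos_powR a v * expR (- v))%:E : \bar R.
have mf : measurable_fun [set: R] f.
  apply/measurable_EFinP; apply: measurable_funM; first exact: measurable_pos_powR.
  by apply: measurableT_comp => //; exact: oppr_measurable.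
have f0 x : (0 <= f x)%E by rewrite lee_fin mulr_ge0 ?pos_powR_ge0 ?expR_ge0.
have sp : 0 < s `^ (a - 1) by exact: powR_gt0.
have := ge0_integral_affine 0 (lt0r_neq0 s0) mf f0.
have -> : (fun x => f (s * x + 0)) = (fun x => (s `^ (a - 1))%:E * (pos_powR a x * expR (- (s * x)))%:E)%E.
  by apply/funext => x; rewrite /f addr0 pos_powR_scale// -EFinM -mulrA.
rewrite -/(eGamma a) eGammaE// -EFinM gtr0_norm//.
have mg : measurable_fun [set: R] (fun x => (pos_powR a x * expR (- (s * x)))%:E : \bar R).
  apply/measurable_EFinP; apply: measurable_funM; first exact: measurable_pos_powR.
  apply: measurableT_comp => //; apply: (measurableT_comp (@oppr_measurable R setT)); exact: measurable_funM.
have g0 x : [set: R] x -> (0 <= (pos_powR a x * expR (- (s * x)))%:E)%E by rewrite lee_fin mulr_ge0 ?pos_powR_ge0 ?expR_ge0.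
have sp' : (0 <= (s `^ (a - 1))%:E)%E by rewrite lee_fin ltW.
rewrite (ge0_integralZl leb measurableT mg g0 sp').
have -> : s `^ a = s * s `^ (a - 1).
  rewrite -[X in X * _](powRr1 (ltW s0)) -powRD; last by rewrite (gt_eqF s0) implybT.
  by congr powR; ring.
have I0 : (0 <= \int[leb]_x (pos_powR a x * expR (- (s * x)))%:E)%E by exact: integral_ge0.
move: I0; case: (integral _ _ _) => [x| |]//= _; last by rewrite gt0_muley ?lte_fin.
move=> -[h]; congr EFin; apply: (mulfI (lt0r_neq0 sp)); rewrite h; field.
by rewrite !gt_eqF.
Qed.

Lemma pos_powR0_XM (a y : R) i : pos_powR 0 y ^+ i * pos_powR a y = pos_powR (a - i%:R) y.
Proof.
have [y0|y0] := ltP 0 y; last by rewrite (pos_powR_le0 a y0) (pos_powR_le0 (a - i%:R) y0) mulr0.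
elim: i => [|i IH]; first by rewrite expr0 mul1r subr0.
rewrite exprS -mulrA IH pos_powRM//; congr pos_powR; rewrite -natr1; ring.
Qed.

Definition beta_sum k : R := \sum_(d < n.+1) 'C(n, d)%:R * nu ^+ (n - d) *
  (Gamma (alpha - m%:R - d%:R) / Gamma (alpha - d%:R + k%:R)).

(** What is left of the weight after the substitution [|w|^2 = E x], where [E / Q = 1 / (1 - x)]. *)
Definition beta_mix k (x : R) : R := pos_powR (k + m)%:R x * ((nu + pos_powR 0 (1 - x)) ^+ n * pos_powR (alpha - m%:R) (1 - x)).

Lemma fJ_ge0 k x : 0 <= beta_mix k x.
Proof.
rewrite /beta_mix; have [x0|x0] := ltP 0 x; last by rewrite pos_powR_le0// mul0r.
have [y0|y0] := ltP 0 (1 - x); last by rewrite (pos_powR_le0 (alpha - m%:R) y0) !mulr0.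
rewrite mulr_ge0 ?pos_powR_ge0// mulr_ge0 ?pos_powR_ge0// exprn_ge0// pos_powR_inv//.
have h : 1 <= (1 - x)^-1 by rewrite invf_ge1//; lra.
have := nu1; lra.
Qed.

Lemma measurable_pos_powR_1B a : measurable_fun [set: R] (fun x => pos_powR a (1 - x)).
Proof. by apply: (measurableT_comp (measurable_pos_powR a)); exact: measurable_funB. Qed.

Lemma measurable_fJ k : measurable_fun [set: R] (beta_mix k).
Proof.
apply: measurable_funM; first exact: measurable_pos_powR.
apply: measurable_funM; last exact: measurable_pos_powR_1B.
by apply: measurable_funX; apply: measurable_funD => //; exact: measurable_pos_powR_1B.
Qed.

(** Expanding the power of [nu + 1 / (1 - x)] gives Beta integrals; [alpha > m + n] keeps all
    arguments [alpha - m - d] positive. *)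
Lemma integral_fJ k : (\int[leb]_x (beta_mix k x)%:E = (Gamma ((k + m)%:R) * beta_sum k)%:E)%E.
Proof.
have S0 : 0 < (k + m)%:R :> R by rewrite ltr0n addn_gt0 m0 orbT.
have ad (d : 'I_n.+1) : 0 < alpha - m%:R - d%:R.
  have : d%:R <= n%:R :> R by rewrite ler_nat -ltnS.
  by move: al; rewrite natrD; lra.
rewrite (@integral_signed_sum R n.+1 (fun d => 'C(n, d)%:R * nu ^+ (n - d))
   (fun d => Gamma ((k + m)%:R) * (Gamma (alpha - m%:R - d%:R) / Gamma (alpha - d%:R + k%:R)))
   (fun d x => pos_powR (k + m)%:R x * pos_powR (alpha - m%:R - d%:R) (1 - x))).
- by congr EFin; rewrite /beta_sum mulr_sumr; apply: eq_bigr => d _; ring.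
- by move=> d; apply: measurable_funM; [exact: measurable_pos_powR|exact: measurable_pos_powR_1B].
- by move=> d x; rewrite mulr_ge0 ?pos_powR_ge0.
- move=> d; rewrite -/(eBeta _ _) eBetaE// mulrA; congr (_ / Gamma _)%:E; rewrite natrD; ring.
- exact: measurable_fJ.
- exact: fJ_ge0.
- move=> x; rewrite /beta_mix exprDn mulr_suml mulr_sumr; apply: eq_bigr => d _.
  by rewrite -(pos_powR0_XM (alpha - m%:R) (1 - x) d) -(mulr_natl (_ * _)); ring.
Qed.

Definition exp_rate k : R := (nu + 1) * alpha + k%:R.

(** The origin of the rate [A_k]: the Jacobian, [|w|^2], the weight and the determinant contribute
    [1 + (k + m - 1) + alpha nu + 1 + (alpha - m - 1)] powers of [E], in all
    [(nu + 1) alpha + k]. *)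
Lemma radial_wgt_scale k u x : let E := expR (- (mu * u)) in
  E * (pos_powR (k + m)%:R (E * x) * radial_wgt n m mu nu alpha u (E * x)) =
  mu ^+ n / pi ^+ N * expR (- (mu * exp_rate k * u)) * beta_mix k x.
Proof.
move=> E; have E0 : 0 < E by exact: expR_gt0.
rewrite /radial_wgt -/E (_ : E - E * x = E * (1 - x)); last by ring.
have -> : E * pos_powR 0 (E * (1 - x)) = pos_powR 0 (1 - x).
  by rewrite pos_powR_scale// sub0r powR_inv1 ?(ltW E0)// mulrA mulfV ?(gt_eqF E0)// mul1r.
rewrite !pos_powR_scale//.
have Ep r : E `^ r = expR (- (mu * u) * r) by rewrite /E -expRM.
rewrite !Ep /beta_mix.
have -> : expR (- (mu * exp_rate k * u)) = E * expR (- (mu * u) * ((k + m)%:R - 1)) * expR (- (alpha * nu * mu * u)) * E * expR (- (mu * u) * (alpha - m%:R - 1)).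
  by rewrite /E -!expRD; congr expR; rewrite /exp_rate natrD; ring.
by ring.
Qed.

Lemma measurable_omg1 u : measurable_fun [set: R] (radial_wgt n m mu nu alpha u).
Proof.
exact: (measurableT_comp (@measurable_omg R n m mu nu alpha) (measurable_fun_pair (measurable_cst u) (@measurable_id _ _ setT))).
Qed.

Lemma measurable_omg2 b : measurable_fun [set: R] (fun u => radial_wgt n m mu nu alpha u b).
Proof.
exact: (measurableT_comp (@measurable_omg R n m mu nu alpha) (measurable_fun_pair (@measurable_id _ _ setT) (measurable_cst b))).
Qed.

Lemma pw_omg_ge0 a u b : 0 <= pos_powR a b * radial_wgt n m mu nu alpha u b.
Proof.
have [b0|b0] := ltP 0 b; last by rewrite pos_powR_le0// mul0r.
by rewrite mulr_ge0 ?pos_powR_ge0// radial_wgt_ge0// ltW.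
Qed.

Lemma integral_omg k u : (\int[leb]_b (pos_powR (k + m)%:R b * radial_wgt n m mu nu alpha u b)%:E =
  (mu ^+ n / pi ^+ N * expR (- (mu * exp_rate k * u)) * (Gamma ((k + m)%:R) * beta_sum k))%:E)%E.
Proof.
pose E := expR (- (mu * u)); have E0 : 0 < E by exact: expR_gt0.
pose f b := (pos_powR (k + m)%:R b * radial_wgt n m mu nu alpha u b)%:E : \bar R.
have mf : measurable_fun [set: R] f.
  by apply/measurable_EFinP; apply: measurable_funM; [exact: measurable_pos_powR|exact: measurable_omg1].
have f0 b : (0 <= f b)%E by rewrite lee_fin pw_omg_ge0.
have h := ge0_integral_affine 0 (lt0r_neq0 E0) mf f0.
have -> : (\int[leb]_b f b = E%:E * \int[leb]_x f (E * x + 0)%R)%E.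
  by rewrite h muleA -EFinM gtr0_norm// mulfV ?gt_eqF// mul1e.
have mf' : measurable_fun [set: R] (fun x => f (E * x + 0)).
  exact: (measurableT_comp mf (measurable_lin _ _)).
have f0' x : [set: R] x -> (0 <= f (E * x + 0)%R)%E by [].
have E0' : (0 <= E%:E)%E by rewrite lee_fin ltW.
rewrite -(ge0_integralZl leb measurableT mf' f0' E0').
pose c := mu ^+ n / pi ^+ N * expR (- (mu * exp_rate k * u)).
have c0 : (0 <= c%:E)%E.
  by rewrite lee_fin; apply: mulr_ge0; [rewrite divr_ge0 ?exprn_ge0 ?pi_ge0 ?(ltW mu0)|exact: expR_ge0].
transitivity (\int[leb]_x (c%:E * (beta_mix k x)%:E))%E.
  by apply: eq_integral => x _; rewrite addr0 -!EFinM radial_wgt_scale.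
have mJ : measurable_fun [set: R] (fun x => (beta_mix k x)%:E : \bar R) by apply/measurable_EFinP; exact: measurable_fJ.
have J0 x : [set: R] x -> (0 <= (beta_mix k x)%:E)%E by rewrite lee_fin fJ_ge0.
by rewrite (ge0_integralZl leb measurableT mJ J0 c0) integral_fJ.
Qed.

Lemma dirichlet_block N' lo k (q : 'I_N' -> nat) F (G : R -> \bar R) (Z : cpt R N') : (0 < k)%N ->
  (lo + k <= N')%N -> measurable_fun [set: R] G -> (forall u, 0 <= G u)%E ->
  (forall W, (forall j : 'I_N', ~~ (lo <= j < lo + k)%N -> W j = Z j) ->
    F W = ((\prod_(j < N' | (lo <= j < lo + k)%N) cabs2 (W j) ^+ q j)%:E *
      G (\sum_(j < N' | (lo <= j < lo + k)%N) cabs2 (W j))%R)%E) ->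
  cints lo k F Z =
  ((pi ^+ k * (\prod_(j < N' | (lo <= j < lo + k)%N) Gamma ((q j)%:R + 1)) /
    Gamma ((\sum_(j < N' | (lo <= j < lo + k)%N) q j + k)%N%:R))%:E *
   \int[leb]_u ((pos_powR (\sum_(j < N' | (lo <= j < lo + k)%N) q j + k)%N%:R u)%:E * G u))%E.
Proof. by case: k => // k _; exact: dirichlet_cints. Qed.

Lemma block_l (T : Type) (idx : T) (op : Monoid.com_law idx) (F : 'I_N -> T) :
  \big[op/idx]_(j < N | (0 <= j < 0 + n)%N) F j = \big[op/idx]_(i < n) F (lshift m i).
Proof.
rewrite big_split_ord /= [X in op _ X]big_pred0 ?Monoid.mulm1; last first.
  by move=> i; rewrite add0n ltnNge leq_addr.
by apply: eq_bigl => i; rewrite add0n ltn_ord.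
Qed.

Lemma block_r (T : Type) (idx : T) (op : Monoid.com_law idx) (F : 'I_N -> T) :
  \big[op/idx]_(j < N | (n <= j < n + m)%N) F j = \big[op/idx]_(i < m) F (rshift n i).
Proof.
rewrite big_split_ord /= [X in op X _]big_pred0 ?Monoid.mul1m; last first.
  by move=> i; rewrite leqNgt ltn_ord.
by apply: eq_bigl => i; rewrite leq_addr ltn_add2l ltn_ord.
Qed.

Lemma cabs2_mon N' (Z : cpt R N') I : cabs2 (monomial Z I) = \prod_(j < N') cabs2 (Z j) ^+ I j.
Proof.
rewrite -cnorm_sqr cnorm_monomial -prodrXl; apply: eq_bigr => j _.
by rewrite -cnorm_sqr -!exprM mulnC.
Qed.

Lemma Ak_gt0 k : 0 < exp_rate k.
Proof.
have a0 : 0 < alpha by apply: le_lt_trans al; rewrite ler0n.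
have h : 0 < (nu + 1) * alpha by rewrite mulr_gt0//; have := nu1; lra.
by rewrite /exp_rate ltr_wpDr.
Qed.

(** Dirichlet's formula on the [z]-block, then on the [w]-block, leaves a double integral in
    [u = |z|^2] and [b = |w|^2]. *)
Lemma cI2_wgt I : let P := (\sum_(i < n) I (lshift m i))%N in let k := (\sum_(i < m) I (rshift n i))%N in
  mon_sqnorm (wgt mu nu alpha) I = ((\prod_(j < N) (I j)`!%:R) * (mu ^+ n / (mu * exp_rate k) ^+ (P + n) * beta_sum k))%:E.
Proof.
move=> P k.
pose F (Z : cpt R N) : \bar R := (cabs2 (monomial Z I) * wgt mu nu alpha Z)%:E.
pose pl (Z : cpt R N) := \prod_(i < n) cabs2 (Z (lshift m i)) ^+ I (lshift m i).
pose pr (Z : cpt R N) := \prod_(i < m) cabs2 (Z (rshift n i)) ^+ I (rshift n i).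
have pr0 Z : 0 <= pr Z by rewrite prodr_ge0// => i _; rewrite exprn_ge0// cabs2_ge0.
have FE Z : F Z = (pl Z * (pr Z * radial_wgt n m mu nu alpha (sqn (zpart Z)) (sqn (wpart Z))))%:E.
  by rewrite /F wgtE// cabs2_mon big_split_ord /= mulrA.
pose k1 := pi ^+ n * (\prod_(i < n) Gamma ((I (lshift m i))%:R + 1)) / Gamma ((P + n)%N%:R) : R.
pose k2 := pi ^+ m * (\prod_(i < m) Gamma ((I (rshift n i))%:R + 1)) / Gamma ((k + m)%N%:R) : R.
have Pn : 0 < (P + n)%N%:R :> R by rewrite ltr0n addn_gt0 n0 orbT.
have km : 0 < (k + m)%N%:R :> R by rewrite ltr0n addn_gt0 m0 orbT.
have k10 : 0 <= k1.
  rewrite divr_ge0 ?mulr_ge0 ?exprn_ge0 ?pi_ge0 ?(ltW (Gamma_gt0 _))//.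
  by rewrite prodr_ge0// => i _; rewrite ltW// Gamma_gt0// natr1 ltr0n.
(* The absolute value makes the integrand nonnegative for every real [b]; it disappears under the
   cut-off [0 < b]. *)
pose Hi (b : R) := (\int[leb]_u (pos_powR (P + n)%N%:R u * radial_wgt n m mu nu alpha u `|b|)%:E)%E.
have po0 u b : 0 <= pos_powR (P + n)%N%:R u * radial_wgt n m mu nu alpha u `|b| by rewrite mulr_ge0 ?pos_powR_ge0// radial_wgt_ge0.
pose H b : \bar R := (k1%:E * Hi b)%E.
have inner Z : iint n F Z = ((pr Z)%:E * H (sqn (wpart Z)))%E.
  rewrite iint_cints (@dirichlet_block N 0 n I F (fun u => (pr Z * radial_wgt n m mu nu alpha u (sqn (wpart Z)))%:E) Z n0 (leq_addr _ _)).
  - rewrite !block_l -/P -/k1 /H muleCA; congr (_ * _)%E.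
    rewrite /Hi ger0_norm ?sqn_ge0//.
    have mo : measurable_fun [set: R] (fun u => (pos_powR (P + n)%:R u * radial_wgt n m mu nu alpha u (sqn (wpart Z)))%:E : \bar R).
      by apply/measurable_EFinP; apply: measurable_funM; [exact: measurable_pos_powR|exact: measurable_omg2].
    have o0 u : [set: R] u -> (0 <= (pos_powR (P + n)%:R u * radial_wgt n m mu nu alpha u (sqn (wpart Z)))%:E)%E.
      by move=> _; rewrite lee_fin mulr_ge0 ?pos_powR_ge0// radial_wgt_ge0// sqn_ge0.
    have pZ : (0 <= (pr Z)%:E)%E by rewrite lee_fin.
    rewrite -(ge0_integralZl leb measurableT mo o0 pZ).
    by apply: eq_integral => u _; rewrite -!EFinM mulrCA.
  - by apply/measurable_EFinP; apply: measurable_funM => //; exact: measurable_omg2.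
  - by move=> u; rewrite lee_fin mulr_ge0// radial_wgt_ge0// sqn_ge0.
  move=> W hW; rewrite FE !block_l EFinM; congr (_ * (_ * radial_wgt _ _ _ _ _ _ _)%:E)%E.
    by apply: eq_bigr => i _; rewrite hW// add0n -leqNgt leq_addr.
  by apply: eq_bigr => i _; rewrite /wpart hW// add0n -leqNgt leq_addr.
have mpair : measurable_fun [set: mR * mR] (fun p => (pos_powR (P + n)%:R p.2 * radial_wgt n m mu nu alpha p.2 `|p.1|)%:E : \bar R).
  apply/measurable_EFinP; apply: measurable_funM.
    by apply: (measurableT_comp (measurable_pos_powR _)); exact: measurable_snd.
  apply: (measurableT_comp (@measurable_omg R n m mu nu alpha) (measurable_fun_pair _ _)).
    exact: measurable_snd.
  by apply: (measurableT_comp (@normr_measurable _ _)); exact: measurable_fst.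
have mHi : measurable_fun [set: R] Hi.
  by apply: (@measurable_fun_fubini_tonelli_F _ _ _ _ R leb _ mpair) => p; rewrite lee_fin.
have mH : measurable_fun [set: R] H by apply: emeasurable_funM.
have Hi0 b : (0 <= Hi b)%E by apply: integral_ge0 => u _; rewrite lee_fin.
have H0 b : (0 <= H b)%E by rewrite mule_ge0// lee_fin.
rewrite /mon_sqnorm /sqnormW /intC iint_cat -/F.
rewrite (@dirichlet_block N n m I (iint n F) H (fun=> 0) m0 (leqnn _) mH H0); last first.
  by move=> W hW; rewrite inner !block_r.
rewrite !block_r -/k -/k2.
have -> : (\int[leb]_b ((pos_powR (k + m)%:R b)%:E * H b) = k1%:E * \int[leb]_b \int[leb]_u (pos_powR (k + m)%:R b * (pos_powR (P + n)%:R u * radial_wgt n m mu nu alpha u `|b|))%:E)%E.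
  have mI : measurable_fun [set: R] (fun b => (pos_powR (k + m)%:R b)%:E * Hi b)%E.
    by apply: emeasurable_funM => //; apply/measurable_EFinP; exact: measurable_pos_powR.
  have I0 b : [set: R] b -> (0 <= (pos_powR (k + m)%:R b)%:E * Hi b)%E by move=> _; rewrite mule_ge0// lee_fin pos_powR_ge0.
  have k10' : (0 <= k1%:E)%E by rewrite lee_fin.
  transitivity (k1%:E * \int[leb]_b ((pos_powR (k + m)%:R b)%:E * Hi b))%E.
    by rewrite -(ge0_integralZl leb measurableT mI I0 k10'); apply: eq_integral => b _; rewrite /H muleCA.
  congr (_ * _)%E; apply: eq_integral => b _; rewrite /Hi.
  have mb : measurable_fun [set: R] (fun u => (pos_powR (P + n)%:R u * radial_wgt n m mu nu alpha u `|b|)%:E : \bar R).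
    by apply/measurable_EFinP; apply: measurable_funM; [exact: measurable_pos_powR|exact: measurable_omg2].
  have b0 u : [set: R] u -> (0 <= (pos_powR (P + n)%:R u * radial_wgt n m mu nu alpha u `|b|)%:E)%E by move=> _; rewrite lee_fin.
  have pb : (0 <= (pos_powR (k + m)%:R b)%:E)%E by rewrite lee_fin pos_powR_ge0.
  by rewrite -(ge0_integralZl leb measurableT mb b0 pb); apply: eq_integral => u _; rewrite EFinM.
have mF2 : measurable_fun [set: mR * mR] (fun p => (pos_powR (k + m)%:R p.1 * (pos_powR (P + n)%:R p.2 * radial_wgt n m mu nu alpha p.2 `|p.1|))%:E : \bar R).
  apply/measurable_EFinP; apply: measurable_funM.
    by apply: (measurableT_comp (measurable_pos_powR _)); exact: measurable_fst.
  by apply/measurable_EFinP.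
have F20 p : (0 <= (pos_powR (k + m)%:R p.1 * (pos_powR (P + n)%:R p.2 * radial_wgt n m mu nu alpha p.2 `|p.1|))%:E)%E.
  by rewrite lee_fin mulr_ge0 ?pos_powR_ge0.
(* The scale [E] of the substitution [b = E x] depends on [u], so [b] must be integrated first. *)
rewrite (@fubini_tonelli _ _ _ _ _ leb leb _ mF2 F20) /=.
pose K := mu ^+ n / pi ^+ N * (Gamma ((k + m)%:R) * beta_sum k) : R.
have K0 : (0 <= K%:E)%E.
  have h : 0 <= mu ^+ n / pi ^+ N by rewrite divr_ge0 ?exprn_ge0 ?pi_ge0 ?(ltW mu0).
  rewrite lee_fin; apply: mulr_ge0 => //; rewrite -lee_fin -integral_fJ; apply: integral_ge0 => x _.
  by rewrite lee_fin fJ_ge0.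
have is_zcoord : 0 < mu * exp_rate k by rewrite mulr_gt0// Ak_gt0.
have -> : (\int[leb]_u \int[leb]_b (pos_powR (k + m)%:R b * (pos_powR (P + n)%:R u * radial_wgt n m mu nu alpha u `|b|))%:E =
   K%:E * \int[leb]_u (pos_powR (P + n)%:R u * expR (- (mu * exp_rate k * u)))%:E)%E.
  have me : measurable_fun [set: R] (fun u => (pos_powR (P + n)%:R u * expR (- (mu * exp_rate k * u)))%:E : \bar R).
    apply/measurable_EFinP; apply: measurable_funM; first exact: measurable_pos_powR.
    apply: measurableT_comp => //; apply: (measurableT_comp (@oppr_measurable R setT)); exact: measurable_funM.
  have e0 u : [set: R] u -> (0 <= (pos_powR (P + n)%:R u * expR (- (mu * exp_rate k * u)))%:E)%E.
    by move=> _; rewrite lee_fin mulr_ge0 ?pos_powR_ge0 ?expR_ge0.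
  rewrite -(ge0_integralZl leb measurableT me e0 K0); apply: eq_integral => u _.
  have mb : measurable_fun [set: R] (fun b => (pos_powR (k + m)%:R b * radial_wgt n m mu nu alpha u b)%:E : \bar R).
    by apply/measurable_EFinP; apply: measurable_funM; [exact: measurable_pos_powR|exact: measurable_omg1].
  have b0 b : [set: R] b -> (0 <= (pos_powR (k + m)%:R b * radial_wgt n m mu nu alpha u b)%:E)%E by move=> _; rewrite lee_fin pw_omg_ge0.
  have pb : (0 <= (pos_powR (P + n)%:R u)%:E)%E by rewrite lee_fin pos_powR_ge0.
  transitivity ((pos_powR (P + n)%:R u)%:E * \int[leb]_b (pos_powR (k + m)%:R b * radial_wgt n m mu nu alpha u b)%:E)%E.
    rewrite -(ge0_integralZl leb measurableT mb b0 pb); apply: eq_integral => b _.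
    rewrite -EFinM; congr EFin; have [bp|bn] := ltP 0 b; last by rewrite (pos_powR_le0 _ bn) !mul0r mulr0.
    by rewrite gtr0_norm//; ring.
  by rewrite integral_omg -!EFinM; congr EFin; rewrite /K; ring.
rewrite integral_pos_powR_expR// powR_mulrn ?(ltW is_zcoord)// -!EFinM; congr EFin.
have gE j : Gamma ((I j)%:R + 1) = (I j)`!%:R :> R by rewrite Gamma_nat.
rewrite big_split_ord /= /k1 /k2 /K.
rewrite (eq_bigr (fun i => (I (rshift n i))`!%:R)); last by move=> i _; rewrite gE.
rewrite [X in _ * (pi ^+ n * X / _ * _)](eq_bigr (fun i => (I (lshift m i))`!%:R)); last by move=> i _; rewrite gE.
have g1 := lt0r_neq0 (Gamma_gt0 Pn); have g2 := lt0r_neq0 (Gamma_gt0 km).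
have p1 : pi ^+ n != 0 :> R by rewrite expf_neq0// gt_eqF// pi_gt0.
have p2 : pi ^+ m != 0 :> R by rewrite expf_neq0// gt_eqF// pi_gt0.
have s1 : (mu * exp_rate k) ^+ (P + n) != 0 by rewrite expf_neq0// gt_eqF.
rewrite [pi ^+ N]exprD.
move: (Gamma _) (Gamma _) (_ ^+ (P + n)) (pi ^+ n) (pi ^+ m) g1 g2 p1 p2 s1 => x1 x2 x3 x4 x5 h1 h2 h3 h4 h5.
field.
by rewrite h1 h2 h3 h4 h5.
Qed.

End Explicit.

(** * Rearrangement of the kernel series *)

Lemma exp_sum_le (R : realType) (x : R) L : 0 <= x -> \sum_(p < L.+1) x ^+ p / p`!%:R <= expR x.
Proof.
move=> x0; have h := @exp_sum_cvg R x.
have nd : nondecreasing_seq (fun L => \sum_(p < L.+1) x ^+ p / p`!%:R).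
  by apply/nondecreasing_seqP => k; rewrite [leRHS]big_ord_recr /= lerDl divr_ge0// exprn_ge0.
by rewrite -(cvg_lim _ h)//; apply: nondecreasing_cvgn_le => //; exact: cvgP h.
Qed.

Lemma cvg_prod_seq (R : realType) (I : Type) (r : seq I) (u : I -> nat -> R) (l : I -> R) :
  (forall i, u i @ \oo --> l i) -> (fun L => \prod_(i <- r) u i L) @ \oo --> \prod_(i <- r) l i.
Proof.
move=> h; elim: r => [|i r IH].
  by rewrite big_nil; under eq_fun do rewrite big_nil; exact: cvg_cst.
by rewrite big_cons; under eq_fun do rewrite big_cons; apply: cvgM.
Qed.

Lemma cvg_sum_seq (R : realType) (I : Type) (r : seq I) (P : pred I) (u : I -> nat -> R) (l : I -> R) :
  (forall i, u i @ \oo --> l i) -> (fun L => \sum_(i <- r | P i) u i L) @ \oo --> \sum_(i <- r | P i) l i.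
Proof.
move=> h; elim: r => [|i r IH].
  by rewrite big_nil; under eq_fun do rewrite big_nil; exact: cvg_cst.
rewrite big_cons; under eq_fun do rewrite big_cons.
by case: ifP => // _; apply: cvgD.
Qed.

Section SplitCube.
Variables (n m : nat).
Local Notation N := (n + m)%N.

Definition icat (p : 'I_n -> nat) (q : 'I_m -> nat) : 'I_N -> nat :=
  fun j => match fintype.split j with inl i => p i | inr i => q i end.

Lemma icat_l p q i : icat p q (lshift m i) = p i.
Proof. by rewrite /icat splitl. Qed.
Lemma icat_r p q i : icat p q (rshift n i) = q i.
Proof. by rewrite /icat splitr'. Qed.

Lemma sum_cube_cat (V : nmodType) L (F : ('I_N -> nat) -> V) :
  \sum_(g : {ffun 'I_N -> 'I_L.+1}) F (cube_mi g) =
  \sum_(q : {ffun 'I_m -> 'I_L.+1}) \sum_(p : {ffun 'I_n -> 'I_L.+1}) F (icat (cube_mi p) (cube_mi q)).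
Proof.
rewrite pair_big /=.
pose h (x : {ffun 'I_m -> 'I_L.+1} * {ffun 'I_n -> 'I_L.+1}) : {ffun 'I_N -> 'I_L.+1} :=
  [ffun j => match fintype.split j with inl i => x.2 i | inr i => x.1 i end].
rewrite (reindex h) /=; last first.
  exists (fun g => ([ffun i => g (rshift n i)], [ffun i => g (lshift m i)])) => [[q p] _|g _].
    by congr (_, _); apply/ffunP => i; rewrite !ffunE ?splitl ?splitr'.
  apply/ffunP => j; rewrite ffunE -{2}(splitK j); case: (fintype.split j) => i; by rewrite ffunE.
apply: eq_bigr => -[q p] _; congr F; apply/funext => j; rewrite /cube_mi /icat ffunE.
by case: (fintype.split j).
Qed.

End SplitCube.

(** * From cubes of multi-indices to blocks of fixed total degree *)

Section Rearrange.
Variables (R : realType) (m : nat) (T : ('I_m -> nat) -> R) (rho : nat -> ('I_m -> nat) -> R) (U : R).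
Hypothesis m0 : (0 < m)%N.
Hypothesis T0 : forall q, 0 <= T q.
Hypothesis rho0 : forall L q, 0 <= rho L q.
Hypothesis rho1 : forall L q, rho L q <= 1.
Hypothesis rho_cvg : forall q, rho ^~ q @ \oo --> (1 : R).
Hypothesis U_cvg : (fun L => \sum_(q : {ffun 'I_m -> 'I_L.+1}) T (cube_mi q) * rho L (cube_mi q)) @ \oo --> U.

Let tot (q : 'I_m -> nat) := (\sum_(i < m) q i)%N.
(** Summation by total degree, as in the theorem; the factors [rho] account for the sum over [p]
    that a cube truncates. *)
Definition block k : R := \sum_(q : {ffun 'I_m -> 'I_k.+1} | tot (cube_mi q) == k) T (cube_mi q).

Lemma le_tot q j : (q j <= tot q)%N.
Proof. by rewrite /tot (bigD1 j)//= leq_addr. Qed.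

Lemma seriesE K : series block K = \sum_(q : {ffun 'I_m -> 'I_K.+1}) (if (tot (cube_mi q) < K)%N then T (cube_mi q) else 0).
Proof.
rewrite /series /= big_mkord.
transitivity (\sum_(k < K) \sum_(q : {ffun 'I_m -> 'I_K.+1}) (if tot (cube_mi q) == k then T (cube_mi q) else 0)).
  apply: eq_bigr => k _; rewrite /block big_mkcond /=.
  have kK : (k <= K)%N by exact: ltnW.
  rewrite -(sum_cube_widen (fun I => if tot I == k then T I else 0) kK) big_mkcond /=.
  apply: eq_bigr => q _; case: ifPn => // /negP h; case: ifPn => // /eqP e; case: h.
  by apply/forallP => j; rewrite -e le_tot.
rewrite exchange_big; apply: eq_bigr => q _ /=; rewrite -big_mkcond /=.
case: ifPn => [h|]; first by rewrite (big_pred1 (Ordinal h))// => k /=; rewrite eq_sym.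
by rewrite -leqNgt => h; rewrite big_pred0// => k; apply/negbTE/eqP => e; move: h; rewrite e leqNgt ltn_ord.
Qed.

(* Fixed blocks are limits of parts of the cube sums, and the [L]-th cube sum lies inside
   the first [m L + 1] blocks. *)
Lemma series_block_cvg : series block @ \oo --> U.
Proof.
have nd : nondecreasing_seq (series block).
  apply/nondecreasing_seqP => k; rewrite /series /= big_nat_recr //= lerDl sumr_ge0// => q _; exact: T0.
have VU K : series block K <= U.
  have h : (fun L => \sum_(q : {ffun 'I_m -> 'I_K.+1}) (if (tot (cube_mi q) < K)%N then T (cube_mi q) * rho L (cube_mi q) else 0)) @ \oo --> series block K.
    rewrite seriesE; apply: cvg_sum_seq => q; case: ifP => _; last exact: cvg_cst.
    by rewrite -[X in _ --> X]mulr1; apply: cvgM; [exact: cvg_cst|exact: rho_cvg].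
  apply: ler_cvg_to h U_cvg _; exists K => // L /= KL.
  have p0 I : 0 <= T I * rho L I by exact: mulr_ge0.
  apply: le_trans (sum_cube_le p0 KL); apply: ler_sum => q _.
  by case: ifP.
have bnd : has_ubound (range (series block)) by exists U => _ [k _ <-].
have cv := nondecreasing_is_cvgn nd bnd.
have UV : U <= limn (series block).
  have cst : (fun _ : nat => limn (series block)) @ \oo --> limn (series block) by exact: cvg_cst.
  apply: ler_cvg_to U_cvg cst _; apply: nearW => L.
  pose K := (\sum_(i < m) L).+1.
  have LK : (L <= K)%N by rewrite /K sum_nat_const card_ord leqW// leq_pmull.
  apply: le_trans (nondecreasing_cvgn_le nd cv K); rewrite seriesE.
  have p0 I : 0 <= (if (tot I < K)%N then T I else 0) by case: ifP.
  apply: le_trans (sum_cube_le p0 LK); apply: ler_sum => q _.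
  rewrite ifT; first by rewrite ler_piMr.
  by rewrite /K ltnS leq_sum// => i _; exact: (forallP (fI_incube q) i).
have -> : U = limn (series block).
  apply/le_anti; rewrite UV /=; apply: limr_le => //; exact: nearW.
exact: cv.
Qed.

End Rearrange.

(** * Existence of the kernel and the closed formula *)

Section Final.
Variables (R : realType) (n m : nat) (mu nu alpha : R).
Local Notation C := R[i].
Local Notation N := (n + m)%N.
Hypothesis n0 : (0 < n)%N.
Hypothesis m0 : (0 < m)%N.
Hypothesis mu0 : 0 < mu.
Hypothesis nu1 : -1 < nu.
Hypothesis al : (m + n)%:R < alpha.
Local Notation D := (Dnm n m mu).
Local Notation Phi := (PhiNM n m mu nu).
Local Notation wt := (@wgt R n m mu nu alpha).

Let w_ge0 : forall Z, 0 <= wt Z.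
Proof. exact: wgt_ge0. Qed.
Let w_nice : borelR wt.
Proof. exact: borelR_wgt. Qed.
Let w_rot : forall w Z, (forall j, cabs2 (w j) = 1) -> wt (rotv w Z) = wt Z.
Proof. exact: wgt_rot. Qed.
Let w_out : forall Z, ~ D Z -> wt Z = 0.
Proof. exact: wgt_out. Qed.
Let w_nbhs := Dnm_nbhs mu0 nu1 al n0.
Let w_D0 : D (fun=> 0).
Proof. exact: Dnm0. Qed.
Let w_fin : forall I, (mon_sqnorm wt I < +oo)%E.
Proof. by move=> I; rewrite cI2_wgt// ltry. Qed.

Let A_gt0 k : 0 < exp_rate nu alpha k.
Proof. exact: Ak_gt0 nu1 al k. Qed.

Lemma wnorm2E f : wnorm2 D Phi alpha f = sqnormW wt f.
Proof.
rewrite /wnorm2 /sqnormW; congr intC; apply/funext => Z; congr EFin; rewrite /wgt; ring.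
Qed.

Lemma winnerE f g : winner D Phi alpha f g = inner wt f g.
Proof. by rewrite /winner /inner; congr (_ / _); apply: eq_bigr => k _; rewrite wnorm2E. Qed.

Lemma repr_exists : exists K, is_repr_kernel D Phi alpha K.
Proof.
exists (ker wt); split=> [W DW|f W [hf ff] DW].
  split; last by rewrite wnorm2E; exact: (ker_fin w_ge0 w_nice w_rot w_out w_nbhs w_D0 w_fin).
  exact: (power_series_holomorphic w_nbhs (ker_PS w_ge0 w_nice w_rot w_nbhs w_D0 w_fin DW)).
rewrite winnerE; rewrite wnorm2E in ff.
exact: (ker_repr w_ge0 w_nice w_rot w_out w_nbhs w_D0 w_fin).
Qed.

(** The terms change sign when [nu < 0], so positivity is read off the norm of a monomial, namely
    the [k]-th power of the first [w]-coordinate. *)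
Lemma Ssum_gt0 k : 0 < beta_sum n m nu alpha k.
Proof.
pose I : 'I_N -> nat := icat (fun=> 0%N) (fun i => if i == Ordinal m0 then k else 0%N).
have := c_gt0 w_ge0 w_nbhs w_D0 w_fin I; rewrite cI2_wgt//=.
have -> : (\sum_(i < m) I (rshift n i))%N = k.
  rewrite (bigD1 (Ordinal m0))//= /I icat_r eqxx big1 ?addn0// => i /negbTE ih.
  by rewrite icat_r ih.
have f0 : 0 < \prod_(j < N) ((I j)`!%:R : R) by rewrite prodr_gt0// => j _; rewrite ltr0n fact_gt0.
rewrite pmulr_rgt0// pmulr_rgt0// divr_gt0 ?exprn_gt0// mulr_gt0// A_gt0.
Qed.

Let T (Z : cpt R N) (q : 'I_m -> nat) : R :=
  chi n m nu alpha (\sum_(i < m) q i) / (\prod_(i < m) (q i)`!%:R) * cabs2 (\prod_(i < m) wtilde mu Z i ^+ q i).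

Lemma chiE k : chi n m nu alpha k = exp_rate nu alpha k ^+ n / beta_sum n m nu alpha k.
Proof. by []. Qed.

Lemma chi_gt0 k : 0 < chi n m nu alpha k.
Proof. by rewrite chiE divr_gt0 ?Ssum_gt0// exprn_gt0// A_gt0. Qed.

Lemma alpha_mn : 0 < alpha - m%:R - n%:R.
Proof. by have := al; rewrite natrD; lra. Qed.

Lemma eblockE Z k : eblock n m mu nu alpha Z k =
  Gamma (alpha - m%:R - n%:R) / Gamma alpha * block (T Z) k.
Proof.
have a0 : 0 < alpha by apply: le_lt_trans al; rewrite ler0n.
rewrite /eblock /block mulr_sumr; apply: eq_bigr => q /eqP qk.
rewrite /eterm /T /psi /cube_mi /=.
rewrite [\prod_(i < m) Gamma _](eq_bigr (fun i => (q i : nat)`!%:R)); last by move=> i _; rewrite Gamma_nat.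
have g1 : Gamma alpha != 0 by rewrite gt_eqF// Gamma_gt0.
have g2 : Gamma (alpha + (\sum_(i < m) q i)%:R) != 0 by rewrite gt_eqF// Gamma_gt0// ltr_pwDl.
have f0 : \prod_(i < m) ((q i : nat)`!%:R : R) != 0.
  by apply/prodf_neq0 => i _; rewrite pnatr_eq0 -lt0n fact_gt0.
rewrite [(\sum_(i < m) q i)%:R + alpha]addrC.
move: f0 g1 g2.
move: (\prod_(i < m) _) (Gamma alpha) (Gamma (_ + _)) (cabs2 _) => x1 x2 x3 x4 h1 h2 h3.
by field; rewrite h1 h2 h3.
Qed.

Lemma pochE : poch (alpha - (m + n)%:R) (m + n) = Gamma alpha / Gamma (alpha - m%:R - n%:R).
Proof. by rewrite /poch subrK natrD opprD addrA. Qed.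

Lemma main_formula K Z : is_repr_kernel D Phi alpha K -> D Z ->
  cvgn (series (eblock n m mu nu alpha Z : R^nat)) /\
  rawnsley Phi alpha K Z =
     (poch (alpha - (m + n)%:R) (m + n) * powR (1 - sqn (wtilde mu Z)) alpha *
      limn (series (eblock n m mu nu alpha Z : R^nat)))%:C.
Proof.
move=> [hK1 hK2] DZ.
have hcv : ccvg (fun L => (\sum_(g : {ffun 'I_N -> 'I_L.+1}) cabs2 (monomial Z (cube_mi g)) / fine (mon_sqnorm wt (cube_mi g)))%:C) (K Z Z).
  apply: (repr_unique w_ge0 w_nice w_rot w_out w_nbhs w_D0 w_fin) DZ.
    by move=> W DW; have [h1 h2] := hK1 W DW; rewrite wnorm2E in h2.
  move=> f W hf ff DW; rewrite -winnerE; apply: hK2 => //.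
  by split; rewrite ?wnorm2E.
set u := (fun L => \sum_(g : {ffun 'I_N -> 'I_L.+1}) cabs2 (monomial Z (cube_mi g)) / fine (mon_sqnorm wt (cube_mi g))) : nat -> R in hcv.
have [U0 KU ucv] : exists2 U0 : R, K Z Z = U0%:C & u @ \oo --> U0.
  exists (complex.Re (K Z Z)); last exact: (ccvg_Re hcv).
  have h1 := ccvg_Im hcv; have h2 : (fun L => complex.Im (u L)%:C) @ \oo --> (0 : R) by exact: cvg_cst.
  have h3 := cvg_unique _ h1 h2; apply: complexP => //=; exact: h3.
pose A := sqn (zpart Z); pose B := sqn (wpart Z).
pose a k i := mu * exp_rate nu alpha k * cabs2 (zpart Z i).
(* What remains of [exp (- alpha Phi)] when [(1 - |w~|^2)^alpha] is factored out. *)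
pose kap := expR (- (alpha * (nu + 1) * mu * A)).
pose tot (q : 'I_m -> nat) := (\sum_(i < m) q i)%N.
(* The share of [exp (mu A_k |z|^2)] captured by the indices [p <= L]; for each fixed [q] it tends
   to 1. *)
pose rho L (q : 'I_m -> nat) := \prod_(i < n) ((\sum_(p < L.+1) a (tot q) i ^+ p / p`!%:R) / expR (a (tot q) i)).
have a0 k i : 0 <= a k i.
  by rewrite mulr_ge0 ?cabs2_ge0// mulr_ge0 ?(ltW mu0)// ltW// A_gt0.
have suma k : \sum_(i < n) a k i = mu * exp_rate nu alpha k * A by rewrite -mulr_sumr.
have T0 q : 0 <= T Z q.
  rewrite mulr_ge0 ?cabs2_ge0// divr_ge0 ?(ltW (chi_gt0 _))//.
  by rewrite prodr_ge0.
have e0 k i L : 0 <= \sum_(p < L.+1) a k i ^+ p / p`!%:R.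
  by rewrite sumr_ge0// => p _; rewrite divr_ge0// exprn_ge0.
have rho0 L q : 0 <= rho L q by rewrite prodr_ge0// => i _; rewrite divr_ge0// expR_ge0.
have rho1 L q : rho L q <= 1.
  rewrite /rho -[leRHS](@big1 _ _ *%R _ (index_enum 'I_n) xpredT (fun=> 1))//.
  apply: ler_prod => i _; apply/andP; split; first by rewrite divr_ge0 ?expR_ge0.
  by rewrite ler_pdivrMr ?expR_gt0// mul1r exp_sum_le.
have rho_cvg q : rho ^~ q @ \oo --> (1 : R).
  rewrite -[X in _ --> X](@big1 _ _ *%R _ (index_enum 'I_n) xpredT (fun=> 1))//.
  apply: cvg_prod_seq => i; rewrite -[X in _ --> X](@mulfV _ (expR (a (tot q) i))); last by rewrite gt_eqF// expR_gt0.
  by apply: cvgM; [exact: exp_sum_cvg|exact: cvg_cst].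
have uE L : kap * u L = \sum_(q : {ffun 'I_m -> 'I_L.+1}) T Z (cube_mi q) * rho L (cube_mi q).
  rewrite /u (sum_cube_cat L (fun I => cabs2 (monomial Z I) / fine (mon_sqnorm wt I))) mulr_sumr; apply: eq_bigr => q _.
  set k := tot (cube_mi q).
  have Sn : beta_sum n m nu alpha k != 0 by rewrite gt_eqF// Ssum_gt0.
  have An : exp_rate nu alpha k != 0 by rewrite gt_eqF// A_gt0.
  have mun : mu != 0 by rewrite gt_eqF.
  have fq : \prod_(i < m) ((cube_mi q i)`!%:R : R) != 0.
    by apply/prodf_neq0 => i _; rewrite pnatr_eq0 -lt0n fact_gt0.
  transitivity (kap * \sum_(p : {ffun 'I_n -> 'I_L.+1}) (chi n m nu alpha k / (\prod_(i < m) (cube_mi q i)`!%:R) *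
      (\prod_(i < m) cabs2 (wpart Z i) ^+ cube_mi q i)) * \prod_(i < n) (a k i ^+ p i / (p i)`!%:R)).
    congr (_ * _); apply: eq_bigr => p _; rewrite cI2_wgt//=.
    have -> : (\sum_(i < m) icat (cube_mi p) (cube_mi q) (rshift n i))%N = k by apply: eq_bigr => i _; rewrite icat_r.
    have -> : (\sum_(i < n) icat (cube_mi p) (cube_mi q) (lshift m i))%N = (\sum_(i < n) cube_mi p i)%N by apply: eq_bigr => i _; rewrite icat_l.
    rewrite cabs2_mon !big_split_ord /=.
    have -> : \prod_(i < n) cabs2 (Z (lshift m i)) ^+ icat (cube_mi p) (cube_mi q) (lshift m i) = \prod_(i < n) cabs2 (zpart Z i) ^+ p i.
      by apply: eq_bigr => i _; rewrite icat_l.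
    have -> : \prod_(i < m) cabs2 (Z (rshift n i)) ^+ icat (cube_mi p) (cube_mi q) (rshift n i) = \prod_(i < m) cabs2 (wpart Z i) ^+ cube_mi q i.
      by apply: eq_bigr => i _; rewrite icat_r.
    have -> : \prod_(i < n) ((icat (cube_mi p) (cube_mi q) (lshift m i))`!%:R : R) = \prod_(i < n) (p i)`!%:R.
      by apply: eq_bigr => i _; rewrite icat_l.
    have -> : \prod_(i < m) ((icat (cube_mi p) (cube_mi q) (rshift n i))`!%:R : R) = \prod_(i < m) (cube_mi q i)`!%:R.
      by apply: eq_bigr => i _; rewrite icat_r.
    have -> : \prod_(i < n) (a k i ^+ p i / (p i)`!%:R) =
        (mu * exp_rate nu alpha k) ^+ (\sum_(i < n) cube_mi p i) * (\prod_(i < n) cabs2 (zpart Z i) ^+ p i) / \prod_(i < n) (p i)`!%:R.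
      rewrite -prodrXr -big_split -prodf_div /=; apply: eq_bigr => i _.
      by rewrite /a exprMn.
    have fp : \prod_(i < n) ((p i)`!%:R : R) != 0.
      by apply/prodf_neq0 => i _; rewrite pnatr_eq0 -lt0n fact_gt0.
    have ms : (mu * exp_rate nu alpha k) ^+ (\sum_(i < n) cube_mi p i) != 0 by rewrite expf_neq0// mulf_neq0.
    have mn : mu ^+ n != 0 by rewrite expf_neq0.
    have Ann : exp_rate nu alpha k ^+ n != 0 by rewrite expf_neq0.
    rewrite chiE exprD [(mu * _) ^+ n]exprMn.
    move: (\prod_(i < n) _ ^+ _) (\prod_(i < m) _ ^+ _) fp fq ms mn Ann Sn => x1 x2.
    move: (\prod_(i < n) _) (\prod_(i < m) _) (_ ^+ (\sum_(i < n) _)) (mu ^+ n) (_ ^+ n) (beta_sum _ _ _ _ _) => x3 x4 x5 x6 x7 x8 h1 h2 h3 h4 h5 h6.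
    by field; rewrite h1 h2 h3 h4 h5 h6.
  rewrite -mulr_sumr.
  (* Distributivity turns the sum over [p] into a product of [n] truncated exponential series. *)
  rewrite -(bigA_distr_bigA (fun (i : 'I_n) (p : 'I_L.+1) => a k i ^+ p / p`!%:R)).
  have -> : \prod_(i < n) \sum_(p < L.+1) a k i ^+ p / p`!%:R = rho L (cube_mi q) * expR (mu * exp_rate nu alpha k * A).
    rewrite -suma /rho -/k expR_sum -big_split; apply: eq_bigr => i _ /=.
    by rewrite divfK// gt_eqF// expR_gt0.
  rewrite /T -/(tot (cube_mi q)) -/k.
  have -> : cabs2 (\prod_(i < m) wtilde mu Z i ^+ cube_mi q i) = expR (mu * k%:R * A) * \prod_(i < m) cabs2 (wpart Z i) ^+ cube_mi q i.
    have -> : \prod_(i < m) wtilde mu Z i ^+ cube_mi q i = monomial (wtilde mu Z) (cube_mi q) by [].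
    rewrite cabs2_mon; have -> : expR (mu * k%:R * A) = \prod_(i < m) expR (mu * A) ^+ cube_mi q i.
      rewrite prodrXr -/(tot (cube_mi q)) -/k -expRM_natl; congr expR; ring.
    rewrite -big_split; apply: eq_bigr => i _ /=; rewrite -exprMn; congr (_ ^+ _).
    rewrite /wtilde cabs2M -cnorm_sqr cnorm_real gtr0_norm ?expR_gt0// expr2 -expRD.
    by congr (expR _ * _); rewrite -/A; field.
  (* The factor [kap] cancels the part [(nu + 1) alpha] of the rate; the remaining
     [exp (mu k |z|^2)] turns [|w^q|^2] into [|w~^q|^2]. *)
  have -> : expR (mu * exp_rate nu alpha k * A) = kap^-1 * expR (mu * k%:R * A).
    by rewrite /kap -expRN -expRD; congr expR; rewrite /exp_rate; ring.
  have kn : kap != 0 by rewrite gt_eqF// expR_gt0.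
  move: (\prod_(i < m) cabs2 _ ^+ _) => x1.
  by field; rewrite kn fq.
pose U := kap * U0.
have Ucv : (fun L => \sum_(q : {ffun 'I_m -> 'I_L.+1}) T Z (cube_mi q) * rho L (cube_mi q)) @ \oo --> U.
  by under eq_fun do rewrite -uE; apply: cvgM; [exact: cvg_cst|exact: ucv].
have := series_block_cvg m0 T0 rho0 rho1 rho_cvg Ucv => hb.
pose gm := Gamma (alpha - m%:R - n%:R) / Gamma alpha.
have hs : series (eblock n m mu nu alpha Z : R^nat) @ \oo --> gm * U.
  have -> : series (eblock n m mu nu alpha Z : R^nat) = (fun L => gm * series (block (T Z)) L).
    by apply/funext => L; rewrite /series /= mulr_sumr; apply: eq_bigr => k _; rewrite eblockE.
  by apply: cvgM; [exact: cvg_cst|exact: hb].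
split; first exact: cvgP hs.
rewrite (cvg_lim _ hs)// /rawnsley KU -rmorphM; congr (_%:C).
have Q0 : 0 < defining_fun mu Z by apply/DnmE.
have a0' : 0 < alpha by apply: le_lt_trans al; rewrite ler0n.
have g1 : Gamma alpha != 0 by rewrite gt_eqF// Gamma_gt0.
have g2 : Gamma (alpha - m%:R - n%:R) != 0 by rewrite gt_eqF// Gamma_gt0// alpha_mn.
have x1 : 1 - sqn (wtilde mu Z) = expR (mu * A) * defining_fun mu Z.
  have -> : sqn (wtilde mu Z) = expR (mu * A) * B.
    rewrite /sqn mulr_sumr; apply: eq_bigr => i _.
    rewrite /wtilde cabs2M -cnorm_sqr cnorm_real gtr0_norm ?expR_gt0// expr2 -expRD.
    by congr (expR _ * _); rewrite -/A; field.
  by rewrite /defining_fun /gauss_factor -/A -/B mulrBr -expRD addrN expR0.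
have -> : expR (- (alpha * PhiNM n m mu nu Z)) = kap * (1 - sqn (wtilde mu Z)) `^ alpha.
  have hx : 0 < expR (mu * A) * defining_fun mu Z by rewrite mulr_gt0 ?expR_gt0.
  rewrite x1 -(lnK (x := expR (mu * A) * defining_fun mu Z)) ?posrE// -expRM -expRD; congr expR.
  rewrite lnM ?posrE ?expR_gt0// expRK /PhiNM -/A -/(gauss_factor mu Z) -/(defining_fun mu Z); ring.
rewrite pochE /gm /U.
by field; rewrite g1 g2.
Qed.

End Final.

Theorem theorem2p7 (R : realType) (n m : nat) (mu nu alpha : R) :
  (0 < n)%N -> (0 < m)%N -> 0 < mu -> -1 < nu -> (m + n)%:R < alpha ->
  (exists K, is_repr_kernel (Dnm n m mu) (PhiNM n m mu nu) alpha K) /\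
  (forall K, is_repr_kernel (Dnm n m mu) (PhiNM n m mu nu) alpha K ->
   forall Z, Dnm n m mu Z ->
     cvgn (series (eblock n m mu nu alpha Z : R^nat)) /\
     rawnsley (PhiNM n m mu nu) alpha K Z =
       (poch (alpha - (m + n)%:R) (m + n) *
        powR (1 - sqn (wtilde mu Z)) alpha *
        limn (series (eblock n m mu nu alpha Z : R^nat)))%:C%C).
Proof.
move=> n0 m0 mu0 nu1 al; split; first exact: repr_exists.
by move=> K hK Z DZ; exact: main_formula.
Qed.
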